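(* Let $L$ be a homogeneous Lévy basis on $\mathcal B_b(\mathbb R^d)$ and let $g\in L^1(\mathbb R^d,ds)\cap\mathcal L_{\Phi_0}$ have non-vanishing Fourier transform. Define $X_u=\int_{\mathbb R^d}g(u-s)L(ds)$, $u\in\mathbb R^d$. Then for every $m\in\{0,1,2,\dots\}$, $\mathcal L(X)\in\mathbb L_m(\mathbb R^{\mathbb R^d})$ if and only if $\mathcal L(L)\in\mathbb L_m(\mathbb R^{\mathcal B_b(\mathbb R^d)})$.
   Context: $\mathcal B_b(\mathbb R^d)$ is the $\delta$-ring of bounded Borel sets. A Lévy basis on it is an independently scattered, a.s. countably additive family $\{L(A)\}$ of ID random variables with $\log\mathbb Ee^{i\theta L(A)}=\int_A\psi(\theta,s)c(ds)$, $\psi(\theta,s)=i\gamma(s)\theta-\frac12b^2(s)\theta^2+\int[e^{i\theta x}-1-i\theta\tau_1(x)]\rho(s,dx)$, $\tau_1(x)=x/(1\vee|x|)$. It is homogeneous if $\gamma,b,\rho$ do not depend on $s$ and $c$ is proportional to Lebesgue measure. $\mathcal L_{\Phi_0}$ is the space of $L$-integrable functions: $\{f:\int\Phi_0(|f(s)|,s)c(ds)<\infty\}$ with $\Phi_0(r,s)=\sup_{|c|\le1}|\gamma cr+\int[\tau_1(xcr)-cr\tau_1(x)]\rho(dx)|+b^2r^2+\int[\mathbf 1_{\{|xr|>1\}}+|xr|^2\mathbf 1_{\{|xr|\le1\}}]\rho(dx)$. Urbanik classes: $\mu\in\mathbb L_0(\mathbb R^k)$ (selfdecomposable) if for each $q>1$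 there is ID $\mu_q$ with $\hat\mu(\theta)=\hat\mu(q^{-1}\theta)\hat\mu_q(\theta)$, and $\mu\in\mathbb L_m$ if also each $\mu_q\in\mathbb L_{m-1}$; the law of a field indexed by $I$ is in $\mathbb L_m(\mathbb R^I)$ iff all its finite-dimensional distributions are in $\mathbb L_m$. *)

(* Defs.v *)
From HB Require Import structures.
From mathcomp Require Import all_boot all_order all_algebra.
From mathcomp Require Import all_classical all_reals all_analysis.
From mathcomp Require Import complex.
Set Implicit Arguments.
Unset Strict Implicit.
Unset Printing Implicit Defensive.
Import Order.TTheory GRing.Theory Num.Theory.
Import numFieldNormedType.Exports.
Local Open Scope classical_set_scope.
Local Open Scope ring_scope.

Section LevyDefs.
Variable R : realType.

(** R^n is modelled as [n.-tuple R], with its product (= Borel) sigma-algebra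
    provided by MathComp-Analysis. *)
Notation Rn n := (n.-tuple R).

Definition dotp n (x y : Rn n) : R := \sum_(i < n) tnth x i * tnth y i.
Definition tsub n (x y : Rn n) : Rn n := [tuple tnth x i - tnth y i | i < n].
Definition tscale n (c : R) (x : Rn n) : Rn n := [tuple c * tnth x i | i < n].

Definition cexp (z : R[i]) : R[i] :=
  Complex (expR (complex.Re z) * cos (complex.Im z)) (expR (complex.Re z) * sin (complex.Im z)).

(** Lebesgue measure on R^d: the measure of every half-open box is the
    product of its side lengths (this determines it uniquely on Borel sets). *)
Definition is_lebesgue_measure d (lam : {measure set (Rn d) -> \bar R}) : Prop :=
  forall a b : Rn d, (forall i, tnth a i <= tnth b i) ->
    lam [set x | forall i, tnth a i < tnth x i <= tnth b i] =
    (\prod_(i < d) (tnth b i - tnth a i))%:E.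

Definition bounded_borel d (A : set (Rn d)) : Prop :=
  measurable A /\ exists M : R, forall x, A x -> forall i, `|tnth x i| <= M.

Definition tau1 (x : R) : R := x / Num.max 1 `|x|.

Definition levy_measure (rho : {measure set R -> \bar R}) : Prop :=
  rho [set 0] = 0%E /\
  (\int[rho]_x (Num.min 1 (x ^+ 2))%:E < +oo)%E.

Definition lk_exponent (gam b : R) (rho : {measure set R -> \bar R}) (th : R) : R[i] :=
  Complex (- (b ^+ 2 * th ^+ 2) / 2 + Rintegral rho setT (fun x => cos (th * x) - 1))
          (gam * th + Rintegral rho setT (fun x => sin (th * x) - th * tau1 x)).

Section Prob.
Context {dO : measure_display} {Om : measurableType dO} (P : probability Om R).

Definition charfun (Y : Om -> R) (th : R) : R[i] :=
  Complex (Rintegral P setT (fun w => cos (th * Y w)))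
          (Rintegral P setT (fun w => sin (th * Y w))).

Definition charfun_vec k (Y : Om -> Rn k) (th : Rn k) : R[i] :=
  Complex (Rintegral P setT (fun w => cos (dotp th (Y w))))
          (Rintegral P setT (fun w => sin (dotp th (Y w)))).

Definition independent n (Y : 'I_n -> Om -> R) : Prop :=
  forall B : 'I_n -> set R, (forall i, measurable (B i)) ->
    fine (P (\bigcap_(i in setT) (Y i @^-1` B i))) =
    \prod_(i < n) fine (P (Y i @^-1` B i)).

Definition cvg_in_prob (Y : nat -> Om -> R) (Z : Om -> R) : Prop :=
  forall e : R, 0 < e ->
    (fun n => P [set w | e <= `|Y n w - Z w|]) @ \oo --> 0%E.

(** Homogeneous Levy basis on B_b(R^d) with triplet (gam, b^2, rho) and
    control measure lam (Lebesgue measure; any constant factor of the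
    control measure is absorbed into the triplet). *)
Definition homogeneous_levy_basis d (lam : {measure set (Rn d) -> \bar R})
    (L : set (Rn d) -> Om -> R) (gam b : R) (rho : {measure set R -> \bar R}) : Prop :=
  [/\ levy_measure rho,
      (forall A, bounded_borel A -> measurable_fun setT (L A)),
      (forall n (A : 'I_n -> set (Rn d)), (forall i, bounded_borel (A i)) ->
         (forall i j, i != j -> A i `&` A j = set0) ->
         independent (fun i => L (A i))),
      (forall A : nat -> set (Rn d), (forall n, bounded_borel (A n)) ->
         trivIset setT A -> bounded_borel (\bigcup_n A n) ->
         {ae P, forall w, (fun n => \sum_(i < n) L (A i) w) @ \oo
                          --> L (\bigcup_n A n) w}) &
      (forall A, bounded_borel A -> forall th : R,
         charfun (L A) th = cexp (Complex (fine (lam A)) 0 * lk_exponent gam b rho th))].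

Record simple_rep d := SimpleRep {
  sr_n : nat;
  sr_a : 'I_sr_n -> R;
  sr_A : 'I_sr_n -> set (Rn d) }.

Definition sr_fun d (s : simple_rep d) (x : Rn d) : R :=
  \sum_(i < sr_n s) @sr_a d s i * \1_(@sr_A d s i) x.

Definition sr_int d (L : set (Rn d) -> Om -> R) (s : simple_rep d)
    (B : set (Rn d)) (w : Om) : R :=
  \sum_(i < sr_n s) @sr_a d s i * L (B `&` @sr_A d s i) w.

(** Rajput--Rosinski stochastic integral: Y = int_{R^d} f dL. *)
Definition is_stoch_integral d (lam : {measure set (Rn d) -> \bar R})
    (L : set (Rn d) -> Om -> R) (f : Rn d -> R) (Y : Om -> R) : Prop :=
  exists s : nat -> simple_rep d,
    [/\ (forall n i, bounded_borel (@sr_A d (s n) i)),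
        {ae lam, forall x, (fun n => sr_fun (s n) x) @ \oo --> f x},
        (forall B, measurable B -> exists Z : Om -> R,
            measurable_fun setT Z /\ cvg_in_prob (fun n => sr_int L (s n) B) Z) &
        cvg_in_prob (fun n => sr_int L (s n) setT) Y].
End Prob.

Definition charfun_meas k (mu : probability (Rn k) R) (th : Rn k) : R[i] :=
  Complex (Rintegral mu setT (fun x => cos (dotp th x)))
          (Rintegral mu setT (fun x => sin (dotp th x))).

(** Infinite divisibility (mu = nu^{*n} expressed via characteristic functions). *)
Definition infinitely_divisible k (mu : probability (Rn k) R) : Prop :=
  forall n : nat, (0 < n)%N -> exists nu : probability (Rn k) R,
    forall th, charfun_meas nu th ^+ n = charfun_meas mu th.

(** Urbanik classes L_m(R^k), for a law given by its characteristic function phi. *)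
Definition urbanik_step k (phi : Rn k -> R[i])
    (Q : (Rn k -> R[i]) -> Prop) : Prop :=
  forall q : R, 1 < q -> exists muq : probability (Rn k) R,
    [/\ infinitely_divisible muq,
        (forall th, phi th = phi (tscale q^-1 th) * charfun_meas muq th) &
        Q (charfun_meas muq)].

Fixpoint urbanik_cf k (m : nat) (phi : Rn k -> R[i]) : Prop :=
  match m with
  | 0 => urbanik_step phi (fun _ => True)
  | m'.+1 => urbanik_step phi (@urbanik_cf k m')
  end.

Definition urbanik_meas k (m : nat) (mu : probability (Rn k) R) : Prop :=
  urbanik_cf m (charfun_meas mu).

Section Fields.
Context {dO : measure_display} {Om : measurableType dO} (P : probability Om R).

(** Law of (X_u)_{u in R^d} in L_m(R^{R^d}): all fdd's in L_m. *)
Definition field_in_urbanik d (X : Rn d -> Om -> R) (m : nat) : Prop :=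
  forall k (u : 'I_k -> Rn d),
    urbanik_cf m (charfun_vec P (fun w => [tuple X (u i) w | i < k])).

Definition basis_in_urbanik d (L : set (Rn d) -> Om -> R) (m : nat) : Prop :=
  forall k (A : 'I_k -> set (Rn d)), (forall i, bounded_borel (A i)) ->
    urbanik_cf m (charfun_vec P (fun w => [tuple L (A i) w | i < k])).
End Fields.

Definition Phi0_drift (gam : R) (rho : {measure set R -> \bar R}) (r c : R) : R :=
  `| gam * c * r +
     Rintegral rho setT (fun x => tau1 (x * c * r) - c * r * tau1 x) |.

Definition Phi0_jump (r x : R) : R :=
  \1_[set y : R | 1 < `|y * r|] x + `|x * r| ^+ 2 * \1_[set y : R | `|y * r| <= 1] x.

Definition Phi0 (gam b : R) (rho : {measure set R -> \bar R}) (r : R) : \bar R :=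
  let S := [set (Phi0_drift gam rho r c)%:E | c in [set c : R | `|c| <= 1]] in
  (ereal_sup S + (b ^+ 2 * r ^+ 2)%:E + \int[rho]_x (Phi0_jump r x)%:E)%E.

Definition in_L_Phi0 d (lam : {measure set (Rn d) -> \bar R}) (gam b : R)
    (rho : {measure set R -> \bar R}) (f : Rn d -> R) : Prop :=
  measurable_fun setT f /\
  (\int[lam]_s Phi0 gam b rho `|f s| < +oo)%E.

Definition fourier d (lam : {measure set (Rn d) -> \bar R}) (g : Rn d -> R)
    (xi : Rn d) : R[i] :=
  Complex (Rintegral lam setT (fun s => g s * cos (dotp xi s)))
          (Rintegral lam setT (fun s => g s * sin (dotp xi s))).

End LevyDefs.

(* Main.v *)
Require Import Defs.
From HB Require Import structures.
From mathcomp Require Import all_boot all_order all_algebra.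
From mathcomp Require Import all_classical all_reals all_analysis.
From mathcomp Require Import complex.
From mathcomp Require Import measurable_realfun.
From mathcomp Require Import ring lra.

(** Let psi be the Lévy–Khintchine exponent of the basis and psi_q(t) = psi(t) - psi(t/q).
    Membership in L_m says that, for all q_0, ..., q_j > 1 with j <= m, the iterated difference
    of the exponent is again a Lévy exponent: all its nonnegative multiples are logarithms of
    characteristic functions. The finite-dimensional laws of L and of X have the exponents
    th |-> \int psi(\sum_i th_i f_i(s)) ds with f_i = 1_{A_i}, respectively f_i = g(u_i - .).
    If the differences of psi are Lévy exponents, then so are these integrals, so psi decides
    both laws; evaluating L on a cube of volume one gives psi back from L.

    To get psi back from X, consider signed sums Psi(t) = \sum_j sig_j psi(c_j t), a class stable
    under differences. If \int Psi(\sum_i th_i g(u_i - s)) ds is always a Lévy exponent, applying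
    it to nonnegative trigonometric polynomials vanishing at 0 gives
    \sum_j sig_j \iint f(c_j x g(. - s))^2 w(c_j x g(u_0 - s)) rho(dx) ds >= 0
    for trigonometric polynomials f and the weight w(y) = (1 - cos (r y))^2, hence for their
    limits. Averaging over translations u recovers x \int g from the values x g(u - s); as
    \int g <> 0 (the Fourier transform at 0), f may be any bounded Borel function of c_j x.
    So \sum_j sig_j rho(c_j x \in B) >= 0 for all Borel B away from 0 and Psi is a Lévy exponent.

    Laws with prescribed limit exponents come from Lévy's continuity theorem, where the limit
    law is a Loeb measure pushed forward by the standard part. Integrability of psi(t f) for
    an integrable f follows from Vitali–Hahn–Saks, because the integrals of the approximating
    simple functions converge over every Borel set. *)

Set Implicit Arguments.
Unset Strict Implicit.
Unset Printing Implicit Defensive.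
Import Order.TTheory GRing.Theory Num.Theory.
Import numFieldNormedType.Exports.
Local Open Scope classical_set_scope.
Local Open Scope ring_scope.

(** * Integrals of real functions and finite-valued approximation *)

Section RintegralTools.
Context d (T : measurableType d) (R : realType) (mu : {measure set T -> \bar R}).
Implicit Types (D : set T) (f : T -> R).

(** The obstacle is on the way back from X: the jump part of an iterated difference is a signed
    combination of dilated copies of [rho], each possibly infinite near 0, and its positivity must
    be tested while the copies stay coupled. Hence every approximation uses one sequence of
    trigonometric polynomials for all dilations at once, and only a quadratic inequality is passed
    to the limit: squares keep the test functions nonnegative whatever the signs of their
    approximants. The tests do not see the Gaussian part; its coefficient [\sum_j sig_j * c_j ^+ 2]
    is nonnegative by construction, since it starts at 1 and each difference multiplies it by
    [1 - q ^- 2]. A drift is a Lévy exponent with either sign. Logarithms are never taken of an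
    unknown limit: exponents of approximants are compared with each other, and the phase is fixed by
    its continuity along rays from the value 0 at the origin. *)

Lemma bounded_integrable D f M : measurable D -> (mu D < +oo)%E ->
  measurable_fun D f -> (forall x, D x -> `|f x| <= M) ->
  mu.-integrable D (EFin \o f).
Proof.
move=> mD Df mf fM; apply: measurable_bounded_integrable => //.
exists M; split; first exact: num_real.
by move=> N MN x Dx; apply: (le_trans (fM _ Dx)); exact: ltW.
Qed.

Lemma integrable_le D f g : measurable D -> measurable_fun D f ->
  mu.-integrable D (EFin \o g) -> (forall x, D x -> `|f x| <= g x) ->
  mu.-integrable D (EFin \o f).
Proof.
move=> mD mf ig fg; apply: (le_integrable mD _ _ ig).
  exact/measurable_EFinP.
move=> x Dx /=; rewrite lee_fin; apply: (le_trans (fg _ Dx)).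
exact: ler_norm.
Qed.

Lemma measurable_integrable D f : mu.-integrable D (EFin \o f) ->
  measurable_fun D f.
Proof. by move=> /measurable_int /measurable_EFinP. Qed.

Lemma EFin_Rintegral D f : measurable D -> mu.-integrable D (EFin \o f) ->
  (\int[mu]_(x in D) (f x)%:E = (Rintegral mu D f)%:E)%E.
Proof. by move=> mD fi; rewrite /Rintegral fineK//; exact: (integrable_fin_num mD fi). Qed.

Lemma integrable_ae_eq D (f g : T -> \bar R) : measurable D -> measurable_fun D g ->
  ae_eq mu D f g -> mu.-integrable D f -> mu.-integrable D g.
Proof.
move=> mD mg fg /integrableP[mf fi]; apply/integrableP; split => //.
rewrite (ae_eq_integral (abse \o f))//.
- exact: measurableT_comp.
- exact: measurableT_comp.
- by apply: filterS fg => x h Dx /=; rewrite h.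
Qed.

Lemma Rintegral_dct D (f_ : nat -> T -> R) f g : measurable D ->
  (forall n, measurable_fun D (f_ n)) -> measurable_fun D f ->
  {ae mu, forall x, D x -> f_ ^~ x @ \oo --> f x} ->
  mu.-integrable D (EFin \o g) -> (forall n x, D x -> `|f_ n x| <= g x) ->
  mu.-integrable D (EFin \o f) /\
  (fun n => Rintegral mu D (f_ n)) @ \oo --> Rintegral mu D f.
Proof.
move=> mD mf_ mf ff ig fg.
have m1 n : measurable_fun D (EFin \o f_ n) by exact/measurable_EFinP.
have m2 : measurable_fun D (EFin \o f) by exact/measurable_EFinP.
have c1 : {ae mu, forall x, D x -> (fun n => (EFin \o f_ n) x) @ \oo --> (EFin \o f) x}.
  by apply: filterS ff => x fx Dx; exact: cvg_comp (fx Dx) _.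
have b1 : {ae mu, forall x n, D x -> (`|(EFin \o f_ n) x| <= (EFin \o g) x)%E}.
  by apply: aeW => x n Dx /=; rewrite lee_fin fg.
have [h1 _ h3] := @dominated_convergence _ T R mu D mD _ _ _ m1 m2 c1 ig b1.
split => //.
have := h3; rewrite -[X in _ --> X]fineK; last exact: integrable_fin_num.
by move=> /fine_cvg.
Qed.

Lemma Rintegral_sum (I : Type) (s : seq I) (F : I -> T -> R) D :
  measurable D -> (forall i, mu.-integrable D (EFin \o F i)) ->
  Rintegral mu D (fun x => \sum_(i <- s) F i x) = \sum_(i <- s) Rintegral mu D (F i) /\
  mu.-integrable D (EFin \o (fun x => \sum_(i <- s) F i x)).
Proof.
move=> mD iF; elim: s => [|i s [IH1 IH2]].
  split.
    rewrite big_nil; under eq_Rintegral do rewrite big_nil.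
    by rewrite Rintegral_cst// mul0r.
  rewrite [X in integrable _ _ X](_ : _ = cst 0%E); first exact: integrable0.
  by apply/funext => x /=; rewrite big_nil.
have e : (fun x => \sum_(j <- i :: s) F j x) = (fun x => F i x + \sum_(j <- s) F j x).
  by apply/funext => x; rewrite big_cons.
rewrite e; split; first by rewrite RintegralD// IH1 big_cons.
exact: (integrableD mD (iF i) IH2).
Qed.

End RintegralTools.

Lemma measurable_cos_comp d (T : measurableType d) (R : realType) (D : set T) (f : T -> R) :
  measurable_fun D f -> measurable_fun D (cos \o f).
Proof. by move=> mf; apply: measurableT_comp => //; exact: (continuous_measurable_fun (@continuous_cos R)). Qed.

Lemma measurable_sin_comp d (T : measurableType d) (R : realType) (D : set T) (f : T -> R) :
  measurable_fun D f -> measurable_fun D (sin \o f).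
Proof. by move=> mf; apply: measurableT_comp => //; exact: (continuous_measurable_fun (@continuous_sin R)). Qed.

Section FiniteIndex.
Context d (T : measurableType d) (R : realType).

Lemma measurable_finidx (I : finType) (idx : T -> I) (h : I -> R) :
  (forall i, measurable (idx @^-1` [set i])) -> measurable_fun setT (h \o idx).
Proof.
move=> mi _ Y mY; rewrite setTI.
have -> : (h \o idx) @^-1` Y = \big[setU/set0]_(i | h i \in Y) (idx @^-1` [set i]).
  apply/seteqP; split => x /=.
    by move=> Yx; rewrite -bigcup_mkcond_ord || idtac; rewrite (bigD1 (idx x)) /=; [left|exact/mem_set].
  elim/big_ind : _ => [//|A B hA hB [/hA|/hB]//|i /set_mem hi /= ->//].
by apply: bigsetU_measurable => i _.
Qed.

Lemma Rintegral_finidx_in (mu : {measure set T -> \bar R}) (D : set T) (I : finType)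
    (idx : T -> I) (h : I -> R) :
  measurable D -> (mu D < +oo)%E -> (forall i, measurable (idx @^-1` [set i])) ->
  Rintegral mu D (h \o idx) = \sum_i fine (mu (idx @^-1` [set i] `&` D)) * h i.
Proof.
move=> mD muD mi.
have e : h \o idx = fun x => \sum_i h i * \1_(idx @^-1` [set i]) x.
  apply/funext => x /=; rewrite (bigD1 (idx x)) //= indicE mem_set//= mulr1.
  rewrite big1 ?addr0// => i ix; rewrite indicE memNset ?mulr0//=.
  by move=> e; move: ix; rewrite e eqxx.
have ii i : mu.-integrable D (EFin \o (\1_(idx @^-1` [set i]) : T -> R)).
  apply: (@bounded_integrable _ _ _ _ _ _ 1) => //.
  by move=> x _; rewrite indicE; case: (_ \in _); rewrite ?normr1 ?normr0.
have ih i : mu.-integrable D (EFin \o (fun x => h i * (\1_(idx @^-1` [set i]) x : R))).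
  exact: (integrableZl mD (h i) (ii i)).
rewrite e (Rintegral_sum _ mD ih).1; apply: eq_bigr => i _.
rewrite RintegralZl// mulrC; congr (_ * _).
by rewrite /Rintegral integral_indic.
Qed.

Lemma Rintegral_finidx (mu : {measure set T -> \bar R}) (I : finType) (idx : T -> I) (h : I -> R) :
  (mu setT < +oo)%E -> (forall i, measurable (idx @^-1` [set i])) ->
  Rintegral mu setT (h \o idx) = \sum_i h i * fine (mu (idx @^-1` [set i])).
Proof.
move=> muT mi; rewrite Rintegral_finidx_in//.
by apply: eq_bigr => i _; rewrite setIT mulrC.
Qed.

(** The grid depends on the bound [M] and the mesh [e] only, not on [f], so that several functions,
    such as the coordinates of a vector, can share one finite set of values. The index of [x] is the
    integer part of [(f x + M) / e]. *)
Lemma finidx_approx_uniform (M e : R) : 0 < e ->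
  exists n (c : 'I_n.+1 -> R), forall f : T -> R, measurable_fun setT f ->
    (forall x, `|f x| <= M) -> exists idx : T -> 'I_n.+1,
    (forall i, measurable (idx @^-1` [set i])) /\
    (forall x, `|f x - c (idx x)| <= e).
Proof.
move=> e0; pose n := Num.trunc ((M + M) / e).
exists n, (fun i => i%:R * e - M) => f mf fM.
pose fl x := Num.trunc ((f x + M) / e).
have fM0 x : 0 <= f x + M by have := fM x; rewrite ler_norml; lra.
have fln x : (fl x < n.+1)%N.
  rewrite ltnS /fl /n; apply: Num.Theory.le_truncn.
  by rewrite ler_pM2r ?invr_gt0// lerD2r; have := fM x; rewrite ler_norml => /andP[].
pose idx x : 'I_n.+1 := Ordinal (fln x).
exists idx; split.
  move=> i; have -> : idx @^-1` [set i] =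
      [set x | i%:R * e <= f x + M < i.+1%:R * e].
    apply/seteqP; split => x /=.
      move=> <- /=; have := Num.Theory.truncn_itv (divr_ge0 (fM0 x) (ltW e0)).
      by rewrite ler_pdivlMr// ltr_pdivrMr.
    rewrite -ler_pdivlMr// -ltr_pdivrMr// => /Num.Theory.truncn_def ix.
    by apply/val_inj.
  rewrite (_ : mkset _ = (fun x => f x + M) @^-1` `[i%:R * e, i.+1%:R * e[); last first.
    by apply/seteqP; split => x /=; rewrite in_itv.
  rewrite -[X in measurable X]setTI; apply: measurable_funD => //.
move=> x /=; rewrite /fl; have := Num.Theory.truncn_itv (divr_ge0 (fM0 x) (ltW e0)).
rewrite -natr1; set N := (Num.trunc _)%:R; rewrite ler_pdivlMr// ltr_pdivrMr// mulrDl mul1r => /andP[a b].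
by rewrite ler_norml; lra.
Qed.

Lemma finidx_approx (f : T -> R) (M e : R) : measurable_fun setT f ->
  (forall x, `|f x| <= M) -> 0 < e ->
  exists n (idx : T -> 'I_n.+1) (c : 'I_n.+1 -> R),
    (forall i, measurable (idx @^-1` [set i])) /\
    (forall x, `|f x - c (idx x)| <= e).
Proof.
move=> mf fM e0; have [n [c nc]] := finidx_approx_uniform M e0.
by have [idx h] := nc f mf fM; exists n, idx, c.
Qed.

End FiniteIndex.

Lemma cvg_bigsum (R : realType) (T : Type) (F : set_system T) {FF : Filter F} (I : Type)
    (s : seq I) (Pr : pred I) (f : I -> T -> R) (l : I -> R) :
  (forall i, f i @ F --> l i) ->
  (fun x => \sum_(i <- s | Pr i) f i x) @ F --> \sum_(i <- s | Pr i) l i.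
Proof.
move=> fl; elim: s => [|i s IH].
  rewrite big_nil; under eq_fun do rewrite big_nil; exact: cvg_cst.
rewrite big_cons; under eq_fun do rewrite big_cons.
by case: (Pr i) => //; apply: cvgD => //; exact: fl.
Qed.

(** * Loeb measures *)

Lemma nat_ultra_subproof : exists U : set_system nat, UltraFilter U /\ \oo `<=` U.
Proof. exact: ultraFilterLemma. Qed.

(** Along this ultrafilter every bounded real sequence converges, and a convergent sequence keeps
    its limit because the ultrafilter refines [\oo]. It takes the place of the extraction of
    subsequences. *)
Definition nat_ultra : set_system nat := sval (cid nat_ultra_subproof).

#[global] Instance nat_ultraP : UltraFilter nat_ultra.
Proof. by rewrite /nat_ultra; case: cid => U /= []. Qed.

Lemma nat_ultra_oo : \oo `<=` nat_ultra.
Proof. by rewrite /nat_ultra; case: cid => U /= []. Qed.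

#[global] Instance nat_ultra_proper : ProperFilter nat_ultra := ultra_proper.

#[global] Instance nat_ultra_filter : Filter nat_ultra := nat_ultra_proper.

Section Ulim.
Context {R : realType}.
Implicit Types a b : nat -> R.

Definition ulim a : R := lim (a @ nat_ultra).

(** A segment is compact, so the image ultrafilter clusters at some point of it, and an ultrafilter
    converges to each of its cluster points. *)
Lemma ulim_cvg a M : (forall n, `|a n| <= M) -> a @ nat_ultra --> ulim a.
Proof.
move=> aM.
have := @segment_compact R (- M) M (a @ nat_ultra) _ _.
case => [|l [_ cl]].
  apply: nearW => n /=; rewrite in_itv /=; have := aM n.
  by rewrite ler_norml.
suff : a @ nat_ultra --> l by move=> /cvgP.
move=> B Bl; have [//|hc] := in_ultra_setVsetC (a @^-1` B) nat_ultraP.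
have [x [/= h1 h2]] := cl (~` B) B hc Bl.
by [].
Qed.

Lemma ulimE a l : a @ nat_ultra --> l -> ulim a = l.
Proof. by move=> al; apply: cvg_lim. Qed.

Lemma ulim_cvgn a l : a @ \oo --> l -> ulim a = l.
Proof. by move=> al; apply: ulimE => B /al; exact: nat_ultra_oo. Qed.

Lemma ulim_ge0 a M : (forall n, 0 <= a n <= M) -> 0 <= ulim a.
Proof.
move=> aM; apply: limr_ge.
  apply/cvgP/(@ulim_cvg _ M) => n; have /andP[h1 h2] := aM n; by rewrite ger0_norm.
by apply: nearW => n; case/andP: (aM n).
Qed.

Lemma nat_ultra_norm_le a (l e : R) : a @ nat_ultra --> l ->
  (\forall n \near nat_ultra, `|a n| <= e) -> `|l| <= e.
Proof.
move=> al ae; have nl : (fun n => `|a n|) @ nat_ultra --> `|l| by exact: cvg_norm.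
rewrite -(cvg_lim _ nl)//; apply: limr_le => //.
by apply/cvg_ex; eexists; exact: nl.
Qed.

End Ulim.

(** Sequences are not identified modulo the ultrafilter: [ext] below cannot distinguish sequences
    that agree for most indices, so the quotient stays implicit. The separate name lets sequences
    carry the algebra of internal sets. *)
Definition loeb (T : Type) := nat -> T.

HB.instance Definition _ (T : pointedType) := Pointed.copy (loeb T) (nat -> T).

Section Internal.
Context d (T : measurableType d).
Implicit Types A B : nat -> set T.

Definition ext A : set (loeb T) := [set w | nat_ultra [set n | A n (w n)]].

Definition internal : set (set (loeb T)) :=
  [set E | exists2 A, forall n, measurable (A n) & E = ext A].

Lemma extC A : ~` ext A = ext (fun n => ~` A n).
Proof.
apply/seteqP; split => w /=.
  by have [//|] := in_ultra_setVsetC [set n | A n (w n)] nat_ultraP.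
move=> h1 h2; have : nat_ultra set0.
  by apply: filterS (filterI h1 h2) => n [/= ].
exact: filter_not_empty.
Qed.

Lemma extI A B : ext A `&` ext B = ext (fun n => A n `&` B n).
Proof.
apply/seteqP; split => w /=.
  by move=> [h1 h2]; apply: filterS (filterI h1 h2) => n [].
by move=> h; split; apply: filterS h => n [].
Qed.

Lemma extU A B : ext A `|` ext B = ext (fun n => A n `|` B n).
Proof.
rewrite -[LHS]setCK setCU !extC extI extC; congr ext; apply/funext => n.
by rewrite -setCU setCK.
Qed.

Lemma ext0 : ext (fun=> set0) = set0.
Proof.
apply/seteqP; split => w //= h; suff : nat_ultra set0 by exact: filter_not_empty.
by apply: filterS h.
Qed.

Lemma internal0 : internal set0.
Proof. by exists (fun=> set0); [move=> n; exact: measurable0 | rewrite ext0]. Qed.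

Lemma internalC : setC_closed internal.
Proof.
move=> E [A mA ->]; rewrite extC; exists (fun n => ~` A n) => // n.
exact: measurableC.
Qed.

Lemma internalU : setU_closed internal.
Proof.
move=> _ _ [A mA ->] [B mB ->]; rewrite extU; exists (fun n => A n `|` B n) => // n.
exact: measurableU.
Qed.

(** If the inclusion failed for most [n], a choice of points of [A n] outside [B n] at these stages
    would be an element of [ext A] outside [ext B]. An internal set thus determines its sequence of
    sets up to a negligible set of indices. *)
Lemma ext_subset A B : ext A `<=` ext B -> nat_ultra [set n | A n `<=` B n].
Proof.
move=> AB; have [//|h] := in_ultra_setVsetC [set n | A n `<=` B n] nat_ultraP.
have /choice[w wP] : forall n, exists x, ~ (A n `<=` B n) -> A n x /\ ~ B n x.
  move=> n; have [AnB|nAnB] := pselect (A n `<=` B n); first by exists point.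
  by move/existsNP: nAnB => [x /not_implyP xP]; exists x.
have wA : ext A w by apply: filterS h => n /= /wP[].
suff : nat_ultra set0 by move=> /filter_not_empty.
by apply: filterS (filterI h (AB _ wA)) => n [/= /wP[_ ?]].
Qed.

Lemma ext_nonempty A : ext A !=set0 -> nat_ultra [set n | A n !=set0].
Proof. by move=> [w wA]; apply: filterS wA => n ?; exists (w n). Qed.

(* Countable saturation: the diagonal point picks, at stage [n], an element of as
   many of the first [n] sets as possible. *)
Lemma ext_saturation (A : nat -> nat -> set T) :
  (forall N, (\bigcap_(j in [set j | (j <= N)%N]) ext (A j)) !=set0) ->
  (\bigcap_j ext (A j)) !=set0.
Proof.
move=> ne; pose C N n := \bigcap_(j in [set j | (j <= N)%N]) A j n.
have extC' N : ext (C N) = \bigcap_(j in [set j | (j <= N)%N]) ext (A j).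
  elim: N => [|N IH].
    have -> : C 0%N = A 0%N.
      apply/funext => n; apply/seteqP; split => x /=; first exact.
      by move=> h j /=; rewrite leqn0 => /eqP ->.
    apply/seteqP; split => w /=; last exact.
    by move=> h j /=; rewrite leqn0 => /eqP ->.
  have -> : C N.+1 = fun n => C N n `&` A N.+1 n.
    apply/funext => n; apply/seteqP; split => x /=.
      by move=> h; split; [move=> j /= jN; apply: h; exact: leqW | apply: h => /=].
    by move=> [h1 h2] j /=; rewrite leq_eqVlt => /orP[/eqP -> //|]; exact: h1.
  rewrite -extI IH; apply/seteqP; split => x /=.
    by move=> [h1 h2] j /=; rewrite leq_eqVlt => /orP[/eqP -> //|]; exact: h1.
  by move=> h; split; [move=> j /= jN; apply: h; exact: leqW | apply: h => /=].
have /choice[w wP] : forall n, exists x, forall N, (N <= n)%N -> C N n !=set0 -> C N n x.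
  move=> n; suff : forall k, exists x, forall N, (N <= k)%N -> C N n !=set0 -> C N n x by [].
  elim=> [|k [x xP]].
    have [[x xC]|nC] := pselect (C 0%N n !=set0).
      by exists x => N; rewrite leqn0 => /eqP ->.
    by exists point => N; rewrite leqn0 => /eqP ->.
  have [[y yC]|nC] := pselect (C k.+1 n !=set0).
    by exists y => N Nk _ j /= jN; apply: yC; exact: leq_trans Nk.
  exists x => N; rewrite leq_eqVlt => /orP[/eqP -> //|]; exact: xP.
exists w => j _.
have h1 : nat_ultra [set n | C j n !=set0].
  by apply: ext_nonempty; rewrite extC'; exact: ne.
have h2 : nat_ultra [set n | (j <= n)%N] by apply: nat_ultra_oo; exact: nbhs_infty_ge.
apply: filterS (filterI h1 h2) => n [/= /wP h jn]; apply: (h jn) => /=.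
exact: leqnn.
Qed.

(** Saturation applied to complements: if no finite subfamily covered [E], what finitely many [F j]
    leave of [E] would never be empty, and some point of [E] would lie outside all [F j]. This
    compactness is the source of countable additivity. *)
Lemma internal_cover_finite (F : nat -> set (loeb T)) E :
  internal E -> (forall j, internal (F j)) -> E `<=` \bigcup_j F j ->
  exists N, E `<=` \bigcup_(j in [set j | (j <= N)%N]) F j.
Proof.
move=> [A mA ->] /(_ _)/cid2 iF Ecov; apply: contrapT => /forallNP nN.
have [] := @ext_saturation (fun j n => A n `&` ~` (s2val (iF j)) n).
  move=> N; have /existsNP[w /not_implyP[wA wF]] := nN N.
  exists w => j /= jN; rewrite -extI -extC -(s2valP' (iF j)); split => // Fj.
  by apply: wF; exists j.
move=> w wP; have wA : ext A w by have := wP 0%N I; rewrite -extI => -[].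
have [j _ Fjw] := Ecov _ wA.
have := wP j I; rewrite -extI -extC -(s2valP' (iF j)) => -[_]; exact.
Qed.

End Internal.

(** An opaque display keeps the algebra of internal sets apart from the sigma-algebra of [T]. *)
Fact loeb_display : measure_display -> measure_display.
Proof. by []. Qed.

HB.instance Definition _ d (T : measurableType d) :=
  @isAlgebraOfSets.Build (loeb_display d) (loeb T) (@internal d T)
    (@internal0 d T) (@internalU d T) (@internalC d T).

Section LoebContent.
Context d (T : measurableType d) (R : realType) (mu : nat -> probability T R).
Implicit Types (A B : nat -> set T) (E : set (loeb T)).

(** A content is a function of the set alone, so a representing sequence is chosen. Sets that are
    not internal receive the constant sequence [set0], which makes the content total. *)
Definition loeb_rep E : nat -> set T :=
  xget (fun=> set0) [set A | (forall n, measurable (A n)) /\ E = ext A].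

Definition loeb_content E : \bar R := (ulim (fun n => fine (mu n (loeb_rep E n))))%:E.

Lemma fine_prob_bnd (P : probability T R) (A : set T) : measurable A -> 0 <= fine (P A) <= 1.
Proof.
move=> mA; rewrite fine_ge0 //= -lee_fin fineK ?fin_num_measure//.
exact: probability_le1.
Qed.

Lemma fine_prob_norm (P : probability T R) (A : set T) : measurable A -> `|fine (P A)| <= 1.
Proof. by move=> /(fine_prob_bnd P)/andP[h1 h2]; rewrite ger0_norm. Qed.

(** Two representing sequences agree for most indices, by [ext_subset] in both directions, and
    therefore have the same limit along the ultrafilter. *)
Lemma loeb_contentE A : (forall n, measurable (A n)) ->
  loeb_content (ext A) = (ulim (fun n => fine (mu n (A n))))%:E.
Proof.
move=> mA; rewrite /loeb_content; set B := loeb_rep _.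
have [mB eAB] : (forall n, measurable (B n)) /\ ext A = ext B.
  by apply: (@xgetPex _ (fun=> set0) [set B | (forall n, measurable (B n)) /\ ext A = ext B]); exists A.
congr EFin; apply: ulimE.
have h1 : nat_ultra [set n | A n `<=` B n] by apply: ext_subset; rewrite eAB.
have h2 : nat_ultra [set n | B n `<=` A n] by apply: ext_subset; rewrite eAB.
have h3 : \forall n \near nat_ultra, fine (mu n (A n)) = fine (mu n (B n)).
  by apply: filterS (filterI h1 h2) => n [/= a b]; congr (fine (mu _ _)); exact/seteqP.
have c : (fun n => fine (mu n (A n))) @ nat_ultra --> ulim (fun n => fine (mu n (A n))).
  by apply: (@ulim_cvg _ _ 1) => n; exact: fine_prob_norm.
by apply: cvg_trans c; apply: near_eq_cvg; apply: filterS h3.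
Qed.

Lemma loeb_content0 : loeb_content set0 = 0%E.
Proof.
rewrite -(@ext0 _ T) loeb_contentE//; congr EFin; apply: ulim_cvgn.
by under eq_fun do rewrite measure0; exact: cvg_cst.
Qed.

Lemma loeb_content_ge0 E : (0 <= loeb_content E)%E.
Proof.
rewrite lee_fin; apply: (@ulim_ge0 _ _ 1) => n; apply: fine_prob_bnd.
rewrite /loeb_rep; case: xgetP => [B -> []//|_]; exact: measurable0.
Qed.

Lemma loeb_contentU E F : internal E -> internal F -> E `&` F = set0 ->
  loeb_content (E `|` F) = (loeb_content E + loeb_content F)%E.
Proof.
move=> [A mA ->] [B mB ->]; rewrite extI extU => AB0.
rewrite !loeb_contentE//; last by move=> n; exact: measurableU.
rewrite -EFinD; congr EFin; apply: ulimE.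
have h : nat_ultra [set n | A n `&` B n `<=` set0].
  by apply: (@ext_subset _ _ (fun n => A n `&` B n) (fun=> set0)); rewrite AB0.
have cA : (fun n => fine (mu n (A n))) @ nat_ultra --> ulim (fun n => fine (mu n (A n))).
  by apply: (@ulim_cvg _ _ 1) => n; exact: fine_prob_norm.
have cB : (fun n => fine (mu n (B n))) @ nat_ultra --> ulim (fun n => fine (mu n (B n))).
  by apply: (@ulim_cvg _ _ 1) => n; exact: fine_prob_norm.
apply: cvg_trans (cvgD cA cB); apply: near_eq_cvg; apply: filterS h => n /= AB.
by rewrite measureU ?fineD ?fin_num_measure// ; exact/seteqP.
Qed.

Lemma loeb_content_bigU (F : nat -> set (loeb T)) n : (forall j, internal (F j)) ->
  trivIset setT F ->
  internal (\big[setU/set0]_(j < n) F j) /\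
  loeb_content (\big[setU/set0]_(j < n) F j) = (\sum_(0 <= j < n) loeb_content (F j))%E.
Proof.
move=> iF tF; elim: n => [|n [IH1 IH2]].
  by rewrite big_ord0 big_nil loeb_content0; split => //; exact: internal0.
rewrite big_ord_recr big_nat_recr//= -IH2; split; first exact: internalU.
apply: loeb_contentU => //; apply/seteqP; split => // w [].
rewrite -bigcup_mkord => -[j /= jn Fj Fn].
have := tF j n I I => /(_ (ex_intro _ w (conj Fj Fn))) ejn.
by move: jn; rewrite ejn ltnn.
Qed.

(** When a disjoint union of internal sets is internal, finitely many of them already cover it; the
    partial sums are eventually constant and finite additivity concludes. *)
Lemma loeb_content_sigma_additive : semi_sigma_additive (loeb_content : set (loeb T) -> \bar R).
Proof.
move=> F iF tF iE.
have [N hN] := internal_cover_finite iE iF (@subset_refl _ _).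
apply: cvg_near_cst; near=> n.
rewrite -(loeb_content_bigU n iF tF).2; congr loeb_content.
rewrite -bigcup_mkord; apply/seteqP; split => w.
  by move=> [j _ Fj]; exists j.
move=> /hN[j /= jN Fj]; exists j => //=; apply: leq_ltn_trans jN _.
by near: n; exact: nbhs_infty_gt.
Unshelve. all: by end_near. Qed.

HB.instance Definition _ := isMeasure.Build _ _ _ loeb_content
  loeb_content0 loeb_content_ge0 loeb_content_sigma_additive.

Definition loeb_space := g_sigma_algebraType (@measurable _ (loeb T)).

Definition loeb_measure : set loeb_space -> \bar R := measure_extension loeb_content.

HB.instance Definition _ := Measure.on loeb_measure.

Lemma loeb_measureE A : (forall n, measurable (A n)) ->
  measurable (ext A : set loeb_space) /\
  loeb_measure (ext A) = (ulim (fun n => fine (mu n (A n))))%:E.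
Proof.
move=> mA; have iA : internal (ext A) by exists A.
split; first exact: sub_sigma_algebra.
by rewrite /loeb_measure /measure_extension measurable_mu_extE//; exact: loeb_contentE.
Qed.

Lemma loeb_measureT : loeb_measure setT = 1%E.
Proof.
have -> : [set: loeb_space] = ext (fun=> setT : set T).
  by apply/seteqP; split => // w _; exact: filterT.
rewrite (loeb_measureE (fun=> measurableT)).2; congr EFin; apply: ulim_cvgn.
by under eq_fun do rewrite probability_setT; exact: cvg_cst.
Qed.

HB.instance Definition _ := Measure_isProbability.Build _ _ _ loeb_measure loeb_measureT.

End LoebContent.

Lemma near_invS_le (R : realType) (e : R) : 0 < e -> \forall n \near \oo, n.+1%:R^-1 <= e.
Proof. by move=> e0; near do apply/ltW; exact: (near_infty_natSinv_lt (PosNum e0)). Unshelve. all: by end_near. Qed.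

(** * Integrals of bounded functions on a probability space *)

Section ProbTools.
Context d (T : measurableType d) (R : realType) (P : probability T R).
Implicit Types f g : T -> R.

Lemma prob_lty : (P setT < +oo)%E.
Proof. by rewrite probability_setT ltry. Qed.

Lemma prob_integrable f M : measurable_fun setT f -> (forall x, `|f x| <= M) ->
  P.-integrable setT (EFin \o f).
Proof. by move=> mf fM; apply: (@bounded_integrable _ _ _ _ _ _ M) => //; exact: prob_lty. Qed.

Lemma prob_integrable_cst (c : R) : P.-integrable setT (EFin \o (fun=> c)).
Proof. exact: (@prob_integrable _ `|c|). Qed.

Lemma prob_Rintegral_cst (c : R) : Rintegral P setT (fun=> c) = c.
Proof. rewrite Rintegral_cst// (_ : fine _ = 1) ?mulr1//.
by rewrite -[RHS]/(fine 1%E); congr fine; exact: probability_setT. Qed.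

Lemma prob_Rintegral_le f M : measurable_fun setT f -> (forall x, `|f x| <= M) ->
  `|Rintegral P setT f| <= M.
Proof.
move=> mf fM; have fi := prob_integrable mf fM.
apply: le_trans (le_normr_Rintegral measurableT fi) _.
rewrite -[leRHS]prob_Rintegral_cst; apply: le_Rintegral => //.
- by apply: (@prob_integrable (fun x => `|f x|) M) => [|x]; [exact: measurableT_comp|rewrite normr_id].
- by apply: (@prob_integrable (fun x => M) M) => // x; rewrite ger0_norm//; exact: le_trans (fM x).
Qed.

Lemma prob_Rintegral_dist f g M e : measurable_fun setT f -> measurable_fun setT g ->
  (forall x, `|f x| <= M) -> (forall x, `|f x - g x| <= e) ->
  `|Rintegral P setT f - Rintegral P setT g| <= e.
Proof.
move=> mf mg fM fg; have fi := prob_integrable mf fM.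
have gi : P.-integrable setT (EFin \o g).
  apply: (@prob_integrable g (M + e)) => // x.
  have -> : g x = f x - (f x - g x) by ring.
  by apply: le_trans (ler_normB _ _) _; exact: lerD.
rewrite -RintegralB//; apply: prob_Rintegral_le => //.
exact: measurable_funB.
Qed.

(** Image laws enter the proof through integrals of bounded functions, hence this form of the change
    of variables. *)
Lemma prob_image d' (T' : measurableType d') (phi : T -> T') : measurable_fun setT phi ->
  exists Q : probability T' R, forall (h : T' -> R) M, measurable_fun setT h -> (forall x, `|h x| <= M) ->
    Rintegral Q setT h = Rintegral P setT (h \o phi).
Proof.
move=> mphi.
pose X : {mfun T >-> T'} := MeasurableFun.Pack (MeasurableFun.Class (isMeasurableFun.Build _ _ _ _ _ mphi)).
exists (distribution P X) => h M mh hM.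
rewrite /Rintegral integral_pushforward//; first exact/measurable_EFinP.
rewrite preimage_setT; apply: (@prob_integrable (h \o phi) M) => [|x]; last exact: hM.
exact: measurableT_comp mh mphi.
Qed.

End ProbTools.

Lemma ultra_finite (I : finType) (h : nat -> I) : exists i, nat_ultra [set n | h n = i].
Proof.
apply: contrapT => /forallNP hn.
have hi i : nat_ultra [set n | h n <> i].
  have [hc|hc] := in_ultra_setVsetC [set n | h n = i] nat_ultraP.
    by case: (hn i).
  by apply: filterS hc.
have h1 : nat_ultra [set n | forall i, h n <> i] by exact: filter_forall. suff : nat_ultra set0 by exact: filter_not_empty.
by apply: filterS h1 => n /(_ (h n)).
Qed.

(** * Integrals of limits along the ultrafilter *)

Section LoebIntegral.
Context d (T : measurableType d) (R : realType) (mu : nat -> probability T R).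
Local Notation W := (@loeb_space _ T).
Local Notation Lam := (loeb_measure mu).

(** For a finite-valued function, integral and limit commute exactly: along a sequence [w] the index
    is constant for most [n], and the Loeb measure of a level set is by construction the limit of
    its measures. A uniform error [e] survives both limits. *)
Lemma loeb_ulim_approx (f : T -> R) (M e : R) : measurable_fun setT f -> (forall x, `|f x| <= M) -> 0 < e ->
  exists c : W -> R, [/\ measurable_fun setT c,
    forall w : W, `|ulim (fun n => f (w n)) - c w| <= e &
    `|ulim (fun n => Rintegral (mu n) setT f) - Rintegral Lam setT c| <= e].
Proof.
move=> mf fM e0; have [m [idx [c [midx fc]]]] := finidx_approx mf fM e0.
have /choice[J JP] : forall w : W, exists i, nat_ultra [set n | idx (w n) = i].
  by move=> w; exact: (ultra_finite (fun n => idx (w n))).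
have JE i : J @^-1` [set i] = ext (fun=> idx @^-1` [set i]).
  apply/seteqP; split => w /=; first by move=> <-; exact: JP.
  move=> wi; have [n [/= <- <-//]] := filter_ex (filterI wi (JP w)).
have mJ i : measurable (J @^-1` [set i]).
  by rewrite JE; exact: (loeb_measureE mu (fun=> midx i)).1.
exists (c \o J); split.
- exact: measurable_finidx.
- move=> w; have cf : (fun n => f (w n)) @ nat_ultra --> ulim (fun n => f (w n)).
    by apply: (@ulim_cvg _ _ M).
  have cf2 : (fun n => f (w n) - c (J w)) @ nat_ultra --> ulim (fun n => f (w n)) - c (J w).
    by apply: cvgB => //; exact: cvg_cst.
  apply: (nat_ultra_norm_le cf2).
  by apply: filterS (JP w) => n /= <-; exact: fc.
rewrite (Rintegral_finidx _ (prob_lty _) mJ).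
have -> : \sum_i c i * fine (Lam (J @^-1` [set i])) = ulim (fun n => Rintegral (mu n) setT (c \o idx)).
  apply/esym/ulimE.
  under eq_fun do rewrite (Rintegral_finidx _ (prob_lty _) midx).
  apply: cvg_bigsum => i; apply: cvgM; first exact: cvg_cst.
  rewrite JE (loeb_measureE mu (fun=> midx i)).2 /=.
  by apply: (@ulim_cvg _ _ 1) => n; exact: fine_prob_norm.
have mc : measurable_fun setT (c \o idx) by exact: measurable_finidx.
have b1 n : `|Rintegral (mu n) setT f| <= M by exact: prob_Rintegral_le.
have b2 n : `|Rintegral (mu n) setT (c \o idx)| <= M + e.
  apply: prob_Rintegral_le => // x /=.
  have -> : c (idx x) = f x - (f x - c (idx x)) by ring.
  by apply: le_trans (ler_normB _ _) _; exact: lerD.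
set b := ulim _; set b' := ulim _.
have cc : (fun n => Rintegral (mu n) setT f - Rintegral (mu n) setT (c \o idx)) @ nat_ultra --> b - b'.
  by apply: cvgB; [exact: ulim_cvg b1|exact: ulim_cvg b2].
apply: (nat_ultra_norm_le cc).
apply: nearW => n; exact: (prob_Rintegral_dist (mu n) mf mc fM fc).
Qed.

Lemma loeb_ulim_measurable (f : T -> R) (M : R) : measurable_fun setT f -> (forall x, `|f x| <= M) ->
  measurable_fun setT (fun w : W => ulim (fun n => f (w n))).
Proof.
move=> mf fM.
have /choice[c cP] : forall k, exists c : W -> R, measurable_fun setT c /\
    forall w : W, `|ulim (fun n => f (w n)) - c w| <= k.+1%:R^-1.
  move=> k; have [|c [h1 h2 _]] := @loeb_ulim_approx f M k.+1%:R^-1 mf fM; first by rewrite invr_gt0.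
  by exists c.
apply: (@measurable_fun_cvg _ _ _ _ c) => [m|w _]; first by have [] := cP m.
apply/cvgrPdist_le => e e0; near=> k.
apply: le_trans ((cP k).2 w) _.
by near: k; exact: near_invS_le.
Unshelve. all: by end_near. Qed.

Lemma loeb_ulim_bnd (f : T -> R) (M : R) : (forall x, `|f x| <= M) ->
  forall w : W, `|ulim (fun n => f (w n))| <= M.
Proof.
move=> fM w; have cf : (fun n => f (w n)) @ nat_ultra --> ulim (fun n => f (w n)).
  by apply: (@ulim_cvg _ _ M).
apply: (nat_ultra_norm_le cf).
exact: nearW.
Qed.

Lemma loeb_ulim_Rintegral (f : T -> R) (M : R) : measurable_fun setT f -> (forall x, `|f x| <= M) ->
  Rintegral Lam setT (fun w : W => ulim (fun n => f (w n))) =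
  ulim (fun n => Rintegral (mu n) setT f).
Proof.
move=> mf fM; apply/eqP; rewrite -subr_eq0 -normr_eq0; apply/eqP/le_anti.
rewrite normr_ge0 andbT; apply/ler_addgt0Pr => e e0; rewrite add0r.
have [|c [mc h1 h2]] := @loeb_ulim_approx f M (e / 2) mf fM; first by rewrite divr_gt0.
have h3 := prob_Rintegral_dist Lam (loeb_ulim_measurable mf fM) mc (loeb_ulim_bnd fM) h1.
rewrite distrC in h2; move: h2 h3; rewrite !ler_norml => /andP[? ?] /andP[? ?].
by apply/andP; split; lra.
Qed.

End LoebIntegral.

Lemma Rintegral_onem_cos (R : realType) (y dl : R) : 0 < dl -> y != 0 ->
  (\int[lebesgue_measure]_(t in `[0%R, dl]) (1 - cos (t * y))%:E = (dl - sin (dl * y) / y)%:E)%E.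
Proof.
move=> d0 y0.
have dF (x : R) : is_derive x 1 (fun t => t - sin (t * y) / y) (1 - cos (x * y)).
  apply: is_deriveB; rewrite (_ : cos (x * y) = y^-1 *: (cos (x * y) *: (y *: 1%R))); last first.
    by rewrite /GRing.scale /= mulr1; field.
  rewrite (_ : (fun t : R => sin (t * y) / y) = y^-1 \*: (sin \o ( *%R^~ y))); last first.
    by apply/funext => t /=; rewrite /GRing.scale /= mulrC.
  apply: is_deriveZ; apply: is_derive1_comp.
  rewrite [X in is_derive _ _ X](_ : _ = y \*: id); last by apply/funext => t; rewrite /= mulrC.
  exact: is_deriveZ.
rewrite (@continuous_FTC2 R (fun t => 1 - cos (t * y)) (fun t => t - sin (t * y) / y))//.
- by rewrite mul0r sin0 mul0r subr0 -EFinB subr0.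
- have h : continuous (fun t : R => t * y) by move=> t; apply: cvgM; [exact: cvg_id|exact: cvg_cst].
  apply: continuous_subspaceT => x; apply: cvgB; first exact: cvg_cst.
  exact: (continuous_comp (h x) (@continuous_cos R _)).
- have cF x : continuous_at x (fun t : R => t - sin (t * y) / y).
    by apply/differentiable_continuous/derivable1_diffP/ex_derive.
  split; first by move=> x _; exact: ex_derive.
  + exact/cvg_at_right_filter/cF.
  + exact/cvg_at_left_filter/cF.
- by move=> x _; rewrite derive1E; exact: derive_val.
Qed.

(** * Continuity theorem for characteristic functions *)

Section Tightness.
Context d (T : measurableType d) (R : realType) (P : probability T R).
Variable Y : T -> R.
Hypothesis mY : measurable_fun setT Y.

Let f (x : R * T) : \bar R := (1 + cos (x.1 * Y x.2))%:E.

Let mprod : measurable_fun setT (fun x : R * T => x.1 * Y x.2).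
Proof.
apply: measurable_funM; first exact: measurable_fst.
by apply: measurableT_comp mY _; exact: measurable_snd.
Qed.

(** Adding 1 makes the cosine nonnegative, so that Tonelli's theorem gives the measurability of its
    partial integral. *)
Lemma measurable_charfun_ray : measurable_fun setT (fun t : R => Rintegral P setT (fun w => cos (t * Y w))).
Proof.
have mf : measurable_fun setT f.
  by apply/measurable_EFinP; apply: measurable_funD => //; exact: measurable_cos_comp mprod.
have f0 x : (0 <= f x)%E by rewrite lee_fin; have := cos_geN1 (x.1 * Y x.2); lra.
have m1 := measurable_fun_fubini_tonelli_F (m2 := P) f mf f0.
have mc t : measurable_fun setT (fun w => cos (t * Y w)).
  by apply: measurable_cos_comp; apply: measurable_funM => //; exact: measurable_cst.
have e t : fubini_F P f t = (1 + Rintegral P setT (fun w => cos (t * Y w)))%:E.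
  have i1 : P.-integrable setT (EFin \o (fun w => cos (t * Y w))).
    by apply: (@prob_integrable _ _ _ _ _ 1) => // w; rewrite ler_norml cos_geN1 cos_le1.
  have i2 : P.-integrable setT (EFin \o (fun w => 1 + cos (t * Y w))).
    apply: (@prob_integrable _ _ _ _ _ 2); first exact: measurable_funD.
    by move=> w; rewrite ler_norml; have := cos_geN1 (t * Y w); have := cos_le1 (t * Y w); lra.
  rewrite /fubini_F /f /= -[LHS]fineK; last exact: integrable_fin_num.
  congr EFin; rewrite -[LHS]/(Rintegral P setT (fun w => 1 + cos (t * Y w))) RintegralD//.
    by rewrite prob_Rintegral_cst.
  exact: prob_integrable_cst.
have -> : (fun t => Rintegral P setT (fun w => cos (t * Y w))) = (fun t => fine (fubini_F P f t) - 1).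
  by apply/funext => t; rewrite e /= addrC addKr.
apply: measurable_funB; last exact: measurable_cst.
exact: measurableT_comp.
Qed.

(** The truncation inequality. Integrating [1 - cos (t * Y)] over [t] before [w] gives
    [dl - sin (dl * Y) / Y], which is at least [dl / 2] as soon as [|Y| >= 2 / dl]; for the other
    [w] nonnegativity is enough. *)
Lemma tail_charfun_le (dl : R) : 0 < dl ->
  ((dl / 2)%:E * P [set w | (2 / dl <= `|Y w|)%R] <=
  \int[lebesgue_measure]_(t in `[0%R, dl]) (1 - Rintegral P setT (fun w => cos (t * Y w)))%:E)%E.
Proof.
move=> d0; set A := mkset _.
have mA : measurable A.
  rewrite (_ : A = (fun w => `|Y w|) @^-1` `[2 / dl, +oo[); last first.
    by apply/seteqP; split => w /=; rewrite in_itv/= andbT.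
  have mn : measurable_fun setT (fun w => `|Y w|) by exact: measurableT_comp.
  by rewrite -[X in measurable X]setTI; apply: mn.
pose h (x : R * T) : \bar R := (\1_(`[0%R, dl] : set R) x.1 * (1 - cos (x.1 * Y x.2)))%:E.
have h0 x : (0 <= h x)%E.
  by rewrite lee_fin mulr_ge0// ?indicE// subr_ge0 cos_le1.
have mh : measurable_fun setT h.
  apply/measurable_EFinP; apply: measurable_funM.
    by apply: (measurableT_comp _ (@measurable_fst _ _ _ _)); exact: measurable_indic.
  by apply: measurable_funB => //; exact: measurable_cos_comp mprod.
have -> : (\int[lebesgue_measure]_(t in `[0%R, dl]) (1 - Rintegral P setT (fun w => cos (t * Y w)))%:E
   = \int[lebesgue_measure]_t \int[P]_w h (t, w))%E.
  rewrite integral_mkcond; apply: eq_integral => t _; rewrite /h /=.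
  under [RHS]eq_integral do rewrite EFinM.
  have i1 : P.-integrable setT (EFin \o (fun w => cos (t * Y w))).
    apply: (@prob_integrable _ _ _ _ _ 1) => // [|w]; last by rewrite ler_norml cos_geN1 cos_le1.
    by apply: measurable_cos_comp; apply: measurable_funM => //; exact: measurable_cst.
  have i0 : P.-integrable setT (EFin \o (fun=> 1%R)) by exact: prob_integrable_cst.
  have i2 : P.-integrable setT (EFin \o (fun w => 1 - cos (t * Y w))%R).
    exact: (integrableB measurableT i0 i1).
  rewrite (integralZl measurableT i2) patchE indicE.
  case: ifPn => _; last by rewrite mul0e.
  rewrite mul1e -[RHS]fineK; last exact: integrable_fin_num.
  congr EFin; rewrite -[RHS]/(Rintegral P setT (fun w => 1 - cos (t * Y w))%R) RintegralB//.
  by rewrite prob_Rintegral_cst.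
have -> : (\int[lebesgue_measure]_t \int[P]_w h (t, w) = \int[P]_w \int[lebesgue_measure]_t h (t, w))%E.
  exact: (@fubini_tonelli _ _ _ _ _ lebesgue_measure P h mh h0).
have -> : ((dl / 2)%:E * P A = \int[P]_w ((dl / 2) * \1_A w)%:E)%E.
  under eq_integral do rewrite EFinM.
  rewrite ge0_integralZl//; last 2 first.
    by apply/measurable_EFinP; exact: measurable_indic.
    by rewrite lee_fin divr_ge0// ltW.
  by rewrite integral_indic// setIT.
apply: ge0_le_integral => //.
- by move=> w _; rewrite lee_fin mulr_ge0// ?divr_ge0 ?(ltW d0)// indicE.
- by apply/measurable_EFinP; apply: measurable_funM => //; exact: measurable_indic.
- exact: (@measurable_fun_fubini_tonelli_G _ _ _ _ _ (@lebesgue_measure R) h mh h0).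
move=> w _; rewrite indicE; have [wA|_] := boolP (w \in A); last first.
  by rewrite mulr0; exact: integral_ge0.
rewrite inE in wA; have wA' : 2 / dl <= `|Y w| := wA.
have Y0 : Y w != 0.
  by rewrite -normr_gt0; apply: lt_le_trans wA'; rewrite divr_gt0.
have -> : (\int[lebesgue_measure]_t h (t, w) = (dl - sin (dl * Y w) / Y w)%:E)%E.
  rewrite -Rintegral_onem_cos// [RHS]integral_mkcond; apply: eq_integral => t _.
  rewrite /h /= patchE indicE; case: ifPn => _; by rewrite ?mul1r ?mul0r.
rewrite lee_fin mulr1.
have : `|sin (dl * Y w) / Y w| <= dl / 2.
  rewrite normrM normfV ler_pdivrMr ?normr_gt0//.
  have s1 : `|sin (dl * Y w)| <= 1 by rewrite ler_norml sin_geN1 sin_le1.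
  apply: le_trans s1 _; move: wA'; rewrite ler_pdivrMr// mulrC => h2.
  by rewrite mulrAC ler_pdivlMr// mul1r.
by rewrite ler_norml; lra.
Qed.

End Tightness.

Lemma le_of_dist (R : realType) (a c dl e : R) :
  c <= e / 4 * dl -> `|c - a| <= e / 4 * dl -> a <= dl / 2 * e.
Proof. by rewrite ler_norml => h1 /andP[h2 h3]; lra. Qed.

Lemma tight_of_charfun d (T : measurableType d) (R : realType)
    (mu : nat -> probability T R) (Y : T -> R) (phi : R -> R) : measurable_fun setT Y ->
  (forall t, (fun n => Rintegral (mu n) setT (fun w => cos (t * Y w))) @ \oo --> phi t) ->
  phi t @[t --> (0 : R)] --> (1 : R) -> forall e : R, 0 < e ->
  exists2 K : R, 0 < K & \forall n \near \oo, (mu n [set w | (K <= `|Y w|)%R] <= e%:E)%E.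
Proof.
move=> mY phin phi1 e e0.
(* On [[0, dl]] the limit is within [e / 4] of 1, so its defect integrates to at most [dl * e / 4],
   and the defect of the n-th law eventually to at most [dl * e / 2]. The truncation inequality then
   divides by [dl / 2]. *)
have e4 : 0 < e / 4 by rewrite divr_gt0.
have /cvgrPdist_le/(_ _ e4)/nbhs_ballP[r /= r0 hr] := phi1.
pose dl := r / 2; have d0 : 0 < dl by rewrite divr_gt0.
have phir t : 0 <= t <= dl -> `|1 - phi t| <= e / 4.
  move=> /andP[t0 td]; apply: hr; rewrite /ball /= sub0r normrN ger0_norm//.
  by apply: le_lt_trans td _; rewrite ltr_pdivrMr// mulr_natr mulr2n ltrDl.
pose psi n (t : R) := 1 - Rintegral (mu n) setT (fun w => cos (t * Y w)).
have mpsi n : measurable_fun setT (psi n).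
  by apply: measurable_funB => //; exact: measurable_charfun_ray.
have mphi : measurable_fun setT phi.
  exact: (measurable_fun_cvg (fun n => measurable_charfun_ray (mu n) mY) (fun t _ => phin t)).
have mD : measurable (`[0, dl]%classic : set R) by [].
have psib n t : `|psi n t| <= 2.
  have : `|Rintegral (mu n) setT (fun w => cos (t * Y w))| <= 1.
    apply: prob_Rintegral_le => [|w]; last by rewrite ler_norml cos_geN1 cos_le1.
    by apply: measurable_cos_comp; apply: measurable_funM => //; exact: measurable_cst.
  by rewrite /psi !ler_norml; lra.
have i2 : lebesgue_measure.-integrable (`[0, dl]%classic : set R) (EFin \o (fun=> 2 : R)).
  apply: (@bounded_integrable _ _ _ _ _ _ 2) => //.
    by rewrite /= lebesgue_measure_itv /=; case: ifP => _; rewrite ?ltry // -EFinB ltry.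
  by move=> x _; rewrite ger0_norm.
have m1phi : measurable_fun setT (fun t => 1 - phi t) by apply: measurable_funB.
have psicv t : (fun n => psi n t) @ \oo --> 1 - phi t.
  by apply: cvgB; [exact: cvg_cst|exact: phin].
have aecv : {ae lebesgue_measure, forall t, (`[0, dl]%classic : set R) t -> (fun n => psi n t) @ \oo --> 1 - phi t}.
  by apply: aeW => t _; exact: psicv.
have [i1 cv] := @Rintegral_dct _ _ _ lebesgue_measure `[0, dl]%classic psi (fun t => 1 - phi t) (fun=> 2)
  mD (fun n => measurable_funTS (mpsi n)) (measurable_funTS m1phi)
  aecv i2 (fun n t _ => psib n t).
have lim_le : Rintegral lebesgue_measure `[0, dl]%classic (fun t => 1 - phi t) <= e / 4 * dl.
  have -> : e / 4 * dl = Rintegral lebesgue_measure `[0, dl]%classic (fun=> e / 4).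
    rewrite Rintegral_cst//= lebesgue_measure_itv /= lte_fin d0 /= subr0//.
  apply: le_Rintegral => //.
    apply: (@bounded_integrable _ _ _ _ _ _ (e / 4)) => //.
      by rewrite /= lebesgue_measure_itv /=; case: ifP => _; rewrite ?ltry // -EFinB ltry.
    by move=> x _; rewrite ger0_norm// ltW.
  by move=> t /=; rewrite in_itv /= => /phir; rewrite ler_norml => /andP[].
exists (2 / dl); first by rewrite divr_gt0.
have ed : 0 < e / 4 * dl by rewrite mulr_gt0.
have /cvgrPdist_le/(_ _ ed) := cv.
apply: filterS => n hn.
have i1n : lebesgue_measure.-integrable (`[0, dl]%classic : set R) (EFin \o psi n).
  by apply: (@integrable_le _ _ _ lebesgue_measure _ (psi n) (fun=> 2) mD (measurable_funTS (mpsi n)) i2).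
have e1 : (\int[lebesgue_measure]_(t in `[0%R, dl]) (psi n t)%:E =
    (Rintegral lebesgue_measure `[0, dl]%classic (psi n))%:E)%E.
  exact: (@EFin_Rintegral _ _ _ lebesgue_measure _ _ mD i1n).
have : ((dl / 2)%:E * mu n [set w | (2 / dl <= `|Y w|)%R] <=
    (Rintegral lebesgue_measure `[0, dl]%classic (psi n))%:E)%E.
  by rewrite -e1; exact: tail_charfun_le.
have mA : measurable [set w | 2 / dl <= `|Y w|].
  rewrite (_ : mkset _ = (fun w => `|Y w|) @^-1` `[2 / dl, +oo[); last first.
    by apply/seteqP; split => w /=; rewrite in_itv/= andbT.
  have mn : measurable_fun setT (fun w => `|Y w|) by exact: measurableT_comp.
  by rewrite -[X in measurable X]setTI; apply: mn.
rewrite -[mu n _]fineK ?fin_num_measure// -EFinM !lee_fin.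
move=> h.
have : dl / 2 * fine (mu n [set w | 2 / dl <= `|Y w|]) <= dl / 2 * e.
  by apply: le_trans h _; exact: le_of_dist lim_le hn.
by rewrite ler_pM2l// divr_gt0.
Qed.

Lemma measurable_dotp (R : realType) k (th : k.-tuple R) : measurable_fun setT (dotp th).
Proof.
apply: measurable_sum => i; apply: measurable_funM => //.
exact: measurable_tnth.
Qed.

Lemma Rintegral_eq_off_null d (T : measurableType d) (R : realType) (mu : {measure set T -> \bar R})
    (B : set T) (f g : T -> R) : measurable B -> mu (~` B) = 0%E -> measurable_fun setT f ->
  measurable_fun setT g -> (forall x, B x -> f x = g x) ->
  Rintegral mu setT f = Rintegral mu setT g.
Proof.
move=> mB B0 mf mg fg; rewrite /Rintegral; congr fine.
apply: ae_eq_integral => //; [exact/measurable_EFinP|exact/measurable_EFinP|].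
exists (~` B); split => //; first exact: measurableC.
by move=> x /= h Bx; apply: h => _; rewrite fg.
Qed.

Section LevyContinuity.
Context (R : realType) (k : nat) (mu : nat -> probability (k.-tuple R) R).
Variables fc fs : k.-tuple R -> R.
Hypothesis cos_cvg : forall th, (fun n => Rintegral (mu n) setT (fun x => cos (dotp th x))) @ \oo --> fc th.
Hypothesis sin_cvg : forall th, (fun n => Rintegral (mu n) setT (fun x => sin (dotp th x))) @ \oo --> fs th.
Hypothesis fc_ray : forall th, fc (tscale t th) @[t --> (0 : R)] --> (1 : R).

Let T : measurableType _ := (k.-tuple R : Type).
Let W := @loeb_space _ T.
Let Lam := loeb_measure mu.

Let big (K : nat) (i : 'I_k) : set T := [set x | K%:R <= `|tnth x i|].

Let mbig K i : measurable (big K i).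
Proof.
rewrite (_ : big K i = (fun x => `|tnth x i|) @^-1` `[K%:R, +oo[); last first.
  by apply/seteqP; split => w /=; rewrite in_itv/= andbT.
have mn : measurable_fun setT (fun x : T => `|tnth x i|).
  by apply: measurableT_comp => //; exact: measurable_tnth.
by rewrite -[X in measurable X]setTI; apply: mn.
Qed.

(** Sequences all of whose coordinates stay below [K] in absolute value for most indices. The union
    [B] of these sets consists of the finite points, on which the standard part lives. *)
Let Bdd (K : nat) : set W := ext (fun=> ~` \big[setU/set0]_(i < k) big K i).

Let mBdd_aux K : forall n : nat, measurable (~` \big[setU/set0]_(i < k) big K i).
Proof. by move=> n; apply: measurableC; apply: bigsetU_measurable => i _; exact: mbig. Qed.

Let mBdd K : measurable (Bdd K).
Proof. exact: (loeb_measureE mu (mBdd_aux K)).1. Qed.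

Let B : set W := \bigcup_K Bdd K.

Let mB : measurable B.
Proof. by apply: bigcupT_measurable => K; exact: mBdd. Qed.

Let tail_coord (i : 'I_k) (e : R) : 0 < e -> exists K0 : nat, forall K, (K0 <= K)%N ->
  \forall n \near \oo, (mu n (big K i) <= e%:E)%E.
Proof.
move=> e0.
pose ei : k.-tuple R := [tuple (i == j)%:R | j < k].
have dei (t : R) (x : k.-tuple R) : dotp (tscale t ei) x = t * tnth x i.
  rewrite /dotp (bigD1 i)//= big1 ?addr0.
    by rewrite !tnth_mktuple eqxx mulr1.
  by move=> j ji; rewrite !tnth_mktuple eq_sym (negbTE ji) mulr0 mul0r.
have [t|K K0 KP] := @tight_of_charfun _ _ _ mu (fun x => tnth x i) (fun t => fc (tscale t ei))
   (measurable_tnth _) _ (@fc_ray ei) _ e0.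
  have := @cos_cvg (tscale t ei).
  by under eq_fun do under eq_Rintegral do rewrite dei.
exists (Num.trunc K).+1 => N KN; apply: filterS KP => n; apply: le_trans.
have mK : measurable [set w : k.-tuple R | K <= `|tnth w i|].
  rewrite (_ : mkset _ = (fun x => `|tnth x i|) @^-1` `[K, +oo[); last first.
    by apply/seteqP; split => w /=; rewrite in_itv/= andbT.
  have mn : measurable_fun setT (fun x : T => `|tnth x i|).
    by apply: measurableT_comp => //; exact: measurable_tnth.
  by rewrite -[X in measurable X]setTI; apply: mn.
apply: le_measure; rewrite ?inE//; first exact: mbig.
move=> x /=; apply: le_trans; apply/ltW/(lt_le_trans (Num.Theory.truncnS_gt K)).
by rewrite ler_nat.
Qed.

Let tail_all (e : R) : 0 < e -> exists K, \forall n \near \oo,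
  (mu n (\big[setU/set0]_(i < k) big K i) <= (k%:R * e)%:E)%E.
Proof.
move=> e0; have /choice[K KP] : forall i, exists K0 : nat, forall K, (K0 <= K)%N ->
    \forall n \near \oo, (mu n (big K i) <= e%:E)%E by move=> i; exact: tail_coord.
exists (\max_i K i)%N.
have h i : \forall n \near \oo, (mu n (big (\max_i K i)%N i) <= e%:E)%E.
  by apply: KP; exact: leq_bigmax.
have : \forall n \near \oo, forall i, (mu n (big (\max_i K i)%N i) <= e%:E)%E by exact: filter_forall.
apply: filterS => n hn.
apply: (@le_trans _ _ (\sum_(i < k) mu n (big (\max_i K i)%N i))%E).
  suff : measurable (\big[setU/set0]_(i < k) big (\max_i K i)%N i) /\
      (mu n (\big[setU/set0]_(i < k) big (\max_i K i)%N i) <=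
       \sum_(i < k) mu n (big (\max_i K i)%N i))%E by case.
  apply: (big_ind2 (fun A x => measurable A /\ (mu n A <= x)%E)) => [|A x A' x' [mA hA] [mA' hA']|i _]; first by rewrite measure0.
    split; first exact: measurableU.
    by apply: (@le_trans _ _ (mu n A + mu n A')%E); [exact: measureU2|exact: leeD].
  by split => //; exact: mbig.
apply: (@le_trans _ _ (\sum_(i < k) e%:E)%E); first by apply: lee_sum => i _; exact: hn.
by rewrite sumEFin sumr_const card_ord mulr_natl.
Qed.

Let nullB : Lam (~` B) = 0%E.
Proof.
apply/eqP; rewrite eq_le measure_ge0 andbT; apply/lee_addgt0Pr => e e0; rewrite add0e.
(* The [k] coordinates contribute at most [k * (e / (k + 1)) <= e]; the successor covers dimension
   0. *)
have ek : 0 < e / k.+1%:R by rewrite divr_gt0.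
have [K KP] := tail_all ek.
have mU : forall n : nat, measurable (\big[setU/set0]_(i < k) big K i).
  by move=> _; apply: bigsetU_measurable => i _; exact: mbig.
have [m1 m2] := loeb_measureE mu mU.
apply: (@le_trans _ _ (Lam (ext (fun=> \big[setU/set0]_(i < k) big K i)))).
  apply: le_measure; rewrite ?inE//; first exact: measurableC.
  move=> w; rewrite /B setC_bigcup => /(_ K I); rewrite /Bdd extC.
  by apply: filterS => n; rewrite setCK.
rewrite /Lam m2 lee_fin.
have c1 : (fun n => fine (mu n (\big[setU/set0]_(i < k) big K i))) @ nat_ultra -->
    ulim (fun n => fine (mu n (\big[setU/set0]_(i < k) big K i))).
  by apply: (@ulim_cvg _ _ 1) => n; exact: (fine_prob_norm _ (mU n)).
apply: le_trans (ler_norm _) _; apply: (nat_ultra_norm_le c1).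
apply: nat_ultra_oo; apply: filterS KP => n KPn.
rewrite ger0_norm ?fine_ge0// -lee_fin fineK; last by rewrite fin_num_measure//; exact: mU n.
apply: le_trans KPn _; rewrite lee_fin.
rewrite mulrCA ler_piMr//; first exact: ltW.
by rewrite ler_pdivrMr// mul1r ler_nat.
Qed.

Let clamp (K : nat) (x : R) : R := Num.max (- K%:R) (Num.min K%:R x).

Let clamp_bnd K x : `|clamp K x| <= K%:R.
Proof.
rewrite ler_norml /clamp le_max lexx /= ge_max ge_min lexx /=.
by rewrite andbT lerNl; apply: le_trans (ler0n R K); rewrite oppr_le0.
Qed.

Let clamp_id K x : `|x| < K%:R -> clamp K x = x.
Proof.
rewrite ltr_norml => /andP[h1 h2].
by rewrite /clamp min_r ?max_r// ltW.
Qed.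

(** The truncated sequence is bounded, so its limit exists at every [w] and is measurable in [w]. At
    a finite point the truncations agree from some [K] on. *)
Let Yk (K : nat) (i : 'I_k) (w : W) : R := ulim (fun n => clamp K (tnth (w n) i)).

Let mYk K i : measurable_fun setT (Yk K i).
Proof.
apply: (@loeb_ulim_measurable _ T R mu (fun x => clamp K (tnth x i)) K%:R) => //.
have mt : measurable_fun setT (fun x : T => tnth x i) by exact: measurable_tnth.
apply: measurable_maxr; first exact: measurable_cst.
by apply: measurable_minr => //; exact: measurable_cst.
Qed.

(** The standard part of the i-th coordinate. The factor [\1_B] sends the other points to 0, so that
    the limit in [K] exists everywhere and is measurable. *)
Let Y (i : 'I_k) (w : W) : R := limn (fun K => Yk K i w * \1_B w).

Let Bdd_eventually K w : Bdd K w -> nat_ultra [set n | forall i, `|tnth (w n) i| < K%:R].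
Proof.
apply: filterS => n /= h i; rewrite ltNge; apply/negP => hi; apply: h.
by rewrite (bigD1 i)//=; left.
Qed.

Let Yk_const K K' i w : Bdd K w -> (K <= K')%N ->
  (fun n => tnth (w n) i) @ nat_ultra --> Yk K' i w /\ Yk K' i w = Yk K i w.
Proof.
move=> /Bdd_eventually wK KK'.
have h K1 : (K <= K1)%N -> (fun n => tnth (w n) i) @ nat_ultra --> Yk K1 i w.
  move=> KK1; have c : (fun n => clamp K1 (tnth (w n) i)) @ nat_ultra --> Yk K1 i w.
    by apply: (@ulim_cvg _ _ K1%:R) => n.
  apply: cvg_trans c; apply: near_eq_cvg; apply: filterS wK => n /= hn.
  by rewrite clamp_id//; apply: lt_le_trans (hn i) _; rewrite ler_nat.
split; first exact: h.
by rewrite -(ulimE (h _ KK')) -(ulimE (h _ (leqnn _))).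
Qed.

Let Y_cvg i w : (fun K => Yk K i w * \1_B w) @ \oo --> Y i w.
Proof.
have [Bw|nBw] := pselect (B w).
  have [K _ wK] := Bw; suff : (fun K => Yk K i w * \1_B w) @ \oo --> Yk K i w * \1_B w.
    by move=> /cvgP.
  apply: cvg_near_cst; exists K => // K' /= KK'.
  by rewrite (Yk_const i wK KK').2.
suff : (fun K => Yk K i w * \1_B w) @ \oo --> (0 : R) by move=> /cvgP.
apply: cvg_near_cst; apply: nearW => K.
by rewrite indicE memNset ?mulr0.
Qed.

Let mY i : measurable_fun setT (Y i).
Proof.
have m K : measurable_fun setT (fun w => Yk K i w * \1_B w).
  by apply: measurable_funM; [exact: mYk|exact: measurable_indic].
exact: (measurable_fun_cvg m (fun w _ => @Y_cvg i w)).
Qed.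

Let Y_lim i w : B w -> (fun n => tnth (w n) i) @ nat_ultra --> Y i w.
Proof.
move=> Bw; have [K _ wK] := Bw.
suff -> : Y i w = Yk K i w by have [] := Yk_const i wK (leqnn K).
apply: (@cvg_lim _ _ _ _ _ (fun K => Yk K i w * \1_B w)) => //.
apply: cvg_near_cst; exists K => // K' /= KK'.
by rewrite (Yk_const i wK KK').2 indicE mem_set// mulr1.
Qed.

Let st (w : W) : k.-tuple R := [tuple Y i w | i < k].

Let mst : measurable_fun setT st.
Proof.
apply/measurable_fun_tnthP => i; apply: eq_measurable_fun (mY i) => w _ /=.
by rewrite tnth_mktuple.
Qed.

Let st_dotp th w : B w -> (fun n => dotp th (w n)) @ nat_ultra --> dotp th (st w).
Proof.
move=> Bw; apply: cvg_bigsum => i; apply: cvgM; first exact: cvg_cst.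
by rewrite tnth_mktuple; exact: Y_lim.
Qed.

(** For [h] the cosine or the sine and [w] finite, continuity makes [h (dotp th (st w))] the limit
    of [h (dotp th (w n))] along the ultrafilter. The Loeb integral of that limit is the limit of
    the integrals over [mu n], known by hypothesis. *)
Theorem levy_continuity : exists Q : probability (k.-tuple R) R, forall th,
  Rintegral Q setT (fun x => cos (dotp th x)) = fc th /\
  Rintegral Q setT (fun x => sin (dotp th x)) = fs th.
Proof.
have [Q QP] := prob_image Lam mst; exists Q => th.
have key (h : R -> R) (l : R) : measurable_fun setT h -> continuous h -> (forall x, `|h x| <= 1) ->
    (fun n => Rintegral (mu n) setT (fun x => h (dotp th x))) @ \oo --> l ->
    Rintegral Q setT (fun x => h (dotp th x)) = l.
  move=> mh ch h1 hl.
  have mhd : measurable_fun setT (fun x : T => h (dotp th x)).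
    by apply: measurableT_comp mh _; exact: measurable_dotp.
  rewrite (QP _ 1)// -(ulim_cvgn hl) -(loeb_ulim_Rintegral mu mhd (fun x => h1 _)).
  apply: (Rintegral_eq_off_null mB nullB).
  - exact: measurableT_comp mhd mst.
  - exact: (loeb_ulim_measurable mu mhd (fun x => h1 _)).
  move=> w Bw /=; apply/esym/ulimE.
  apply: (@cvg_comp _ _ _ (fun n => dotp th (w n)) h _ (nbhs (dotp th (st w)))).
    exact: st_dotp.
  exact: ch.
split.
  apply: (@key cos) => //; [exact: continuous_measurable_fun (@continuous_cos R)|exact: continuous_cos|].
  by move=> x; rewrite ler_norml cos_geN1 cos_le1.
apply: (@key sin) => //; [exact: continuous_measurable_fun (@continuous_sin R)|exact: continuous_sin|].
by move=> x; rewrite ler_norml sin_geN1 sin_le1.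
Qed.

End LevyContinuity.

(** * Exponents of infinitely divisible laws *)

Section RFubini.
Context d1 d2 (T1 : measurableType d1) (T2 : measurableType d2) (R : realType).
Variable m1 : {sigma_finite_measure set T1 -> \bar R}.
Variable m2 : {sigma_finite_measure set T2 -> \bar R}.
Variable f : T1 * T2 -> R.
Hypothesis fi : (m1 \x m2)%E.-integrable setT (EFin \o f).

Lemma Rintegral12 :
  m1.-integrable setT (EFin \o (fun x => Rintegral m2 setT (fun y => f (x, y)))) /\
  Rintegral m1 setT (fun x => Rintegral m2 setT (fun y => f (x, y))) =
  Rintegral (m1 \x m2)%E setT f.
Proof.
have iF := integrable_fubini_F fi.
have ae1 := ae_integrable1 fi.
have mF : measurable_fun setT (EFin \o (fun x => Rintegral m2 setT (fun y => f (x, y)))).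
  by apply/measurable_EFinP; apply: measurableT_comp => //; exact: measurable_fubini_F fi.
have aeE : ae_eq m1 setT (fubini_F m2 (EFin \o f))
    (EFin \o (fun x => Rintegral m2 setT (fun y => f (x, y)))).
  apply: filterS ae1 => x ix _.
  by rewrite /fubini_F /= -(EFin_Rintegral measurableT ix).
split; first exact: (integrable_ae_eq measurableT mF aeE iF).
rewrite /Rintegral; congr fine; rewrite -(integral12_prod_meas1 fi).
apply: ae_eq_integral => //; first exact: measurable_fubini_F fi.
exact: ae_eq_sym.
Qed.

Lemma Rintegral21 :
  m2.-integrable setT (EFin \o (fun y => Rintegral m1 setT (fun x => f (x, y)))) /\
  Rintegral m2 setT (fun y => Rintegral m1 setT (fun x => f (x, y))) =
  Rintegral (m1 \x m2)%E setT f.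
Proof.
have mf : measurable_fun setT (EFin \o f) by exact: measurable_int fi.
have iF : m2.-integrable setT (fubini_G m1 (EFin \o f)).
  apply/integrableP; split; first exact: measurable_fubini_G fi.
  apply: le_lt_trans ((integrable21ltyP _ _ mf).1 fi).
  apply: ge0_le_integral => //.
  - by apply: measurableT_comp => //; exact: measurable_fubini_G fi.
  - have mfa : measurable_fun setT (abse \o (EFin \o f)) by exact: measurableT_comp.
    exact: (measurable_fun_fubini_tonelli_G (m1 := m1) (abse \o (EFin \o f)) mfa (fun=> abse_ge0 _)).
  - move=> y _; apply: le_abse_integral => //.
    exact: (measurableT_comp mf (pair2_measurable y)).
have ae1 := ae_integrable2 fi.
have mF : measurable_fun setT (EFin \o (fun y => Rintegral m1 setT (fun x => f (x, y)))).
  by apply/measurable_EFinP; apply: measurableT_comp => //; exact: measurable_fubini_G fi.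
have aeE : ae_eq m2 setT (fubini_G m1 (EFin \o f))
    (EFin \o (fun y => Rintegral m1 setT (fun x => f (x, y)))).
  apply: filterS ae1 => x ix _.
  by rewrite /fubini_G /= -(EFin_Rintegral measurableT ix).
split; first exact: (integrable_ae_eq measurableT mF aeE iF).
rewrite /Rintegral; congr fine; rewrite -(integral21_prod_meas1 fi).
apply: ae_eq_integral => //; first exact: measurable_fubini_G fi.
exact: ae_eq_sym.
Qed.

End RFubini.

(* [Q] has characteristic function [exp (A + i B)]. *)
Definition cfexp (R : realType) k (Q : probability (k.-tuple R) R) (A B : k.-tuple R -> R) :=
  forall th, Rintegral Q setT (fun x => cos (dotp th x)) = expR (A th) * cos (B th) /\
             Rintegral Q setT (fun x => sin (dotp th x)) = expR (A th) * sin (B th).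

(** All real [t >= 0] are asked for, not only the [1 / n] of infinite divisibility: stability under
    nonnegative scaling is then immediate, and sums and limits are handled for each [t]
    separately. *)
Definition levy_exp (R : realType) k (A B : k.-tuple R -> R) :=
  forall t : R, 0 <= t -> exists Q : probability (k.-tuple R) R,
    cfexp Q (fun th => t * A th) (fun th => t * B th).

Section LevyExp.
Context (R : realType).

Lemma cos_norm_le1 (x : R) : `|cos x| <= 1.
Proof. by rewrite ler_norml cos_geN1 cos_le1. Qed.

Lemma sin_norm_le1 (x : R) : `|sin x| <= 1.
Proof. by rewrite ler_norml sin_geN1 sin_le1. Qed.

Lemma measurable_cos_dotp k (th : k.-tuple R) : measurable_fun setT (fun x => cos (dotp th x)).
Proof. by apply: measurable_cos_comp; exact: measurable_dotp. Qed.

Lemma measurable_sin_dotp k (th : k.-tuple R) : measurable_fun setT (fun x => sin (dotp th x)).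
Proof. by apply: measurable_sin_comp; exact: measurable_dotp. Qed.

Lemma cfexp_dirac k (y : k.-tuple R) : cfexp (\d_y : probability _ R) (fun=> 0) (fun th => dotp th y).
Proof.
move=> th; rewrite expR0 !mul1r /Rintegral !integral_dirac ?diracT ?mul1e//.
  by apply/measurable_EFinP; exact: measurable_sin_dotp.
by apply/measurable_EFinP; exact: measurable_cos_dotp.
Qed.

Lemma Rintegral_prod_mul d1 d2 (T1 : measurableType d1) (T2 : measurableType d2)
    (P : probability T1 R) (Q : probability T2 R) (f : T1 -> R) (g : T2 -> R) :
  measurable_fun setT f -> measurable_fun setT g -> (forall x, `|f x| <= 1) -> (forall x, `|g x| <= 1) ->
  (P \x Q)%E.-integrable setT (EFin \o (fun z => f z.1 * g z.2)) /\
  Rintegral (P \x Q)%E setT (fun z => f z.1 * g z.2) = Rintegral P setT f * Rintegral Q setT g.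
Proof.
move=> mf mg f1 g1.
have i1 : (P \x Q)%E.-integrable setT (EFin \o (fun z => f z.1 * g z.2)).
  apply: (@prob_integrable _ _ _ _ _ 1).
    apply: measurable_funM.
      by apply: measurableT_comp mf _; exact: measurable_fst.
    by apply: measurableT_comp mg _; exact: measurable_snd.
  by move=> z; rewrite normrM mulr_ile1.
split => //; rewrite -(Rintegral12 i1).2 /=.
have gi := prob_integrable Q mg g1; have fi := prob_integrable P mf f1.
under eq_Rintegral do rewrite RintegralZl//.
by rewrite RintegralZr.
Qed.

Lemma cfexp_conv k (P Q : probability (k.-tuple R) R) A B A' B' :
  cfexp P A B -> cfexp Q A' B' ->
  exists S : probability (k.-tuple R) R, cfexp S (fun th => A th + A' th) (fun th => B th + B' th).
Proof.
move=> hP hQ.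
pose add (z : k.-tuple R * k.-tuple R) : k.-tuple R := [tuple tnth z.1 i + tnth z.2 i | i < k].
have madd : measurable_fun setT add.
  apply/measurable_fun_tnthP => i.
  apply: (@eq_measurable_fun _ _ _ _ _ (fun z : k.-tuple R * k.-tuple R => tnth z.1 i + tnth z.2 i)).
    by move=> z _ /=; rewrite tnth_mktuple.
  apply: measurable_funD.
    by apply: measurableT_comp (measurable_tnth i) _; exact: measurable_fst.
  by apply: measurableT_comp (measurable_tnth i) _; exact: measurable_snd.
have dadd th z : dotp th (add z) = dotp th z.1 + dotp th z.2.
  rewrite /dotp -big_split; apply: eq_bigr => i _.
  by rewrite tnth_mktuple mulrDr.
have [S hS] := prob_image (P \x Q)%E madd.
exists S => th; have [p1 p2] := hP th; have [q1 q2] := hQ th.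
have [icc ecc] := Rintegral_prod_mul P Q (measurable_cos_dotp th) (measurable_cos_dotp th)
  (fun x => cos_norm_le1 _) (fun x => cos_norm_le1 _).
have [iss ess] := Rintegral_prod_mul P Q (measurable_sin_dotp th) (measurable_sin_dotp th)
  (fun x => sin_norm_le1 _) (fun x => sin_norm_le1 _).
have [isc esc] := Rintegral_prod_mul P Q (measurable_sin_dotp th) (measurable_cos_dotp th)
  (fun x => sin_norm_le1 _) (fun x => cos_norm_le1 _).
have [ics ecs] := Rintegral_prod_mul P Q (measurable_cos_dotp th) (measurable_sin_dotp th)
  (fun x => cos_norm_le1 _) (fun x => sin_norm_le1 _).
split.
  rewrite (hS _ 1 (measurable_cos_dotp th) (fun x => cos_norm_le1 _)).
  under eq_Rintegral do rewrite /= dadd cosD.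
  rewrite RintegralB// ecc ess p1 p2 q1 q2 expRD cosD; ring.
rewrite (hS _ 1 (measurable_sin_dotp th) (fun x => sin_norm_le1 _)).
under eq_Rintegral do rewrite /= dadd sinD.
rewrite RintegralD// esc ecs p1 p2 q1 q2 expRD sinD; ring.
Qed.

Lemma cfexp_ext k (P : probability (k.-tuple R) R) A B A' B' :
  cfexp P A B -> A =1 A' -> B =1 B' -> cfexp P A' B'.
Proof. by move=> h a b th; rewrite -a -b; exact: h. Qed.

Lemma levy_exp_ext k (A B A' B' : k.-tuple R -> R) :
  levy_exp A B -> A =1 A' -> B =1 B' -> levy_exp A' B'.
Proof.
move=> h a b t t0; have [Q hQ] := h t t0; exists Q.
by apply: (cfexp_ext hQ) => th; rewrite ?a ?b.
Qed.

Lemma levy_exp_add k (A B A' B' : k.-tuple R -> R) : levy_exp A B -> levy_exp A' B' ->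
  levy_exp (fun th => A th + A' th) (fun th => B th + B' th).
Proof.
move=> h h' t t0; have [Q hQ] := h t t0; have [Q' hQ'] := h' t t0.
have [S hS] := cfexp_conv hQ hQ'; exists S.
by apply: (cfexp_ext hS) => th; rewrite mulrDr.
Qed.

Lemma levy_exp_scale k (A B : k.-tuple R -> R) c : 0 <= c -> levy_exp A B ->
  levy_exp (fun th => c * A th) (fun th => c * B th).
Proof.
move=> c0 h t t0; have [Q hQ] := h (t * c) (mulr_ge0 t0 c0); exists Q.
by apply: (cfexp_ext hQ) => th; rewrite mulrA.
Qed.

Lemma levy_exp_drift k (y : k.-tuple R) : levy_exp (fun=> 0) (fun th => dotp th y).
Proof.
move=> t t0; exists \d_(tscale t y); apply: (cfexp_ext (cfexp_dirac _)) => th; first by rewrite mulr0.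
rewrite /dotp mulr_sumr; apply: eq_bigr => i _.
by rewrite tnth_mktuple; ring.
Qed.

Lemma levy_exp0 k : @levy_exp R k (fun=> 0) (fun=> 0).
Proof.
apply: (levy_exp_ext (levy_exp_drift [tuple 0 | i < k])) => // th.
by rewrite /dotp big1// => i _; rewrite tnth_mktuple mulr0.
Qed.

Lemma levy_exp_sum k (I : Type) (s : seq I) (c : I -> R) (A B : I -> k.-tuple R -> R) :
  (forall i, 0 <= c i) -> (forall i, levy_exp (A i) (B i)) ->
  levy_exp (fun th => \sum_(i <- s) c i * A i th) (fun th => \sum_(i <- s) c i * B i th).
Proof.
move=> c0 h; elim: s => [|i s IH].
  by apply: (levy_exp_ext (levy_exp0 k)) => th; rewrite big_nil.
apply: (levy_exp_ext (levy_exp_add (levy_exp_scale (c0 i) (h i)) IH)) => th; by rewrite big_cons.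
Qed.

Lemma levy_exp_map (a b : R -> R) k (y : k.-tuple R) :
  levy_exp (fun th : 1.-tuple R => a (thead th)) (fun th => b (thead th)) ->
  levy_exp (fun th => a (dotp th y)) (fun th => b (dotp th y)).
Proof.
move=> h t t0; have [Q hQ] := h t t0.
pose phi (x : 1.-tuple R) : k.-tuple R := tscale (thead x) y.
have mphi : measurable_fun setT phi.
  apply/measurable_fun_tnthP => i.
  apply: (@eq_measurable_fun _ _ _ _ _ (fun x : 1.-tuple R => tnth x ord0 * tnth y i)).
    by move=> z _ /=; rewrite tnth_mktuple.
  apply: measurable_funM; last exact: measurable_cst.
  exact: measurable_tnth.
have [S hS] := prob_image Q mphi; exists S => th.
have e x : dotp th (phi x) = dotp [tuple dotp th y] x.
  rewrite /phi {2}/dotp big_ord_recl big_ord0 addr0 /dotp mulr_suml; apply: eq_bigr => i _.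
  by rewrite tnth_mktuple /thead; ring.
have [q1 q2] := hQ [tuple dotp th y].
rewrite (hS _ 1 (measurable_cos_dotp th) (fun x => cos_norm_le1 _)).
rewrite (hS _ 1 (measurable_sin_dotp th) (fun x => sin_norm_le1 _)).
by split; under eq_Rintegral do rewrite /= e.
Qed.

Lemma cfexp_lim k (P : nat -> probability (k.-tuple R) R) (A B : nat -> k.-tuple R -> R) A' B' :
  (forall n, cfexp (P n) (A n) (B n)) ->
  (forall th, (fun n => A n th) @ \oo --> A' th) ->
  (forall th, (fun n => B n th) @ \oo --> B' th) ->
  (forall th, A' (tscale t th) @[t --> (0 : R)] --> (0 : R)) ->
  (forall th, B' (tscale t th) @[t --> (0 : R)] --> (0 : R)) ->
  exists Q, cfexp Q A' B'.
Proof.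
move=> hP hA hB rA rB.
have [th|th|th|Q hQ] := @levy_continuity R k P (fun th => expR (A' th) * cos (B' th))
  (fun th => expR (A' th) * sin (B' th)).
- under eq_fun do rewrite (hP _ _).1.
  apply: cvgM; first exact: (cvg_comp _ _ (hA th) (@continuous_expR R _)).
  exact: (cvg_comp _ _ (hB th) (@continuous_cos R _)).
- under eq_fun do rewrite (hP _ _).2.
  apply: cvgM; first exact: (cvg_comp _ _ (hA th) (@continuous_expR R _)).
  exact: (cvg_comp _ _ (hB th) (@continuous_sin R _)).
- have -> : (1 : R) = expR 0 * cos 0 by rewrite expR0 cos0 mulr1.
  apply: cvgM; first exact: (cvg_comp _ _ (rA th) (@continuous_expR R _)).
  exact: (cvg_comp _ _ (rB th) (@continuous_cos R _)).
by exists Q.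
Qed.

Lemma levy_exp_lim k (A B : nat -> k.-tuple R -> R) A' B' :
  (forall n, levy_exp (A n) (B n)) ->
  (forall th, (fun n => A n th) @ \oo --> A' th) ->
  (forall th, (fun n => B n th) @ \oo --> B' th) ->
  (forall th, A' (tscale t th) @[t --> (0 : R)] --> (0 : R)) ->
  (forall th, B' (tscale t th) @[t --> (0 : R)] --> (0 : R)) ->
  levy_exp A' B'.
Proof.
move=> hP hA hB rA rB t t0.
have /choice[P hP'] : forall n, exists Q, cfexp Q (fun th => t * A n th) (fun th => t * B n th).
  by move=> n; exact: hP.
apply: (cfexp_lim hP') => th.
- by apply: cvgM; [exact: cvg_cst|exact: hA].
- by apply: cvgM; [exact: cvg_cst|exact: hB].
- by rewrite -[X in _ --> X](mulr0 t); apply: cvgM; [exact: cvg_cst|exact: rA].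
- by rewrite -[X in _ --> X](mulr0 t); apply: cvgM; [exact: cvg_cst|exact: rB].
Qed.

End LevyExp.

(** The sequential form of a limit at a point, through which dominated convergence along sequences
    proves continuity in a parameter. *)
Lemma cvg_seq_nbhs (R : realType) (f : R -> R) (p l : R) :
  (forall u : nat -> R, u @ \oo --> p -> (fun n => f (u n)) @ \oo --> l) ->
  f x @[x --> p] --> l.
Proof.
move=> h; apply/cvgrPdist_le => e e0; apply: contrapT => hn.
have /choice[u uP] : forall n : nat, exists x, `|p - x| < n.+1%:R^-1 /\ ~ `|l - f x| <= e.
  move=> n; apply: contrapT => /forallNP hx; apply: hn; apply/nbhs_ballP.
  exists n.+1%:R^-1 => /=; first by rewrite invr_gt0.
  by move=> x xp; apply: contrapT => hh; apply: (hx x).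
have up : u @ \oo --> p.
  apply/cvgrPdist_le => r r0; near=> n; apply/ltW/(lt_le_trans (uP n).1).
  by near: n; exact: near_invS_le.
have /cvgrPdist_le/(_ _ e0)[N _ hN] := h u up.
by apply: (uP N).2; apply: hN => /=.
Unshelve. all: by end_near. Qed.

Section Poisson.
Context (R : realType).

Lemma cfexp_pow k (Q : probability (k.-tuple R) R) A B n : cfexp Q A B ->
  exists S : probability (k.-tuple R) R, cfexp S (fun th => n%:R * A th) (fun th => n%:R * B th).
Proof.
move=> hQ; elim: n => [|n [S hS]].
  have [Q0 hQ0] := @levy_exp0 R k 0 (lexx 0).
  by exists Q0; apply: (cfexp_ext hQ0) => th; rewrite !mul0r.
have [S' hS'] := cfexp_conv hQ hS; exists S'.
by apply: (cfexp_ext hS') => th; rewrite -natr1 mulrDl mul1r addrC.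
Qed.

(** [m n * f (x n)] is the difference quotient of [f] at 0 times [m n * x n]. Since [x n] may
    vanish, the quotient is completed by its limit [D] at 0, where it becomes continuous. *)
Lemma cvg_scaled_quotient (f : R -> R) (D L : R) (m x : nat -> R) :
  f 0 = 0 -> is_derive (0 : R) 1 f D -> (forall n, m n != 0) ->
  (fun n => (m n)^-1) @ \oo --> (0 : R) -> (fun n => m n * x n) @ \oo --> L ->
  (fun n => m n * f (x n)) @ \oo --> D * L.
Proof.
move=> f0 fD m0 mi mx.
pose s h := if h == 0 then D else h^-1 * f h.
have cs : s h @[h --> (0 : R)] --> s 0.
  apply/(@continuous_withinNx _ _ (s : R -> R)); rewrite {2}/s eqxx.
  have [/cvg_ex[/= l hl] dl] := fD.
  have : (fun h => h^-1 *: (f (h *: 1 + 0) - f 0)) @ 0^' --> D.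
    by rewrite -dl; apply/cvg_ex; exists l.
  apply: cvg_trans; apply: near_eq_cvg; near=> h.
  have h0 : h != 0 by near: h; exact: nbhs_dnbhs_neq.
  by rewrite /s (negbTE h0) f0 subr0 addr0 /GRing.scale /= mulr1.
have x0 : x @ \oo --> (0 : R).
  have -> : x = (fun n => (m n)^-1 * (m n * x n)) by apply/funext => n; rewrite mulKf.
  by rewrite -[X in _ --> X](mul0r L); apply: cvgM.
have -> : (fun n => m n * f (x n)) = (fun n => s (x n) * (m n * x n)).
  apply/funext => n; rewrite /s; case: eqP => [->|/eqP xn]; first by rewrite f0 !mulr0.
  by rewrite [RHS]mulrC -mulrA; congr (_ * _); rewrite mulrA mulfV// mul1r.
apply: cvgM => //; have -> : D = s 0 by rewrite /s eqxx.
exact: (cvg_comp _ _ x0 cs).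
Unshelve. all: by end_near. Qed.

(** This is the logarithm of [1 + i w]: its modulus is the square root of [1 + w ^+ 2] and its
    argument is [atan w]. *)
Lemma cos_sin_atan (w : R) : expR (ln (1 + w ^+ 2) / 2) * cos (atan w) = 1 /\
  expR (ln (1 + w ^+ 2) / 2) * sin (atan w) = w.
Proof.
have p0 : 0 < 1 + w ^+ 2 by rewrite ltr_pwDl// sqr_ge0.
have e : expR (ln (1 + w ^+ 2) / 2) = Num.sqrt (1 + w ^+ 2).
  apply/eqP; rewrite -(@eqrXn2 _ 2%N)// ?sqr_sqrtr ?expR_ge0 ?sqrtr_ge0 ?(ltW p0)//.
  by rewrite -expRM_natl -mulr_natl mulrC divfK// lnK.
have c1 : expR (ln (1 + w ^+ 2) / 2) * cos (atan w) = 1.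
  by rewrite e cos_atan divff// gt_eqF// sqrtr_gt0.
split => //.
have cn : cos (atan w) != 0.
  by apply/eqP => h; move: c1; rewrite h mulr0 => /eqP; rewrite eq_sym oner_eq0.
have : tan (atan w) = w by exact: atanK.
rewrite /tan => h; have -> : sin (atan w) = w * cos (atan w) by rewrite -{2}h mulfVK.
by rewrite mulrCA c1 mulr1.
Qed.

Lemma bernoulli_cf (p y : R) : 0 <= p <= 1 -> exists Q : probability (1.-tuple R) R,
  forall th, Rintegral Q setT (fun x => cos (dotp th x)) = 1 + p * (cos (thead th * y) - 1) /\
             Rintegral Q setT (fun x => sin (dotp th x)) = p * sin (thead th * y).
Proof.
move=> p01.
pose phi (b : bool) : 1.-tuple R := [tuple if b then y else 0].
have mphi : measurable_fun setT phi by [].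
have [Q hQ] := prob_image (bernoulli_prob p) mphi; exists Q => th.
have dphi b : dotp th (phi b) = thead th * (if b then y else 0).
  by rewrite /dotp big_ord_recl big_ord0 addr0.
have ib (h : bool -> R) : Rintegral (bernoulli_prob p) setT h = p * h true + (1 - p) * h false.
  rewrite (@Rintegral_finidx _ bool R (bernoulli_prob p) bool id h)//; last exact: prob_lty.
  have m b c : (b \in (id @^-1` [set c] : set bool)) = (b == c).
    by apply/idP/eqP => [/set_mem|->]; [exact|exact: mem_set].
  have bE (b : bool) : fine (bernoulli_prob p (id @^-1` [set b])) = if b then p else 1 - p.
    rewrite bernoulli_probE// !diracE !m -!EFinM -EFinD /=.
    by case: b; rewrite /= ?mulr1 ?mulr0 ?addr0 ?add0r.
  transitivity (\sum_(b : bool) h b * (if b then p else 1 - p)).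
    by apply: eq_bigr => b _; congr (_ * _); exact: bE.
  by rewrite big_bool /= mulrC [X in _ + X]mulrC.
rewrite (hQ _ 1 (measurable_cos_dotp th) (fun x => cos_norm_le1 _)) ib /= !dphi.
rewrite (hQ _ 1 (measurable_sin_dotp th) (fun x => sin_norm_le1 _)) ib /= !dphi.
by rewrite !mulr0 cos0 sin0; split; ring.
Qed.

(* The law is the limit of binomial laws of success probability [O(1/n)]; no compound Poisson
   measure has to be constructed. *)
Lemma levy_exp_poisson (y : R) :
  levy_exp (fun th : 1.-tuple R => cos (thead th * y) - 1) (fun th => sin (thead th * y)).
Proof.
(* Starting beyond [4 * t] keeps the success probability [p n] at most 1/4. The real part
   [1 + x n th] of the Bernoulli characteristic function is then positive, and its argument is an
   arctangent. *)
move=> t t0; pose N := (Num.trunc (4 * t)).+1.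
pose m n : R := (n + N)%:R.
have m4 n : 4 * t < m n.
  apply: lt_le_trans (Num.Theory.truncnS_gt _) _.
  by rewrite ler_nat leq_addl.
have mgt0 n : 0 < m n by rewrite ltr0n addnS.
have m0 n : m n != 0 by rewrite gt_eqF.
have mi : (fun n => (m n)^-1) @ \oo --> (0 : R).
  have := @cvg_harmonic R; rewrite -(cvg_shiftn N.-1) => h.
  by apply: cvg_trans h; apply: near_eq_cvg; apply: nearW => n; rewrite /m addnS.
pose p n := t / m n.
have p4 n : 0 <= p n <= 4^-1.
  rewrite divr_ge0 ?(ltW (mgt0 n))//= ler_pdivrMr// mulrC ler_pdivlMr//.
  by rewrite mulrC ltW.
have /choice[P0 hP0] n : exists Q : probability (1.-tuple R) R,
  forall th, Rintegral Q setT (fun x => cos (dotp th x)) = 1 + p n * (cos (thead th * y) - 1) /\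
             Rintegral Q setT (fun x => sin (dotp th x)) = p n * sin (thead th * y).
  by apply: bernoulli_cf; have := p4 n; lra.
pose x n (th : 1.-tuple R) := p n * (cos (thead th * y) - 1) : R.
pose w n (th : 1.-tuple R) := p n * sin (thead th * y) / (1 + x n th) : R.
have xgt n th : 0 < 1 + x n th.
  rewrite /x; have /andP[p0 p1] := p4 n; have := cos_geN1 (thead th * y); have := cos_le1 (thead th * y).
  by move=> h1 h2; nra.
have cP0 n : cfexp (P0 n) (fun th => ln (1 + x n th) + ln (1 + w n th ^+ 2) / 2) (fun th => atan (w n th)).
  move=> th; have [h1 h2] := hP0 n th; have [a1 a2] := cos_sin_atan (w n th).
  rewrite h1 h2 expRD lnK ?posrE ?xgt//; split; rewrite -[RHS]mulrA ?a1 ?a2 ?mulr1//.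
  by rewrite [RHS]mulrC divfK// gt_eqF.
have /choice[P1 hP1] n : exists S : probability (1.-tuple R) R,
    cfexp S (fun th => m n * (ln (1 + x n th) + ln (1 + w n th ^+ 2) / 2)) (fun th => m n * atan (w n th)).
  exact: (cfexp_pow (n + N) (cP0 n)).
have ln1D : is_derive (0 : R) 1 (fun h : R => ln (1 + h)) 1.
  have d1 : is_derive (0 : R) 1 (fun h : R => 1 + h) (0 + 1) by apply: is_deriveD.
  have d2 : is_derive (1 + 0 : R) 1 (@ln R) (1 + 0)^-1 by apply: is_derive1_ln; rewrite addr0.
  have := @is_derive1_comp _ (@ln R) (fun h : R => 1 + h) _ _ _ d2 d1.
  by rewrite add0r addr0 invr1 mul1r.
have atanD : is_derive (0 : R) 1 (@atan R) 1.
  apply: DeriveDef; first exact: derivable_atan.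
  by rewrite -derive1E derive1_atan expr0n /= addr0 invr1.
have mx th : (fun n => m n * x n th) @ \oo --> t * (cos (thead th * y) - 1).
  apply: cvg_near_cst; apply: nearW => n; rewrite /x /p mulrA; congr (_ * _).
  by rewrite mulrCA divff ?mulr1.
have x0 th : (fun n => 1 + x n th) @ \oo --> (1 : R).
  rewrite -[X in _ --> X]addr0; apply: cvgD; first exact: cvg_cst.
  have -> : x^~ th = (fun n => (m n)^-1 * (m n * x n th)) by apply/funext => n; rewrite mulKf.
  by rewrite -[X in _ --> X](mul0r (t * (cos (thead th * y) - 1))); apply: cvgM; [exact: mi|exact: mx].
have mw th : (fun n => m n * w n th) @ \oo --> t * sin (thead th * y).
  have -> : (fun n => m n * w n th) = (fun n => t * sin (thead th * y) * (1 + x n th)^-1).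
    apply/funext => n; rewrite /w /p; move: (m n) (m0 n) (1 + x n th) (sin _) => a a0 q sn.
    by rewrite -!mulrA mulrCA (mulrA a) divff// mul1r.
  rewrite -[X in _ --> X]mulr1; apply: cvgM; first exact: cvg_cst.
  by rewrite -[X in _ --> X]invr1; apply: cvgV; [exact: oner_neq0|exact: x0].
have w0 th : (fun n => w n th) @ \oo --> (0 : R).
  have -> : w^~ th = (fun n => (m n)^-1 * (m n * w n th)) by apply/funext => n; rewrite mulKf.
  by rewrite -[X in _ --> X](mul0r (t * sin (thead th * y))); apply: cvgM; [exact: mi|exact: mw].
apply: (cfexp_lim hP1) => th.
- have c1 : (fun n => m n * ln (1 + x n th)) @ \oo --> 1 * (t * (cos (thead th * y) - 1)).
    by apply: (@cvg_scaled_quotient (fun h => ln (1 + h))) => //; rewrite addr0 ln1.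
  have c2 : (fun n => m n * ln (1 + w n th ^+ 2)) @ \oo --> 1 * (t * sin (thead th * y) * 0).
    apply: (@cvg_scaled_quotient (fun h => ln (1 + h))) => //; first by rewrite addr0 ln1.
    by under eq_fun do rewrite expr2 mulrA; apply: cvgM; [exact: mw|exact: w0].
  have c3 : (fun n => m n * ln (1 + x n th) + m n * ln (1 + w n th ^+ 2) * 2^-1) @ \oo -->
      1 * (t * (cos (thead th * y) - 1)) + 1 * (t * sin (thead th * y) * 0) * 2^-1.
    by apply: cvgD => //; apply: cvgM => //; exact: cvg_cst.
  move: c3; rewrite mul1r mulr0 mulr0 mul0r addr0; apply: cvg_trans.
  by apply: near_eq_cvg; apply: nearW => n; rewrite mulrDr mulrA.
- have c1 : (fun n => m n * atan (w n th)) @ \oo --> 1 * (t * sin (thead th * y)).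
    by apply: (@cvg_scaled_quotient atan) => //; exact: atan0.
  by move: c1; rewrite mul1r.
- have c : continuous (fun s : R => t * (cos (s * (thead th * y)) - 1)).
    move=> s; apply: cvgM; first exact: cvg_cst.
    apply: cvgB; last exact: cvg_cst.
    have h : continuous (fun s : R => s * (thead th * y)) by move=> r; apply: cvgM; [exact: cvg_id|exact: cvg_cst].
    exact: (continuous_comp (h s) (@continuous_cos R _)).
  have := c 0; rewrite /continuous_at mul0r cos0 subrr mulr0; apply: cvg_trans.
  by apply: near_eq_cvg; apply: nearW => s; rewrite /thead tnth_mktuple mulrA.
- have c : continuous (fun s : R => t * sin (s * (thead th * y))).
    move=> s; apply: cvgM; first exact: cvg_cst.
    have h : continuous (fun s : R => s * (thead th * y)) by move=> r; apply: cvgM; [exact: cvg_id|exact: cvg_cst].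
    exact: (continuous_comp (h s) (@continuous_sin R _)).
  have := c 0; rewrite /continuous_at mul0r sin0 mulr0; apply: cvg_trans.
  by apply: near_eq_cvg; apply: nearW => s; rewrite /thead tnth_mktuple mulrA.
Qed.

End Poisson.

(** * Uniqueness of continuous roots of characteristic functions *)

Section RootUniqueness.
Context (R : realType).

Lemma continuous_ray_charfun k (Q : probability (k.-tuple R) R) (h : R -> R) (th : k.-tuple R) :
  continuous h -> (forall x, `|h x| <= 1) ->
  continuous (fun t : R => Rintegral Q setT (fun x => h (dotp (tscale t th) x))).
Proof.
move=> ch h1 t; apply: cvg_seq_nbhs => u ut.
have dts (s : R) x : dotp (tscale s th) x = s * dotp th x.
  by rewrite /dotp mulr_sumr; apply: eq_bigr => i _; rewrite tnth_mktuple mulrA.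
have mh (s : R) : measurable_fun setT (fun x => h (dotp (tscale s th) x)).
  apply: measurableT_comp; first exact: continuous_measurable_fun.
  exact: measurable_dotp.
apply: (Rintegral_dct measurableT (g := fun=> 1) (fun n => mh (u n)) (mh t) _ (prob_integrable_cst Q 1) _).2.
  apply: aeW => x _; rewrite /= dts; under eq_fun do rewrite dts.
  have c : (fun n => u n * dotp th x) @ \oo --> t * dotp th x.
    by apply: cvgM => //; exact: cvg_cst.
  exact: (cvg_comp _ _ c (ch _)).
by move=> n x _; exact: h1.
Qed.

(** A count of roots: if [x 1] differed from 1, the intermediate value theorem would let [x] take
    [n + 1] equally spaced values from 1 to [x 1], and the corresponding points would be [n + 1]
    distinct roots of [X^n - 1]. *)
Lemma re_root_unity_const (n : nat) (x y : R -> R) : (0 < n)%N -> continuous x -> x 0 = 1 ->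
  (forall t, Complex (x t) (y t) ^+ n = 1) -> x 1 = 1 /\ y 1 = 0.
Proof.
move=> n0 cx x0 zn.
have nz t : x t ^+ 2 + y t ^+ 2 = 1.
  have zn1 : `|Complex (x t) (y t)| = 1.
    by apply/eqP; rewrite -(@pexpr_eq1 _ _ n)// -normrX zn normr1.
  move: zn1; rewrite normc_def /= => -[] /(congr1 (fun z => z ^+ 2)).
  by rewrite sqr_sqrtr ?addr_ge0 ?sqr_ge0// expr1n.
have x1 : x 1 <= 1 by have := nz 1; have := sqr_ge0 (y 1); nra.
suff x11 : x 1 = 1.
  by split=> //; have := nz 1; rewrite x11 expr1n => h; apply/eqP; rewrite -sqrf_eq0; apply/eqP; lra.
apply/eqP; apply: contraT => xn1.
have xlt : x 1 < 1 by rewrite lt_neqAle xn1.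
pose v (j : nat) := 1 - (1 - x 1) * (j%:R / n%:R).
have /choice[c hc] : forall j, exists t, (j <= n)%N -> x t = v j.
  move=> j; have [jn|] := boolP (j <= n)%N; last by exists 0.
  have [||t _ xt] := @IVT R x 0 1 (v j) ler01; last by exists t.
    exact: continuous_subspaceT.
  rewrite x0 minC maxC min_l ?max_r// ?(ltW xlt)// /v.
  have h1 : 0 <= j%:R / n%:R :> R by rewrite divr_ge0.
  have h2 : j%:R / n%:R <= 1 :> R by rewrite ler_pdivrMr ?ltr0n// mul1r ler_nat.
  by apply/andP; split; nra.
pose rs := [seq Complex (x (c j)) (y (c j)) | j <- iota 0 n.+1].
have urs : uniq rs.
  rewrite map_inj_in_uniq ?iota_uniq// => i j; rewrite !mem_iota !add0n /= !ltnS => ii jj [].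
  rewrite !hc// /v => e _; apply/eqP; rewrite -(@eqr_nat R); apply/eqP.
  have e1 : (1 - x 1) * (i%:R / n%:R) = (1 - x 1) * (j%:R / n%:R) by lra.
  have nx : 1 - x 1 != 0 by rewrite subr_eq0 eq_sym.
  have n0' : (n%:R : R)^-1 != 0 by rewrite invr_eq0 pnatr_eq0 -lt0n.
  by have := mulfI nx e1 => /(mulIf n0').
have rrs : all (root ('X^n - 1)) rs.
  apply/allP => z /mapP[j _ ->]; by rewrite rootE hornerD hornerN hornerXn hornerC zn subrr.
have pn0 : ('X^n - 1 : {poly R[i]}) != 0 by rewrite -size_poly_eq0 size_XnsubC.
have := max_poly_roots pn0 rrs urs.
by rewrite size_XnsubC// /rs size_map size_iota ltnn.
Qed.

End RootUniqueness.

(** * Urbanik classes in terms of exponents *)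

Section CexpFacts.
Context (R : realType).
Implicit Types a b : R.

Lemma cexpD a b a' b' :
  cexp (Complex a b) * cexp (Complex a' b') = cexp (Complex (a + a') (b + b')).
Proof. by rewrite /cexp /= expRD cosD sinD; congr Complex; ring. Qed.

Lemma cexp_exp a b n : cexp (Complex a b) ^+ n = cexp (Complex (n%:R * a) (n%:R * b)).
Proof.
elim: n => [|n IH]; first by rewrite expr0 !mul0r /cexp /= expR0 cos0 sin0 !mul1r.
have e (x : R) : x + n%:R * x = n.+1%:R * x by rewrite -natr1 mulrDl mul1r addrC.
by rewrite exprS IH cexpD !e.
Qed.

Lemma cexp_neq0 a b : cexp (Complex a b) != 0.
Proof.
apply/eqP => h; have := cexpD a b (- a) (- b); rewrite h mul0r !subrr /cexp /= expR0 cos0 sin0 mul1r mul1r.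
by move=> /(congr1 (@complex.Re R)) /= /eqP; rewrite eq_sym oner_eq0.
Qed.

End CexpFacts.

(** Continuity on lines through the origin is what both the continuity theorem and the uniqueness of
    roots draw on, and it is what stochastic integrals provide: a ray corresponds to the multiples
    of one real random variable. *)
Definition ray_continuous (R : realType) k (F : k.-tuple R -> R) :=
  (forall th, continuous (fun t : R => F (tscale t th))) /\ (forall th, F (tscale 0 th) = 0).

Section InfDiv.
Context (R : realType) (k : nat).
Implicit Types (Q : probability (k.-tuple R) R) (A B : k.-tuple R -> R) (th : k.-tuple R).

Lemma cfexpP Q A B : cfexp Q A B <-> forall th, charfun_meas Q th = cexp (Complex (A th) (B th)).
Proof.
split=> h th; first by rewrite /charfun_meas (h th).1 (h th).2.
by have [-> ->] := h th.
Qed.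

Lemma tscale1 th : tscale 1 th = th.
Proof. by apply: eq_from_tnth => i; rewrite tnth_mktuple mul1r. Qed.

Lemma tscaleA (c c' : R) th : tscale c (tscale c' th) = tscale (c * c') th.
Proof. by apply: eq_from_tnth => i; rewrite !tnth_mktuple mulrA. Qed.

Lemma tscale0 th : tscale 0 th = [tuple 0 | i < k].
Proof. by apply: eq_from_tnth => i; rewrite !tnth_mktuple mul0r. Qed.

Lemma dotp0 (x : k.-tuple R) : dotp [tuple 0 | i < k] x = 0.
Proof. by rewrite /dotp big1// => i _; rewrite tnth_mktuple mul0r. Qed.

(* A continuous [n]-th root of 1 along a ray is constant, so the characteristic
   function of a convolution root is the exponential of the divided exponent. *)
Lemma cfexp_root Q A B n : (0 < n)%N -> ray_continuous A -> ray_continuous B ->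
  (forall th, charfun_meas Q th ^+ n = cexp (Complex (A th) (B th))) ->
  cfexp Q (fun th => n%:R^-1 * A th) (fun th => n%:R^-1 * B th).
Proof.
move=> n0 [cA A0] [cB B0] hQ th.
have n0' : n%:R != 0 :> R by rewrite pnatr_eq0 -lt0n.
pose c (t : R) := Rintegral Q setT (fun x => cos (dotp (tscale t th) x)).
pose s (t : R) := Rintegral Q setT (fun x => sin (dotp (tscale t th) x)).
pose a (t : R) := n%:R^-1 * A (tscale t th).
pose b (t : R) := n%:R^-1 * B (tscale t th).
have cc : continuous c by apply: continuous_ray_charfun; [exact: continuous_cos|exact: cos_norm_le1].
have cs : continuous s by apply: continuous_ray_charfun; [exact: continuous_sin|exact: sin_norm_le1].
have ca : continuous a by move=> t; apply: cvgM; [exact: cvg_cst|exact: cA].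
have cb : continuous b by move=> t; apply: cvgM; [exact: cvg_cst|exact: cB].
pose x t := expR (- a t) * (c t * cos (b t) + s t * sin (b t)).
pose y t := expR (- a t) * (s t * cos (b t) - c t * sin (b t)).
have zE t : Complex (x t) (y t) = charfun_meas Q (tscale t th) * cexp (Complex (- a t) (- b t)).
  by rewrite /charfun_meas -/(c t) -/(s t) /cexp /= cosN sinN /x /y; congr Complex; ring.
have zn t : Complex (x t) (y t) ^+ n = 1.
  rewrite zE exprMn hQ cexp_exp cexpD /a /b !mulrN !mulVKf// !subrr /cexp /= expR0 cos0 sin0.
  by rewrite !mul1r.
have cx : continuous x.
  move=> t; apply: cvgM.
    have cna : (fun t => - a t) @ t --> - a t by apply: cvgN; exact: ca.
    exact: (cvg_comp _ _ cna (@continuous_expR R _)).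
  apply: cvgD; apply: cvgM; [exact: cc| |exact: cs|].
    exact: (cvg_comp _ _ (cb t) (@continuous_cos R _)).
  exact: (cvg_comp _ _ (cb t) (@continuous_sin R _)).
have x0 : x 0 = 1.
  rewrite /x /a /b A0 B0 mulr0 oppr0 expR0 cos0 sin0 mul1r mulr0 mulr1 addr0 /c tscale0.
  under eq_Rintegral do rewrite dotp0 cos0.
  exact: prob_Rintegral_cst.
have [x1 y1] := re_root_unity_const n0 cx x0 zn.
have : charfun_meas Q th = cexp (Complex (a 1) (b 1)).
  have := zE 1; rewrite x1 y1 => h.
  have h2 : cexp (Complex (a 1) (b 1)) * cexp (Complex (- a 1) (- b 1)) = 1.
    by rewrite cexpD !subrr /cexp /= expR0 cos0 sin0 !mul1r.
  have := congr1 (fun z => cexp (Complex (a 1) (b 1)) * z) h.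
  by rewrite [in RHS]mulrCA h2 mulr1 mulr1 tscale1 => ->.
by rewrite /a /b tscale1 => -[-> ->].
Qed.

Lemma levy_exp_infdiv A B : levy_exp A B ->
  exists2 Q : probability (k.-tuple R) R, infinitely_divisible Q & cfexp Q A B.
Proof.
move=> h; have [Q hQ] := h 1 ler01; exists Q; last by apply: (cfexp_ext hQ) => th; rewrite mul1r.
move=> n n0; have n0' : n%:R != 0 :> R by rewrite pnatr_eq0 -lt0n.
have [|Q' hQ'] := h n%:R^-1; first by rewrite invr_ge0.
exists Q' => th; move/cfexpP: hQ => ->; move/cfexpP: hQ' => ->.
by rewrite cexp_exp !mulVKf// !mul1r.
Qed.

(** [t] is approached by the fractions [trunc (t * (n + 1)) / (n + 1)]: a convolution root followed
    by a convolution power realises each of them, and the exponents converge. *)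
Lemma infdiv_levy_exp Q A B : infinitely_divisible Q -> cfexp Q A B ->
  ray_continuous A -> ray_continuous B -> levy_exp A B.
Proof.
move=> iQ hQ rA rB t t0.
have /choice[P hP] : forall n, exists S : probability (k.-tuple R) R,
    cfexp S (fun th => (Num.trunc (t * n.+1%:R))%:R * (n.+1%:R^-1 * A th))
            (fun th => (Num.trunc (t * n.+1%:R))%:R * (n.+1%:R^-1 * B th)).
  move=> n; have [nu hnu] := iQ n.+1 isT.
  apply: cfexp_pow; apply: (@cfexp_root nu A B n.+1) => // th.
  by rewrite hnu; exact: (cfexpP _ _ _).1 hQ th.
have tn : (fun n => (Num.trunc (t * n.+1%:R))%:R * n.+1%:R^-1) @ \oo --> t.
  apply/cvgrPdist_le => e e0; near=> n.
  have := Num.Theory.truncn_itv (mulr_ge0 t0 (ler0n R n.+1)).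
  rewrite -[X in _ < X]natr1; set N := (Num.trunc _)%:R => /andP[h1 h2].
  have hn : n.+1%:R^-1 <= e by near: n; exact: near_invS_le.
  have n0 : 0 < n.+1%:R :> R by [].
  have h3 : N * n.+1%:R^-1 <= t by rewrite ler_pdivrMr.
  have h4 : t < N * n.+1%:R^-1 + n.+1%:R^-1.
    by rewrite -[X in _ + X]mul1r -mulrDl ltr_pdivlMr.
  rewrite ger0_norm ?subr_ge0// lerBlDl; apply: le_trans (ltW h4) _.
  by rewrite lerD2l.
apply: (cfexp_lim hP) => th.
- by under eq_fun do rewrite mulrA; apply: cvgM => //; exact: cvg_cst.
- by under eq_fun do rewrite mulrA; apply: cvgM => //; exact: cvg_cst.
- have [cA A0] := rA; have := cA th 0; rewrite /continuous_at A0 => c.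
  by rewrite -[X in _ --> X](mulr0 t); apply: cvgM => //; exact: cvg_cst.
- have [cA A0] := rB; have := cA th 0; rewrite /continuous_at A0 => c.
  by rewrite -[X in _ --> X](mulr0 t); apply: cvgM => //; exact: cvg_cst.
Unshelve. all: by end_near. Qed.

End InfDiv.

Section UrbanikExponents.
Context (R : realType).

Definition qdiff k (q : R) (F : k.-tuple R -> R) (th : k.-tuple R) : R := F th - F (tscale q^-1 th).

Fixpoint urbanik_exp k (m : nat) (A B : k.-tuple R -> R) : Prop :=
  forall q, 1 < q -> levy_exp (qdiff q A) (qdiff q B) /\
    if m is m'.+1 then urbanik_exp m' (qdiff q A) (qdiff q B) else True.

Lemma ray_continuous_qdiff k q (F : k.-tuple R -> R) : ray_continuous F -> ray_continuous (qdiff q F).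
Proof.
move=> [cF F0]; split=> th; last first.
  by rewrite /qdiff F0 tscaleA mulr0 F0 subr0.
move=> t; apply: cvgB; first exact: cF.
have -> : (fun t : R => F (tscale q^-1 (tscale t th))) = (fun t : R => F (tscale t (tscale q^-1 th))).
  by apply/funext => s; rewrite !tscaleA mulrC.
by rewrite !tscaleA mulrC -tscaleA; exact: cF.
Qed.

(** An exponential never vanishes, so the factor [muq] is determined: its characteristic function is
    the exponential of the difference of the exponents at [th] and [th / q]. Ray continuity is
    inherited by such differences, which lets the induction on [m] run. *)
Lemma urbanik_cfP k m (phi : k.-tuple R -> R[i]) A B : ray_continuous A -> ray_continuous B ->
  (forall th, phi th = cexp (Complex (A th) (B th))) ->
  urbanik_cf m phi <-> urbanik_exp m A B.
Proof.
elim: m phi A B => [|m IH] phi A B rA rB phiE; split.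
- move=> h q q1; split => //; have [muq [iq eq _]] := h q q1.
  apply: (infdiv_levy_exp iq); [|exact: ray_continuous_qdiff|exact: ray_continuous_qdiff].
  apply/cfexpP => th; apply: (mulfI (cexp_neq0 (A (tscale q^-1 th)) (B (tscale q^-1 th)))).
  by rewrite -phiE -eq !phiE cexpD /qdiff !subrKC.
- move=> h q q1; have [Q iQ /cfexpP hQ] := levy_exp_infdiv (h q q1).1.
  by exists Q; split => // th; rewrite hQ !phiE cexpD /qdiff !subrKC.
- move=> h q q1; have [muq [iq eq Qq]] := h q q1.
  have cq : cfexp muq (qdiff q A) (qdiff q B).
    apply/cfexpP => th; apply: (mulfI (cexp_neq0 (A (tscale q^-1 th)) (B (tscale q^-1 th)))).
    by rewrite -phiE -eq !phiE cexpD /qdiff !subrKC.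
  split; first by apply: (infdiv_levy_exp iq cq); exact: ray_continuous_qdiff.
  apply: (IH _ _ _ _ _ _).1 Qq; [exact: ray_continuous_qdiff|exact: ray_continuous_qdiff|].
  exact/cfexpP.
- move=> h q q1; have [hl hu] := h q q1; have [Q iQ hQ] := levy_exp_infdiv hl.
  exists Q; split => // [th|].
    by rewrite ((cfexpP _ _ _).1 hQ) !phiE cexpD /qdiff !subrKC.
  apply: (IH _ _ _ _ _ _).2 hu; [exact: ray_continuous_qdiff|exact: ray_continuous_qdiff|].
  exact/cfexpP.
Qed.

End UrbanikExponents.

Lemma continuous_bounded_segment (R : realType) (a : R -> R) (C : R) : continuous a ->
  exists K, forall x, `|x| <= C -> `|a x| <= K.
Proof.
move=> ca; have [C0|C0] := ltP C 0.
  by exists (0 : R) => x xC; have := le_trans (normr_ge0 x) xC; rewrite leNgt C0.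
have cna : continuous (fun x => `|a x|) by move=> x; apply: cvg_norm; exact: ca.
have CC : - C <= C by rewrite (le_trans _ C0)// oppr_le0.
have [c _ hc] := @EVT_max R (fun x => `|a x|) (- C) C CC (continuous_subspaceT cna).
by exists `|a c| => x; rewrite ler_norml => xC; apply: hc; rewrite in_itv.
Qed.

(** * Integrating a Lévy exponent along a vector-valued function *)

Section LevyExpField.
Context d (T : measurableType d) (R : realType) (lam : {measure set T -> \bar R}).
Context (k : nat) (f : T -> k.-tuple R).
Hypothesis mf : forall i, measurable_fun setT (fun s => tnth (f s) i).
Variables a b : R -> R.
Hypothesis ca : continuous a.
Hypothesis cb : continuous b.
Hypothesis a0 : a 0 = 0.
Hypothesis b0 : b 0 = 0.
Hypothesis hab : levy_exp (fun th : 1.-tuple R => a (thead th)) (fun th => b (thead th)).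

Let clamp (K : R) (x : R) : R := Num.max (- K) (Num.min K x).

Let clamp_bnd K x : 0 <= K -> `|clamp K x| <= K.
Proof.
move=> K0; rewrite ler_norml /clamp le_max lexx /= ge_max ge_min lexx /=.
by rewrite andbT (le_trans _ K0)// oppr_le0.
Qed.

Let clamp_id K x : `|x| <= K -> clamp K x = x.
Proof. by rewrite ler_norml => /andP[h1 h2]; rewrite /clamp min_r ?max_r. Qed.

Lemma measurable_dotp_comp th : measurable_fun setT (fun s => dotp th (f s)).
Proof. by apply: measurable_sum => i; apply: measurable_funM => //; exact: mf. Qed.

Lemma dotp_scalel (t : R) th (x : k.-tuple R) : dotp (tscale t th) x = t * dotp th x.
Proof. by rewrite /dotp mulr_sumr; apply: eq_bigr => i _; rewrite tnth_mktuple mulrA. Qed.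

Section Bounded.
Variables (D : set T) (M : R).
Hypothesis mD : measurable D.
Hypothesis lamD : (lam D < +oo)%E.
Hypothesis fM : forall s i, D s -> `|tnth (f s) i| <= M.
Hypothesis M0 : 0 <= M.

Let finite_values (n : nat) : exists (I : finType) (idx : T -> I) (y : I -> k.-tuple R),
  (forall i, measurable (idx @^-1` [set i])) /\
  forall s i, D s -> `|tnth (f s) i - tnth (y (idx s)) i| <= n.+1%:R^-1.
Proof.
have e0 : 0 < n.+1%:R^-1 :> R by rewrite invr_gt0.
have [N [c hc]] := @finidx_approx_uniform _ T R M _ e0.
have /choice[idx hidx] i : exists idx : T -> 'I_N.+1,
    (forall j, measurable (idx @^-1` [set j])) /\
    (forall x, `|clamp M (tnth (f x) i) - c (idx x)| <= n.+1%:R^-1).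
  apply: hc => [|x]; last exact: clamp_bnd.
  apply: measurable_maxr; first exact: measurable_cst.
  by apply: measurable_minr; [exact: measurable_cst|exact: mf].
exists {ffun 'I_k -> 'I_N.+1}, (fun s => [ffun i => idx i s]), (fun j : {ffun 'I_k -> 'I_N.+1} => [tuple c (j i) | i < k]).
split=> [j|s i Ds]; last first.
  by rewrite tnth_mktuple ffunE -{1}(clamp_id (fM i Ds)); exact: (hidx i).2.
rewrite (_ : _ @^-1` _ = \bigcap_(i in [set: 'I_k]) (idx i @^-1` [set j i])).
  apply: fin_bigcap_measurable; first exact: finite_finset.
  by move=> i _; exact: (hidx i).1.
apply/seteqP; split => s /=; first by move=> <- i _ /=; rewrite ffunE.
by move=> h; apply/ffunP => i; rewrite ffunE; exact: h.
Qed.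

Let dct_param (g : R -> R) (th : k.-tuple R) (y : nat -> T -> k.-tuple R) : continuous g ->
  (forall n, measurable_fun D (fun s => g (dotp th (y n s)))) ->
  (forall n s i, D s -> `|tnth (f s) i - tnth (y n s) i| <= n.+1%:R^-1) ->
  (fun n => Rintegral lam D (fun s => g (dotp th (y n s)))) @ \oo -->
  Rintegral lam D (fun s => g (dotp th (f s))).
Proof.
move=> cg my hy; pose C := \sum_(i < k) `|tnth th i| * (M + 1).
have [K hK] := continuous_bounded_segment C cg.
have yb n s : D s -> `|dotp th (y n s)| <= C.
  move=> Ds; apply: le_trans (ler_norm_sum _ _ _) _; apply: ler_sum => i _.
  rewrite normrM ler_wpM2l//.
  have -> : tnth (y n s) i = tnth (f s) i - (tnth (f s) i - tnth (y n s) i) by ring.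
  apply: le_trans (ler_normB _ _) _; apply: lerD; first exact: fM.
  by apply: le_trans (hy _ _ _ Ds) _; rewrite invf_le1// ler1n.
apply: (Rintegral_dct mD my _ _ (g := fun=> K) _ _).2.
- apply: measurable_funTS; apply: measurableT_comp; first exact: continuous_measurable_fun.
  exact: measurable_dotp_comp.
- apply: aeW => s Ds; have c : (fun n => dotp th (y n s)) @ \oo --> dotp th (f s).
    apply: cvg_bigsum => i; apply: cvgM; first exact: cvg_cst.
    apply/cvgrPdist_le => e e0; near=> n; apply: le_trans (hy _ _ _ Ds) _.
    by near: n; exact: near_invS_le.
  exact: (cvg_comp _ _ c (cg _)).
- apply: (@bounded_integrable _ _ _ _ _ _ `|K|) => //.
- by move=> n s Ds; apply: hK; exact: yb.
Unshelve. all: by end_near. Qed.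

Let ray_param (g : R -> R) (th : k.-tuple R) : continuous g -> g 0 = 0 ->
  Rintegral lam D (fun s => g (dotp (tscale t th) (f s))) @[t --> (0 : R)] --> (0 : R).
Proof.
move=> cg g0; apply: cvg_seq_nbhs => u u0.
have zE : (0 : R) = Rintegral lam D (fun=> 0) by rewrite Rintegral_cst// mul0r.
rewrite [X in _ --> X]zE.
have [B hB] : exists B, forall n, `|u n| <= B.
  have /cvg_seq_bounded[B [_ hB]] : cvg (u @ \oo) by apply/cvg_ex; exists 0.
  by exists (B + 1) => n; apply: hB => //; rewrite ltrDl.
pose C := B * \sum_(i < k) `|tnth th i| * M.
have [K hK] := continuous_bounded_segment C cg.
have yb n s : D s -> `|dotp (tscale (u n) th) (f s)| <= C.
  move=> Ds; rewrite dotp_scalel normrM; apply: ler_pM => //.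
  apply: le_trans (ler_norm_sum _ _ _) _; apply: ler_sum => i _.
  by rewrite normrM ler_wpM2l//; exact: fM.
apply: (Rintegral_dct mD _ _ _ (g := fun=> K) _ _).2.
- move=> n; apply: measurable_funTS; apply: measurableT_comp; first exact: continuous_measurable_fun.
  exact: measurable_dotp_comp.
- by [].
- apply: aeW => s Ds; rewrite -g0.
  have c : (fun n => dotp (tscale (u n) th) (f s)) @ \oo --> (0 : R).
    under eq_fun do rewrite dotp_scalel.
    have c0 : (fun n => u n * dotp th (f s)) @ \oo --> 0 * dotp th (f s).
      by apply: cvgM => //; exact: cvg_cst.
    by rewrite mul0r in c0.
  exact: (cvg_comp _ _ c (cg _)).
- apply: (@bounded_integrable _ _ _ _ _ _ `|K|) => //.
- by move=> n s Ds; apply: hK; exact: yb.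
Qed.

(** When [f] takes finitely many values [y i], the exponent is the sum of the [a (dotp th (y i))]
    weighted by the measures of the level sets in [D]: a nonnegative combination of exponents of
    laws carried by lines. Uniform approximation on [D] gives the bounded case. *)
Lemma levy_exp_field_bounded : levy_exp
  (fun th => Rintegral lam D (fun s => a (dotp th (f s))))
  (fun th => Rintegral lam D (fun s => b (dotp th (f s)))).
Proof.
have [I IP] := choice finite_values.
pose idx n := sval (cid (IP n)).
pose y n := sval (cid (svalP (cid (IP n)))).
have hy n : (forall i, measurable (idx n @^-1` [set i])) /\
    forall s i, D s -> `|tnth (f s) i - tnth (y n (idx n s)) i| <= n.+1%:R^-1.
  exact: svalP (cid (svalP (cid (IP n)))).
have my (g : R -> R) n th : measurable_fun D (fun s => g (dotp th (y n (idx n s)))).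
  apply: measurable_funTS.
  exact: (measurable_finidx (fun i => g (dotp th (y n i))) (hy n).1).
have e (g : R -> R) n th : Rintegral lam D (fun s => g (dotp th (y n (idx n s)))) =
    \sum_i fine (lam (idx n @^-1` [set i] `&` D)) * g (dotp th (y n i)).
  exact: (Rintegral_finidx_in (fun i => g (dotp th (y n i))) mD lamD (hy n).1).
apply: (@levy_exp_lim _ _
  (fun n th => Rintegral lam D (fun s => a (dotp th (y n (idx n s)))))
  (fun n th => Rintegral lam D (fun s => b (dotp th (y n (idx n s)))))).
- move=> n; apply: (levy_exp_ext (levy_exp_sum (index_enum (I n))
    (c := fun i => fine (lam (idx n @^-1` [set i] `&` D))) _
    (fun i => levy_exp_map (y n i) hab))) => [i|th|th]; [exact: fine_ge0|by rewrite e|by rewrite e].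
- move=> th; apply: (dct_param (y := fun n s => y n (idx n s))) => // n s i Ds.
  exact: (hy n).2.
- move=> th; apply: (dct_param (y := fun n s => y n (idx n s))) => // n s i Ds.
  exact: (hy n).2.
- by move=> th; exact: ray_param.
- by move=> th; exact: ray_param.
Qed.

End Bounded.

Variable E : nat -> set T.
Hypothesis mE : forall n, measurable (E n).
Hypothesis lamE : forall n, (lam (E n) < +oo)%E.
Hypothesis coverE : forall s, \forall n \near \oo, E n s.
Hypothesis ia : forall th, lam.-integrable setT (EFin \o (fun s => a (dotp th (f s)))).
Hypothesis ib : forall th, lam.-integrable setT (EFin \o (fun s => b (dotp th (f s)))).
Hypothesis ra : forall th, Rintegral lam setT (fun s => a (dotp (tscale t th) (f s))) @[t --> (0 : R)] --> (0 : R).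
Hypothesis rb : forall th, Rintegral lam setT (fun s => b (dotp (tscale t th) (f s))) @[t --> (0 : R)] --> (0 : R).

(** The exhausting sets are cut down to where [f] is bounded by [n], so that the bounded case
    applies on each of them. *)
Let D n := E n `&` \bigcap_(i in [set: 'I_k]) [set s | `|tnth (f s) i| <= n%:R].

Let mD n : measurable (D n).
Proof.
apply: measurableI => //; apply: fin_bigcap_measurable; first exact: finite_finset.
move=> i _; rewrite (_ : mkset _ = (fun x => `|tnth (f x) i|) @^-1` `]-oo, n%:R]); last first.
  by apply/seteqP; split => w /=; rewrite in_itv.
have mn : measurable_fun setT (fun x : T => `|tnth (f x) i|).
  by apply: measurableT_comp => //; exact: mf.
by rewrite -[X in measurable X]setTI; apply: mn.
Qed.

Let lamD n : (lam (D n) < +oo)%E.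
Proof.
apply: le_lt_trans (lamE n); apply: le_measure; rewrite ?inE//.
exact: subIsetl.
Qed.

Let D_near s : \forall n \near \oo, D n s.
Proof.
have h i : \forall n \near \oo, `|tnth (f s) i| <= n%:R by exact: nbhs_infty_ger.
have h2 : \forall n \near \oo, forall i, `|tnth (f s) i| <= n%:R by exact: filter_forall.
by apply: filterS (filterI (coverE s) h2) => n [/= h3 h4]; split => // i _; exact: h4.
Qed.

Let exhaust (g : T -> R) : lam.-integrable setT (EFin \o g) ->
  (fun n => Rintegral lam (D n) g) @ \oo --> Rintegral lam setT g.
Proof.
move=> ig; have mg := measurable_integrable ig.
have mgn n : measurable_fun setT (g \_ (D n)).
  by apply/(measurable_restrictT g (mD n)); exact: measurable_funTS.
under eq_fun do rewrite Rintegral_mkcond.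
apply: (Rintegral_dct measurableT mgn mg _ (g := fun s => `|g s|) _ _).2.
- apply: aeW => s _; apply: cvg_near_cst; apply: filterS (D_near s) => n Ds.
  by rewrite patchE mem_set.
- exact: (integrable_norm ig).
- by move=> n s _; rewrite patchE; case: ifP => _; rewrite ?normr0.
Qed.

Theorem levy_exp_field : levy_exp
  (fun th => Rintegral lam setT (fun s => a (dotp th (f s))))
  (fun th => Rintegral lam setT (fun s => b (dotp th (f s)))).
Proof.
apply: (@levy_exp_lim _ _
  (fun n th => Rintegral lam (D n) (fun s => a (dotp th (f s))))
  (fun n th => Rintegral lam (D n) (fun s => b (dotp th (f s))))) => //.
- move=> n; apply: (@levy_exp_field_bounded (D n) n%:R) => //.
  by move=> s i [_ h]; exact: h.
- by move=> th; exact: exhaust.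
- by move=> th; exact: exhaust.
Qed.

End LevyExpField.

(** * Lebesgue measure on tuples *)

Section LebesgueTuple.
Context (R : realType) (d : nat) (lam : {measure set (d.-tuple R) -> \bar R}).
Hypothesis hlam : is_lebesgue_measure lam.

Definition box (a b : d.-tuple R) : set (d.-tuple R) :=
  [set x | forall i, tnth a i < tnth x i <= tnth b i].

Definition cube (n : nat) : set (d.-tuple R) := box [tuple - n%:R | i < d] [tuple n%:R | i < d].

Lemma measurable_box a b : measurable (box a b).
Proof.
rewrite (_ : box a b = \bigcap_(i in [set: 'I_d]) ((fun x => tnth x i) @^-1` `]tnth a i, tnth b i])).
  apply: fin_bigcap_measurable; first exact: finite_finset.
  by move=> i _; rewrite -[X in measurable X]setTI; apply: (measurable_tnth i).
apply/seteqP; split => x /= h i; first by move=> _ /=; rewrite in_itv /=.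
by have := h i I; rewrite /= in_itv.
Qed.

Lemma cube_near x : \forall n \near \oo, cube n x.
Proof.
have h i : \forall n \near \oo, `|tnth x i| < n%:R by exact: nbhs_infty_gtr.
have h2 : \forall n \near \oo, forall i, `|tnth x i| < n%:R by exact: filter_forall.
apply: filterS h2 => n hn i; rewrite !tnth_mktuple.
by have := hn i; rewrite ltr_norml => /andP[-> /ltW ->].
Qed.

Lemma lam_cube_lty n : (lam (cube n) < +oo)%E.
Proof.
rewrite hlam ?ltry// => i; rewrite !tnth_mktuple.
by rewrite (le_trans (_ : _ <= 0)) ?oppr_le0.
Qed.

Lemma bounded_borel_lty A : bounded_borel A -> (lam A < +oo)%E.
Proof.
move=> [mA [M hM]].
apply: le_lt_trans (lam_cube_lty (Num.trunc M).+1); apply: le_measure; rewrite ?inE//.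
  exact: measurable_box.
move=> x Ax i; rewrite !tnth_mktuple.
have : `|tnth x i| < (Num.trunc M).+1%:R by apply: le_lt_trans (hM x Ax i) (Num.Theory.truncnS_gt _).
by rewrite ltr_norml => /andP[-> /ltW ->].
Qed.

Lemma cube_cover : \bigcup_n cube n = setT.
Proof.
apply/seteqP; split => // x _; have [N _ hN] := cube_near x.
by exists N => //; apply: hN => /=.
Qed.

Lemma lam_sigma_finite : sigma_finite setT lam.
Proof.
exists cube; first by rewrite cube_cover.
by move=> n; split; [exact: measurable_box|exact: lam_cube_lty].
Qed.

(** A strip, in which one coordinate lies in a half-open interval, is the union of boxes that grow
    in the other coordinates, and strips generate the product sigma-algebra. *)
Lemma measurable_tuple_box :
  (measurable : set (set (d.-tuple R))) = <<s [set box ab.1 ab.2 | ab in setT] >>.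
Proof.
apply/seteqP; split; last first.
  apply: smallest_sub; first exact: sigma_algebra_measurable.
  by move=> _ [[a b] _ <-]; exact: measurable_box.
apply: smallest_sub; first exact: smallest_sigma_algebra.
set S := <<s _ >>.
have SS : sigma_algebra setT S by exact: smallest_sigma_algebra.
have SU (F : nat -> set (d.-tuple R)) : (forall n, S (F n)) -> S (\bigcup_n F n) by exact: sigma_algebra_bigcup.
suff h i : preimage_set_system setT (fun x : d.-tuple R => tnth x i) measurable `<=` S.
  elim/big_ind : _ => //= A B hA hB C [/hA|/hB]//.
move=> _ [A mA <-]; rewrite setTI.
have : <<s @ocitv R >> `<=` [set A | S ((fun x : d.-tuple R => tnth x i) @^-1` A)].
  apply: smallest_sub.
    split => /=.
    - by rewrite preimage_set0; exact: sigma_algebra0.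
    - by move=> B SB; rewrite setTD preimage_setC; exact: sigma_algebraC.
    - by move=> F SF; rewrite preimage_bigcup; exact: SU.
  move=> _ [[a b] _ <-] /=.
  rewrite (_ : _ @^-1` _ = \bigcup_n box [tuple if j == i then a else - n%:R | j < d]
                                   [tuple if j == i then b else n%:R | j < d]).
    by apply: SU => n; apply: sub_sigma_algebra; exists ([tuple if j == i then a else - n%:R | j < d],
                                   [tuple if j == i then b else n%:R | j < d]).
  apply/seteqP; split => x /=.
    rewrite in_itv /= => xab; have [N _ hN] := cube_near x; exists N => // j.
    rewrite !tnth_mktuple; case: eqP => [->//|_].
    by have := hN N (leqnn _) j; rewrite !tnth_mktuple.
  by move=> [n _ /(_ i)]; rewrite !tnth_mktuple eqxx in_itv.
exact.
Qed.

Definition ttrans (v x : d.-tuple R) : d.-tuple R := tsub x v.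

Lemma measurable_ttrans v : measurable_fun setT (ttrans v).
Proof.
apply/measurable_fun_tnthP => i.
apply: (@eq_measurable_fun _ _ _ _ _ (fun x : d.-tuple R => tnth x i - tnth v i)).
  by move=> z _ /=; rewrite tnth_mktuple.
by apply: measurable_funB => //; exact: measurable_tnth.
Qed.

Lemma box_empty a b i : tnth b i < tnth a i -> box a b = set0.
Proof.
move=> ba; apply/seteqP; split => // x /(_ i) /andP[h1 h2].
by have := lt_trans (lt_le_trans h1 h2) ba; rewrite ltxx.
Qed.

(** A translated box has the same side lengths, and a measure finite on the cubes is determined by
    its values on boxes, which are stable under intersection. Boxes with a reversed side fall
    outside [is_lebesgue_measure] and are empty before and after translation. *)
Lemma lam_translation v A : measurable A -> lam (ttrans v @^-1` A) = lam A.
Proof.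
move=> mA; symmetry.
have mp := measurable_ttrans v.
pose pl : {measure set (d.-tuple R) -> \bar R} := pushforward lam (ttrans v).
change (lam A = pl mp A).
apply: (measure_unique [set box ab.1 ab.2 | ab in setT] cube) => //.
- exact: measurable_tuple_box.
- move=> _ _ [[a b] _ <-] [[a' b'] _ <-] /=.
  exists ([tuple Num.max (tnth a i) (tnth a' i) | i < d], [tuple Num.min (tnth b i) (tnth b' i) | i < d]) => //=.
  apply/seteqP; split => x /=.
    by move=> h; split => i; have := h i; rewrite !tnth_mktuple gt_max le_min => /andP[/andP[? ?] /andP[? ?]]; apply/andP.
  move=> [h h'] i; have := h i; have := h' i; rewrite !tnth_mktuple gt_max le_min.
  by move=> /andP[-> ->] /andP[-> ->].
- by move=> n; exists ([tuple - n%:R | i < d], [tuple n%:R | i < d]).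
- exact: cube_cover.
- move=> _ [[a b] _ <-] /=.
  rewrite /pushforward (_ : _ @^-1` _ = box [tuple tnth a i + tnth v i | i < d] [tuple tnth b i + tnth v i | i < d]); last first.
    by apply/seteqP; split => x /= h i; have := h i; rewrite !tnth_mktuple ltrBrDr lerBlDr.
  have [ab|] := pselect (forall i, tnth a i <= tnth b i).
    rewrite !hlam// => [|i]; last by rewrite !tnth_mktuple lerD2r.
    congr EFin; apply: eq_bigr => i _; rewrite !tnth_mktuple; ring.
  move=> /existsNP[i /negP]; rewrite -ltNge => ba.
  rewrite (box_empty ba) (@box_empty _ _ i) ?measure0//.
  by rewrite !tnth_mktuple ltrD2r.
- exact: lam_cube_lty.
Qed.

Lemma integral_translation v (h : d.-tuple R -> R) : lam.-integrable setT (EFin \o h) ->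
  lam.-integrable setT (EFin \o (h \o ttrans v)) /\
  Rintegral lam setT (h \o ttrans v) = Rintegral lam setT h.
Proof.
move=> ih; have mh := measurable_integrable ih.
have mp := measurable_ttrans v.
pose phi : {mfun (d.-tuple R) >-> (d.-tuple R)} := MeasurableFun.Pack (MeasurableFun.Class (isMeasurableFun.Build _ _ _ _ _ mp)).
have E : forall f : d.-tuple R -> \bar R, measurable_fun setT f -> (forall x, 0 <= f x)%E ->
    (\int[lam]_x f (ttrans v x) = \int[lam]_x f x)%E.
  move=> f mf f0; transitivity (\int[pushforward lam phi]_x f x)%E.
    by rewrite [RHS]ge0_integral_pushforward ?preimage_setT.
  by apply: eq_measure_integral => A mA _; exact: lam_translation.
have i1 : lam.-integrable setT (EFin \o (h \o ttrans v)).
  apply/integrableP; split; first by apply/measurable_EFinP; exact: measurableT_comp.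
  rewrite (E (fun x => `|(h x)%:E|%E))//; first by case/integrableP: ih.
  by apply: measurableT_comp => //; exact/measurable_EFinP.
split => //; rewrite /Rintegral; congr fine.
transitivity (\int[pushforward lam phi]_x (h x)%:E)%E.
  by rewrite [RHS]integral_pushforward ?preimage_setT//; exact/measurable_EFinP.
by apply: eq_measure_integral => A mA _; exact: lam_translation.
Qed.

End LebesgueTuple.

(** * Characteristic functions of independent sums *)

Section IndependentSum.
Context {dO : measure_display} {Om : measurableType dO} (R : realType) (P : probability Om R).

(** Independence is given on sets, so the product formula is obtained for variables clamped to
    [[- m, m]] and rounded to a grid, where it is the expansion of a product of finite sums over all
    vectors of grid indices. Letting [m] grow gives the general case by dominated convergence. *)
Lemma independent_charfun n (Y : 'I_n -> Om -> R) :
  (forall i, measurable_fun setT (Y i)) -> independent P Y ->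
  Complex (Rintegral P setT (fun w => cos (\sum_i Y i w)))
          (Rintegral P setT (fun w => sin (\sum_i Y i w))) =
  \prod_i Complex (Rintegral P setT (fun w => cos (Y i w))) (Rintegral P setT (fun w => sin (Y i w))).
Proof.
move=> mY iY.
pose clamp (K : nat) (x : R) : R := Num.max (- K%:R) (Num.min K%:R x).
have clampb K x : `|clamp K x| <= K%:R.
  rewrite ler_norml /clamp le_max lexx /= ge_max ge_min lexx /= andbT.
  by rewrite (le_trans (_ : _ <= 0)) ?oppr_le0.
have approx m : exists t : 'I_n -> Om -> R,
    [/\ forall i, measurable_fun setT (t i), forall i w, `|clamp m (Y i w) - t i w| <= m.+1%:R^-1 &
    Complex (Rintegral P setT (fun w => cos (\sum_i t i w)))
          (Rintegral P setT (fun w => sin (\sum_i t i w))) =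
    \prod_i Complex (Rintegral P setT (fun w => cos (t i w))) (Rintegral P setT (fun w => sin (t i w)))].
  have e0 : 0 < m.+1%:R^-1 :> R by rewrite invr_gt0.
  have [N [c hc]] := @finidx_approx_uniform _ (R : measurableType _) R m%:R _ e0.
  have [|x|ix [mix hix]] := hc (clamp m); [|exact: clampb|].
    apply: measurable_maxr; first exact: measurable_cst.
    by apply: measurable_minr => //; exact: measurable_cst.
  pose idx i w := ix (Y i w).
  have midx i j : measurable (idx i @^-1` [set j]).
    by rewrite -[X in measurable X]setTI; apply: (mY i measurableT (ix @^-1` [set j])).
  exists (fun i w => c (idx i w)); split => [i|i w|].
  - exact: (measurable_finidx c (midx i)).
  - exact: hix.
  pose I := {ffun 'I_n -> 'I_N.+1}.
  pose idxf w : I := [ffun i => idx i w].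
  have eF (j : I) : idxf @^-1` [set j] = \bigcap_(i in setT) (Y i @^-1` (ix @^-1` [set j i])).
    apply/seteqP; split => w /=; first by move=> <- i _ /=; rewrite ffunE.
    by move=> h; apply/ffunP => i; rewrite ffunE; exact: h.
  have midxf (j : I) : measurable (idxf @^-1` [set j]).
    rewrite eF; apply: fin_bigcap_measurable; first exact: finite_finset.
    by move=> i _; exact: midx.
  have pj (j : I) : fine (P (idxf @^-1` [set j])) = \prod_i fine (P (idx i @^-1` [set j i])).
    by rewrite eF (iY (fun i => ix @^-1` [set j i])).
  have Ef (h : R -> R) : Rintegral P setT (fun w => h (\sum_i c (idx i w))) =
      \sum_(j : I) h (\sum_i c (j i)) * fine (P (idxf @^-1` [set j])).
    rewrite -(Rintegral_finidx (fun j : I => h (\sum_i c (j i))) (prob_lty P) midxf).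
    by apply: eq_Rintegral => w _ /=; congr h; apply: eq_bigr => i _; rewrite ffunE.
  have E1 (h : R -> R) i : Rintegral P setT (fun w => h (c (idx i w))) =
      \sum_j h (c j) * fine (P (idx i @^-1` [set j])).
    exact: (Rintegral_finidx (fun j => h (c j)) (prob_lty P) (midx i)).
  have CS (J : finType) (x y : J -> R) : Complex (\sum_j x j) (\sum_j y j) = \sum_j Complex (x j) (y j).
    by apply: (big_rec3 (fun a b (z : R[i]) => Complex a b = z)) => // j a b z _ <-.
  rewrite !Ef CS; under [RHS]eq_bigr do rewrite !E1 CS.
  rewrite bigA_distr_bigA /=; apply: eq_bigr => j _.
  rewrite pj.
  have cexpS (s : seq 'I_n) (x p : 'I_n -> R) :
      Complex (cos (\sum_(i <- s) x i) * \prod_(i <- s) p i) (sin (\sum_(i <- s) x i) * \prod_(i <- s) p i) =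
      \prod_(i <- s) Complex (cos (x i) * p i) (sin (x i) * p i).
    elim: s => [|i s IH]; first by rewrite !big_nil cos0 sin0 mul1r mul0r.
    by rewrite !big_cons -IH cosD sinD; congr Complex; ring.
  exact: cexpS.
have [t ht] := choice approx.
have tcv i w : (fun m => t m i w) @ \oo --> Y i w.
  apply/cvgrPdist_le => e e0; near=> m.
  have cY : clamp m (Y i w) = Y i w.
    have : `|Y i w| <= m%:R by near: m; exact: nbhs_infty_ger.
    by rewrite ler_norml => /andP[h1 h2]; rewrite /clamp min_r ?max_r.
  have [_ h _] := ht m; rewrite -cY; apply: le_trans (h i w) _.
  by near: m; exact: near_invS_le.
have dct (h : R -> R) (u : nat -> Om -> R) (v : Om -> R) : continuous h -> (forall x, `|h x| <= 1) ->
    (forall m, measurable_fun setT (u m)) -> (forall w, (fun m => u m w) @ \oo --> v w) ->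
    (fun m => Rintegral P setT (fun w => h (u m w))) @ \oo --> Rintegral P setT (fun w => h (v w)).
  move=> ch h1 mu uv; have mh : measurable_fun setT h by exact: continuous_measurable_fun.
  have mv : measurable_fun setT v by exact: (measurable_fun_cvg mu (fun w _ => uv w)).
  apply: (Rintegral_dct measurableT _ _ _ (prob_integrable_cst P 1) _).2 => //.
  - by move=> m; exact: measurableT_comp mh (mu m).
  - exact: measurableT_comp mh mv.
  - by apply: aeW => w _; exact: (cvg_comp _ _ (uv w) (ch _)).
have cprod (s : seq 'I_n) (x y : nat -> 'I_n -> R) (x' y' : 'I_n -> R) :
    (forall i, (fun m => x m i) @ \oo --> x' i) -> (forall i, (fun m => y m i) @ \oo --> y' i) ->
    (fun m => complex.Re (\prod_(i <- s) Complex (x m i) (y m i))) @ \oo --> complex.Re (\prod_(i <- s) Complex (x' i) (y' i)) /\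
    (fun m => complex.Im (\prod_(i <- s) Complex (x m i) (y m i))) @ \oo --> complex.Im (\prod_(i <- s) Complex (x' i) (y' i)).
  move=> hx hy; elim: s => [|i s [IH1 IH2]].
    by rewrite !big_nil; split; under eq_fun do rewrite big_nil; exact: cvg_cst.
  have re (z w : R[i]) : complex.Re (z * w) = complex.Re z * complex.Re w - complex.Im z * complex.Im w by case: z; case: w.
  have im (z w : R[i]) : complex.Im (z * w) = complex.Re z * complex.Im w + complex.Im z * complex.Re w by case: z; case: w.
  rewrite !big_cons; split.
    under eq_fun do rewrite big_cons re /=; rewrite re /=.
    by apply: cvgB; apply: cvgM => //.
  under eq_fun do rewrite big_cons im /=; rewrite im /=.
  by apply: cvgD; apply: cvgM => //.
have mt m i : measurable_fun setT (t m i) by have [] := ht m.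
have Scv w : (fun m => \sum_i t m i w) @ \oo --> \sum_i Y i w by apply: cvg_bigsum => i.
have mS m : measurable_fun setT (fun w => \sum_i t m i w) by apply: measurable_sum => i.
have [c1 c2] := cprod (index_enum 'I_n) _ _ _ _
  (fun i => dct cos (fun m => t m i) (Y i) (@continuous_cos R) (@cos_norm_le1 R) (fun m => mt m i) (tcv i))
  (fun i => dct sin (fun m => t m i) (Y i) (@continuous_sin R) (@sin_norm_le1 R) (fun m => mt m i) (tcv i)).
have l1 := dct cos _ _ (@continuous_cos R) (@cos_norm_le1 R) mS Scv.
have l2 := dct sin _ _ (@continuous_sin R) (@sin_norm_le1 R) mS Scv.
have eq_lim (u : nat -> R) (x y : R) : u @ \oo --> x -> u @ \oo --> y -> x = y.
  by move=> ux uy; rewrite -(cvg_lim _ ux)// -(cvg_lim _ uy).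
apply/eqP; rewrite eq_complex; apply/andP; split; apply/eqP => /=.
  apply: (eq_lim _ _ _ l1).
  rewrite (_ : (fun m => _) = (fun m => complex.Re (\prod_i Complex (Rintegral P setT (fun w => cos (t m i w)))
    (Rintegral P setT (fun w => sin (t m i w))))))//.
  by apply/funext => m; have [_ _ <-] := ht m.
apply: (eq_lim _ _ _ l2).
rewrite (_ : (fun m => _) = (fun m => complex.Im (\prod_i Complex (Rintegral P setT (fun w => cos (t m i w)))
  (Rintegral P setT (fun w => sin (t m i w))))))//.
by apply/funext => m; have [_ _ <-] := ht m.
Unshelve. all: by end_near. Qed.

End IndependentSum.

(** * The Lévy–Khintchine exponent *)

(** Converts the property into the bundled structure that Fubini's theorem expects, with an equality
    along which the original measure can be replaced. *)
Lemma pack_sigma_finite d (T : measurableType d) (R : realType) (mu : {measure set T -> \bar R}) :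
  sigma_finite setT mu -> exists m : {sigma_finite_measure set T -> \bar R}, mu = m.
Proof.
case: mu => f c h; pose mu : {measure set T -> \bar R} := Measure.Pack c.
pose H := Measure_isSigmaFinite.Build _ _ _ mu h.
pose m : {sigma_finite_measure set T -> \bar R} := HB.pack f c H.
by exists m.
Qed.

Section Kernel.
Context (R : realType).

Lemma norm_le_derive (f df : R -> R) (C y : R) : (forall x : R, is_derive x 1 f (df x)) ->
  (forall x, `|x| <= `|y| -> `|df x| <= C) -> `|f y - f 0| <= C * `|y|.
Proof.
move=> hf hC.
have cf : continuous f by move=> x; apply/differentiable_continuous/derivable1_diffP; apply: ex_derive.
have [y0|y0] := leP 0 y.
  have [c /itvP cI ->] := MVT_segment y0 (fun x _ => hf x) (continuous_subspaceT cf).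
  rewrite subr0 normrM ler_wpM2r// hC// !ger0_norm// ?cI//.
have [c /itvP cI e] := MVT_segment (ltW y0) (fun x _ => hf x) (continuous_subspaceT cf).
rewrite distrC e sub0r normrM normrN ler_wpM2r// hC// !ler0_norm ?(ltW y0)// ?cI//.
by rewrite lerN2 cI.
Qed.

Lemma sin_norm_le (y : R) : `|sin y| <= `|y|.
Proof.
have := @norm_le_derive sin cos 1 y (fun x => is_derive_sin x) (fun x _ => cos_max x).
by rewrite sin0 subr0 mul1r.
Qed.

Lemma onem_cos_le_norm (y : R) : `|cos y - 1| <= `|y|.
Proof.
have h := @norm_le_derive cos (fun x => - sin x) 1 y (fun x => is_derive_cos x).
by rewrite -cos0 -[leRHS]mul1r; apply: h => x _; rewrite normrN sin_max.
Qed.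

Lemma onem_cos_le_sqr (y : R) : `|cos y - 1| <= y ^+ 2.
Proof.
have h := @norm_le_derive cos (fun x => - sin x) `|y| y (fun x => is_derive_cos x).
rewrite -cos0 -(real_normK (num_real y)) expr2; apply: h => x xy.
by rewrite normrN; exact: le_trans (sin_norm_le x) xy.
Qed.

Lemma sin_sub_le_sqr (y : R) : `|sin y - y| <= y ^+ 2.
Proof.
have h := @norm_le_derive (fun x => sin x - x) (fun x => cos x - 1) `|y| y.
have {}h : `|(sin y - y) - (sin 0 - 0)| <= `|y| * `|y|.
  by apply: h => x xy; apply: le_trans xy; exact: onem_cos_le_norm.
by move: h; rewrite sin0 !subr0 -expr2 real_normK ?num_real.
Qed.

Definition m1 (x : R) : R := Num.min 1 (x ^+ 2).
Definition kre (th x : R) : R := cos (th * x) - 1.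
Definition kim (th x : R) : R := sin (th * x) - th * tau1 x.

Lemma m1_ge0 x : 0 <= m1 x. Proof. by rewrite /m1 le_min ler01 sqr_ge0. Qed.

Lemma tau1_small (x : R) : `|x| <= 1 -> tau1 x = x.
Proof. by move=> h; rewrite /tau1 max_l ?divr1. Qed.

Lemma tau1_norm_le1 (x : R) : `|tau1 x| <= 1.
Proof.
rewrite /tau1; have h : 0 < Num.max 1 `|x| by rewrite lt_max ltr01.
by rewrite normf_div (gtr0_norm h) ler_pdivrMr// mul1r le_max lexx orbT.
Qed.

Lemma m1_small x : `|x| <= 1 -> m1 x = x ^+ 2.
Proof. by move=> h; rewrite /m1 min_r// -(real_normK (num_real x)) exprn_ile1. Qed.

Lemma m1_large x : 1 < `|x| -> m1 x = 1.
Proof. by move=> h; rewrite /m1 min_l// -(real_normK (num_real x)) expr_ge1// ltW. Qed.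

Lemma kre_le th x : `|kre th x| <= 2 * (1 + th ^+ 2) * m1 x.
Proof.
have t0 := sqr_ge0 th.
have [h|h] := leP `|x| 1.
  rewrite m1_small//; apply: le_trans (onem_cos_le_sqr _) _.
  by rewrite exprMn ler_wpM2r ?sqr_ge0//; lra.
rewrite m1_large// mulr1 /kre; apply: le_trans (ler_normB _ _) _.
by rewrite normr1; have := cos_max (th * x); lra.
Qed.

(** For [|x| <= 1] the compensator is exactly [th * x] and cancels the linear part of the sine,
    leaving a quadratic bound; for larger [x] both terms are bounded in [x]. *)
Lemma kim_le th x : `|kim th x| <= 2 * (1 + th ^+ 2) * m1 x.
Proof.
have t0 := sqr_ge0 th.
have [h|h] := leP `|x| 1.
  rewrite m1_small// /kim tau1_small//; apply: le_trans (sin_sub_le_sqr _) _.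
  by rewrite exprMn ler_wpM2r ?sqr_ge0//; lra.
rewrite m1_large// mulr1 /kim; apply: le_trans (ler_normB _ _) _.
apply: (@le_trans _ _ (1 + `|th|)).
  apply: lerD; first exact: sin_max.
  by rewrite normrM ler_piMr// tau1_norm_le1.
have : 0 <= (`|th| - 1) ^+ 2 by exact: sqr_ge0.
by rewrite sqrrB1 real_normK ?num_real// -[_ *+ 2]mulr_natr; lra.
Qed.

Lemma kre_le0 th x : kre th x <= 0.
Proof. by rewrite subr_le0 cos_le1. Qed.

Lemma kre0 x : kre 0 x = 0. Proof. by rewrite /kre mul0r cos0 subrr. Qed.
Lemma kim0 x : kim 0 x = 0. Proof. by rewrite /kim !mul0r sin0 subrr. Qed.

(** [cos (2 y) - 1] is [2 (cos y - 1) (cos y + 1)], with [cos y - 1 <= 0] and [cos y + 1 <= 2]. Its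
    use is to carry a lower bound on the modulus of a characteristic function from a neighbourhood
    of 0 to any bounded range. *)
Lemma kre_double th x : 4 * kre th x <= kre (2 * th) x.
Proof.
rewrite /kre -mulrA [2 * (th * x)]mulr_natl cos_mulr2n -mulr_natr.
have : 0 <= (cos (th * x) - 1) ^+ 2 by exact: sqr_ge0.
by rewrite sqrrB1 -[_ *+ 2]mulr_natr; lra.
Qed.

Lemma measurable_m1 : measurable_fun setT m1.
Proof.
apply: measurable_minr; first exact: measurable_cst.
by apply: continuous_measurable_fun; exact: exprn_continuous.
Qed.

Lemma continuous_tau1 : continuous (@tau1 R).
Proof.
move=> x; apply: cvgM => //; apply: cvgV; first by rewrite gt_eqF// lt_max ltr01.
apply: (@continuous_max _ _ (fun=> 1 : R) (fun x : R => `|x|) x); first exact: cst_continuous.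
exact: norm_continuous.
Qed.

Lemma measurable_tau1 : measurable_fun setT (@tau1 R).
Proof. exact: continuous_measurable_fun continuous_tau1. Qed.

Lemma measurable_kre th : measurable_fun setT (kre th).
Proof.
apply: measurable_funB; last exact: measurable_cst.
exact: (@measurable_cos_comp _ R R setT (fun x => th * x) (mulrl_measurable _)).
Qed.

Lemma measurable_kim th : measurable_fun setT (kim th).
Proof.
apply: measurable_funB.
  exact: (@measurable_sin_comp _ R R setT (fun x => th * x) (mulrl_measurable _)).
by apply: measurable_funM; [exact: measurable_cst|exact: measurable_tau1].
Qed.

Lemma kre_cvg (u : nat -> R) th x : u @ \oo --> th -> (fun n => kre (u n) x) @ \oo --> kre th x.
Proof.
move=> h; apply: cvgB; last exact: cvg_cst.
have c : (fun n => u n * x) @ \oo --> th * x by apply: cvgM => //; exact: cvg_cst.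
exact: (cvg_comp _ _ c (@continuous_cos R _)).
Qed.

Lemma kim_cvg (u : nat -> R) th x : u @ \oo --> th -> (fun n => kim (u n) x) @ \oo --> kim th x.
Proof.
move=> h; apply: cvgB; last by apply: cvgM => //; exact: cvg_cst.
have c : (fun n => u n * x) @ \oo --> th * x by apply: cvgM => //; exact: cvg_cst.
exact: (cvg_comp _ _ c (@continuous_sin R _)).
Qed.

Section LevyMeasure.
Context (rho : {measure set R -> \bar R}).
Hypothesis hrho : levy_measure rho.

Lemma integrable_m1 : rho.-integrable setT (EFin \o m1).
Proof.
apply/integrableP; split; first by apply/measurable_EFinP; exact: measurable_m1.
apply: le_lt_trans hrho.2; apply: ge0_le_integral => //.
- by apply/measurable_EFinP; apply: measurableT_comp => //; exact: measurable_m1.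
- by apply/measurable_EFinP; exact: measurable_m1.
- by move=> x _; rewrite lee_fin ger0_norm ?m1_ge0.
Qed.

Lemma m1_dominated (f : R -> R) (C : R) : measurable_fun setT f -> (forall x, `|f x| <= C * m1 x) ->
  rho.-integrable setT (EFin \o f).
Proof.
move=> mf fC; apply: (integrable_le measurableT mf _ (g := fun x => C * m1 x)) => //.
have := integrableZl measurableT C integrable_m1.
by apply: eq_integrable => // x _; rewrite /= EFinM.
Qed.

Lemma integrable_kre th : rho.-integrable setT (EFin \o kre th).
Proof. exact: m1_dominated (measurable_kre th) (kre_le th). Qed.

Lemma integrable_kim th : rho.-integrable setT (EFin \o kim th).
Proof. exact: m1_dominated (measurable_kim th) (kim_le th). Qed.

(** The sets where [m1] is at least [1 / (n + 1)] have finite measure by Markov's inequality; the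
    one point they miss is 0, which is null by the definition of a Lévy measure. *)
Lemma levy_sigma_finite : sigma_finite setT rho.
Proof.
pose F n := [set x : R | n.+1%:R^-1 <= m1 x] `|` [set 0].
exists F.
  apply/seteqP; split => // x _; have [->|x0] := eqVneq x 0; first by exists 0%N => //; right.
  have mx : 0 < m1 x by rewrite lt_min ltr01 exprn_even_gt0.
  by have [N _ hN] := near_invS_le mx; exists N => //; left; apply: hN => /=.
move=> n; have mF : measurable [set x : R | n.+1%:R^-1 <= m1 x].
  rewrite (_ : mkset _ = m1 @^-1` `[n.+1%:R^-1, +oo[); last first.
    by apply/seteqP; split => x /=; rewrite in_itv /= andbT.
  by rewrite -[X in measurable X]setTI; apply: measurable_m1.
have m0 : measurable [set (0 : R)] by [].
split; first exact: measurableU.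
apply: le_lt_trans (measureU2 _ mF m0) _; rewrite /= hrho.1 adde0.
have h : ((n.+1%:R^-1)%:E * rho [set x : R | (n.+1%:R^-1 <= m1 x)%R] < +oo)%E.
  apply: le_lt_trans hrho.2; rewrite -integral_cst//.
  apply: (@le_trans _ _ (\int[rho]_(x in [set x : R | (n.+1%:R^-1 <= m1 x)%R]) (m1 x)%:E)%E).
    apply: ge0_le_integral => //; first by move=> x _; rewrite lee_fin.
    by apply/measurable_EFinP; apply: measurable_funTS; exact: measurable_m1.
  apply: ge0_subset_integral => //; first by apply/measurable_EFinP; exact: measurable_m1.
  by move=> x _; rewrite lee_fin m1_ge0.
rewrite ltey; apply: contraTN h => /eqP ->.
by rewrite gt0_muley ?lte_fin ?invr_gt0// -leNgt.
Qed.

Definition Kre th := Rintegral rho setT (kre th).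
Definition Kim th := Rintegral rho setT (kim th).

Lemma Kre0 : Kre 0 = 0.
Proof. by rewrite /Kre (_ : kre 0 = fun=> 0) ?Rintegral_cst ?mul0r//; apply/funext => x; rewrite kre0. Qed.

Lemma Kim0 : Kim 0 = 0.
Proof. by rewrite /Kim (_ : kim 0 = fun=> 0) ?Rintegral_cst ?mul0r//; apply/funext => x; rewrite kim0. Qed.

Lemma Kre_le0 th : Kre th <= 0.
Proof.
rewrite -oppr_ge0 -mulN1r -RintegralZl//; last exact: integrable_kre.
by apply: Rintegral_ge0 => x _; rewrite mulN1r oppr_ge0 kre_le0.
Qed.

Lemma Kre_double th : 4 * Kre th <= Kre (2 * th).
Proof.
have i1 := integrable_kre th; have i2 := integrable_kre (2 * th).
rewrite -subr_ge0 /Kre -RintegralZl// -RintegralB//; last first.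
  by have := integrableZl measurableT 4 i1; apply: eq_integrable => // x _; rewrite /= EFinM.
by apply: Rintegral_ge0 => x _; rewrite subr_ge0 kre_double.
Qed.

Let dom_cvg (K : R -> R -> R) : (forall th, measurable_fun setT (K th)) ->
  (forall th x, `|K th x| <= 2 * (1 + th ^+ 2) * m1 x) ->
  (forall (u : nat -> R) th x, u @ \oo --> th -> (fun n => K (u n) x) @ \oo --> K th x) ->
  continuous (fun th => Rintegral rho setT (K th)).
Proof.
move=> mK hK cK th; apply: cvg_seq_nbhs => u uth.
have [B hB] : exists B, forall n, `|u n| <= B.
  have /cvg_seq_bounded[B [_ hB]] : cvg (u @ \oo) by apply/cvg_ex; exists th.
  by exists (B + 1) => n; apply: hB => //; rewrite ltrDl.
have ig : rho.-integrable setT (EFin \o (fun x => 2 * (1 + B ^+ 2) * m1 x)).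
  have := integrableZl measurableT (2 * (1 + B ^+ 2)) integrable_m1.
  by apply: eq_integrable => // x _; rewrite /= EFinM.
apply: (Rintegral_dct measurableT _ _ _ ig _).2 => //.
  by apply: aeW => x _; exact: cK.
move=> n x _; apply: le_trans (hK _ _) _; rewrite ler_wpM2r ?m1_ge0// ler_wpM2l// lerD2l.
by rewrite -(real_normK (num_real (u n))) lerXn2r ?nnegrE// (le_trans _ (hB n)).
Qed.

Lemma continuous_Kre : continuous Kre.
Proof. exact: dom_cvg measurable_kre kre_le kre_cvg. Qed.

Lemma continuous_Kim : continuous Kim.
Proof. exact: dom_cvg measurable_kim kim_le kim_cvg. Qed.

End LevyMeasure.

Definition lk_re (b : R) (rho : {measure set R -> \bar R}) (th : R) : R := - (b ^+ 2 * th ^+ 2) / 2 + Kre rho th.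
Definition lk_im (gam : R) (rho : {measure set R -> \bar R}) (th : R) : R := gam * th + Kim rho th.

Lemma lk_exponentE gam b rho th :
  lk_exponent gam b rho th = Complex (lk_re b rho th) (lk_im gam rho th).
Proof. by []. Qed.

Section LkExponent.
Context (gam b : R) (rho : {measure set R -> \bar R}).
Hypothesis hrho : levy_measure rho.

Lemma lk_re0 : lk_re b rho 0 = 0.
Proof. by rewrite /lk_re Kre0 expr0n/= mulr0 oppr0 mul0r addr0. Qed.

Lemma lk_im0 : lk_im gam rho 0 = 0.
Proof. by rewrite /lk_im Kim0 mulr0 addr0. Qed.

Lemma lk_re_le_Kre th : lk_re b rho th <= Kre rho th.
Proof. by rewrite gerDr mulNr oppr_le0 divr_ge0// mulr_ge0// sqr_ge0. Qed.

Lemma lk_re_le0 th : lk_re b rho th <= 0.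
Proof. exact: le_trans (lk_re_le_Kre th) (Kre_le0 hrho th). Qed.

Lemma lk_re_double th : 4 * lk_re b rho th <= lk_re b rho (2 * th).
Proof.
have := Kre_double hrho th; rewrite /lk_re exprMn.
have -> : 4 * (- (b ^+ 2 * th ^+ 2) / 2 + Kre rho th) =
  - (b ^+ 2 * (2 ^+ 2 * th ^+ 2)) / 2 + 4 * Kre rho th by field.
by rewrite lerD2l.
Qed.

Lemma continuous_lk_re : continuous (lk_re b rho).
Proof.
move=> x; apply: cvgD; last exact: continuous_Kre.
apply: cvgM; last exact: cvg_cst.
by apply: cvgN; apply: cvgM; [exact: cvg_cst|exact: exprn_continuous].
Qed.

Lemma continuous_lk_im : continuous (lk_im gam rho).
Proof.
move=> x; apply: cvgD; last exact: continuous_Kim.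
by apply: cvgM; [exact: cvg_cst|exact: cvg_id].
Qed.

End LkExponent.
End Kernel.

(** * Integrals of simple functions *)

Lemma prod_cexp (R : realType) (I : Type) (s : seq I) (x y : I -> R) :
  \prod_(i <- s) cexp (Complex (x i) (y i)) = cexp (Complex (\sum_(i <- s) x i) (\sum_(i <- s) y i)).
Proof.
elim: s => [|i s IH]; last by rewrite !big_cons IH cexpD.
by rewrite !big_nil /cexp /= expR0 cos0 sin0 mulr1 mulr0.
Qed.

Lemma ae_eq_Rintegral d (T : measurableType d) (R : realType) (mu : {measure set T -> \bar R}) (f g : T -> R) :
  measurable_fun setT f -> measurable_fun setT g -> {ae mu, forall x, f x = g x} ->
  Rintegral mu setT f = Rintegral mu setT g.
Proof.
move=> mf mg fg; rewrite /Rintegral; congr fine; apply: ae_eq_integral => //.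
- exact/measurable_EFinP.
- exact/measurable_EFinP.
- by apply: filterS fg => x /= -> .
Qed.

Lemma ae_ball d (T : measurableType d) (R : realType) (mu : {measure set T -> \bar R}) (I : finType)
  (Q : I -> T -> Prop) : (forall i, {ae mu, forall x, Q i x}) -> {ae mu, forall x, forall i, Q i x}.
Proof. by move=> h; apply: filter_forall => i; exact: h. Qed.

Section LevyBasis.
Context (R : realType) (d : nat) (lam : {measure set (d.-tuple R) -> \bar R}).
Hypothesis hlam : is_lebesgue_measure lam.
Context {dO : measure_display} {Om : measurableType dO} (P : probability Om R).
Context (L : set (d.-tuple R) -> Om -> R) (gam b : R) (rho : {measure set R -> \bar R}).
Hypothesis hL : homogeneous_levy_basis P lam L gam b rho.

Lemma levy_basis_measure : levy_measure rho.
Proof. by case: hL. Qed.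

Lemma bounded_borel_sub (A B : set (d.-tuple R)) : bounded_borel A -> measurable B -> B `<=` A -> bounded_borel B.
Proof. by move=> [mA [M hM]] mB BA; split => //; exists M => x /BA /hM. Qed.

Lemma bounded_borel0 : bounded_borel (set0 : set (d.-tuple R)).
Proof. by split => //; exists 0. Qed.

Lemma bounded_borel_bigU (I : finType) (A : I -> set (d.-tuple R)) : (forall i, bounded_borel (A i)) ->
  bounded_borel (\bigcup_(i in setT) A i).
Proof.
move=> hA; split.
  by apply: fin_bigcup_measurable => [|i _]; [exact: finite_finset|exact: (hA i).1].
have /choice[M hM] i := (hA i).2.
exists (\sum_i `|M i|) => x [i _ Aix] j; apply: le_trans (hM i x Aix j) _.
apply: le_trans (ler_norm _) _; rewrite (bigD1 i)//= lerDl.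
by apply: sumr_ge0 => ? _.
Qed.

(** Countable additivity for the constant sequence of empty sets makes [n * L set0 w] converge; its
    increments all equal [L set0 w], which is therefore 0. *)
Lemma levy_basis_set0 : {ae P, forall w, L set0 w = 0}.
Proof.
have [_ _ _ hadd _] := hL.
have := hadd (fun=> set0) (fun=> bounded_borel0).
rewrite bigcup0// => /(_ _ bounded_borel0) h.
have {}h := h ltac:(by apply/trivIsetP => i j _ _ _; rewrite setI0).
apply: filterS h => w h.
have e n : \sum_(i < n) L set0 w = n%:R * L set0 w by rewrite sumr_const card_ord mulr_natl.
have c1 : (fun n => n%:R * L set0 w) @ \oo --> L set0 w.
  by under eq_fun do rewrite -e.
have c2 : (fun n => n.+1%:R * L set0 w) @ \oo --> L set0 w.
  by rewrite (cvg_shiftS (fun n => n%:R * L set0 w)).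
have c3 : (fun n => n.+1%:R * L set0 w - n%:R * L set0 w) @ \oo --> L set0 w - L set0 w.
  exact: cvgB.
rewrite subrr in c3.
have {}c3 : (fun n : nat => L set0 w) @ \oo --> (0 : R).
  apply: cvg_trans c3; apply: near_eq_cvg; apply: nearW => n.
  by rewrite -mulrBl -natr1 addrAC subrr add0r mul1r.
by rewrite -(cvg_lim _ c3)// lim_cst.
Qed.

Lemma levy_basis_additive (I : finType) (A : I -> set (d.-tuple R)) : (forall i, bounded_borel (A i)) ->
  (forall i j, i != j -> A i `&` A j = set0) ->
  {ae P, forall w, L (\bigcup_(i in setT) A i) w = \sum_i L (A i) w}.
Proof.
move=> bA dA; have [_ _ _ hadd _] := hL.
(* The finite family is enumerated and continued by empty sets, whose values are almost surely 0. *)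
pose F (k : nat) := if insub k is Some o then A (enum_val (o : 'I_#|I|)) else set0.
have FE : \bigcup_k F k = \bigcup_(i in setT) A i.
  apply/seteqP; split => x [k _].
    by rewrite /F; case: insubP => // z _ _ h; exists (enum_val z).
  move=> Akx; exists (enum_rank k) => //; rewrite /F.
  case: insubP => [z _ zE|]; last by rewrite ltn_ord.
  by rewrite (_ : z = enum_rank k) ?enum_rankK//; exact: val_inj.
have hF k : bounded_borel (F k).
  by rewrite /F; case: insubP => [z _ _|_]; [exact: bA|exact: bounded_borel0].
have tF : trivIset setT F.
  apply/trivIsetP => i j _ _ ij; rewrite /F.
  case: insubP => [y _ oi|]; last by rewrite set0I.
  case: insubP => [z _ oj|]; last by rewrite setI0.
  apply: dA; apply: contra ij => /eqP /enum_val_inj oo.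
  by rewrite -oi -oj oo.
have h := hadd F hF tF; rewrite FE in h.
have {}h := h (bounded_borel_bigU bA).
have h0 := levy_basis_set0.
apply: filterS2 h h0 => w h h0.
have c : (fun n => \sum_(i < n) L (F i) w) @ \oo --> \sum_i L (A i) w.
  have : (fun n : nat => \sum_i L (A i) w) @ \oo --> \sum_i L (A i) w by exact: cvg_cst.
  apply: cvg_trans; apply: near_eq_cvg; near=> n.
  have nI : (#|I| <= n)%N by near: n; exact: nbhs_infty_ge.
  rewrite -(subnKC nI) big_split_ord /= [X in _ + X]big1 ?addr0 => [|i _]; last first.
    by rewrite /F insubF ?h0//; apply/negbTE; rewrite -leqNgt leq_addr.
  rewrite (reindex (@enum_val I predT)) /=; last first.
    by exists enum_rank => i _; [exact: enum_valK|exact: enum_rankK].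
  apply: eq_bigr => i _; rewrite /F; case: insubP => [z _ zE|]; last by rewrite ltn_ord.
  by congr (L (A (enum_val _)) w); exact: val_inj.
by rewrite -(cvg_lim _ h)// -(cvg_lim _ c).
Unshelve. all: by end_near. Qed.

Lemma independent_scale n (Y : 'I_n -> Om -> R) (c : 'I_n -> R) :
  independent P Y -> independent P (fun i w => c i * Y i w).
Proof.
move=> iY B mB; have mcB i : measurable ((fun x : R => c i * x) @^-1` B i).
  by rewrite -[X in measurable X]setTI; apply: (@mulrl_measurable R setT (c i)).
exact: (iY (fun i => (fun x => c i * x) @^-1` B i) mcB).
Qed.

Section SimpleSum.
Context (n : nat) (a : 'I_n -> R) (A : 'I_n -> set (d.-tuple R)).
Hypothesis hA : forall i, bounded_borel (A i).

Let U := \bigcup_(i in [set: 'I_n]) A i.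
(** The sets [A i] may overlap. [idx s] records which of them contain [s], and its level sets inside
    the union are the atoms of the generated algebra: they are disjoint, so that independence
    applies to them. *)
Let idx (s : d.-tuple R) : {set 'I_n} := [set i | `[< A i s >]]%SET.
Let atom (J : {set 'I_n}) := idx @^-1` [set J] `&` U.
Let c (J : {set 'I_n}) := \sum_(i in J) a i.

Let midx J : measurable (idx @^-1` [set J]).
Proof.
rewrite (_ : _ @^-1` _ = \bigcap_(i in [set: 'I_n]) (if i \in J then A i else ~` A i)).
  apply: fin_bigcap_measurable => [|i _]; first exact: finite_finset.
  by case: ifP => _; [exact: (hA i).1|apply: measurableC; exact: (hA i).1].
apply/seteqP; split => s /=.
  by move=> <- i _; rewrite inE; case: asboolP.
move=> h; apply/setP => i; rewrite inE; have := h i I.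
by case: (i \in J) => /= ?; apply/asboolP.
Qed.

Let bU : bounded_borel U. Proof. exact: bounded_borel_bigU. Qed.

Let batom J : bounded_borel (atom J).
Proof.
apply: (bounded_borel_sub bU); last exact: subIsetr.
by apply: measurableI; [exact: midx|exact: bU.1].
Qed.

Let datom J K : J != K -> atom J `&` atom K = set0.
Proof.
move=> JK; apply/seteqP; split => // s [[/= sJ _] [/= sK _]].
by move: JK; rewrite -sJ -sK eqxx.
Qed.

Let L_atoms : {ae P, forall w, \sum_(i < n) a i * L (A i) w = \sum_J c J * L (atom J) w}.
Proof.
have hi (i : 'I_n) : {ae P, forall w, L (A i) w = \sum_(J : {set 'I_n} | i \in J) L (atom J) w}.
  pose B (J : {set 'I_n}) := if i \in J then atom J else set0.
  have bB J : bounded_borel (B J) by rewrite /B; case: ifP => _; [exact: batom|exact: bounded_borel0].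
  have dB J K : J != K -> B J `&` B K = set0.
    by move=> JK; rewrite /B; case: ifP => _; [case: ifP => _; rewrite ?setI0// datom|rewrite set0I].
  have UB : \bigcup_(J in setT) B J = A i.
    apply/seteqP; split => s.
      move=> [J _]; rewrite /B; case: ifPn => // iJ [/= sJ _].
      by move: iJ; rewrite -sJ inE => /asboolP.
    move=> As; exists (idx s) => //; rewrite /B inE asboolT//.
    by split => //; exists i.
  have h1 := levy_basis_additive bB dB; rewrite UB in h1.
  have h2 := levy_basis_set0.
  apply: filterS2 h1 h2 => w -> h0; rewrite [RHS]big_mkcond; apply: eq_bigr => J _.
  by rewrite /B; case: ifP => // _; rewrite h0.
have {}hi := ae_ball hi.
apply: filterS hi => w hi.
under eq_bigr => i _ do rewrite hi mulr_sumr big_mkcond.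
rewrite exchange_big; apply: eq_bigr => J _ /=; rewrite mulr_suml [RHS]big_mkcond.
by [].
Qed.

Let f (s : d.-tuple R) := \sum_(i < n) a i * \1_(A i) s.

Let fE s : f s = c (idx s).
Proof.
rewrite /f /c [RHS]big_mkcond; apply: eq_bigr => i _; rewrite indicE [in RHS]inE.
have [As|nAs] := pselect (A i s); first by rewrite mem_set// asboolT// mulr1.
by rewrite memNset// asboolF// mulr0.
Qed.

Lemma measurable_simple (g : R -> R) : measurable_fun setT (fun s => g (\sum_(i < n) a i * \1_(A i) s)).
Proof.
have := measurable_finidx (fun J => g (c J)) midx.
by apply: eq_measurable_fun => s _ /=; rewrite -/(f s) fE.
Qed.

Let f_off s : ~ U s -> f s = 0.
Proof.
move=> nU; rewrite /f big1// => i _; rewrite indicE memNset ?mulr0// => As.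
by apply: nU; exists i.
Qed.

Let Rintegral_simple (g : R -> R) : g 0 = 0 ->
  lam.-integrable setT (EFin \o (fun s => g (f s))) /\
  Rintegral lam setT (fun s => g (f s)) = \sum_J fine (lam (atom J)) * g (c J).
Proof.
move=> g0; have lU := bounded_borel_lty hlam bU.
have e : (fun s => g (f s)) \_ U = (fun s => g (f s)).
  by apply/funext => s; rewrite patchE; case: ifPn => //; rewrite notin_setE => /f_off ->; rewrite g0.
split.
  rewrite (_ : EFin \o _ = (EFin \o (fun s => g (f s))) \_ U); last first.
    by rewrite -[in LHS]e restrict_EFin.
  apply: (iffLR (integrable_mkcond _ bU.1)).
  apply: (@bounded_integrable _ _ _ _ _ _ (\sum_J `|g (c J)|)) => //; first exact: bU.1.
    by apply: measurable_funTS; exact: measurable_simple.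
  by move=> s _; rewrite fE (bigD1 (idx s))//= lerDl sumr_ge0.
rewrite -e -Rintegral_mkcond -(Rintegral_finidx_in (fun J => g (c J)) bU.1 lU midx).
by apply: eq_Rintegral => s _; rewrite fE.
Qed.

Lemma integrable_simple (g : R -> R) : g 0 = 0 ->
  lam.-integrable setT (EFin \o (fun s => g (\sum_(i < n) a i * \1_(A i) s))).
Proof. by move=> /Rintegral_simple[]. Qed.

(** The weights and values are chosen before [g], so one representation serves the real and the
    imaginary part and every multiple of the simple function. *)
Lemma simple_finite : exists (I : finType) (wt x : I -> R), (forall i, 0 <= wt i) /\
  forall g : R -> R, g 0 = 0 ->
    Rintegral lam setT (fun s => g (\sum_(i < n) a i * \1_(A i) s)) = \sum_i wt i * g (x i).
Proof.
exists {set 'I_n}, (fun J => fine (lam (atom J))), c; split=> [J|g g0]; first exact: fine_ge0.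
exact: (Rintegral_simple g0).2.
Qed.

Lemma charfun_simple :
  Complex (Rintegral P setT (fun w => cos (\sum_(i < n) a i * L (A i) w)))
          (Rintegral P setT (fun w => sin (\sum_(i < n) a i * L (A i) w))) =
  cexp (Complex (Rintegral lam setT (fun s => lk_re b rho (\sum_(i < n) a i * \1_(A i) s)))
                (Rintegral lam setT (fun s => lk_im gam rho (\sum_(i < n) a i * \1_(A i) s)))).
Proof.
have [_ mL iL _ chL] := hL.
rewrite (Rintegral_simple (lk_re0 b rho)).2 (Rintegral_simple (lk_im0 gam rho)).2.
have mS (I : finType) (x : I -> R) (B : I -> set (d.-tuple R)) : (forall i, bounded_borel (B i)) ->
    measurable_fun setT (fun w => \sum_i x i * L (B i) w).
  by move=> hB; apply: measurable_sum => i; apply: measurable_funM => //; exact: mL.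
have ae_h (h : R -> R) : measurable_fun setT h ->
    Rintegral P setT (fun w => h (\sum_(i < n) a i * L (A i) w)) =
    Rintegral P setT (fun w => h (\sum_J c J * L (atom J) w)).
  move=> mh; apply: ae_eq_Rintegral.
  - exact: (measurableT_comp mh (mS _ a A hA)).
  - exact: (measurableT_comp mh (mS _ c atom batom)).
  - by apply: filterS L_atoms => w ->.
rewrite !ae_h; [|exact: continuous_measurable_fun (@continuous_sin R)|exact: continuous_measurable_fun (@continuous_cos R)].
pose ev := @enum_val {set 'I_n} predT.
have reidx (F : {set 'I_n} -> R) : \sum_J F J = \sum_k F (ev k).
  by rewrite (reindex ev)//; exists enum_rank => i _; [exact: enum_valK|exact: enum_rankK].
under eq_Rintegral do rewrite reidx.
under [X in Complex _ X]eq_Rintegral do rewrite reidx.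
rewrite (@independent_charfun _ _ _ P _ (fun k w => c (ev k) * L (atom (ev k)) w)); last 2 first.
- by move=> k; apply: measurable_funM => //; apply: mL; exact: batom.
- apply: independent_scale; apply: (iL _ (fun k => atom (ev k))) => [k|i j ij]; first exact: batom.
  by apply: datom; apply: contra ij => /eqP /enum_val_inj ->.
rewrite !reidx -prod_cexp; apply: eq_bigr => k _.
have := chL _ (batom (ev k)) (c (ev k)); rewrite /charfun lk_exponentE => ->.
by congr (cexp _); rewrite /GRing.mul /= !mul0r subr0 addr0.
Qed.

End SimpleSum.
End LevyBasis.

(** * Logarithms of nearby characteristic functions *)

Section LogIncrement.
Context (R : realType).

Lemma atan_norm_le (y : R) : `|atan y| <= `|y|.
Proof.
have h := @norm_le_derive R atan (fun x => (1 + x ^+ 2)^-1) 1 y (fun x => is_derive1_atan x).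
rewrite -[leRHS]mul1r -[X in `|X|]subr0 -atan0; apply: h => x _.
by rewrite ger0_norm ?invr_ge0 ?addr_ge0 ?sqr_ge0// invf_le1 ?lerDl ?sqr_ge0// ltr_pwDl// sqr_ge0.
Qed.

(** A continuous phase that starts at 0 and has modulus at least [pi / 2] at [T] must have modulus
    exactly [pi / 2] on the way, where the cosine vanishes. This excludes the other branches of the
    logarithm. *)
Lemma cos_pos_path (w : R -> R) (T : R) : continuous w -> w 0 = 0 -> 
  (forall x, `|x| <= `|T| -> 0 < cos (w x)) -> `|w T| < pi / 2.
Proof.
move=> cw w0 hw; rewrite ltNge; apply/negP => hT.
have cn : continuous (fun x : R => `|w (x * T)|).
  move=> x; apply: cvg_norm; apply: (cvg_comp (fun x : R => x * T) w _ (cw _)).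
  by apply: cvgM; [exact: cvg_id|exact: cvg_cst].
have [|x /itvP xI e] := @IVT R (fun x => `|w (x * T)|) 0 1 (pi / 2) ler01 (continuous_subspaceT cn).
  rewrite mul0r mul1r w0 normr0 ge_min le_max.
  by rewrite hT orbT andbT divr_ge0 ?pi_ge0.
have := hw (x * T); rewrite -cos_norm e cos_pihalf ltxx normrM ger0_norm ?xI//.
by rewrite ler_piMl ?xI// => /(_ isT).
Qed.

(** The number with logarithm [a + i w] stays close to 1 along the whole segment, so its phase stays
    in []- pi / 2, pi / 2[] and is the arctangent of the ratio of its coordinates. The factor 5 is a
    crude bound valid for all [e <= 1 / 2]. *)
Lemma log_increment (a w : R -> R) (T e : R) : 0 <= e <= 1 / 2 -> continuous w -> w 0 = 0 ->
  (forall x, `|x| <= `|T| -> `|expR (a x) * cos (w x) - 1| <= e) ->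
  (forall x, `|x| <= `|T| -> `|expR (a x) * sin (w x)| <= e) ->
  `|a T| <= 5 * e /\ `|w T| <= 5 * e.
Proof.
move=> /andP[e0 e1] cw w0 hc hs.
have cpos x : `|x| <= `|T| -> 0 < cos (w x).
  move=> /hc; rewrite ler_norml => /andP[h _].
  by rewrite -(pmulr_rgt0 _ (expR_gt0 (a x))); lra.
have wT := cos_pos_path cw w0 cpos.
have {hc} := hc T (lexx _); have {hs} := hs T (lexx _); have {cpos} := cpos T (lexx _).
set A := expR (a T); set C := cos _; set S := sin _ => C0 hs hc.
have A0 : 0 < A by exact: expR_gt0.
have CS : C ^+ 2 + S ^+ 2 = 1 by exact: cos2Dsin2.
move: (hc); rewrite ler_norml => /andP[hc1 hc2].
have C1 : C <= 1 by exact: cos_le1.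
have Ale : A <= 1 + 5 * e.
  rewrite -(@ler_pXn2r _ 2)// ?nnegrE; [|exact: ltW|lra].
  have -> : A ^+ 2 = (A * C) ^+ 2 + (A * S) ^+ 2 by rewrite !exprMn -mulrDr CS mulr1.
  have h1 : (A * C) ^+ 2 <= (1 + e) ^+ 2 by apply: lerXn2r; rewrite ?nnegrE; [apply: mulr_ge0; exact: ltW|lra|lra].
  have h2 : (A * S) ^+ 2 <= e ^+ 2.
    by rewrite -(real_normK (num_real (A * S))); apply: lerXn2r; rewrite ?nnegrE.
  apply: le_trans (lerD h1 h2) _; nra.
have Age : 1 - e <= A by apply: (@le_trans _ _ (A * C)); [lra|rewrite ler_piMr// ltW].
split.
  rewrite ler_norml; apply/andP; split.
    have h := expR_ge1Dx (- a T); rewrite expRN -/A in h.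
    have h2 : A^-1 <= 1 + 2 * e.
      rewrite -[A^-1]mul1r ler_pdivrMr//; nra.
    lra.
  have h := expR_ge1Dx (a T); rewrite -/A in h; lra.
have tw : tan (w T) = (A * S) / (A * C).
  rewrite /tan -/S -/C; field; apply/andP; split; exact: lt0r_neq0.
rewrite -(@tanK _ (w T)); last by rewrite in_itv /= -ltr_norml.
apply: le_trans (atan_norm_le _) _; rewrite tw normf_div ler_pdivrMr; last first.
  by rewrite normr_gt0 mulf_neq0 // gt_eqF.
apply: le_trans hs _; rewrite ger0_norm; last by rewrite mulr_ge0// ltW.
nra.
Qed.

(** [log_increment] is applied to the quotient of the two characteristic functions, whose logarithm
    is the difference of the exponents. Division by a number of modulus at least [c] turns the
    distance [dl] in each coordinate into the distance [e] from 1. *)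
Lemma log_increment2 (u v u' v' : R -> R) (T dl c e : R) : 0 < c -> 2 * dl <= e * c -> 0 <= e <= 1 / 2 ->
  continuous v -> continuous v' -> v 0 = 0 -> v' 0 = 0 ->
  (forall x, `|x| <= `|T| -> c <= expR (u' x)) ->
  (forall x, `|x| <= `|T| -> `|expR (u x) * cos (v x) - expR (u' x) * cos (v' x)| <= dl) ->
  (forall x, `|x| <= `|T| -> `|expR (u x) * sin (v x) - expR (u' x) * sin (v' x)| <= dl) ->
  `|u T - u' T| <= 5 * e /\ `|v T - v' T| <= 5 * e.
Proof.
move=> c0 dc he cv cv' v0 v'0 hc hcos hsin.
have sub x y z t : `|x| <= dl -> `|y| <= dl -> `|z| <= 1 -> `|t| <= 1 -> `|x * z + y * t| <= 2 * dl :> R.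
  move=> xd yd z1 t1; apply: le_trans (ler_normD _ _) _; rewrite !normrM mulr_natl mulr2n.
  by apply: lerD; rewrite -[leRHS]mulr1; apply: ler_pM.
have quo x y : `|x| <= `|T| -> `|y| <= 2 * dl -> `|y / expR (u' x)| <= e.
  move=> xT yd; rewrite normf_div (gtr0_norm (expR_gt0 _)) ler_pdivrMr ?expR_gt0//.
  apply: le_trans yd _; apply: le_trans dc _; rewrite ler_wpM2l ?hc//.
  by case/andP: he.
apply: (@log_increment (fun x => u x - u' x) (fun x => v x - v' x)) => //.
- by move=> x; apply: cvgB; [exact: cv|exact: cv'].
- by rewrite v0 v'0 subrr.
- move=> x xT; have h := sub _ _ _ _ (hcos x xT) (hsin x xT) (cos_max (v' x)) (sin_max (v' x)).
  rewrite expRD expRN cosB.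
  have -> : expR (u x) / expR (u' x) * (cos (v x) * cos (v' x) + sin (v x) * sin (v' x)) - 1 =
    ((expR (u x) * cos (v x) - expR (u' x) * cos (v' x)) * cos (v' x) +
     (expR (u x) * sin (v x) - expR (u' x) * sin (v' x)) * sin (v' x)) / expR (u' x).
    apply: (mulIf (lt0r_neq0 (expR_gt0 (u' x)))); rewrite divfK ?lt0r_neq0 ?expR_gt0//.
    rewrite mulrBl mul1r mulrAC divfK ?lt0r_neq0 ?expR_gt0//.
    have := cos2Dsin2 (v' x) => CS.
    rewrite [X in _ - X = _](_ : _ = expR (u' x) * (cos (v' x) ^+ 2 + sin (v' x) ^+ 2)); last by rewrite CS mulr1.
    by ring.
  exact: quo.
- move=> x xT; have nsin : `|- cos (v' x)| <= 1 by rewrite normrN cos_max.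
  have h := sub _ _ _ _ (hcos x xT) (hsin x xT) (sin_max (v' x)) nsin.
  rewrite expRD expRN sinB.
  have -> : expR (u x) / expR (u' x) * (sin (v x) * cos (v' x) - cos (v x) * sin (v' x)) =
    - (((expR (u x) * cos (v x) - expR (u' x) * cos (v' x)) * sin (v' x) +
     (expR (u x) * sin (v x) - expR (u' x) * sin (v' x)) * (- cos (v' x))) / expR (u' x)).
    by field; exact: lt0r_neq0 (expR_gt0 _).
  by rewrite normrN; exact: quo.
Qed.

End LogIncrement.

Section CharfunUniform.
Context {dO : measure_display} {Om : measurableType dO} (R : realType) (P : probability Om R).

Lemma measurable_dev (Y Z : Om -> R) (e : R) : measurable_fun setT Y -> measurable_fun setT Z ->
  measurable [set w | e <= `|Y w - Z w|].
Proof.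
move=> mY mZ; rewrite (_ : mkset _ = (fun w => `|Y w - Z w|) @^-1` `[e, +oo[); last first.
  by apply/seteqP; split => x /=; rewrite in_itv /= andbT.
have m : measurable_fun setT (fun w => `|Y w - Z w|) by apply: measurableT_comp => //; exact: measurable_funB.
by rewrite -[X in measurable X]setTI; apply: m.
Qed.

Lemma charfun_uniform (Y : nat -> Om -> R) (Z : Om -> R) (h : R -> R) (T e : R) :
  (forall n, measurable_fun setT (Y n)) -> measurable_fun setT Z -> cvg_in_prob P Y Z ->
  continuous h -> (forall x, `|h x| <= 1) -> (forall x y, `|h x - h y| <= `|x - y|) -> 0 < e ->
  \forall n \near \oo, forall th, `|th| <= T ->
    `|Rintegral P setT (fun w => h (th * Y n w)) - Rintegral P setT (fun w => h (th * Z w))| <= e.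
Proof.
move=> mY mZ YZ ch h1 hl e0.
have [T0|T0] := ltP T 0.
  by apply: nearW => n th thT; have := le_lt_trans thT T0; rewrite ltNge normr_ge0.
(* Where [Y n] and [Z] differ by less than [dl] the integrand is at most [T * dl <= e / 2]; the
   remaining event has probability at most [e / 4] and the integrand is at most 2 there. The [+ 1]
   covers [T = 0]. *)
pose dl := e / (2 * (T + 1)).
have T1 : 0 < T + 1 by lra.
have d0 : 0 < dl by rewrite divr_gt0// mulr_gt0.
have mh : measurable_fun setT h by exact: continuous_measurable_fun.
have h2 := YZ _ d0; have /fine_cvgP[_ h3] := h2.
have e4 : 0 < e / 4 by rewrite divr_gt0.
have /cvgrPdist_le /(_ _ e4) h4 := h3.
apply: filterS h4 => n; rewrite /= sub0r normrN ger0_norm; last exact: fine_ge0.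
move=> hn th thT.
have mhY (X : Om -> R) : measurable_fun setT X -> measurable_fun setT (fun w => h (th * X w)).
  by move=> mX; apply: measurableT_comp mh _; apply: measurable_funM => //; exact: measurable_cst.
have iY (X : Om -> R) : measurable_fun setT X -> P.-integrable setT (EFin \o (fun w => h (th * X w))).
  by move=> mX; apply: (@prob_integrable _ _ _ P _ 1) => [|w]; [exact: mhY|exact: h1].
rewrite -RintegralB//; [|exact: iY|exact: iY].
set A := [set w | dl <= `|Y n w - Z w|].
have mA : measurable A by exact: measurable_dev.
pose g w := e / 2 + 2 * \1_A w.
have ig : P.-integrable setT (EFin \o g).
  apply: (@prob_integrable _ _ _ P _ (e / 2 + 2)) => [|w].
    by apply: measurable_funD; [exact: measurable_cst|apply: measurable_funM; [exact: measurable_cst|exact: measurable_indic]].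
  rewrite /g indicE ger0_norm; last by rewrite addr_ge0 ?divr_ge0 ?(ltW e0).
  by case: (w \in A); rewrite ?mulr1// mulr0; lra.
have eg : Rintegral P setT g = e / 2 + 2 * fine (P A).
  rewrite RintegralD//; last 2 first.
    exact: prob_integrable_cst.
    apply: (@prob_integrable _ _ _ P _ 2) => [|w].
      by apply: measurable_funM; [exact: measurable_cst|exact: measurable_indic].
    by rewrite indicE; case: (w \in A); rewrite ?mulr1 ?mulr0 ?normr0 ?ger0_norm.
  rewrite prob_Rintegral_cst RintegralZl//; last first.
    apply: (@prob_integrable _ _ _ P _ 1) => [|w]; first exact: measurable_indic.
    by rewrite indicE; case: (w \in A); rewrite ?normr0 ?normr1.
  by rewrite /Rintegral integral_indic// setIT.
have step : `|Rintegral P setT (fun w => h (th * Y n w) - h (th * Z w))| <= Rintegral P setT g.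
  have ib : P.-integrable setT (EFin \o (fun w => h (th * Y n w) - h (th * Z w))).
    have := integrableB measurableT (iY _ (mY n)) (iY _ mZ).
    by apply: eq_integrable => // w _; rewrite /= EFinB.
  apply: le_trans (le_normr_Rintegral measurableT ib) _.
  apply: le_Rintegral => //.
    have := integrable_abse ib; apply: eq_integrable => // w _.
  move=> w _; rewrite /g indicE; have [Aw|nAw] := pselect (A w).
    rewrite mem_set// mulr1; apply: le_trans (ler_normB _ _) _.
    have := h1 (th * Y n w); have := h1 (th * Z w); lra.
  rewrite memNset// mulr0 addr0; apply: le_trans (hl _ _) _; rewrite -mulrBr normrM.
  move: nAw => /negP; rewrite -ltNge => nAw.
  apply: (@le_trans _ _ (T * dl)); first by apply: ler_pM => //; exact: ltW.
  rewrite /dl mulrA ler_pdivrMr; last by rewrite mulr_gt0.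
  nra.
apply: le_trans step _; rewrite eg; lra.
Qed.

Lemma cos_lip (x y : R) : `|cos x - cos y| <= `|x - y|.
Proof.
have h := @norm_le_derive R (fun z => cos (z + y)) (fun z => - sin (z + y)) 1 (x - y).
rewrite -[leRHS]mul1r; have <- : cos ((x - y) + y) - cos (0 + y) = cos x - cos y by rewrite subrK add0r.
apply: h => [z|z _]; last by rewrite normrN sin_max.
by apply: is_derive_eq; rewrite /= ?scaler1 ?addr0; ring.
Qed.

Lemma sin_lip (x y : R) : `|sin x - sin y| <= `|x - y|.
Proof.
have h := @norm_le_derive R (fun z => sin (z + y)) (fun z => cos (z + y)) 1 (x - y).
rewrite -[leRHS]mul1r; have <- : sin ((x - y) + y) - sin (0 + y) = sin x - sin y by rewrite subrK add0r.
apply: h => [z|z _]; last by rewrite cos_max.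
by apply: is_derive_eq; rewrite /= ?scaler1 ?addr0; ring.
Qed.

End CharfunUniform.

(** * Gliding hump and Vitali–Hahn–Saks *)

Section Schur.
Context (R : realType).

(** The absolute values sum to twice the sum over the nonnegative terms minus the full sum, so
    convergence over every set of indices gives absolute convergence. *)
Lemma abs_series_tail (x : nat -> R) (S : set nat -> R) (e : R) :
  (forall J, (fun K => \sum_(0 <= j < K) x j * \1_J j) @ \oo --> S J) -> 0 < e ->
  exists a, forall b M, (a <= b)%N -> \sum_(b <= j < M) `|x j| <= e.
Proof.
move=> hS e0; pose J := [set j | 0 <= x j].
pose T K := \sum_(0 <= j < K) `|x j|.
have TE : T @ \oo --> 2 * S J - S setT.
  have h : (fun K => 2 * \sum_(0 <= j < K) x j * \1_J j - \sum_(0 <= j < K) x j * \1_setT j) @ \oo --> 2 * S J - S setT.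
    by apply: cvgB; [apply: cvgM; [exact: cvg_cst|exact: hS]|exact: hS].
  apply: cvg_trans h; apply: near_eq_cvg; apply: nearW => K.
  rewrite mulr_sumr -sumrB; apply: eq_bigr => j _.
  rewrite [\1_setT _]indicE mem_set// mulr1 indicE; have [x0|x0] := leP 0 (x j).
    by rewrite mem_set// mulr1 ger0_norm//; ring.
  by rewrite memNset ?ltr0_norm//=; [ring|apply/negP; rewrite -ltNge].
have Tmono : {homo T : m n / (m <= n)%N >-> m <= n}.
  by move=> m n mn; rewrite /T [leRHS](big_cat_nat (n := m))//= lerDl sumr_ge0.
have Tle K : T K <= 2 * S J - S setT.
  by apply: (cvgr_to_ge TE); near=> n; apply: Tmono; near: n; exact: nbhs_infty_ge.
have /cvgrPdist_le /(_ _ e0) [a _ ha] := TE.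
exists a => b M ab; have [bM|Mb] := leqP b M; last by rewrite big_geq// ?ltW// ltnW.
have : T M = T b + \sum_(b <= j < M) `|x j| by rewrite /T -big_cat_nat.
have /= := ha b ab; rewrite ger0_norm ?subr_ge0// => h1 h2; have := Tle M; lra.
Unshelve. all: by end_near. Qed.

(* Gliding hump: if the tails do not become small, disjoint finite blocks carry almost all
   of the mass of suitable rows, and a union of blocks contradicts the convergence of [S]. *)
Lemma schur0 (y : nat -> nat -> R) (S : nat -> set nat -> R) :
  (forall n J, (fun K => \sum_(0 <= j < K) y n j * \1_J j) @ \oo --> S n J) ->
  (forall J, S ^~ J @ \oo --> (0 : R)) ->
  forall e, 0 < e -> exists N, forall n, (N <= n)%N -> forall K, \sum_(0 <= j < K) `|y n j| <= e.
Proof.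
move=> hS h0 e e0; apply: contrapT => /forallNP hN.
have e8 : 0 < e / 8 by rewrite divr_gt0.
have y0 j : (fun n => y n j) @ \oo --> (0 : R).
  apply: cvg_trans (h0 [set j]); apply: near_eq_cvg; apply: nearW => n.
  have c : (fun K => \sum_(0 <= i < K) y n i * \1_[set j] i) @ \oo --> y n j.
    have : (fun K : nat => y n j) @ \oo --> y n j by exact: cvg_cst.
    apply: cvg_trans; apply: near_eq_cvg; near=> K.
    have jK : (j < K)%N by near: K; exact: nbhs_infty_gt.
    rewrite (bigD1_seq j) ?mem_index_iota ?iota_uniq//= indicE mem_set// mulr1 big1 ?addr0// => i ij.
    by rewrite indicE memNset ?mulr0//= => /eqP; rewrite (negbTE ij).
  by rewrite -(cvg_lim _ c)// -(cvg_lim _ (hS n [set j])).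
(* Given a lower bound for the row and a left end [p.2], a block [q] consists of a row, a right end
   and a set of indices. That row has mass at most [e / 8] before the block and at most [e / 8]
   beyond it, and its sum over the chosen indices in the block has modulus at least [3 * e / 8]. *)
pose Q (p : nat * nat) (q : nat * nat * set nat) :=
  [/\ (p.1 <= q.1.1)%N, (p.2 <= q.1.2)%N, \sum_(0 <= j < p.2) `|y q.1.1 j| <= e / 8,
      3 * (e / 8) <= `|\sum_(p.2 <= j < q.1.2) y q.1.1 j * \1_(q.2) j| &
      forall M, \sum_(q.1.2 <= j < M) `|y q.1.1 j| <= e / 8].
have /choice[f hf] p : exists q, Q p q.
  case: p => k a.
  have small : (fun n => \sum_(0 <= j < a) `|y n j|) @ \oo --> (0 : R).
    have c : (fun n => \sum_(0 <= j < a) `|y n j|) @ \oo --> \sum_(0 <= j < a) (0 : R).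
      apply: cvg_bigsum => j; have c0 : (fun n => `|y n j|) @ \oo --> `|0 : R| by apply: cvg_norm; exact: y0.
      by rewrite normr0 in c0.
    by rewrite big1 in c.
  have /cvgrPdist_le /(_ _ e8) [N1 _ hN1] := small.
  have /existsNP[n /not_implyP[nN /existsNP[K /negP]]] := hN (maxn N1 k).
  rewrite -ltNge => hK; move: nN; rewrite geq_max => /andP[n1 nk].
  have [t ht] := abs_series_tail (hS n) e8.
  pose a' := maxn (maxn a K) t.
  have ale : (a <= a')%N by rewrite /a' !leq_max leqnn.
  have Kle : (K <= a')%N by rewrite /a' !leq_max leqnn orbT.
  have hl : \sum_(0 <= j < a) `|y n j| <= e / 8.
    by have /= := hN1 n n1; rewrite sub0r normrN ger0_norm// sumr_ge0.
  (* The total mass exceeds [e] and the part before [a] is at most [e / 8]. One of the two signs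
     then carries at least half of [6 * e / 8]. *)
  have hm : 6 * (e / 8) <= \sum_(a <= j < a') `|y n j|.
    have hT : \sum_(0 <= j < a') `|y n j| = \sum_(0 <= j < a) `|y n j| + \sum_(a <= j < a') `|y n j|.
      by rewrite -big_cat_nat.
    have hKa : \sum_(0 <= j < K) `|y n j| <= \sum_(0 <= j < a') `|y n j|.
      by rewrite [leRHS](big_cat_nat (n := K))//= lerDl sumr_ge0.
    lra.
  pose G := [set j | 0 < y n j].
  have split_sum : \sum_(a <= j < a') `|y n j| =
      \sum_(a <= j < a') y n j * \1_G j - \sum_(a <= j < a') y n j * \1_(~` G) j.
    rewrite -sumrB; apply: eq_bigr => j _; have [y_gt0|y_le0] := ltP 0 (y n j).
      by rewrite !indicE mem_set// memNset//= ?mulr1 ?mulr0 ?subr0 ?gtr0_norm//; exact.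
    rewrite !indicE memNset ?mem_set//= ?mulr1 ?mulr0 ?sub0r ?ler0_norm//; apply/negP; rewrite -leNgt//.
  have [h|h] := leP (3 * (e / 8)) `|\sum_(a <= j < a') y n j * \1_G j|.
    exists (n, a', G); split => //= M; apply: ht; exact: leq_maxr.
  exists (n, a', ~` G); split => //= [|M]; last by apply: ht; exact: leq_maxr.
  have := ler_norm (\sum_(a <= j < a') y n j * \1_G j).
  have := ler_norm (- \sum_(a <= j < a') y n j * \1_(~` G) j); rewrite normrN.
  lra.
pose a := fix a k := if k is k'.+1 then (f (k', a k')).1.2 else 0%N.
pose nn k := (f (k, a k)).1.1.
pose G k := (f (k, a k)).2.
have hk k : [/\ (k <= nn k)%N, (a k <= a k.+1)%N, \sum_(0 <= j < a k) `|y (nn k) j| <= e / 8,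
    3 * (e / 8) <= `|\sum_(a k <= j < a k.+1) y (nn k) j * \1_(G k) j| &
    forall M, \sum_(a k.+1 <= j < M) `|y (nn k) j| <= e / 8] := hf (k, a k).
have amono : {homo a : m n / (m <= n)%N}.
  by apply: homo_leq => //; [exact: leq_trans|move=> k; have [] := hk k].
pose J := [set j | exists k, (a k <= j < a k.+1)%N /\ G k j].
have JG k j : (a k <= j < a k.+1)%N -> \1_J j = \1_(G k) j :> R.
  move=> jk; rewrite !indicE; congr (_%:R : R); congr nat_of_bool.
  apply/idP/idP => /set_mem.
    move=> [l [jl Gl]]; suff -> : k = l by exact/mem_set.
    move: jk jl => /andP[h1 h2] /andP[h3 h4].
    have [kl'|lk|->//] := ltngtP k l.
      by have := leq_trans h2 (leq_trans (amono _ _ kl') h3); rewrite ltnn.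
    by have := leq_trans h4 (leq_trans (amono _ _ lk) h1); rewrite ltnn.
  by move=> Gk; apply/mem_set; exists k.
have indle (B : set nat) (z : nat -> R) m M : `|\sum_(m <= j < M) z j * \1_B j| <= \sum_(m <= j < M) `|z j|.
  apply: le_trans (ler_norm_sum _ _ _) _; apply: ler_sum => j _.
  by rewrite normrM indicE; case: (j \in B); rewrite ?normr1 ?mulr1// normr0 mulr0.
(* The block contributes [3 * e / 8], from which the indices before and beyond it remove at most
   [e / 8] each. *)
have Sbig k : e / 8 <= `|S (nn k) J|.
  have [_ kk h1 h2 h3] := hk k.
  apply: (cvgr_to_ge (cvg_norm (hS (nn k) J))); near=> M.
  have aM : (a k.+1 <= M)%N by near: M; exact: nbhs_infty_ge.
  rewrite (big_cat_nat (n := a k))//=; last exact: leq_trans kk aM.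
  rewrite [X in _ + X](big_cat_nat (n := a k.+1))//=.
  have -> : \sum_(a k <= j < a k.+1) y (nn k) j * \1_J j = \sum_(a k <= j < a k.+1) y (nn k) j * \1_(G k) j.
    by apply: eq_big_nat => j jk; rewrite (JG k).
  have l1 := le_trans (indle J (y (nn k)) 0%N (a k)) h1.
  have l3 := le_trans (indle J (y (nn k)) (a k.+1) M) (h3 M).
  move: l1 h2 l3; set A := \sum_(0 <= j < _) _; set B := \sum_(_ <= j < _) _; set C := \sum_(_ <= j < _) _ => l1 h2 l3.
  have : `|B| <= `|A + (B + C)| + `|A| + `|C|.
    have {1}-> : B = (A + (B + C)) - A - C by ring.
    by apply: le_trans (ler_normB _ _) _; rewrite lerD2r; exact: ler_normB.
  lra.
have e16 : 0 < e / 16 by rewrite divr_gt0.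
have /cvgrPdist_le /(_ _ e16) [N _ hN'] := h0 J.
have [Nn _ _ _ _] := hk N; have /= := hN' (nn N) Nn; have := Sbig N.
rewrite sub0r normrN; lra.
Unshelve. all: by end_near. Qed.

(** If the rows were not Cauchy in l1, differences of pairs of far rows would contradict [schur0].
    Convergence in l1 bounds the absolute sums of the limit row and identifies its sum with the
    limit of the full sums. *)
Lemma schur (x : nat -> nat -> R) (xl : nat -> R) (S : nat -> set nat -> R) :
  (forall n J, (fun K => \sum_(0 <= j < K) x n j * \1_J j) @ \oo --> S n J) ->
  (forall J, cvg (S ^~ J @ \oo)) ->
  (forall j, (fun n => x n j) @ \oo --> xl j) ->
  (exists C, forall K, \sum_(0 <= j < K) `|xl j| <= C) /\
  forall s : R, S ^~ setT @ \oo --> s -> (fun K => \sum_(0 <= j < K) xl j) @ \oo --> s.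
Proof.
move=> hS cS hx.
have cauchy e : 0 < e -> exists N, forall n m, (N <= n)%N -> (N <= m)%N ->
    forall K, \sum_(0 <= j < K) `|x n j - x m j| <= e.
  move=> e0; apply: contrapT => /forallNP hN.
  have /choice[f hf] k : exists p : nat * nat, [/\ (k <= p.1)%N, (k <= p.2)%N &
      exists K, e < \sum_(0 <= j < K) `|x p.1 j - x p.2 j|].
    have /existsNP[n /existsNP[m /not_implyP[h1 /not_implyP[h2 /existsNP[K /negP]]]]] := hN k.
    by rewrite -ltNge => h3; exists (n, m); split => //; exists K.
  have [||N hN'] := @schur0 (fun k j => x (f k).1 j - x (f k).2 j) (fun k J => S (f k).1 J - S (f k).2 J) _ _ e e0.
  - move=> k J; have h := cvgB (hS (f k).1 J) (hS (f k).2 J).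
    have {}h : (fun K => \sum_(0 <= j < K) x (f k).1 j * \1_J j - \sum_(0 <= j < K) x (f k).2 j * \1_J j) @ \oo
      --> S (f k).1 J - S (f k).2 J by exact: h.
    apply: cvg_trans h; apply: near_eq_cvg; apply: nearW => K.
    by rewrite -sumrB; apply: eq_bigr => j _; rewrite mulrBl.
  - move=> J; have /cvg_ex[/= l hl] := cS J.
    have hl' (g : nat -> nat) : (forall k, (k <= g k)%N) -> (fun k => S (g k) J) @ \oo --> l.
      move=> gk; apply/cvgrPdist_le => d d0; have /cvgrPdist_le /(_ _ d0)[N _ h] := hl.
      by exists N => // k Nk; apply: h => /=; exact: leq_trans (gk k).
    rewrite -(subrr l); apply: cvgB; apply: hl' => k; have [] := hf k => //.
  have [_ _ [K]] := hf N; rewrite ltNge => /negP; apply.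
  exact: hN'.
have lim_le e : 0 < e -> exists N, forall n, (N <= n)%N -> forall K, \sum_(0 <= j < K) `|x n j - xl j| <= e.
  move=> e0; have [N hN] := cauchy e e0; exists N => n Nn K.
  have c : (fun m => \sum_(0 <= j < K) `|x n j - x m j|) @ \oo --> \sum_(0 <= j < K) `|x n j - xl j|.
    by apply: cvg_bigsum => j; apply: cvg_norm; apply: cvgB; [exact: cvg_cst|exact: hx].
  by apply: (cvgr_to_le c); near=> m; apply: hN => //; near: m; exact: nbhs_infty_ge.
split.
  have [N hN] := lim_le 1 ltr01.
  have [a ha] := abs_series_tail (hS N) ltr01.
  exists (1 + (\sum_(0 <= j < a) `|x N j| + 1)) => K.
  have h1 : \sum_(0 <= j < K) `|x N j| <= \sum_(0 <= j < a) `|x N j| + 1.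
    have [aK|Ka] := leqP a K; first by rewrite (big_cat_nat (n := a))//= lerD2l ha.
    rewrite (big_cat_nat (n := K) (p := a))//= ?(ltnW Ka)// -addrA lerDl.
    by rewrite addr_ge0// sumr_ge0.
  apply: le_trans (_ : _ <= \sum_(0 <= j < K) (`|x N j - xl j| + `|x N j|)) _.
    apply: ler_sum => j _; have xlE : xl j = x N j - (x N j - xl j) by ring.
    by rewrite {1}xlE distrC; exact: ler_normB.
  by rewrite big_split; apply: lerD => //; exact: hN.
move=> s hs; apply/cvgrPdist_le => e e0.
have e3 : 0 < e / 3 by rewrite divr_gt0.
have [N1 h1] := lim_le _ e3.
have /cvgrPdist_le /(_ _ e3)[N2 _ h2] := hs.
pose n := maxn N1 N2.
have {}h1 := h1 n (leq_maxl _ _); have /= {}h2 := h2 n (leq_maxr _ _).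
have /cvgrPdist_le /(_ _ e3) := hS n setT; apply: filterS => K h3.
have h4 : `|\sum_(0 <= j < K) x n j * \1_setT j - \sum_(0 <= j < K) xl j| <= e / 3.
  rewrite -sumrB; apply: le_trans (ler_norm_sum _ _ _) _; apply: le_trans (h1 K).
  by apply: ler_sum => j _; rewrite indicE mem_set// mulr1.
have -> : s - \sum_(0 <= j < K) xl j = (s - S n setT) + (S n setT - \sum_(0 <= j < K) x n j * \1_setT j) +
  (\sum_(0 <= j < K) x n j * \1_setT j - \sum_(0 <= j < K) xl j) by ring.
apply: le_trans (ler_normD _ _) _; apply: le_trans (lerD (ler_normD _ _) (lexx _)) _.
lra.
Unshelve. all: by end_near. Qed.

End Schur.

Section VitaliHahnSaks.
Context d (T : measurableType d) (R : realType) (lam : {measure set T -> \bar R}).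

Lemma integrable_mulr_indic (D : set T) (f : T -> R) : measurable D ->
  lam.-integrable setT (EFin \o f) -> lam.-integrable setT (EFin \o (fun s => f s * \1_D s)).
Proof.
move=> mD fi; have fm := measurable_integrable fi.
apply: (integrable_le measurableT _ (integrable_abse fi)).
  by apply: measurable_funM => //; exact: measurable_indic.
by move=> s _ /=; rewrite normrM indicE; case: (s \in D); rewrite ?normr1 ?mulr1// normr0 mulr0.
Qed.

Lemma mulr_indic_patch (D : set T) (f : T -> R) : (fun s => f s * \1_D s) = f \_ D.
Proof.
by apply/funext => s; rewrite patchE indicE; case: (s \in D); rewrite ?mulr1 ?mulr0.
Qed.

Lemma Rintegral_mulr_indic (D : set T) (f : T -> R) :
  Rintegral lam setT (fun s => f s * \1_D s) = Rintegral lam D f.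
Proof. by rewrite mulr_indic_patch [RHS]Rintegral_mkcond. Qed.

Section Disjoint.
Variable D : nat -> set T.
Hypothesis tD : trivIset setT D.

Let sub (J : set nat) := \bigcup_(j in J) D j.

Lemma sum_disjoint_indic (J : set nat) K s :
  \sum_(0 <= j < K) \1_J j * \1_(D j) s = \1_(sub (J `&` `I_K)) s :> R.
Proof.
have [[j0 Ds]|nD] := pselect (exists j, D j s); last first.
  rewrite big1 => [|j _]; last by rewrite [X in _ * X]indicE memNset ?mulr0// => ?; apply: nD; exists j.
  by rewrite indicE memNset// => -[j _ ?]; apply: nD; exists j.
have uniq j : D j s -> j = j0 by move=> Djs; apply: (tD I I); exists s.
have z j : j != j0 -> \1_J j * \1_(D j) s = 0 :> R.
  by move=> jj; rewrite [X in _ * X]indicE memNset ?mulr0// => /uniq /eqP; rewrite (negbTE jj).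
have [jK|Kj] := ltnP j0 K.
  rewrite (bigD1_seq j0) ?mem_index_iota ?iota_uniq//= big1 ?addr0 => [|j jj]; last exact: z.
  rewrite [X in _ * X]indicE mem_set// mulr1 !indicE; congr (_%:R : R); congr nat_of_bool.
  apply/idP/idP => /set_mem; first by move=> Jj; apply/mem_set; exists j0.
  by move=> [j [Jj _] Djs]; apply/mem_set; rewrite -(uniq j Djs).
rewrite big_nat big1 => [|j jK]; last first.
  by apply: z; apply: contraTN jK => /eqP ->; rewrite -leqNgt.
rewrite indicE memNset// => -[j [_ /= jK] /uniq jj].
by move: jK; rewrite jj ltnNge Kj.
Qed.

Hypothesis mD : forall j, measurable (D j).

Let msub J : measurable (sub J). Proof. by apply: bigcup_measurable => j _. Qed.

Lemma Rintegral_disjoint_series (f : T -> R) (J : set nat) : lam.-integrable setT (EFin \o f) ->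
  (fun K => \sum_(0 <= j < K) Rintegral lam setT (fun s => f s * \1_(D j) s) * \1_J j) @ \oo -->
  Rintegral lam setT (fun s => f s * \1_(sub J) s).
Proof.
move=> fi; have mf := measurable_integrable fi.
have fiD j : lam.-integrable setT (EFin \o (fun s => \1_J j * (f s * \1_(D j) s))).
  have := integrableZl measurableT (\1_J j) (integrable_mulr_indic (mD j) fi).
  by apply: eq_integrable => // s _; rewrite /= EFinM.
have e K : \sum_(0 <= j < K) Rintegral lam setT (fun s => f s * \1_(D j) s) * \1_J j =
    Rintegral lam setT (fun s => f s * \1_(sub (J `&` `I_K)) s).
  transitivity (\sum_(0 <= j < K) Rintegral lam setT (fun s => \1_J j * (f s * \1_(D j) s))).
    apply: eq_bigr => j _; rewrite (RintegralZl (\1_J j) measurableT (integrable_mulr_indic (mD j) fi)).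
    by rewrite mulrC.
  rewrite -(Rintegral_sum (index_iota 0 K) measurableT fiD).1; apply: eq_Rintegral => s _.
  rewrite -sum_disjoint_indic mulr_sumr; apply: eq_bigr => j _; ring.
have c : (fun K => Rintegral lam setT (fun s => f s * \1_(sub (J `&` `I_K)) s)) @ \oo -->
    Rintegral lam setT (fun s => f s * \1_(sub J) s).
  apply: (Rintegral_dct measurableT _ _ _ (integrable_abse fi) _).2.
  - by move=> K; apply: measurable_funM => //; exact: measurable_indic.
  - by apply: measurable_funM => //; exact: measurable_indic.
  - apply: aeW => s _; have : (fun K : nat => f s * \1_(sub J) s) @ \oo --> f s * \1_(sub J) s by exact: cvg_cst.
    apply: cvg_trans; apply: near_eq_cvg.
    have [[j Jj Djs]|nJ] := pselect (sub J s).
      near=> K; rewrite !indicE !mem_set//; last by exists j.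
      by exists j => //; split => //=; near: K; exact: nbhs_infty_gt.
    apply: nearW => K; rewrite !indicE !memNset// => -[j [Jj _] Djs]; apply: nJ; by exists j.
  - by move=> K s _ /=; rewrite normrM indicE; case: (s \in _); rewrite ?normr1 ?mulr1// normr0 mulr0.
by under eq_fun do rewrite e.
Unshelve. all: by end_near. Qed.

End Disjoint.

Section Core.
Variables (h : nat -> T -> R) (F : T -> R) (E : nat -> set T).
Hypothesis hi : forall n, lam.-integrable setT (EFin \o h n).
Hypothesis mF : measurable_fun setT F.
Hypothesis hF : forall s, (fun n => h n s) @ \oo --> F s.
Hypothesis mE : forall N, measurable (E N).
Hypothesis lamE : forall N, (lam (E N) < +oo)%E.
Hypothesis coverE : forall s, exists N, E N s.
Hypothesis bndE : forall N, exists M, forall n s, (N <= n)%N -> E N s -> `|h n s| <= M.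
Hypothesis cvgE : forall B, measurable B -> cvg ((fun n => Rintegral lam setT (fun s => h n s * \1_B s)) @ \oo).

Let D := seqDU E.
Let tD : trivIset setT D. Proof. exact: trivIset_seqDU. Qed.
Let DE j : D j `<=` E j. Proof. by move=> s []. Qed.
Let mD j : measurable (D j).
Proof. by apply: measurableD => //; apply: bigsetU_measurable. Qed.
Let UD : \bigcup_j D j = setT.
Proof.
rewrite -seqDU_bigcup_eq; apply/seteqP; split => // s _.
by have [N ?] := coverE s; exists N.
Qed.

Let mh n : measurable_fun setT (h n). Proof. exact: measurable_integrable (hi n). Qed.

Let F_bnd N : exists M, forall s, E N s -> `|F s| <= M.
Proof.
have [M hM] := bndE N; exists M => s Es.
have c : (fun n => `|h n s|) @ \oo --> `|F s| by apply: cvg_norm; exact: @hF s.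
apply: (cvgr_to_le c); near=> n; apply: hM => //.
by near: n; exact: nbhs_infty_ge.
Unshelve. all: by end_near. Qed.

Let iFD j : lam.-integrable (D j) (EFin \o F).
Proof.
have [M hM] := F_bnd j; apply: (@bounded_integrable _ _ _ _ _ _ M) => //.
- apply: le_lt_trans (lamE j); apply: le_measure; rewrite ?inE//; exact: DE.
- exact: measurable_funTS.
- by move=> s /DE /hM.
Qed.

Let cvg_piece j : (fun n => Rintegral lam setT (fun s => h n s * \1_(D j) s)) @ \oo --> Rintegral lam (D j) F.
Proof.
rewrite (_ : (fun n => _) = (fun n => Rintegral lam (D j) (h n))); last first.
  by apply/funext => n; rewrite Rintegral_mulr_indic.
have [M hM] := bndE j.
rewrite -(cvg_shiftn j (fun n => Rintegral lam (D j) (h n))).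
apply: (Rintegral_dct (mD j) _ _ _ (g := fun=> M) _ _).2.
- by move=> n; apply: measurable_funTS.
- exact: measurable_funTS.
- apply: aeW => s _; have := @hF s; rewrite -(cvg_shiftn j (fun n => h n s)); exact.
- apply: (@bounded_integrable _ _ _ _ _ _ `|M|) => //.
  apply: le_lt_trans (lamE j); apply: le_measure; rewrite ?inE//; exact: DE.
- by move=> n s Ds; apply: hM; [exact: leq_addl|exact: DE].
Qed.

(** Cut along the disjoint pieces [D j], the integrals form a matrix whose row sums over every set
    of pieces converge, while each column converges by dominated convergence. [schur] bounds the sum
    of the integrals of [F] over the pieces, which for [F >= 0] is integrability. *)
Lemma vitali_hahn_saks_ge0 : (forall s, 0 <= F s) ->
  lam.-integrable setT (EFin \o F) /\
  (fun n => Rintegral lam setT (h n)) @ \oo --> Rintegral lam setT F.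
Proof.
move=> F0.
have [|J|j|[C hC] hs] := @schur R (fun n j => Rintegral lam setT (fun s => h n s * \1_(D j) s))
  (fun j => Rintegral lam (D j) F)
  (fun n J => Rintegral lam setT (fun s => h n s * \1_(\bigcup_(j in J) D j) s)).
- by move=> n J; exact: Rintegral_disjoint_series.
- by apply: cvgE; exact: bigcup_measurable.
- exact: cvg_piece.
have iF : lam.-integrable setT (EFin \o F).
  apply/integrableP; split; first exact/measurable_EFinP.
  rewrite (eq_integral (fun s => (F s)%:E)); last by move=> s _ /=; rewrite ger0_norm.
  rewrite -[X in integral lam X]UD ge0_integral_bigcup//; last 2 first.
    by apply: measurable_funTS; exact/measurable_EFinP.
    by move=> s _; rewrite lee_fin.
  apply: (@le_lt_trans _ _ C%:E); last exact: ltry.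
  apply: lime_le.
    by apply: is_cvg_nneseries => j _ _; apply: integral_ge0 => s _; rewrite lee_fin.
  apply: nearW => K; rewrite (eq_bigr (fun j => (Rintegral lam (D j) F)%:E)) => [|j _]; last first.
    by rewrite -EFin_Rintegral.
  rewrite sumEFin lee_fin; apply: le_trans (hC K); apply: ler_sum => j _; exact: ler_norm.
split => //.
have cT := cvgE measurableT.
have hT (f : T -> R) : (fun s => f s * \1_(\bigcup_(j in setT) D j) s) = f.
  by apply/funext => s; rewrite UD indicE mem_set// mulr1.
have /cvg_ex[/= l hl] := cT.
have hl' : (fun n => Rintegral lam setT (h n)) @ \oo --> l.
  apply: cvg_trans hl; apply: near_eq_cvg; apply: nearW => n.
  by apply: eq_Rintegral => s _; rewrite indicE mem_set// mulr1.
have c1 := hs l.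
have {}c1 : (fun K => \sum_(0 <= j < K) Rintegral lam (D j) F) @ \oo --> l.
  apply: c1; apply: cvg_trans hl'; apply: near_eq_cvg; apply: nearW => n; by rewrite hT.
have c2 := @Rintegral_disjoint_series D tD mD F setT iF; rewrite hT in c2.
have {}c2 : (fun K => \sum_(0 <= j < K) Rintegral lam (D j) F) @ \oo --> Rintegral lam setT F.
  apply: cvg_trans c2; apply: near_eq_cvg; apply: nearW => K; apply: eq_bigr => j _.
  by rewrite indicE mem_set// mulr1 Rintegral_mulr_indic.
by rewrite -(cvg_lim _ c2)// (cvg_lim _ c1).
Qed.

End Core.

(** The space is cut by the sign of the limit [F], not of [h n]: the cut does not depend on [n], so
    both pieces inherit the convergence over all measurable sets. *)
Lemma vitali_hahn_saks (h : nat -> T -> R) (F : T -> R) (E : nat -> set T) :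
  (forall n, lam.-integrable setT (EFin \o h n)) ->
  measurable_fun setT F ->
  (forall s, (fun n => h n s) @ \oo --> F s) ->
  (forall N, measurable (E N)) ->
  (forall N, (lam (E N) < +oo)%E) ->
  (forall s, exists N, E N s) ->
  (forall N, exists M, forall n s, (N <= n)%N -> E N s -> `|h n s| <= M) ->
  (forall B, measurable B -> cvg ((fun n => Rintegral lam setT (fun s => h n s * \1_B s)) @ \oo)) ->
  lam.-integrable setT (EFin \o F) /\
  (fun n => Rintegral lam setT (h n)) @ \oo --> Rintegral lam setT F.
Proof.
move=> hi mF hF mE lamE coverE bndE cvgE.
have mpos : measurable [set s | 0 <= F s].
  rewrite (_ : mkset _ = F @^-1` `[0, +oo[).
    by rewrite -[X in measurable X]setTI; apply: mF.
  by apply/seteqP; split => s /=; rewrite in_itv /= andbT.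
have key (c : R) (Q : set T) : `|c| <= 1 -> measurable Q -> (forall s, Q s -> 0 <= c * F s) ->
    lam.-integrable setT (EFin \o (fun s => c * (F s * \1_Q s))) /\
    (fun n => Rintegral lam setT (fun s => c * (h n s * \1_Q s))) @ \oo -->
    Rintegral lam setT (fun s => c * (F s * \1_Q s)).
  move=> c1 mQ QF.
  have i1 n : lam.-integrable setT (EFin \o (fun s => c * (h n s * \1_Q s))).
    have := integrableZl measurableT c (integrable_mulr_indic mQ (hi n)).
    by apply: eq_integrable => // s _; rewrite /= EFinM.
  apply: (@vitali_hahn_saks_ge0 (fun n s => c * (h n s * \1_Q s)) (fun s => c * (F s * \1_Q s)) E _ _ _ mE lamE coverE).
  - exact: i1.
  - apply: measurable_funM; first exact: measurable_cst.
    by apply: measurable_funM => //; exact: measurable_indic.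
  - by move=> s; apply: cvgM; [exact: cvg_cst|apply: cvgM => //; exact: cvg_cst].
  - move=> N; have [M hM] := bndE N; exists M => n s Nn Es.
    apply: le_trans (hM n s Nn Es); rewrite normrM indicE.
    apply: le_trans (_ : 1 * `|h n s * (s \in Q)%:R| <= _); first exact: ler_wpM2r.
    by rewrite mul1r normrM; case: (s \in Q); rewrite ?normr1 ?mulr1// normr0 mulr0.
  - move=> B mB.
    have cB := cvgE _ (measurableI _ _ mQ mB).
    have {}cB : cvg ((fun n => c * Rintegral lam setT (fun s => h n s * \1_(Q `&` B) s)) @ \oo).
      by apply: is_cvgM => //; exact: is_cvg_cst.
    rewrite (_ : (fun n => _) = (fun n => c * Rintegral lam setT (fun s => h n s * \1_(Q `&` B) s)))//.
    apply/funext => n.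
    rewrite -(RintegralZl c measurableT (integrable_mulr_indic (measurableI _ _ mQ mB) (hi n))).
    by apply: eq_Rintegral => s _; rewrite indicI /= !mulrA.
  - move=> s; rewrite indicE; have [Qs|nQ] := pselect (Q s); first by rewrite mem_set// mulr1 QF.
    by rewrite memNset// !mulr0.
have [||s Fs|i1 c1] := key 1 [set s | 0 <= F s] => //.
  by rewrite normr1.
  by rewrite mul1r.
have [||s Fs|i2 c2] := key (-1) (~` [set s | 0 <= F s]) => //.
  by rewrite normrN1.
  exact: measurableC.
  by rewrite mulN1r oppr_ge0 ltW// ltNge; apply/negP.
pose Q := [set s | 0 <= F s].
have dec (f : T -> R) : f = (fun s => 1 * (f s * \1_Q s) - (-1) * (f s * \1_(~` Q) s)).
  apply/funext => s; rewrite !indicE; have [Qs|nQ] := pselect (Q s).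
    by rewrite mem_set// memNset//= ?mulr0 ?subr0 ?mulr1 ?mul1r//; exact.
  by rewrite memNset// mem_set//= mulr0 mulr1 mulr0 mulN1r opprK add0r.
split.
  have := integrableB measurableT i1 i2; apply: eq_integrable => // s _.
  by rewrite /= -EFinB; congr EFin; exact: (esym (congr1 (fun f => f s) (dec F))).
have iB (f : T -> R) : lam.-integrable setT (EFin \o (fun s => 1 * (f s * \1_Q s))) ->
   lam.-integrable setT (EFin \o (fun s => -1 * (f s * \1_(~` Q) s))) ->
   Rintegral lam setT f = Rintegral lam setT (fun s => 1 * (f s * \1_Q s)) - Rintegral lam setT (fun s => (-1) * (f s * \1_(~` Q) s)).
  by move=> j1 j2; rewrite -RintegralB//; apply: eq_Rintegral => s _; rewrite {1}(dec f).
rewrite [X in _ --> X](iB F)//.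
have c : (fun n => Rintegral lam setT (fun s => 1 * (h n s * \1_Q s)) - Rintegral lam setT (fun s => (-1) * (h n s * \1_(~` Q) s)))
  @ \oo --> Rintegral lam setT (fun s => 1 * (F s * \1_Q s)) - Rintegral lam setT (fun s => (-1) * (F s * \1_(~` Q) s)).
  exact: cvgB.
apply: cvg_trans c; apply: near_eq_cvg; apply: nearW => n; rewrite [RHS]iB//.
  have := integrableZl measurableT 1 (integrable_mulr_indic mpos (hi n)).
  by apply: eq_integrable => // s _; rewrite /= EFinM.
have := integrableZl measurableT (-1) (integrable_mulr_indic (measurableC mpos) (hi n)).
by apply: eq_integrable => // s _; rewrite /= EFinM.
Qed.

End VitaliHahnSaks.

(** * Stochastic integrals *)

Section CvgInProb.
Context {dO : measure_display} {Om : measurableType dO} (R : realType) (P : probability Om R).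

Lemma cvg_in_prob_lin (c : R) (Y Y' : nat -> Om -> R) (Z Z' : Om -> R) :
  (forall n, measurable_fun setT (Y n)) -> (forall n, measurable_fun setT (Y' n)) ->
  measurable_fun setT Z -> measurable_fun setT Z' ->
  cvg_in_prob P Y Z -> cvg_in_prob P Y' Z' ->
  cvg_in_prob P (fun n w => c * Y n w + Y' n w) (fun w => c * Z w + Z' w).
Proof.
move=> mY mY' mZ mZ' YZ YZ' e e0.
have c1 : 0 < `|c| + 1 by rewrite ltr_wpDl.
pose d := e / 2 / (`|c| + 1).
have e2 : 0 < e / 2 by rewrite divr_gt0.
have d0 : 0 < d by rewrite divr_gt0.
have lin (X X' : Om -> R) : measurable_fun setT X -> measurable_fun setT X' -> measurable_fun setT (fun w => c * X w + X' w).
  by move=> mX mX'; apply: measurable_funD => //; apply: measurable_funM => //; exact: measurable_cst.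
have lim0 : (fun n => P [set w | (d <= `|Y n w - Z w|)%R] + P [set w | (e / 2 <= `|Y' n w - Z' w|)%R])%E @ \oo --> 0%E.
  by rewrite -[X in _ --> X]adde0; apply: cvgeD => //; [exact: YZ|exact: YZ'].
have lim00 : (fun n : nat => 0%E : \bar R) @ \oo --> 0%E by exact: cvg_cst.
apply: (squeeze_cvge _ lim00 lim0); apply: nearW => n; rewrite measure_ge0 /=.
have m1' := measurable_dev d (mY n) mZ.
have m2' := measurable_dev (e / 2) (mY' n) mZ'.
apply: le_trans (_ : _ <= P ([set w | (d <= `|Y n w - Z w|)%R] `|` [set w | (e / 2 <= `|Y' n w - Z' w|)%R]))%E _; last first.
  exact: measureU2.
apply: le_measure; rewrite ?inE.
- by apply: measurable_dev; exact: lin.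
- exact: measurableU.
move=> w /= hw; apply: contrapT => /not_orP[/negP + /negP]; rewrite -!ltNge => h1 h2.
move: hw; apply/negP; rewrite -ltNge.
have -> : c * Y n w + Y' n w - (c * Z w + Z' w) = c * (Y n w - Z w) + (Y' n w - Z' w) by ring.
apply: le_lt_trans (ler_normD _ _) _; rewrite normrM.
have h3 : `|c| * `|Y n w - Z w| <= e / 2.
  apply: (@le_trans _ _ ((`|c| + 1) * d)).
    by apply: ler_pM => //; [rewrite lerDl|exact: ltW].
  by rewrite /d mulrC divfK// gt_eqF.
lra.
Qed.

End CvgInProb.

Section StochIntegral.
Context (R : realType) (d : nat) (lam : {measure set (d.-tuple R) -> \bar R}).
Hypothesis hlam : is_lebesgue_measure lam.
Context {dO : measure_display} {Om : measurableType dO} (P : probability Om R).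
Context (L : set (d.-tuple R) -> Om -> R) (gam b : R) (rho : {measure set R -> \bar R}).
Hypothesis hL : homogeneous_levy_basis P lam L gam b rho.
Let pr := lk_re b rho.
Let pi := lk_im gam rho.
Let hrho : levy_measure rho := levy_basis_measure hL.

(** The representations are concatenated rather than reduced to a common refinement, so the
    linearity of [sr_fun] and of [sr_int] is the splitting of one finite sum. *)
Definition sr_cat (c : R) (s t : simple_rep R d) : simple_rep R d :=
  @SimpleRep R d (sr_n s + sr_n t)
    (fun i => match fintype.split i with inl j => c * sr_a j | inr j => sr_a j end)
    (fun i => match fintype.split i with inl j => sr_A j | inr j => sr_A j end).

Lemma sr_cat_sum (V : nmodType) c s t (F : R -> set (d.-tuple R) -> V) :
  \sum_(i < sr_n (sr_cat c s t)) F (@sr_a _ _ (sr_cat c s t) i) (@sr_A _ _ (sr_cat c s t) i) =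
  \sum_(i < sr_n s) F (c * @sr_a _ _ s i) (@sr_A _ _ s i) + \sum_(i < sr_n t) F (@sr_a _ _ t i) (@sr_A _ _ t i).
Proof.
rewrite big_split_ord /=; congr (_ + _); apply: eq_bigr => i _.
  by rewrite -[lshift _ _]/(unsplit (inl i)) unsplitK.
by rewrite -[rshift _ _]/(unsplit (inr i)) unsplitK.
Qed.

Lemma sr_fun_cat c s t x : sr_fun (sr_cat c s t) x = c * sr_fun s x + sr_fun t x.
Proof.
rewrite /sr_fun (sr_cat_sum c s t (fun a A => a * \1_A x)) mulr_sumr; congr (_ + _).
by apply: eq_bigr => i _; rewrite mulrA.
Qed.

Lemma sr_int_cat c s t B w : sr_int L (sr_cat c s t) B w = c * sr_int L s B w + sr_int L t B w.
Proof.
rewrite /sr_int (sr_cat_sum c s t (fun a A => a * L (B `&` A) w)) mulr_sumr; congr (_ + _).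
by apply: eq_bigr => i _; rewrite mulrA.
Qed.

Definition sr_bounded (s : simple_rep R d) := forall i, bounded_borel (@sr_A _ _ s i).

Lemma bounded_borelI (B A : set (d.-tuple R)) : measurable B -> bounded_borel A -> bounded_borel (B `&` A).
Proof.
move=> mB bA; apply: (bounded_borel_sub bA); last exact: subIsetr.
by apply: measurableI => //; exact: bA.1.
Qed.

Lemma measurable_sr_int s B : measurable B -> sr_bounded s -> measurable_fun setT (sr_int L s B).
Proof.
move=> mB bs; apply: measurable_sum => i; apply: measurable_funM; first exact: measurable_cst.
by have [_ mL _ _ _] := hL; apply: mL; exact: bounded_borelI.
Qed.

Lemma stoch_integral_lin (c : R) f Y f' Y' : measurable_fun setT Y -> measurable_fun setT Y' ->
  is_stoch_integral P lam L f Y -> is_stoch_integral P lam L f' Y' ->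
  is_stoch_integral P lam L (fun s => c * f s + f' s) (fun w => c * Y w + Y' w).
Proof.
move=> mY mY' [s [bs fs Bs Ys]] [t [bt ft Bt Yt]].
have msr B n : measurable B -> measurable_fun setT (sr_int L (s n) B).
  by move=> mB; apply: measurable_sr_int => // i; exact: bs.
have mtr B n : measurable B -> measurable_fun setT (sr_int L (t n) B).
  by move=> mB; apply: measurable_sr_int => // i; exact: bt.
have e B : (fun n => sr_int L (sr_cat c (s n) (t n)) B) = (fun n w => c * sr_int L (s n) B w + sr_int L (t n) B w).
  by apply/funext => n; apply/funext => w; rewrite sr_int_cat.
exists (fun n => sr_cat c (s n) (t n)); split.
- by move=> n i /=; case: (fintype.split i) => j; [exact: bs|exact: bt].
- apply: filterS2 fs ft => x fx ftx; under eq_fun do rewrite sr_fun_cat.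
  by apply: cvgD => //; apply: cvgM => //; exact: cvg_cst.
- move=> B mB; have [Z [mZ cZ]] := Bs B mB; have [Z' [mZ' cZ']] := Bt B mB.
  exists (fun w => c * Z w + Z' w); split.
    by apply: measurable_funD => //; apply: measurable_funM => //; exact: measurable_cst.
  by rewrite e; apply: cvg_in_prob_lin => // n; [exact: msr|exact: mtr].
- by rewrite e; apply: cvg_in_prob_lin => // n; [exact: msr|exact: mtr].
Qed.

Lemma stoch_integral0 : is_stoch_integral P lam L (fun=> 0) (fun=> 0).
Proof.
exists (fun=> @SimpleRep R d 0 (fun=> 0) (fun=> set0)).
have z : cvg_in_prob P (fun n : nat => sr_int L (@SimpleRep R d 0 (fun=> 0) (fun=> set0)) setT) (fun=> 0).
  move=> e e0; apply: cvg_near_cst; apply: nearW => n.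
  rewrite (_ : mkset _ = set0) ?measure0//; apply/seteqP; split => // w /=.
  by rewrite /sr_int big_ord0 subr0 normr0 leNgt e0.
split => //.
- by move=> n [].
- by apply: aeW => x; apply: cvg_near_cst; apply: nearW => n; rewrite /sr_fun big_ord0.
- move=> B mB; exists (fun=> 0); split; first exact: measurable_cst.
  move=> e e0; apply: cvg_near_cst; apply: nearW => n.
  rewrite (_ : mkset _ = set0) ?measure0//; apply/seteqP; split => // w /=.
  by rewrite /sr_int big_ord0 subr0 normr0 leNgt e0.
Qed.

Lemma stoch_integral_sum (I : Type) (r : seq I) (c : I -> R) (f : I -> d.-tuple R -> R) (Y : I -> Om -> R) :
  (forall i, measurable_fun setT (Y i)) -> (forall i, is_stoch_integral P lam L (f i) (Y i)) ->
  is_stoch_integral P lam L (fun s => \sum_(i <- r) c i * f i s) (fun w => \sum_(i <- r) c i * Y i w).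
Proof.
move=> mY fY; elim: r => [|i r IH].
  rewrite (_ : (fun s => _) = fun=> 0); last by apply/funext => s; rewrite big_nil.
  rewrite [X in is_stoch_integral _ _ _ _ X](_ : _ = fun=> 0); last by apply/funext => s; rewrite big_nil.
  exact: stoch_integral0.
rewrite (_ : (fun s => _) = fun s => c i * f i s + \sum_(j <- r) c j * f j s); last first.
  by apply/funext => s; rewrite big_cons.
rewrite [X in is_stoch_integral _ _ _ _ X](_ : _ = fun w => c i * Y i w + \sum_(j <- r) c j * Y j w); last first.
  by apply/funext => s; rewrite big_cons.
apply: stoch_integral_lin => //.
by apply: measurable_sum => j; apply: measurable_funM => //; exact: measurable_cst.
Qed.

Section Simple.
Context (s : simple_rep R d) (B : set (d.-tuple R)).
Hypothesis bs : sr_bounded s.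
Hypothesis mB : measurable B.

Let sE th x : th * (sr_fun s x * \1_B x) = \sum_(i < sr_n s) (th * sr_a i) * \1_(B `&` @sr_A _ _ s i) x.
Proof.
rewrite /sr_fun mulr_suml mulr_sumr; apply: eq_bigr => i _.
by rewrite indicI /= ; ring.
Qed.

Let bBA i : bounded_borel (B `&` @sr_A _ _ s i). Proof. by apply: bounded_borelI. Qed.

Definition sr_exp (g : R -> R) (th : R) := Rintegral lam setT (fun x => g (th * (sr_fun s x * \1_B x))).

Lemma integrable_sr (g : R -> R) th : g 0 = 0 ->
  lam.-integrable setT (EFin \o (fun x => g (th * (sr_fun s x * \1_B x)))).
Proof.
move=> g0; under eq_fun do rewrite sE.
exact: (integrable_simple hlam (fun i => th * sr_a i) bBA).
Qed.

Lemma sr_exp_finite : exists (I : finType) (wt x : I -> R), (forall i, 0 <= wt i) /\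
  forall g : R -> R, g 0 = 0 -> forall th, sr_exp g th = \sum_i wt i * g (th * x i).
Proof.
have [I [wt [x [wt0 h]]]] := simple_finite hlam (fun i => @sr_a _ _ s i) bBA.
exists I, wt, x; split=> // g g0 th.
rewrite -(h (fun y => g (th * y))) ?mulr0//; apply: eq_Rintegral => y _.
by rewrite -[in RHS](mul1r (\sum_(i < _) _)) mulr_sumr; congr g; rewrite sE mulr_sumr; apply: eq_bigr => i _; ring.
Qed.

Lemma continuous_sr_exp (g : R -> R) : g 0 = 0 -> continuous g -> continuous (sr_exp g).
Proof.
have [I [wt [x [_ h]]]] := sr_exp_finite => g0 cg th.
rewrite (_ : sr_exp g = fun th => \sum_i wt i * g (th * x i)); last by apply/funext => t; exact: h.
apply: cvg_bigsum => i; apply: cvgM; first exact: cvg_cst.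
apply: (cvg_comp (fun t : R => t * x i) g _ (cg _)).
by apply: cvgM; [exact: cvg_id|exact: cvg_cst].
Qed.

Lemma sr_exp0 (g : R -> R) : g 0 = 0 -> sr_exp g 0 = 0.
Proof.
have [I [wt [x [_ h]]]] := sr_exp_finite => g0.
by rewrite h// big1// => i _; rewrite mul0r g0 mulr0.
Qed.

Lemma sr_exp_double th : 4 * sr_exp pr th <= sr_exp pr (2 * th).
Proof.
have [I [wt [x [wt0 h]]]] := sr_exp_finite; have p0 := lk_re0 b rho.
rewrite !h// mulr_sumr; apply: ler_sum => i _; rewrite mulrCA ler_wpM2l// -mulrA.
exact: lk_re_double.
Qed.

Lemma charfun_sr th :
  Rintegral P setT (fun w => cos (th * sr_int L s B w)) = expR (sr_exp pr th) * cos (sr_exp pi th) /\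
  Rintegral P setT (fun w => sin (th * sr_int L s B w)) = expR (sr_exp pr th) * sin (sr_exp pi th).
Proof.
have := charfun_simple hlam hL (fun i => th * sr_a i) bBA.
have e1 g : Rintegral lam setT (fun x => g (\sum_(i < sr_n s) th * sr_a i * \1_(B `&` @sr_A _ _ s i) x)) = sr_exp g th.
  by apply: eq_Rintegral => x _; rewrite sE.
have e2 (h : R -> R) : Rintegral P setT (fun w => h (\sum_(i < sr_n s) th * sr_a i * L (B `&` @sr_A _ _ s i) w)) =
    Rintegral P setT (fun w => h (th * sr_int L s B w)).
  by apply: eq_Rintegral => w _; rewrite /sr_int mulr_sumr; congr h; apply: eq_bigr => i _; rewrite mulrA.
by rewrite !e1 !e2 /cexp /= => -[-> ->].
Qed.

End Simple.

Lemma charfun_near1 (Z : Om -> R) : measurable_fun setT Z ->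
  exists2 dl : R, 0 < dl & forall th, `|th| <= dl -> 3 / 4 <= Rintegral P setT (fun w => cos (th * Z w)).
Proof.
move=> mZ.
have c : Rintegral P setT (fun w => cos (th * Z w)) @[th --> (0 : R)] --> (1 : R).
  apply: cvg_seq_nbhs => u u0.
  have -> : (1 : R) = Rintegral P setT (fun w => cos (0 * Z w)).
    by under eq_Rintegral do rewrite mul0r cos0; rewrite prob_Rintegral_cst.
  apply: (Rintegral_dct measurableT _ _ _ (prob_integrable_cst P 1) _).2.
  - by move=> n; apply: measurable_cos_comp; apply: measurable_funM => //; exact: measurable_cst.
  - by apply: measurable_cos_comp; apply: measurable_funM => //; exact: measurable_cst.
  - apply: aeW => w _; have c : (fun n => u n * Z w) @ \oo --> 0 * Z w by apply: cvgM => //; exact: cvg_cst.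
    exact: (cvg_comp _ _ c (@continuous_cos R _)).
  - by move=> n w _; exact: cos_max.
have q4 : 0 < 1 / 4 :> R by lra.
have /cvgrPdist_le /(_ _ q4) := c.
rewrite near_nbhs => /nbhs_ballP[dl /= dl0 h]; exists (dl / 2); first by rewrite divr_gt0.
move=> th thd; have := h th; rewrite /ball /= sub0r normrN.
have thl : `|th| < dl by lra.
move=> /(_ thl); rewrite ler_norml => /andP[_]; lra.
Qed.

Section Cauchy.
Context (s : nat -> simple_rep R d) (B : set (d.-tuple R)) (Z : Om -> R).
Hypothesis bs : forall n, sr_bounded (s n).
Hypothesis mB : measurable B.
Hypothesis mZ : measurable_fun setT Z.
Hypothesis cZ : cvg_in_prob P (fun n => sr_int L (s n) B) Z.

Let u n := sr_exp (s n) B pr.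
Let v n := sr_exp (s n) B pi.

(** Near 0 the limit has real part at least 3/4, so eventually the n-th characteristic function has
    modulus at least 1/2 there, that is [u n >= - l]. By [sr_exp_double] each doubling of the range
    multiplies this bound by 4. *)
Let lower (T : R) : exists2 c : R, 0 < c & \forall n \near \oo, forall th, `|th| <= T -> c <= expR (u n th).
Proof.
have [dl dl0 hdl] := charfun_near1 mZ.
have q4 : 0 < 1 / 4 :> R by lra.
have unif := charfun_uniform dl (fun n => measurable_sr_int mB (@bs n)) mZ cZ
  (@continuous_cos R) (@cos_norm_le1 R) (@cos_lip R) q4.
pose l : R := - ln (1 / 2).
have hl : expR (- l) = 1 / 2 by rewrite /l opprK lnK// posrE; lra.
have step (n : nat) : (forall th, `|th| <= dl -> - l <= u n th) ->
    forall k th, `|th| <= 2 ^+ k * dl -> - (4 ^+ k * l) <= u n th.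
  move=> h0; elim=> [|k IH] th; first by rewrite !expr0 !mul1r; exact: h0.
  move=> hth; have h2 : `|th / 2| <= 2 ^+ k * dl.
    by rewrite normf_div [`|2|]ger0_norm// ler_pdivrMr// mulrAC -exprSr.
  have := IH _ h2; have := sr_exp_double (@bs n) mB (th / 2); rewrite -/(u n).
  have -> : 2 * (th / 2) = th by rewrite mulrC divfK.
  move=> h3 h4.
  by apply: le_trans h3; rewrite exprS -mulrA -mulrN ler_wpM2l.
have [k hk] : exists k, T <= 2 ^+ k * dl.
  exists (Num.trunc (T / dl)).+1; rewrite -ler_pdivrMr//.
  apply: le_trans (ltW (Num.Theory.truncnS_gt _)) _.
  by rewrite -natrX ler_nat ltnW// ltn_expl.
exists (expR (- (4 ^+ k * l))); first exact: expR_gt0.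
apply: filterS unif => n hn th thT; rewrite ler_expR; apply: (step n _ k th (le_trans thT hk)) => y yd.
rewrite -ler_expR hl; have := hn y yd; have := hdl y yd.
rewrite (charfun_sr (@bs n) mB y).1 ler_norml => h1 /andP[h2 _].
apply: (@le_trans _ _ (expR (u n y) * cos (v n y))).
  have -> : 1 / 2 = 3 / 4 - 1 / 4 :> R by lra.
  rewrite /u /v; lra.
by rewrite ler_piMr ?expR_ge0// cos_le1.
Qed.

(** Two approximants are compared with each other, as both have continuous exponents vanishing at 0;
    the limit [Z] has no exponent yet and enters through its characteristic function alone. *)
Lemma sr_exp_cauchy (T e : R) : 0 < e -> exists N, forall n m, (N <= n)%N -> (N <= m)%N -> forall th, `|th| <= T ->
  `|u n th - u m th| <= e /\ `|v n th - v m th| <= e.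
Proof.
move=> e0; have [c c0 hc] := lower T.
(* [log_increment2] asks for an error of at most 1/2 and returns five times that error. *)
pose e1 := Num.min (e / 5) (1 / 2).
have e10 : 0 < e1 by rewrite lt_min divr_gt0//=; lra.
have e1e : 5 * e1 <= e by rewrite mulrC -ler_pdivlMr// ge_min lexx.
have e1h : e1 <= 1 / 2 by rewrite ge_min lexx orbT.
(* Approximants within [dl] of the limit are within [2 * dl] of each other, and twice this distance
   has to be at most [e1 * c]. *)
pose dl := e1 * c / 4; have dl0 : 0 < dl by rewrite divr_gt0// mulr_gt0.
have uc := charfun_uniform T (fun n => measurable_sr_int mB (@bs n)) mZ cZ
  (@continuous_cos R) (@cos_norm_le1 R) (@cos_lip R) dl0.
have us := charfun_uniform T (fun n => measurable_sr_int mB (@bs n)) mZ cZ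
  (@continuous_sin R) (@sin_norm_le1 R) (@sin_lip R) dl0.
have [N _ hN] : \forall n \near \oo, (forall th, `|th| <= T -> c <= expR (u n th)) /\
   (forall th, `|th| <= T -> `|expR (u n th) * cos (v n th) - Rintegral P setT (fun w => cos (th * Z w))| <= dl) /\
   (forall th, `|th| <= T -> `|expR (u n th) * sin (v n th) - Rintegral P setT (fun w => sin (th * Z w))| <= dl).
  apply: filterS3 hc uc us => n h1 h2 h3; split=> //; split=> th thT.
    by have := h2 th thT; rewrite (charfun_sr (@bs n) mB th).1.
  by have := h3 th thT; rewrite (charfun_sr (@bs n) mB th).2.
exists N => n m Nn Nm th thT.
have [_ [cn sn]] := hN n Nn; have [lm [cm sm]] := hN m Nm.
have hT x : `|x| <= `|th| -> `|x| <= T by move=> h; exact: le_trans thT.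
have tri (x y z : R) : `|x - z| <= dl -> `|y - z| <= dl -> `|x - y| <= 2 * dl.
  move=> h1 h2; have -> : x - y = (x - z) - (y - z) by ring.
  by apply: le_trans (ler_normB _ _) _; rewrite mulr_natl mulr2n; exact: lerD.
have p0 := lk_re0 b rho; have i0 := lk_im0 gam rho.
have [h1 h2] : `|u n th - u m th| <= 5 * e1 /\ `|v n th - v m th| <= 5 * e1.
  apply: (@log_increment2 R (u n) (v n) (u m) (v m) th (2 * dl) c e1) => //.
  - by rewrite /dl; lra.
  - by rewrite (ltW e10).
  - apply: continuous_sr_exp => //; exact: continuous_lk_im.
  - apply: continuous_sr_exp => //; exact: continuous_lk_im.
  - exact: sr_exp0.
  - exact: sr_exp0.
  - by move=> x /hT; exact: lm.
  - by move=> x /hT xT; apply: tri (cn x xT) (cm x xT).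
  - by move=> x /hT xT; apply: tri (sn x xT) (sm x xT).
by split; [exact: (le_trans h1 e1e)|exact: (le_trans h2 e1e)].
Qed.

Lemma sr_exp_cvg th : cvg ((fun n => u n th) @ \oo) /\ cvg ((fun n => v n th) @ \oo).
Proof.
have h e : 0 < e -> exists N, forall n m, (N <= n)%N -> (N <= m)%N -> `|u n th - u m th| <= e /\ `|v n th - v m th| <= e.
  by move=> e0; have [N hN] := sr_exp_cauchy `|th| e0; exists N => n m Nn Nm; exact: hN.
split; apply: cauchy_cvg; apply/cauchy_exP => e e0.
  have e2 : 0 < e / 2 by rewrite divr_gt0.
  have [N hN] := h _ e2; exists (u N th); exists N => // n /= Nn.
  by have [h1 _] := hN N n (leqnn _) Nn; rewrite /ball /=; apply: le_lt_trans h1 _; lra.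
have e2 : 0 < e / 2 by rewrite divr_gt0.
have [N hN] := h _ e2; exists (v N th); exists N => // n /= Nn.
by have [_ h1] := hN N n (leqnn _) Nn; rewrite /ball /=; apply: le_lt_trans h1 _; lra.
Qed.

End Cauchy.
End StochIntegral.

(** * The exponent of a stochastic integral *)

Section StochExponent.
Context (R : realType) (d : nat) (lam : {measure set (d.-tuple R) -> \bar R}).
Hypothesis hlam : is_lebesgue_measure lam.
Context {dO : measure_display} {Om : measurableType dO} (P : probability Om R).
Context (L : set (d.-tuple R) -> Om -> R) (gam b : R) (rho : {measure set R -> \bar R}).
Hypothesis hL : homogeneous_levy_basis P lam L gam b rho.
Let pr := lk_re b rho.
Let pi := lk_im gam rho.

Section Limit.
Context (s : nat -> simple_rep R d) (f : d.-tuple R -> R) (g : R -> R).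
Hypothesis bs : forall n i, bounded_borel (@sr_A _ _ (s n) i).
Hypothesis sf : {ae lam, forall x, (fun n => sr_fun (s n) x) @ \oo --> f x}.
Hypothesis mf : measurable_fun setT f.
Hypothesis cg : continuous g.
Hypothesis g0 : g 0 = 0.
Hypothesis cB : forall B th, measurable B -> cvg ((fun n => sr_exp lam (s n) B g th) @ \oo).

Lemma measurable_sr_fun n : measurable_fun setT (sr_fun (s n)).
Proof.
apply: measurable_sum => i; apply: measurable_funM; first exact: measurable_cst.
by apply: measurable_indic; exact: (bs i).1.
Qed.

(* Convergence of the exponents over every Borel set [B], not only over the whole space,
   is what Vitali-Hahn-Saks needs to make the limit exponent integrable. *)
Lemma sr_exp_limit th : lam.-integrable setT (EFin \o (fun x => g (th * f x))) /\
  (fun n => sr_exp lam (s n) setT g th) @ \oo --> Rintegral lam setT (fun x => g (th * f x)).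
Proof.
have [Z [mZ Z0 hZ]] := sf.
have mZc : measurable (~` Z) by exact: measurableC.
have mg : measurable_fun setT g by exact: continuous_measurable_fun.
(* Limit and approximants are set to 0 on the exceptional null set, which gives convergence at every
   point. *)
pose f' x := f x * \1_(~` Z) x.
pose s' n x := sr_fun (s n) x * \1_(~` Z) x.
have ms' n : measurable_fun setT (s' n).
  by apply: measurable_funM; [exact: measurable_sr_fun|exact: measurable_indic].
have mf' : measurable_fun setT f' by apply: measurable_funM => //; exact: measurable_indic.
have s'f' x : (fun n => s' n x) @ \oo --> f' x.
  have [Zx|nZx] := pselect (Z x).
    rewrite /f' indicE memNset ?mulr0 => [|/(_ Zx)//].
    by apply: cvg_near_cst; apply: nearW => n; rewrite /s' indicE memNset ?mulr0// => /(_ Zx).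
  apply: cvgM; last exact: cvg_cst.
  by apply: contrapT => h; apply: nZx; exact: hZ.
have aeZ (h h' : d.-tuple R -> R) : (forall x, (~` Z) x -> h x = h' x) -> {ae lam, forall x, h x = h' x}.
  by move=> hh; exists Z; split => // x /= nx; apply: contrapT => nZ; apply: nx; exact: hh.
(* In the spirit of Egorov's theorem: sets of finite measure on which [f'] is bounded and all
   approximants from rank [N] on are within 1 of it, hence uniformly bounded. Pointwise convergence
   makes them cover the space. *)
pose E (N : nat) := @cube R d N `&` [set x | `|f' x| <= N%:R] `&` \bigcap_(n in [set n | (N <= n)%N]) [set x | `|s' n x - f' x| <= 1].
have mle (h : d.-tuple R -> R) c : measurable_fun setT h -> measurable [set x | `|h x| <= c].
  move=> mh; rewrite (_ : mkset _ = (fun x => `|h x|) @^-1` `]-oo, c]); last first.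
    by apply/seteqP; split => w /=; rewrite in_itv.
  have mn : measurable_fun setT (fun x => `|h x|) by apply: measurableT_comp.
  by rewrite -[X in measurable X]setTI; apply: mn.
have [| | |N|N|x|N|B mB|iF cF] := @vitali_hahn_saks _ _ R lam (fun n x => g (th * s' n x)) (fun x => g (th * f' x)) E.
- by move=> n; exact: (integrable_sr hlam (@bs n) mZc th g0).
- apply: (measurableT_comp mg); apply: measurable_funM => //; exact: measurable_cst.
- move=> x; have c : (fun n => th * s' n x) @ \oo --> th * f' x by apply: cvgM => //; exact: cvg_cst.
  exact: (cvg_comp _ _ c (@cg _)).
- apply: measurableI; first by apply: measurableI; [exact: measurable_box|exact: mle].
  by apply: bigcap_measurable => [|n _]; [exists N => /=|apply: mle; exact: measurable_funB].
- apply: le_lt_trans (lam_cube_lty hlam N); apply: le_measure; rewrite ?inE.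
  + apply: measurableI; first by apply: measurableI; [exact: measurable_box|exact: mle].
    by apply: bigcap_measurable => [|n _]; [exists N => /=|apply: mle; exact: measurable_funB].
  + exact: measurable_box.
  + by move=> x [[]].
- have [N1 _ h1] := cube_near x.
  have [N2 _ h2] : \forall n \near \oo, `|f' x| <= n%:R by exact: nbhs_infty_ger.
  have /cvgrPdist_le /(_ _ ltr01)[N3 _ h3] := s'f' x.
  exists (maxn N1 (maxn N2 N3)); split.
    split; first by apply: h1 => /=; exact: leq_maxl.
    by apply: h2 => /=; rewrite !leq_max leqnn orbT.
  move=> n /= Nn; rewrite distrC; apply: h3 => /=; apply: leq_trans Nn.
  by rewrite !leq_max leqnn !orbT.
- have [K hK] := continuous_bounded_segment (`|th| * (N%:R + 1)) cg.
  exists K => n x Nn [[_ /= fN] /(_ n Nn) /= sfn]; apply: hK; rewrite normrM ler_wpM2l//.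
  have -> : s' n x = f' x + (s' n x - f' x) by ring.
  by apply: le_trans (ler_normD _ _) _; exact: lerD.
- have := @cB _ th (measurableI _ _ mB mZc).
  rewrite (_ : (fun n => sr_exp _ _ _ _ _) = (fun n => Rintegral lam setT (fun x => g (th * s' n x) * \1_B x)))//.
  apply/funext => n; apply: eq_Rintegral => x _; rewrite indicI /= /s' [\1_B x]indicE.
  by case: (x \in B); rewrite ?mulr1 ?mul1r// mul0r !mulr0.
have e1 : {ae lam, forall x, g (th * f' x) = g (th * f x)}.
  by apply: aeZ => x nZ; rewrite /f' indicE mem_set// mulr1.
have mgf : measurable_fun setT (fun x => g (th * f x)).
  by apply: (measurableT_comp mg); apply: measurable_funM => //; exact: measurable_cst.
have mgf' : measurable_fun setT (fun x => g (th * f' x)).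
  by apply: (measurableT_comp mg); apply: measurable_funM => //; exact: measurable_cst.
split.
  apply: integrable_ae_eq iF => //; first exact/measurable_EFinP.
  by apply: filterS e1 => x /= -> .
rewrite -(ae_eq_Rintegral mgf' mgf e1).
apply: cvg_trans cF; apply: near_eq_cvg; apply: nearW => n.
have T1 x : g (th * (sr_fun (s n) x * \1_setT x)) = g (th * sr_fun (s n) x) by rewrite indicE mem_set// mulr1.
rewrite /sr_exp; under [RHS]eq_Rintegral do rewrite T1.
apply: ae_eq_Rintegral.
- by apply: (measurableT_comp mg); apply: measurable_funM => //; exact: measurable_cst.
- by apply: (measurableT_comp mg); apply: measurable_funM; [exact: measurable_cst|exact: measurable_sr_fun].
- by apply: aeZ => x nZ; rewrite /s' indicE mem_set// mulr1.
Qed.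

End Limit.

Lemma continuous_uniform_limit (w : nat -> R -> R) (W : R -> R) :
  (forall n, continuous (w n)) -> (forall x, (fun n => w n x) @ \oo --> W x) ->
  (forall T e : R, 0 < e -> exists N, forall n m, (N <= n)%N -> (N <= m)%N -> forall x, `|x| <= T ->
     `|w n x - w m x| <= e) -> continuous W.
Proof.
move=> cw wW hc t; apply/cvgrPdist_le => e e0.
have e3 : 0 < e / 3 by rewrite divr_gt0.
have [N hN] := hc (`|t| + 1) _ e3.
have lim x : `|x| <= `|t| + 1 -> `|w N x - W x| <= e / 3.
  move=> xt; have c : (fun m => `|w N x - w m x|) @ \oo --> `|w N x - W x|.
    by apply: cvg_norm; apply: cvgB; [exact: cvg_cst|exact: wW].
  by apply: (cvgr_to_le c); near=> m; apply: hN => //; near: m; exact: nbhs_infty_ge.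
near=> x.
have xt : `|x| <= `|t| + 1.
  have h : `|t - x| <= 1 by near: x; apply: cvgr_dist_le => //; exact: cvg_id.
  have -> : x = t - (t - x) by ring.
  by apply: le_trans (ler_normB _ _) _; exact: lerD.
have h1 := lim x xt.
have h2 : `|w N t - W t| <= e / 3 by apply: lim; rewrite lerDl.
have h3 : `|w N t - w N x| <= e / 3 by near: x; have /cvgrPdist_le /(_ _ e3) := @cw N t; exact.
have -> : W t - W x = - (w N t - W t) + (w N t - w N x) + (w N x - W x) by ring.
apply: le_trans (ler_normD _ _) _; apply: le_trans (lerD (ler_normD _ _) (lexx _)) _.
rewrite normrN; lra.
Unshelve. all: by end_near. Qed.

(** The Cauchy property of the exponents over each Borel set gives integrability and the value of
    the limit; its uniformity on bounded ranges of [th] gives continuity. *)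
Theorem stoch_integral_exponent (f : d.-tuple R -> R) (Y : Om -> R) :
  measurable_fun setT f -> measurable_fun setT Y -> is_stoch_integral P lam L f Y ->
  [/\ forall th, lam.-integrable setT (EFin \o (fun x => pr (th * f x))) /\
        lam.-integrable setT (EFin \o (fun x => pi (th * f x))),
      continuous (fun th : R => Rintegral lam setT (fun x => pr (th * f x))),
      continuous (fun th : R => Rintegral lam setT (fun x => pi (th * f x))) &
      forall th, charfun P Y th = cexp (Complex (Rintegral lam setT (fun x => pr (th * f x)))
                                               (Rintegral lam setT (fun x => pi (th * f x))))].
Proof.
move=> mf mY [s [bs sf Bs Ys]].
have hrho := levy_basis_measure hL.
have cB B th : measurable B -> cvg ((fun n => sr_exp lam (s n) B pr th) @ \oo) /\
    cvg ((fun n => sr_exp lam (s n) B pi th) @ \oo).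
  by move=> mB; have [Z [mZ cZ]] := Bs B mB; exact: (sr_exp_cvg hlam hL bs mB mZ cZ).
have Lr th := sr_exp_limit bs sf mf (@continuous_lk_re R b rho hrho) (lk_re0 b rho) (fun B th mB => (cB B th mB).1) th.
have Li th := sr_exp_limit bs sf mf (@continuous_lk_im R gam rho hrho) (lk_im0 gam rho) (fun B th mB => (cB B th mB).2) th.
have cau := sr_exp_cauchy hlam hL bs measurableT mY Ys.
split.
- by move=> th; split; [exact: (Lr th).1|exact: (Li th).1].
- apply: (@continuous_uniform_limit (fun n => sr_exp lam (s n) setT pr)).
  + move=> n; exact: (continuous_sr_exp hlam (@bs n) measurableT (lk_re0 b rho) (@continuous_lk_re R b rho hrho)).
  + by move=> th; exact: (Lr th).2.
  + move=> T e e0; have [N hN] := cau T e e0; exists N => n m Nn Nm x xT.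
    exact: (hN n m Nn Nm x xT).1.
- apply: (@continuous_uniform_limit (fun n => sr_exp lam (s n) setT pi)).
  + move=> n; exact: (continuous_sr_exp hlam (@bs n) measurableT (lk_im0 gam rho) (@continuous_lk_im R gam rho hrho)).
  + by move=> th; exact: (Li th).2.
  + move=> T e e0; have [N hN] := cau T e e0; exists N => n m Nn Nm x xT.
    exact: (hN n m Nn Nm x xT).2.
move=> th; rewrite /charfun /cexp /=.
have lim_h (h : R -> R) : continuous h -> (forall x, `|h x| <= 1) -> (forall x y, `|h x - h y| <= `|x - y|) ->
    (fun n => Rintegral P setT (fun w => h (th * sr_int L (s n) setT w))) @ \oo -->
    Rintegral P setT (fun w => h (th * Y w)).
  move=> ch h1 hl; apply/cvgrPdist_le => e e0.
  have := charfun_uniform `|th| (fun n => measurable_sr_int hL measurableT (@bs n)) mY Ys ch h1 hl e0.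
  by apply: filterS => n /(_ th (lexx _)); rewrite distrC.
have eq_lim (u : nat -> R) (x y : R) : u @ \oo --> x -> u @ \oo --> y -> x = y.
  by move=> ux uy; rewrite -(cvg_lim _ ux)// -(cvg_lim _ uy).
have cE : (fun n => expR (sr_exp lam (s n) setT pr th)) @ \oo --> expR (Rintegral lam setT (fun x => pr (th * f x))).
  exact: (cvg_comp _ _ (Lr th).2 (@continuous_expR R _)).
congr Complex; under eq_Rintegral do rewrite mulrC.
- apply: (eq_lim (fun n => Rintegral P setT (fun w => cos (th * sr_int L (s n) setT w)))).
    under eq_Rintegral do rewrite mulrC; exact: (lim_h cos (@continuous_cos R) (@cos_norm_le1 R) (@cos_lip R)).
  rewrite (_ : (fun n => _) = (fun n => expR (sr_exp lam (s n) setT pr th) * cos (sr_exp lam (s n) setT pi th))).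
    by apply: cvgM => //; exact: (cvg_comp _ _ (Li th).2 (@continuous_cos R _)).
  by apply/funext => n; rewrite (charfun_sr hlam hL (@bs n) measurableT th).1.
- apply: (eq_lim (fun n => Rintegral P setT (fun w => sin (th * sr_int L (s n) setT w)))).
    under eq_Rintegral do rewrite mulrC; exact: (lim_h sin (@continuous_sin R) (@sin_norm_le1 R) (@sin_lip R)).
  rewrite (_ : (fun n => _) = (fun n => expR (sr_exp lam (s n) setT pr th) * sin (sr_exp lam (s n) setT pi th))).
    by apply: cvgM => //; exact: (cvg_comp _ _ (Li th).2 (@continuous_sin R _)).
  by apply/funext => n; rewrite (charfun_sr hlam hL (@bs n) measurableT th).2.
Qed.

End StochExponent.

(** * Positivity on trigonometric polynomials *)

Section TrigPolynomials.
Context (R : realType) (T : eqType).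
Implicit Types (y : T -> R) (phi : seq (R * T)) (p : seq (R * R * seq (R * T))).

Definition lin phi y : R := \sum_(c <- phi) c.1 * y c.2.

(** Trigonometric polynomials in the variables [y u], possibly infinitely many: an entry holds the
    coefficient of the cosine, that of the sine, and the finite linear form that is their
    frequency. *)
Definition trig p y : R := \sum_(t <- p) (t.1.1 * cos (lin t.2 y) + t.1.2 * sin (lin t.2 y)).

Definition istrig (F : (T -> R) -> R) := exists p, forall y, F y = trig p y.

Lemma lin_cat phi phi' y : lin (phi ++ phi') y = lin phi y + lin phi' y.
Proof. by rewrite /lin big_cat. Qed.

Lemma linZ (c : R) phi y : lin [seq (c * t.1, t.2) | t <- phi] y = c * lin phi y.
Proof. by rewrite /lin big_map mulr_sumr; apply: eq_bigr => t _; rewrite mulrA. Qed.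

Lemma lin_scale (c : R) phi y : lin phi (fun u => c * y u) = c * lin phi y.
Proof. by rewrite /lin mulr_sumr; apply: eq_bigr => t _; rewrite mulrCA. Qed.

Lemma lin1 (c : R) u y : lin [:: (c, u)] y = c * y u.
Proof. by rewrite /lin big_seq1. Qed.

Lemma istrig_ext F G : istrig F -> (forall y, F y = G y) -> istrig G.
Proof. by move=> [p hp] FG; exists p => y; rewrite -FG. Qed.

Lemma istrig_add F G : istrig F -> istrig G -> istrig (fun y => F y + G y).
Proof. by move=> [p hp] [q hq]; exists (p ++ q) => y; rewrite /trig big_cat /= hp hq. Qed.

Lemma istrig_term (x w : R) phi : istrig (fun y => x * cos (lin phi y) + w * sin (lin phi y)).
Proof. by exists [:: (x, w, phi)] => y; rewrite /trig big_seq1. Qed.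

Lemma istrig_sum (I : Type) (s : seq I) (F : I -> (T -> R) -> R) : (forall i, istrig (F i)) ->
  istrig (fun y => \sum_(i <- s) F i y).
Proof.
move=> hF; elim: s => [|i s IH]; first by exists [::] => y; rewrite /trig !big_nil.
by apply: (istrig_ext (istrig_add (hF i) IH)) => y; rewrite big_cons.
Qed.

(** By the product-to-sum formulas, with the sums and differences of the linear forms as
    frequencies. *)
Lemma istrig_mul F G : istrig F -> istrig G -> istrig (fun y => F y * G y).
Proof.
move=> [p hp] [q hq].
apply: (@istrig_ext (fun y => \sum_(t <- p) \sum_(t' <- q)
  (t.1.1 * cos (lin t.2 y) + t.1.2 * sin (lin t.2 y)) * (t'.1.1 * cos (lin t'.2 y) + t'.1.2 * sin (lin t'.2 y)))).
  apply: istrig_sum => t; apply: istrig_sum => t'.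
  apply: (istrig_ext (istrig_add
    (istrig_term ((t.1.1 * t'.1.1 - t.1.2 * t'.1.2) / 2) ((t.1.2 * t'.1.1 + t.1.1 * t'.1.2) / 2) (t.2 ++ t'.2))
    (istrig_term ((t.1.1 * t'.1.1 + t.1.2 * t'.1.2) / 2) ((t.1.2 * t'.1.1 - t.1.1 * t'.1.2) / 2)
       (t.2 ++ [seq (-1 * c.1, c.2) | c <- t'.2])))) => y.
  rewrite !lin_cat linZ mulN1r !cosD !sinD cosN sinN; by field.
by move=> y; rewrite hp hq /trig mulr_suml; apply: eq_bigr => t _; rewrite mulr_sumr.
Qed.

Lemma istrig_cst (c : R) : istrig (fun=> c).
Proof.
by apply: (istrig_ext (istrig_term c 0 [::])) => y; rewrite /lin big_nil cos0 mulr1 mul0r addr0.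
Qed.

Lemma trig_bounded p : exists C, forall y, `|trig p y| <= C.
Proof.
exists (\sum_(t <- p) (`|t.1.1| + `|t.1.2|)) => y; apply: le_trans (ler_norm_sum _ _ _) _.
apply: ler_sum => t _; apply: le_trans (ler_normD _ _) _; rewrite !normrM.
by apply: lerD; rewrite ler_piMr// ?cos_max// sin_max.
Qed.

Lemma trig0 p : trig p (fun=> 0) = \sum_(t <- p) t.1.1.
Proof.
apply: eq_bigr => t _; rewrite (_ : lin _ _ = 0) ?cos0 ?sin0 ?mulr1 ?mulr0 ?addr0//.
by rewrite /lin big1// => c _; rewrite mulr0.
Qed.

End TrigPolynomials.

Section Positivity.
Context (R : realType).

(** The nonnegative polynomial has a nonnegative integral against the law of exponent
    [(A + i B) / (n + 1)]. Since the cosine coefficients sum to 0, every cosine may be replaced by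
    itself minus 1; multiplying by [n + 1] then gives the derivative at 0 in the limit. *)
Lemma levy_exp_positive k (A B : k.-tuple R -> R) (p : seq (R * R * k.-tuple R)) : levy_exp A B ->
  (forall y : k.-tuple R, 0 <= \sum_(t <- p) (t.1.1 * cos (dotp t.2 y) + t.1.2 * sin (dotp t.2 y))) ->
  \sum_(t <- p) t.1.1 = 0 ->
  0 <= \sum_(t <- p) (t.1.1 * A t.2 + t.1.2 * B t.2).
Proof.
move=> hAB hF hx.
have inn n : 0 <= n.+1%:R^-1 :> R by rewrite invr_ge0.
have pos n : 0 <= \sum_(t <- p) (t.1.1 * (n.+1%:R * (expR (n.+1%:R^-1 * A t.2) * cos (n.+1%:R^-1 * B t.2) - 1)) +
    t.1.2 * (n.+1%:R * (expR (n.+1%:R^-1 * A t.2) * sin (n.+1%:R^-1 * B t.2)))).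
  have [Q hQ] := hAB _ (inn n).
  have iQ t : Q.-integrable setT (EFin \o (fun y => t.1.1 * cos (dotp t.2 y) + t.1.2 * sin (dotp t.2 y))).
    apply: (@prob_integrable _ _ _ Q _ (`|t.1.1| + `|t.1.2|)) => [|y].
      by apply: measurable_funD; apply: measurable_funM => //;
        [exact: measurable_cos_dotp|exact: measurable_sin_dotp].
    apply: le_trans (ler_normD _ _) _; rewrite !normrM.
    by apply: lerD; rewrite ler_piMr// ?cos_max// sin_max.
  have h0 : 0 <= Rintegral Q setT (fun y => \sum_(t <- p) (t.1.1 * cos (dotp t.2 y) + t.1.2 * sin (dotp t.2 y))).
    by apply: Rintegral_ge0 => y _; exact: hF.
  rewrite (Rintegral_sum p measurableT iQ).1 in h0.
  have eQ (t : R * R * k.-tuple R) : Rintegral Q setT (fun y => t.1.1 * cos (dotp t.2 y) + t.1.2 * sin (dotp t.2 y)) =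
      t.1.1 * (expR (n.+1%:R^-1 * A t.2) * cos (n.+1%:R^-1 * B t.2)) + t.1.2 * (expR (n.+1%:R^-1 * A t.2) * sin (n.+1%:R^-1 * B t.2)).
    have [<- <-] := hQ t.2.
    have ic : Q.-integrable setT (EFin \o (fun y => cos (dotp t.2 y))).
      by apply: (@prob_integrable _ _ _ Q _ 1) => [|y]; [exact: measurable_cos_dotp|exact: cos_max].
    have is_ : Q.-integrable setT (EFin \o (fun y => sin (dotp t.2 y))).
      by apply: (@prob_integrable _ _ _ Q _ 1) => [|y]; [exact: measurable_sin_dotp|exact: sin_max].
    rewrite -(RintegralZl t.1.1 measurableT ic) -(RintegralZl t.1.2 measurableT is_) -RintegralD//.
    - by have := integrableZl measurableT t.1.1 ic; apply: eq_integrable => // y _; rewrite /= EFinM.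
    - by have := integrableZl measurableT t.1.2 is_; apply: eq_integrable => // y _; rewrite /= EFinM.
  have := mulr_ge0 (ler0n R n.+1) h0; rewrite (eq_bigr _ (fun t _ => eQ t)) mulr_sumr.
  have -> : \sum_(t <- p) n.+1%:R * (t.1.1 * (expR (n.+1%:R^-1 * A t.2) * cos (n.+1%:R^-1 * B t.2)) + t.1.2 * (expR (n.+1%:R^-1 * A t.2) * sin (n.+1%:R^-1 * B t.2))) =
    \sum_(t <- p) (t.1.1 * (n.+1%:R * (expR (n.+1%:R^-1 * A t.2) * cos (n.+1%:R^-1 * B t.2) - 1)) +
    t.1.2 * (n.+1%:R * (expR (n.+1%:R^-1 * A t.2) * sin (n.+1%:R^-1 * B t.2)))) + n.+1%:R * \sum_(t <- p) t.1.1.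
    by rewrite mulr_sumr -big_split; apply: eq_bigr => t _ /=; ring.
  by rewrite hx mulr0 addr0.
have inv0 : (fun n : nat => n.+1%:R^-1 : R) @ \oo --> (0 : R) by exact: cvg_harmonic.
have quo (f : R -> R) (D : R) : f 0 = 0 -> is_derive (0 : R) 1 f D -> (fun n : nat => n.+1%:R * f n.+1%:R^-1) @ \oo --> D.
  move=> f0 fD; rewrite -[D]mulr1; apply: (cvg_scaled_quotient f0 fD) => //.
  by apply: cvg_near_cst; apply: nearW => n; rewrite divff.
have cl (a b : R) : (fun n : nat => n.+1%:R * (expR (n.+1%:R^-1 * a) * cos (n.+1%:R^-1 * b) - 1)) @ \oo --> a.
  apply: (quo (fun t => expR (t * a) * cos (t * b) - 1)).
    by rewrite !mul0r expR0 cos0 mulr1 subrr.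
  apply: is_derive_eq; rewrite /= !mul0r expR0 cos0 sin0 ?scaler0 ?scaler1 /GRing.scale /=; ring.
have sl (a b : R) : (fun n : nat => n.+1%:R * (expR (n.+1%:R^-1 * a) * sin (n.+1%:R^-1 * b))) @ \oo --> b.
  apply: (quo (fun t => expR (t * a) * sin (t * b))).
    by rewrite !mul0r expR0 sin0 mulr0.
  apply: is_derive_eq; rewrite /= !mul0r expR0 cos0 sin0 ?scaler0 ?scaler1 /GRing.scale /=; ring.
have c : (fun n : nat => \sum_(t <- p) (t.1.1 * (n.+1%:R * (expR (n.+1%:R^-1 * A t.2) * cos (n.+1%:R^-1 * B t.2) - 1)) +
    t.1.2 * (n.+1%:R * (expR (n.+1%:R^-1 * A t.2) * sin (n.+1%:R^-1 * B t.2))))) @ \oo -->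
    \sum_(t <- p) (t.1.1 * A t.2 + t.1.2 * B t.2).
  by apply: cvg_bigsum => t; apply: cvgD; apply: cvgM; (try exact: cvg_cst); [exact: cl|exact: sl].
by apply: (cvgr_to_ge c); apply: nearW => n; exact: pos.
Qed.

Section Coefficients.
Context (T : eqType).
Implicit Types (phi : seq (R * T)).

(** A linear form may list a point several times; its coefficient vector over the distinct points
    [U] collects the repetitions. *)
Let coef (U : seq T) phi : (size U).-tuple R := [tuple \sum_(c <- phi | c.2 == tnth (in_tuple U) i) c.1 | i < size U].

Lemma dotp_coef (U : seq T) phi (y : T -> R) : uniq U -> {subset [seq c.2 | c <- phi] <= U} ->
  dotp (coef U phi) [tuple y (tnth (in_tuple U) i) | i < size U] = lin phi y.
Proof.
move=> uU sub; rewrite /dotp /lin.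
under eq_bigr => i _ do rewrite !tnth_mktuple mulr_suml big_mkcond.
rewrite exchange_big [LHS]big_seq [RHS]big_seq; apply: eq_bigr => c cphi.
have cU : c.2 \in U by apply: sub; exact: map_f.
have hi : (index c.2 U < size U)%N by rewrite index_mem.
rewrite (bigD1 (Ordinal hi))//= (tnth_nth c.2) /= nth_index// eqxx big1 ?addr0// => i ne.
case: eqP => // e; case/negP: ne; apply/eqP/val_inj => /=.
by rewrite e (tnth_nth c.2) /= index_uniq.
Qed.

(** Passage to finitely many coordinates: the points that matter are those occurring in [p], so the
    hypothesis provides an exponent for every finite list [U] of points. *)
Lemma levy_exp_trig_positive (A B : seq (R * T) -> R) (p : seq (R * R * seq (R * T))) :
  (forall U : seq T, exists A' B' : (size U).-tuple R -> R, levy_exp A' B' /\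
     forall phi, {subset [seq c.2 | c <- phi] <= U} -> uniq U -> A' (coef U phi) = A phi /\ B' (coef U phi) = B phi) ->
  (forall y, 0 <= trig p y) -> trig p (fun=> 0) = 0 ->
  0 <= \sum_(t <- p) (t.1.1 * A t.2 + t.1.2 * B t.2).
Proof.
move=> hAB hp p0; pose U := undup (flatten [seq [seq c.2 | c <- t.2] | t <- p]).
have uU : uniq U by exact: undup_uniq.
have sub t : t \in p -> {subset [seq c.2 | c <- t.2] <= U}.
  move=> tp u ut; rewrite mem_undup; apply/flattenP; exists [seq c.2 | c <- t.2] => //.
  exact: (map_f (fun t : R * R * seq (R * T) => [seq c.2 | c <- t.2])).
have [A' [B' [lAB eAB]]] := hAB U.
have := @levy_exp_positive _ A' B' [seq (t.1, coef U t.2) | t <- p] lAB.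
rewrite !big_map /= => h.
rewrite big_seq (eq_bigr (fun t => t.1.1 * A' (coef U t.2) + t.1.2 * B' (coef U t.2))) -?big_seq => [|t tp].
  apply: h => [y|]; last by have := p0; rewrite trig0.
  rewrite big_map; pose Y u := nth 0 y (index u U).
  have -> : y = [tuple Y (tnth (in_tuple U) i) | i < size U].
    apply: eq_from_tnth => i; rewrite tnth_mktuple /Y (tnth_nth 0); congr (nth _ _ _).
    by rewrite (tnth_nth (tnth (in_tuple U) i)) /= index_uniq.
  apply: le_trans (hp Y) _; rewrite le_eqVlt; apply/orP; left; apply/eqP.
  rewrite /trig big_seq [RHS]big_seq; apply: eq_bigr => t tp /=.
  by rewrite dotp_coef//; exact: sub.
by have [-> ->] := eAB t.2 (sub t tp) uU.
Qed.

End Coefficients.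
End Positivity.

(** * Test polynomials vanishing to fourth order *)

Section Jets.
Context (R : realType).

Lemma quadratic_small (a b C : R) : (forall t, 0 < t <= 1 -> `|a * t + b * t ^+ 2| <= C * t ^+ 3) -> a = 0 /\ b = 0.
Proof.
move=> h; have C0 : 0 <= C.
  have := h 1; rewrite !expr1n !mulr1 ltr01 lexx => /(_ isT); exact: le_trans.
have small (x K : R) : 0 <= K -> (forall t, 0 < t <= 1 -> `|x| <= K * t) -> x = 0.
  move=> K0 hx; apply/eqP; rewrite -normr_le0 leNgt; apply/negP => x0.
  pose t := Num.min 1 (`|x| / (2 * (K + 1))).
  have t0 : 0 < t by rewrite lt_min ltr01 divr_gt0//; lra.
  have t1 : t <= 1 by rewrite ge_min lexx.
  have := hx t; rewrite t0 t1 => /(_ isT); apply/negP; rewrite -ltNge.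
  apply: (@le_lt_trans _ _ (K * (`|x| / (2 * (K + 1))))); first by rewrite ler_wpM2l// ge_min lexx orbT.
  by rewrite mulrA ltr_pdivrMr; [nra|lra].
have a0 : a = 0.
  apply: (small a (C + `|b|)) => [|t /andP[t0 t1]]; first by rewrite addr_ge0.
  have := h t; rewrite t0 t1 => /(_ isT) ht.
  have e : `|a| * t = `|(a * t + b * t ^+ 2) - b * t ^+ 2|.
    by rewrite addrK normrM (gtr0_norm t0).
  have h2 : `|a| * t <= C * t ^+ 3 + `|b| * t ^+ 2.
    rewrite e; apply: le_trans (ler_normB _ _) _; apply: lerD => //.
    by rewrite normrM [`|t ^+ 2|]ger0_norm// sqr_ge0.
  rewrite -(ler_pM2r t0); apply: le_trans h2 _.
  have t2 : 0 <= t ^+ 2 by exact: sqr_ge0.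
  have : C * t ^+ 3 <= C * t ^+ 2 
    by have -> : C * t ^+ 3 = t * (C * t ^+ 2); [ring|rewrite ler_piMl// mulr_ge0].
  have -> : (C + `|b|) * t * t = C * t ^+ 2 + `|b| * t ^+ 2 by ring.
  by rewrite lerD2r.
split=> //; apply: (small b C) => // t t01; have /andP[t0 t1] := t01.
have := h t t01; rewrite a0 mul0r add0r normrM (ger0_norm (sqr_ge0 t)).
have -> : C * t ^+ 3 = C * t * t ^+ 2 by ring.
by rewrite ler_pM2r// exprn_gt0.
Qed.

Lemma sin_sub_le_cube (y : R) : `|sin y - y| <= `|y| ^+ 3.
Proof.
have h := @norm_le_derive R (fun x => sin x - x) (fun x => cos x - 1) (`|y| ^+ 2) y.
have {}h : `|(sin y - y) - (sin 0 - 0)| <= `|y| ^+ 2 * `|y|.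
  apply: h => x xy; apply: le_trans (onem_cos_le_sqr x) _.
  by rewrite -(real_normK (num_real x)) lerXn2r ?nnegrE.
by move: h; rewrite sin0 !subr0 -exprSr.
Qed.

Lemma cos_quad_le_cube (y : R) : `|cos y - 1 + y ^+ 2 / 2| <= `|y| ^+ 3.
Proof.
have h := @norm_le_derive R (fun x => cos x - 1 + x ^+ 2 / 2) (fun x => x - sin x) (`|y| ^+ 2) y.
have {}h : `|(cos y - 1 + y ^+ 2 / 2) - (cos 0 - 1 + 0 ^+ 2 / 2)| <= `|y| ^+ 2 * `|y|.
  apply: h => [x|x xy].
    by apply: is_derive_eq; rewrite /= ?scaler0 ?scaler1 /GRing.scale /=; field.
  rewrite distrC; apply: le_trans (sin_sub_le_sqr x) _.
  by rewrite -(real_normK (num_real x)) lerXn2r ?nnegrE.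
by move: h; rewrite cos0 subrr expr0n /= mul0r addr0 subr0 -exprSr.
Qed.

(** A fourth-order bound at 0 leaves no room for the Taylor terms of degree 1 and 2, whose
    coefficients are the two moments up to a factor; the remainder of each summand is cubic. *)
Lemma trig_jets (I : Type) (p : seq I) (x w c : I -> R) (C : R) :
  \sum_(i <- p) x i = 0 ->
  (forall t, 0 < t <= 1 -> `|\sum_(i <- p) (x i * cos (t * c i) + w i * sin (t * c i))| <= C * t ^+ 4) ->
  \sum_(i <- p) w i * c i = 0 /\ \sum_(i <- p) x i * c i ^+ 2 = 0.
Proof.
move=> x0 hC.
have [a0 b0] : \sum_(i <- p) w i * c i = 0 /\ - (\sum_(i <- p) x i * c i ^+ 2) / 2 = 0.
  apply: (@quadratic_small _ _ (`|C| + \sum_(i <- p) (`|x i| + `|w i|) * `|c i| ^+ 3)) => t t01.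
  have /andP[t0 t1] := t01.
  have -> : (\sum_(i <- p) w i * c i) * t + (- (\sum_(i <- p) x i * c i ^+ 2) / 2) * t ^+ 2 =
    \sum_(i <- p) (x i * cos (t * c i) + w i * sin (t * c i)) -
    \sum_(i <- p) (x i * (cos (t * c i) - 1 + (t * c i) ^+ 2 / 2) + w i * (sin (t * c i) - t * c i)) - \sum_(i <- p) x i.
    rewrite mulr_suml mulNr mulNr mulr_suml mulr_suml -sumrB -sumrB -sumrB; apply: eq_bigr => i _; by field.
  rewrite x0 subr0; apply: le_trans (ler_normB _ _) _; rewrite mulrDl; apply: lerD.
    apply: le_trans (hC t t01) _; apply: le_trans (_ : `|C| * t ^+ 4 <= _).
      by rewrite ler_wpM2r ?exprn_ge0// ?ler_norm// ltW.
    by rewrite ler_wpM2l// exprS ler_piMl// exprn_ge0// ltW.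
  apply: le_trans (ler_norm_sum _ _ _) _; rewrite mulr_suml; apply: ler_sum => i _.
  have e : `|t * c i| ^+ 3 = `|c i| ^+ 3 * t ^+ 3 by rewrite normrM (gtr0_norm t0) exprMn mulrC.
  rewrite -[leRHS]mulrA -e mulrDl; apply: le_trans (ler_normD _ _) _.
  apply: lerD; rewrite normrM ler_wpM2l//; [exact: cos_quad_le_cube|exact: sin_sub_le_cube].
split=> //; move/eqP: b0; rewrite mulf_eq0 oppr_eq0 invr_eq0 pnatr_eq0 orbF => /eqP //.
Qed.

(** The vanishing moments cancel [gam] and the compensator [tau1], which are linear in [c i], and
    the Gaussian term, which is quadratic. Only the integral over the jumps is left. *)
Lemma lk_trig (gam b : R) (rho : {measure set R -> \bar R}) (I : Type) (p : seq I) (x w c : I -> R) (C : R) :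
  levy_measure rho -> \sum_(i <- p) x i = 0 ->
  (forall t, 0 < t <= 1 -> `|\sum_(i <- p) (x i * cos (t * c i) + w i * sin (t * c i))| <= C * t ^+ 4) ->
  \sum_(i <- p) (x i * lk_re b rho (c i) + w i * lk_im gam rho (c i)) =
  Rintegral rho setT (fun t => \sum_(i <- p) (x i * cos (t * c i) + w i * sin (t * c i))).
Proof.
move=> hrho x0 hC; have [w0 q0] := trig_jets x0 hC.
have ik i : rho.-integrable setT (EFin \o (fun t => x i * kre (c i) t + w i * kim (c i) t)).
  have h1 := integrableZl measurableT (x i) (integrable_kre hrho (c i)).
  have h2 := integrableZl measurableT (w i) (integrable_kim hrho (c i)).
  by have := integrableD measurableT h1 h2; apply: eq_integrable => // t _; rewrite /= EFinD !EFinM.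
transitivity (Rintegral rho setT (fun t => \sum_(i <- p) (x i * kre (c i) t + w i * kim (c i) t))).
  rewrite (Rintegral_sum p measurableT ik).1.
  have e i : Rintegral rho setT (fun t => x i * kre (c i) t + w i * kim (c i) t) = x i * Kre rho (c i) + w i * Kim rho (c i).
    rewrite -(RintegralZl (x i) measurableT (integrable_kre hrho (c i))) -(RintegralZl (w i) measurableT (integrable_kim hrho (c i))) -RintegralD//.
    - by have := integrableZl measurableT (x i) (integrable_kre hrho (c i)); apply: eq_integrable => // t _; rewrite /= EFinM.
    - by have := integrableZl measurableT (w i) (integrable_kim hrho (c i)); apply: eq_integrable => // t _; rewrite /= EFinM.
  rewrite (eq_bigr _ (fun i _ => e i)).
  transitivity (- (b ^+ 2 / 2) * (\sum_(i <- p) x i * c i ^+ 2) + gam * (\sum_(i <- p) w i * c i) +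
    \sum_(i <- p) (x i * Kre rho (c i) + w i * Kim rho (c i))).
    rewrite !mulr_sumr -!big_split; apply: eq_bigr => i _ /=; rewrite /lk_re /lk_im; by field.
  by rewrite w0 q0 !mulr0 !add0r.
apply: eq_Rintegral => t _.
transitivity (\sum_(i <- p) (x i * cos (t * c i) + w i * sin (t * c i)) - \sum_(i <- p) x i - tau1 t * \sum_(i <- p) w i * c i).
  rewrite mulr_sumr -!sumrB; apply: eq_bigr => i _; rewrite /kre /kim [c i * t]mulrC; ring.
by rewrite x0 w0 mulr0 !subr0.
Qed.

End Jets.

(** * Quadratic positivity and its closure *)

Section Main.
Context (R : realType) (d : nat) (lam : {sigma_finite_measure set (d.-tuple R) -> \bar R}).
Context (gam b : R) (rho : {sigma_finite_measure set R -> \bar R}).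
Hypothesis hrho : levy_measure rho.
Context (g : d.-tuple R -> R).
Hypothesis mg : measurable_fun setT g.
Context (J : finType) (c sig : J -> R).
Let T := d.-tuple R.
Let Yg (s : T) : T -> R := fun u => g (tsub u s).
Hypothesis int_re : forall phi : seq (R * T), lam.-integrable setT (EFin \o (fun s => lk_re b rho (lin phi (Yg s)))).
Hypothesis int_im : forall phi : seq (R * T), lam.-integrable setT (EFin \o (fun s => lk_im gam rho (lin phi (Yg s)))).
Let A phi := \sum_j sig j * Rintegral lam setT (fun s => lk_re b rho (c j * lin phi (Yg s))).
Let B phi := \sum_j sig j * Rintegral lam setT (fun s => lk_im gam rho (c j * lin phi (Yg s))).
Hypothesis pos : forall p : seq (R * R * seq (R * T)), (forall y, 0 <= trig p y) -> trig p (fun=> 0) = 0 ->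
  0 <= \sum_(t <- p) (t.1.1 * A t.2 + t.1.2 * B t.2).
Let m := (rho \x lam)%E.
Hypothesis int_cos : forall (r : R) (u : T), m.-integrable setT (EFin \o (fun z => 1 - cos (r * z.1 * g (tsub u z.2)))).

(** The trace that a jump of size [z.1] at location [z.2], dilated by [c j], leaves in the moving
    average at the points [u]. *)
Definition ev (j : J) (z : R * T) : T -> R := fun u => c j * z.1 * g (tsub u z.2).

Let mtsub (u : T) : measurable_fun setT (tsub u).
Proof.
apply/measurable_fun_tnthP => i.
apply: (@eq_measurable_fun _ _ _ _ _ (fun x : d.-tuple R => tnth u i - tnth x i)).
  by move=> z _ /=; rewrite tnth_mktuple.
by apply: measurable_funB => //; exact: measurable_tnth.
Qed.

Lemma measurable_ev j u : measurable_fun setT (fun z => ev j z u).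
Proof.
apply: measurable_funM.
  by apply: measurable_funM; [exact: measurable_cst|exact: measurable_fst].
apply: (measurableT_comp mg); apply: (measurableT_comp (mtsub u)); exact: measurable_snd.
Qed.

Lemma measurable_lin_ev j phi : measurable_fun setT (fun z => lin phi (ev j z)).
Proof.
by apply: measurable_sum => t; apply: measurable_funM; [exact: measurable_cst|exact: measurable_ev].
Qed.

Lemma measurable_trig_ev j p : measurable_fun setT (fun z => trig p (ev j z)).
Proof.
apply: measurable_sum => t; apply: measurable_funD; apply: measurable_funM; try exact: measurable_cst.
  by apply: measurable_cos_comp; exact: measurable_lin_ev.
by apply: measurable_sin_comp; exact: measurable_lin_ev.
Qed.

Section Weight.
Context (r : R) (u0 : T).

Let w (y : T -> R) : R := (1 - cos (r * y u0)) ^+ 2.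
(* Vanishing to fourth order at 0, the weight removes the drift and Gaussian parts from the
   positivity inequality. *)
Definition weight j z : R := w (ev j z).

Let w_trig : istrig w.
Proof.
have h := istrig_add (istrig_cst T 1) (istrig_term (-1) 0 [:: (r, u0)]).
by apply: (istrig_ext (istrig_mul h h)) => y; rewrite lin1 /w expr2; ring.
Qed.

Lemma weight_ge0 j z : 0 <= weight j z. Proof. exact: sqr_ge0. Qed.

Lemma measurable_weight j : measurable_fun setT (weight j).
Proof.
have [p hp] := w_trig.
by rewrite (_ : weight j = fun z => trig p (ev j z)); [exact: measurable_trig_ev|apply/funext => z; rewrite /weight hp].
Qed.

Lemma integrable_weight j : m.-integrable setT (EFin \o weight j).
Proof.
apply: (integrable_le measurableT (measurable_weight j) (g := fun z => 2 * (1 - cos (r * c j * z.1 * g (tsub u0 z.2))))).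
  have := integrableZl measurableT 2 (int_cos (r * c j) u0).
  by apply: eq_integrable => // z _; rewrite /= EFinM.
move=> z _; rewrite ger0_norm ?weight_ge0// /weight /w /ev !mulrA.
set C := cos _; have := cos_le1 (r * c j * z.1 * g (tsub u0 z.2)); have := cos_geN1 (r * c j * z.1 * g (tsub u0 z.2)).
by rewrite -/C expr2 => h1 h2; rewrite ler_wpM2r//; lra.
Qed.

Lemma integrable_mul_weight j (f : R * T -> R) C : measurable_fun setT f -> (forall z, `|f z| <= C) ->
  m.-integrable setT (EFin \o (fun z => f z * weight j z)).
Proof.
move=> mf fC; apply: (integrable_le measurableT _ (g := fun z => C * weight j z)).
- by apply: measurable_funM => //; exact: measurable_weight.
- have := integrableZl measurableT C (integrable_weight j).
  by apply: eq_integrable => // z _; rewrite /= EFinM.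
- by move=> z _; rewrite normrM (ger0_norm (weight_ge0 j z)) ler_wpM2r// weight_ge0.
Qed.

(** [G ^+ 2 * w] is a nonnegative trigonometric polynomial that vanishes to fourth order along every
    ray, so [pos] applies to it, [lk_trig] reduces it to an integral over jump sizes, and Fubini
    moves that integral to the product space. *)
Lemma trig_square_positive (G : (T -> R) -> R) : istrig G ->
  0 <= \sum_j sig j * Rintegral m setT (fun z => G (ev j z) ^+ 2 * weight j z).
Proof.
move=> tG; have [q hq] := tG; have [C hC] := trig_bounded q.
have GC y : `|G y| <= C by rewrite hq.
have C0 : 0 <= C by exact: le_trans (normr_ge0 _) (GC (fun=> 0)).
have [p hp] := istrig_mul (istrig_mul tG tG) w_trig.
have hF y : trig p y = G y ^+ 2 * w y by rewrite -hp expr2.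
have p0 : trig p (fun=> 0) = 0 by rewrite hF /w mulr0 cos0 subrr expr0n mulr0.
have := pos _ p0; rewrite /A /B => h.
have {}h := h (fun y => ltac:(rewrite hF; by apply: mulr_ge0; exact: sqr_ge0)).
have pw j s : \sum_(t <- p) (t.1.1 * lk_re b rho (c j * lin t.2 (Yg s)) + t.1.2 * lk_im gam rho (c j * lin t.2 (Yg s))) =
    Rintegral rho setT (fun x => trig p (ev j (x, s))).
  have e x : \sum_(t <- p) (t.1.1 * cos (x * (c j * lin t.2 (Yg s))) + t.1.2 * sin (x * (c j * lin t.2 (Yg s)))) =
      trig p (fun u => x * (c j * Yg s u)).
    by apply: eq_bigr => t _; rewrite !lin_scale.
  rewrite (lk_trig gam b (C := C ^+ 2 * (r * (c j * Yg s u0)) ^+ 4)) => //; first last.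
  - move=> t /andP[t0 t1]; rewrite e hF normrM -mulrA; apply: ler_pM => //.
      by rewrite normrX lerXn2r ?nnegrE.
    rewrite /w normrX; have h1 := onem_cos_le_sqr (r * (t * (c j * Yg s u0))).
    rewrite distrC in h1.
    have -> : (r * (c j * Yg s u0)) ^+ 4 * t ^+ 4 = ((r * (t * (c j * Yg s u0))) ^+ 2) ^+ 2 by ring.
    by rewrite lerXn2r ?nnegrE// sqr_ge0.
  - by have := p0; rewrite trig0.
  apply: eq_Rintegral => x _; rewrite e; congr (trig p _); apply/funext => u; rewrite /ev /Yg /=; ring.
have iF j : m.-integrable setT (EFin \o (fun z => trig p (ev j z))).
  apply: (@eq_integrable _ _ _ m setT measurableT (EFin \o (fun z => G (ev j z) ^+ 2 * weight j z))).
    by move=> z _ /=; rewrite hF.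
  apply: (@integrable_mul_weight j (fun z => G (ev j z) ^+ 2) (C ^+ 2)) => [|z].
    rewrite (_ : (fun z => _) = fun z => trig q (ev j z) ^+ 2); last by apply/funext => z; rewrite hq.
    by apply: measurable_funX; exact: measurable_trig_ev.
  by rewrite normrX lerXn2r ?nnegrE.
apply: le_trans h _; rewrite le_eqVlt; apply/orP; left; apply/eqP.
transitivity (\sum_j sig j * Rintegral lam setT (fun s => \sum_(t <- p) (t.1.1 * lk_re b rho (c j * lin t.2 (Yg s)) +
   t.1.2 * lk_im gam rho (c j * lin t.2 (Yg s))))).
  under eq_bigr => t _ do rewrite !mulr_sumr -big_split.
  rewrite exchange_big; apply: eq_bigr => j _ /=.
  have i1 (t : R * R * seq (R * T)) : lam.-integrable setT (EFin \o (fun s => lk_re b rho (c j * lin t.2 (Yg s)))).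
    by have := int_re [seq (c j * e.1, e.2) | e <- t.2]; under eq_fun do rewrite linZ.
  have i2 (t : R * R * seq (R * T)) : lam.-integrable setT (EFin \o (fun s => lk_im gam rho (c j * lin t.2 (Yg s)))).
    by have := int_im [seq (c j * e.1, e.2) | e <- t.2]; under eq_fun do rewrite linZ.
  have i1' (t : R * R * seq (R * T)) : lam.-integrable setT (EFin \o (fun s => t.1.1 * lk_re b rho (c j * lin t.2 (Yg s)))).
    by have := integrableZl measurableT t.1.1 (i1 t); apply: eq_integrable => // s _; rewrite /= EFinM.
  have i2' (t : R * R * seq (R * T)) : lam.-integrable setT (EFin \o (fun s => t.1.2 * lk_im gam rho (c j * lin t.2 (Yg s)))).
    by have := integrableZl measurableT t.1.2 (i2 t); apply: eq_integrable => // s _; rewrite /= EFinM.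
  have i3 (t : R * R * seq (R * T)) : lam.-integrable setT (EFin \o (fun s => t.1.1 * lk_re b rho (c j * lin t.2 (Yg s)) +
     t.1.2 * lk_im gam rho (c j * lin t.2 (Yg s)))).
    by have := integrableD measurableT (i1' t) (i2' t); apply: eq_integrable => // s _; rewrite /= EFinD.
  rewrite (Rintegral_sum p measurableT i3).1.
  rewrite mulr_sumr; apply: eq_bigr => t _.
  rewrite (RintegralD measurableT (i1' t) (i2' t)) (RintegralZl t.1.1 measurableT (i1 t)) (RintegralZl t.1.2 measurableT (i2 t)).
  move: (Rintegral _ _ _) (Rintegral _ _ _) => x y; ring.
apply: eq_bigr => j _; congr (_ * _).
under eq_Rintegral do rewrite pw.
rewrite (Rintegral21 (iF j)).2; apply: eq_Rintegral => z _.
by rewrite hF.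
Qed.

Implicit Types f h : J -> R * T -> R.

(* Tuples, indexed by [J], of functions that are limits of one and the same sequence of
   trigonometric polynomials, evaluated at each of the dilated jumps. *)
Inductive cl : (J -> R * T -> R) -> Prop :=
| cl_trig p : cl (fun j z => trig p (ev j z))
| cl_lim (f_ : nat -> J -> R * T -> R) f C : (forall n, cl (f_ n)) ->
    (forall n j z, `|f_ n j z| <= C) -> (forall j z, `|f j z| <= C) ->
    (forall j, measurable_fun setT (f j)) ->
    (forall j, (fun n => Rintegral m setT (fun z => `|f_ n j z - f j z| * weight j z)) @ \oo --> (0 : R)) -> cl f.

Lemma cl_measurable f : cl f -> forall j, measurable_fun setT (f j).
Proof. by elim => // p j; exact: measurable_trig_ev. Qed.

Lemma cl_bounded f : cl f -> exists C, forall j z, `|f j z| <= C.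
Proof.
elim=> [p|f_ {}f C _ _ _ fC _ _]; last by exists C.
by have [C hC] := trig_bounded p; exists C.
Qed.

(** The weight is integrable, so bounded pointwise convergence implies convergence in weighted L1 by
    dominated convergence. *)
Lemma cl_pointwise (f_ : nat -> J -> R * T -> R) f C : (forall n, cl (f_ n)) ->
  (forall n j z, `|f_ n j z| <= C) -> (forall j z, (fun n => f_ n j z) @ \oo --> f j z) -> cl f.
Proof.
move=> clf fC ff.
have mf j : measurable_fun setT (f j).
  exact: (measurable_fun_cvg (fun n => cl_measurable (clf n) j) (fun z _ => ff j z)).
have fC' j z : `|f j z| <= C.
  have h : (fun n => `|f_ n j z|) @ \oo --> `|f j z| by apply: cvg_norm; exact: ff.
  by apply: (cvgr_to_le h); apply: nearW => n; exact: fC.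
apply: (cl_lim clf fC fC' mf) => j.
have -> : (0 : R) = Rintegral m setT (fun=> 0) by rewrite Rintegral_cst// mul0r.
have ig : m.-integrable setT (EFin \o (fun z => (C + C) * weight j z)).
  by have := integrableZl measurableT (C + C) (integrable_weight j); apply: eq_integrable => // z _; rewrite /= EFinM.
apply: (Rintegral_dct measurableT _ _ _ ig _).2 => //.
- move=> n; apply: measurable_funM; last exact: measurable_weight.
  by apply: measurableT_comp => //; apply: measurable_funB => //; exact: cl_measurable.
- apply: aeW => z _.
  have h : (fun n => `|f_ n j z - f j z| * weight j z) @ \oo --> `|f j z - f j z| * weight j z.
    by apply: cvgM; [apply: cvg_norm; apply: cvgB; [exact: ff|exact: cvg_cst]|exact: cvg_cst].
  by rewrite subrr normr0 mul0r in h.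
- move=> n z _; rewrite normrM normr_id (ger0_norm (weight_ge0 j z)) ler_wpM2r ?weight_ge0//.
  by apply: le_trans (ler_normB _ _) _; exact: lerD.
Qed.

Lemma cl_ext f h : cl f -> (forall j z, f j z = h j z) -> cl h.
Proof. by move=> cf fh; rewrite (_ : h = f)//; apply/funext => j; apply/funext => z. Qed.

Lemma cl_istrig (F : (T -> R) -> R) : istrig F -> cl (fun j z => F (ev j z)).
Proof. by move=> [p hp]; apply: (cl_ext (cl_trig p)) => j z; rewrite hp. Qed.

Lemma cl_cst (x : R) : cl (fun _ _ => x).
Proof. exact: (cl_istrig (istrig_cst T x)). Qed.

Lemma cl_cvg_le (f_ h_ : nat -> J -> R * T -> R) f h K j : 0 <= K ->
  (forall n, measurable_fun setT (f_ n j)) -> measurable_fun setT (f j) ->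
  (forall n, measurable_fun setT (h_ n j)) -> measurable_fun setT (h j) ->
  (exists C, (forall n z, `|f_ n j z| <= C) /\ forall z, `|f j z| <= C) ->
  (forall n z, `|h_ n j z - h j z| <= K * `|f_ n j z - f j z|) ->
  (fun n => Rintegral m setT (fun z => `|f_ n j z - f j z| * weight j z)) @ \oo --> (0 : R) ->
  (fun n => Rintegral m setT (fun z => `|h_ n j z - h j z| * weight j z)) @ \oo --> (0 : R).
Proof.
move=> K0 mf_ mf mh_ mh [C [fC_ fC]] hK hc.
have up : (fun n => K * Rintegral m setT (fun z => `|f_ n j z - f j z| * weight j z)) @ \oo --> (0 : R).
  by rewrite -[X in _ --> X](mulr0 K); apply: cvgM => //; exact: cvg_cst.
have lo : (fun n : nat => 0 : R) @ \oo --> (0 : R) by exact: cvg_cst.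
have mfB n : measurable_fun setT (fun z => `|f_ n j z - f j z|).
  by apply: measurableT_comp => //; exact: measurable_funB.
have fB n z : `|(`|f_ n j z - f j z|)| <= C + C.
  by rewrite normr_id; apply: le_trans (ler_normB _ _) _; exact: lerD.
have i1 n := integrable_mul_weight j (mfB n) (fB n).
apply: (squeeze_cvgr _ lo up); apply: nearW => n; apply/andP; split.
  by apply: Rintegral_ge0 => z _; rewrite mulr_ge0// weight_ge0.
rewrite -(RintegralZl K measurableT (i1 n)); apply: le_Rintegral => //.
- apply: (@integrable_mul_weight j _ (K * (C + C))) => [|z].
    by apply: measurableT_comp => //; exact: measurable_funB.
  rewrite normr_id; apply: le_trans (hK n z) _; rewrite ler_wpM2l//.
  by have := fB n z; rewrite normr_id.
- by have := integrableZl measurableT K (i1 n); apply: eq_integrable => // z _; rewrite /= EFinM.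
- by move=> z _; rewrite mulrA ler_wpM2r ?weight_ge0.
Qed.

(** Induction on the first argument, and inside its base case on the second; symmetry of [op] lets
    one limit step serve both. A Lipschitz bound in one argument, uniform while the other stays
    bounded, transfers convergence in weighted L1. *)
Let cl_binop (op : R -> R -> R) (opC : R -> R) :
  (forall F G : (T -> R) -> R, istrig F -> istrig G -> istrig (fun y => op (F y) (G y))) ->
  (forall x y, op x y = op y x) -> measurable_fun setT (fun z : R * R => op z.1 z.2) ->
  (forall C, 0 <= opC C) ->
  (forall x x' y C, `|y| <= C -> `|op x y - op x' y| <= opC C * `|x - x'|) ->
  (forall C D, exists E, forall x y, `|x| <= C -> `|y| <= D -> `|op x y| <= E) ->
  forall f h, cl f -> cl h -> cl (fun j z => op (f j z) (h j z)).
Proof.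
move=> opt opsym mop opC0 oplip opbnd f h cf.
have mopp (f1 f2 : R * T -> R) : measurable_fun setT f1 -> measurable_fun setT f2 -> measurable_fun setT (fun z => op (f1 z) (f2 z)).
  by move=> m1' m2'; exact: (measurableT_comp mop (measurable_fun_pair m1' m2')).
have step (k : J -> R * T -> R) (f_ : nat -> J -> R * T -> R) (f' : J -> R * T -> R) C : cl k -> (forall n, cl (f_ n)) ->
    (forall n, cl (fun j z => op (f_ n j z) (k j z))) ->
    (forall n j z, `|f_ n j z| <= C) -> (forall j z, `|f' j z| <= C) ->
    (forall j, measurable_fun setT (f' j)) ->
    (forall j, (fun n => Rintegral m setT (fun z => `|f_ n j z - f' j z| * weight j z)) @ \oo --> (0 : R)) ->
    cl (fun j z => op (f' j z) (k j z)).
  move=> ck cf_ IH fC_ fC mf hc; have [D kD] := cl_bounded ck; have [E hE] := opbnd C D.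
  apply: (@cl_lim (fun n j z => op (f_ n j z) (k j z)) _ E) => //.
  - by move=> n j z; apply: hE.
  - by move=> j z; apply: hE.
  - by move=> j; apply: mopp => //; exact: cl_measurable.
  move=> j; apply: (@cl_cvg_le f_ (fun n j z => op (f_ n j z) (k j z)) f' (fun j z => op (f' j z) (k j z)) (opC D) j) => //.
  - by move=> n; exact: cl_measurable.
  - by move=> n; apply: mopp; exact: cl_measurable.
  - by apply: mopp => //; exact: cl_measurable.
  - by exists C.
  - by move=> n z; apply: oplip.
elim: cf h => [p|f_ {}f C cf_ IH fC_ fC mf hc] h ch; last first.
  by apply: (step h f_ f C) => // n; exact: IH.
elim: ch => [q|h_ {}h C ch_ IH hC_ hC mh hc].
  by apply: (@cl_istrig (fun y => op (trig p y) (trig q y))); apply: opt; [exists p|exists q].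
apply: (@cl_ext (fun j z => op (h j z) (trig p (ev j z)))) => [|j z]; last exact: opsym.
apply: (step _ h_ h C) => //; first exact: cl_trig.
by move=> n; apply: (cl_ext (IH n)) => j z; exact: opsym.
Qed.

Lemma cl_add f h : cl f -> cl h -> cl (fun j z => f j z + h j z).
Proof.
apply: (cl_binop (op := fun x y => x + y) (opC := fun=> 1)) => [F G|x y||//|x x' y C _|C D].
- exact: istrig_add.
- exact: addrC.
- by apply: measurable_funD; [exact: measurable_fst|exact: measurable_snd].
- by rewrite opprD addrACA subrr addr0 mul1r.
- by exists (C + D) => x y xC yD; apply: le_trans (ler_normD _ _) _; exact: lerD.
Qed.

Lemma cl_mul f h : cl f -> cl h -> cl (fun j z => f j z * h j z).
Proof.
apply: (cl_binop (op := fun x y => x * y) (opC := fun C => `|C|)) => [F G|x y||//|x x' y C yC|C D].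
- exact: istrig_mul.
- exact: mulrC.
- by apply: measurable_funM; [exact: measurable_fst|exact: measurable_snd].
- by rewrite -mulrBl normrM mulrC ler_wpM2r//; exact: le_trans yC (ler_norm _).
- by exists (C * D) => x y xC yD; rewrite normrM; exact: ler_pM.
Qed.

(** Squares of uniformly bounded functions converge in weighted L1 along with the functions. The
    same rank [n] is used for every [j], so the inequality passes to the limit whatever the signs
    [sig j] are. *)
Lemma cl_positive f : cl f -> 0 <= \sum_j sig j * Rintegral m setT (fun z => f j z ^+ 2 * weight j z).
Proof.
elim=> [p|f_ {}f C cf_ IH fC_ fC mf hc].
  by apply: (trig_square_positive (G := trig p)); exists p.
have C0 (j : J) : 0 <= C by exact: le_trans (normr_ge0 _) (fC j (0, [tuple 0 | i < d])).
have key j : (fun n => Rintegral m setT (fun z => f_ n j z ^+ 2 * weight j z)) @ \oo -->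
    Rintegral m setT (fun z => f j z ^+ 2 * weight j z).
  have sq n z : `|f_ n j z ^+ 2 - f j z ^+ 2| <= (C + C) * `|f_ n j z - f j z|.
    rewrite subr_sqr normrM mulrC ler_wpM2r//.
    by apply: le_trans (ler_normD _ _) _; exact: lerD.
  have h := @cl_cvg_le f_ (fun n j z => f_ n j z ^+ 2) f (fun j z => f j z ^+ 2) (C + C) j.
  have {}h : (fun n => Rintegral m setT (fun z => `|f_ n j z ^+ 2 - f j z ^+ 2| * weight j z)) @ \oo --> (0 : R).
    apply: h => //.
    - by rewrite addr_ge0 ?(C0 j).
    - by move=> n; exact: cl_measurable.
    - by move=> n; apply: measurable_funX; exact: cl_measurable.
    - exact: measurable_funX.
    - by exists C.
  have i2 (k : J -> R * T -> R) : (forall j z, `|k j z| <= C) -> measurable_fun setT (k j) ->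
      m.-integrable setT (EFin \o (fun z => k j z ^+ 2 * weight j z)).
    move=> kC mk; apply: (@integrable_mul_weight j _ (C ^+ 2)) => [|z]; first exact: measurable_funX.
    by rewrite normrX lerXn2r ?nnegrE// (C0 j).
  apply/cvgrPdist_le => e e0; have /cvgrPdist_le /(_ _ e0) := h; apply: filterS => n.
  rewrite sub0r normrN ger0_norm; last first.
    by apply: Rintegral_ge0 => z _; rewrite mulr_ge0// weight_ge0.
  apply: le_trans; rewrite distrC -RintegralB//; [|by apply: i2 => //; exact: cl_measurable|exact: i2].
  have iB : m.-integrable setT (EFin \o (fun z => f_ n j z ^+ 2 * weight j z - f j z ^+ 2 * weight j z)).
    have := integrableB measurableT (i2 _ (fC_ n) (cl_measurable (cf_ n) j)) (i2 _ fC (mf j)).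
    by apply: eq_integrable => // z _; rewrite /= EFinB.
  apply: le_trans (le_normr_Rintegral measurableT iB) _; apply: le_Rintegral => //.
  - exact: (integrable_abse iB).
  - apply: (@integrable_mul_weight j _ (C ^+ 2 + C ^+ 2)) => [|z].
      apply: measurableT_comp => //; apply: measurable_funB; apply: measurable_funX => //; exact: cl_measurable.
    rewrite normr_id; apply: le_trans (ler_normB _ _) _; rewrite !normrX.
    by apply: lerD; rewrite lerXn2r ?nnegrE// (C0 j).
  - by move=> z _; rewrite -mulrBl normrM (ger0_norm (weight_ge0 j z)).
have cS : (fun n => \sum_j sig j * Rintegral m setT (fun z => f_ n j z ^+ 2 * weight j z)) @ \oo -->
    \sum_j sig j * Rintegral m setT (fun z => f j z ^+ 2 * weight j z).
  by apply: cvg_bigsum => j; apply: cvgM; [exact: cvg_cst|exact: key].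
by apply: (cvgr_to_ge cS); apply: nearW => n; exact: IH.
Qed.

End Weight.
End Main.

(** * Polynomials converging to a step function *)

Section StepPolynomials.
Context (R : realType).

Lemma bernoulli_le (x : R) n : -1 <= x -> 1 + n%:R * x <= (1 + x) ^+ n.
Proof.
move=> x1; elim: n => [|n IH]; first by rewrite mul0r addr0 expr0.
have x10 : 0 <= 1 + x by lra.
rewrite exprSr; apply: le_trans (ler_wpM2r x10 IH).
have : 0 <= n%:R * x ^+ 2 by rewrite mulr_ge0 ?sqr_ge0.
rewrite -natr1; nra.
Qed.

Lemma cvg_natmul_expr (a : R) : 0 <= a < 1 -> (fun n => n%:R * a ^+ n) @ \oo --> (0 : R).
Proof.
move=> /andP[a0 a1].
(* The lower bound 1/2 makes the square root [s] positive. Bernoulli's inequality bounds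
   [n * s ^+ n], and the second factor [s ^+ n] tends to 0. *)
pose a' := Num.max a (1 / 2); pose s := Num.sqrt a'.
have a'0 : 0 < a' by rewrite lt_max; apply/orP; right; lra.
have a'1 : a' < 1 by rewrite gt_max a1; lra.
have s0 : 0 < s by rewrite sqrtr_gt0.
have s2 : s ^+ 2 = a' by rewrite sqr_sqrtr// ltW.
have s1 : s < 1 by rewrite -(@ltr_pXn2r _ 2)// ?nnegrE ?(ltW s0)// s2 expr1n.
pose h := s^-1 - 1.
have h0 : 0 < h by rewrite subr_gt0 invf_gt1.
have ns n : n%:R * s ^+ n <= h^-1.
  have b := @bernoulli_le h n ltac:(lra).
  have e : 1 + h = s^-1 by rewrite /h; ring.
  rewrite e exprVn in b.
  rewrite -[leRHS]mul1r ler_pdivlMr// mulrAC.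
  have sn : 0 < s ^+ n by rewrite exprn_gt0.
  rewrite -ler_pdivlMr// mul1r; lra.
have up : (fun n => h^-1 * s ^+ n) @ \oo --> (0 : R).
  rewrite -(mulr0 h^-1); apply: cvgM; first exact: cvg_cst.
  by apply: cvg_expr; rewrite gtr0_norm.
have lo : (fun n : nat => 0 : R) @ \oo --> (0 : R) by exact: cvg_cst.
apply: (squeeze_cvgr _ lo up); apply: nearW => n; apply/andP; split.
  by rewrite mulr_ge0// exprn_ge0.
apply: (@le_trans _ _ (n%:R * a' ^+ n)).
  by rewrite ler_wpM2l// lerXn2r ?nnegrE ?(ltW a'0)// le_max lexx.
by rewrite -s2 expr2 exprMn mulrA ler_wpM2r// exprn_ge0// ltW.
Qed.

(** The outer exponent times [u ^+ n.+1] equals [(n + 1) * (2 * u) ^+ n.+1], which tends to 0 for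
    [u < 1 / 2] and is at least [n + 1] from 1/2 on. *)
Definition stepp n (u : R) := (1 - u ^+ n.+1) ^+ (n.+1 * 2 ^ n.+1).

Lemma stepp_itv n u : 0 <= u <= 1 -> 0 <= stepp n u <= 1.
Proof.
move=> /andP[u0 u1].
have h1 : 0 <= 1 - u ^+ n.+1 by rewrite subr_ge0 exprn_ile1.
by rewrite /stepp exprn_ge0// exprn_ile1// gerBl exprn_ge0.
Qed.

(** Write [v] for [u ^+ n.+1] and [k] for the outer exponent. Below 1/2, Bernoulli gives
    [(1 - v) ^+ k >= 1 - k * v], which tends to 1. From 1/2 on, the product of [(1 - v) ^+ k] and
    [(1 + v) ^+ k] is at most 1, while the second factor is at least [1 + k * v >= n + 1]. *)
Lemma stepp_cvg u : 0 <= u <= 1 -> (fun n => stepp n u) @ \oo --> ((u < 1 / 2)%R%:R : R).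
Proof.
move=> u01; have /andP[u0 u1] := u01.
have un n : 0 <= u ^+ n <= 1 by rewrite exprn_ge0// exprn_ile1.
have e n : (n.+1 * 2 ^ n.+1)%:R * u ^+ n.+1 = n.+1%:R * (2 * u) ^+ n.+1.
  by rewrite natrM natrX exprMn mulrA.
have one : (fun n : nat => 1 : R) @ \oo --> (1 : R) by exact: cvg_cst.
case: ltP => hu.
  have c0 : (fun n => n%:R * (2 * u) ^+ n) @ \oo --> (0 : R) by apply: cvg_natmul_expr; lra.
  rewrite -cvg_shiftS in c0.
  have lo : (fun n => 1 - n.+1%:R * (2 * u) ^+ n.+1) @ \oo --> (1 : R).
    by rewrite -[X in _ --> X]subr0; apply: cvgB.
  apply: (squeeze_cvgr _ lo one); apply: nearW => n; apply/andP; split.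
    rewrite -e /stepp -mulrN; apply: bernoulli_le; have := un n.+1; lra.
  by have /andP[] := stepp_itv n u01.
have lo : (fun n : nat => 0 : R) @ \oo --> (0 : R) by exact: cvg_cst.
have up : (fun n : nat => n.+1%:R^-1 : R) @ \oo --> (0 : R) by exact: cvg_harmonic.
apply: (squeeze_cvgr _ lo up); apply: nearW => n; apply/andP; split.
  by have /andP[] := stepp_itv n u01.
have u1n : 1 <= (2 * u) ^+ n.+1 by apply: exprn_ege1; lra.
have pp : 0 < 1 + u ^+ n.+1 by have := un n.+1; lra.
set k := (n.+1 * 2 ^ n.+1)%N.
have b : n.+1%:R <= (1 + u ^+ n.+1) ^+ k.
  have b1 := @bernoulli_le (u ^+ n.+1) k ltac:(have := un n.+1; lra).
  apply: le_trans b1; rewrite e; have := ler_wpM2l (ler0n R n.+1) u1n; lra.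
have q : stepp n u * (1 + u ^+ n.+1) ^+ k <= 1.
  rewrite /stepp -/k -exprMn exprn_ile1//; have := un n.+1; nra.
rewrite -[leRHS]mul1r ler_pdivlMr ?ltr0n//; apply: le_trans q.
by rewrite ler_wpM2l//; have /andP[] := stepp_itv n u01.
Qed.

End StepPolynomials.

Lemma lt_of_half (R : realType) (a y x k : R) : k <= (a - x) / 2 -> a - y < (a - x) / 2 -> x + k < y.
Proof. lra. Qed.

(** * Sets with indicators in the closure *)

Section Sets.
Context (R : realType) (d : nat) (lam : {sigma_finite_measure set (d.-tuple R) -> \bar R}).
Context (rho : {sigma_finite_measure set R -> \bar R}).
Context (g : d.-tuple R -> R).
Hypothesis mg : measurable_fun setT g.
Context (J : finType) (c : J -> R).
Let T := d.-tuple R.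
Let m := (rho \x lam)%E.
Hypothesis int_cos : forall (r : R) (u : T), m.-integrable setT (EFin \o (fun z => 1 - cos (r * z.1 * g (tsub u z.2)))).
Context (r : R) (u0 : T).
Local Notation clf := (cl lam rho g c r u0).
Implicit Types (f h : J -> R * T -> R) (E : J -> set (R * T)).

Let add := @cl_add R d lam rho g mg J c int_cos r u0.
Let mul := @cl_mul R d lam rho g mg J c int_cos r u0.
Let cst := @cl_cst R d lam rho g J c r u0.
Let lim := @cl_pointwise R d lam rho g mg J c int_cos r u0.

Lemma cl_scale x f : clf f -> clf (fun j z => x * f j z).
Proof. exact: (mul (cst x)). Qed.

Lemma cl_sub f h : clf f -> clf h -> clf (fun j z => f j z - h j z).
Proof. by move=> cf ch; apply: (cl_ext (add cf (cl_scale (-1) ch))) => j z; rewrite mulN1r. Qed.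

Lemma cl_exp f n : clf f -> clf (fun j z => f j z ^+ n).
Proof.
move=> cf; elim: n => [|n IH]; first by apply: (cl_ext (cst 1)) => j z; rewrite expr0.
by apply: (cl_ext (mul cf IH)) => j z; rewrite exprS.
Qed.

Lemma cl_prod (f_ : nat -> J -> R * T -> R) n : (forall k, clf (f_ k)) -> clf (fun j z => \prod_(k < n) f_ k j z).
Proof.
move=> cf; elim: n => [|n IH]; first by apply: (cl_ext (cst 1)) => j z; rewrite big_ord0.
by apply: (cl_ext (mul IH (cf n))) => j z; rewrite big_ord_recr.
Qed.

Lemma cl_sum (I : Type) (s : seq I) (f_ : I -> J -> R * T -> R) : (forall k, clf (f_ k)) ->
  clf (fun j z => \sum_(k <- s) f_ k j z).
Proof.
move=> cf; elim: s => [|i s IH]; first by apply: (cl_ext (cst 0)) => j z; rewrite big_nil.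
by apply: (cl_ext (add (cf i) IH)) => j z; rewrite big_cons.
Qed.

(** One set for each [j], because a member of the closure is a whole tuple of functions. *)
Definition clset E := clf (fun j z => \1_(E j) z).

Lemma clset_ext E E' : clset E -> (forall j, E j = E' j) -> clset E'.
Proof. by move=> hE EE; apply: (cl_ext hE) => j z; rewrite EE. Qed.

Lemma clsetC E : clset E -> clset (fun j => ~` E j).
Proof.
by move=> hE; apply: (cl_ext (cl_sub (cst 1) hE)) => j z; rewrite !indicE in_setC; case: (z \in E j); rewrite ?subrr ?subr0.
Qed.

Lemma clset_bigcap (E_ : nat -> J -> set (R * T)) : (forall n, clset (E_ n)) ->
  clset (fun j => \bigcap_n E_ n j).
Proof.
move=> hE; apply: (@lim (fun n j z => \prod_(k < n) \1_(E_ k j) z) _ 1).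
- by move=> n; exact: (@cl_prod (fun k j z => \1_(E_ k j) z) n hE).
- move=> n j z; elim: n => [|n IH]; first by rewrite big_ord0 normr1.
  rewrite big_ord_recr normrM /= -[leRHS]mulr1; apply: ler_pM => //.
  by rewrite indicE; case: (z \in _); rewrite ?normr1 ?normr0.
move=> j z; have [Ez|/existsNP[N]] := pselect (forall n, E_ n j z).
  apply: cvg_near_cst; apply: nearW => n; rewrite indicE mem_set => [|k _]; last exact: Ez.
  by rewrite big1// => k _; rewrite indicE mem_set.
move=> nE; apply: cvg_near_cst; near=> n.
have Nn : (N < n)%N by near: n; exact: nbhs_infty_gt.
rewrite (bigD1 (Ordinal Nn))//= indicE memNset// mul0r indicE memNset// => h.
by apply: nE; exact: h.
Unshelve. all: by end_near. Qed.

Lemma clset_bigcup (E_ : nat -> J -> set (R * T)) : (forall n, clset (E_ n)) ->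
  clset (fun j => \bigcup_n E_ n j).
Proof.
move=> hE; apply: (clset_ext (clsetC (clset_bigcap (fun n => clsetC (hE n))))) => j.
by rewrite setC_bigcap; apply: eq_bigcupr => n _; rewrite setCK.
Qed.

(** Members of the closure are bounded, so an affine map sends [f] into [[0, 1]] with [f > x]
    exactly below 1/2, where [stepp] converges to 1; elsewhere it converges to 0. *)
Lemma clset_gt f x : clf f -> clset (fun j => [set z | x < f j z]).
Proof.
move=> cf; have [C hC] := cl_bounded cf.
pose K := `|C| + `|x| + 1; have K0 : 0 < K by rewrite ltr_wpDl// addr_ge0.
pose u j z := 1 / 2 - (f j z - x) / (2 * K).
have uE j z : 0 <= u j z <= 1 /\ (u j z < 1 / 2) = (x < f j z).
  have hf : `|f j z - x| <= K.
    apply: le_trans (ler_normB _ _) _; have := hC j z; have := ler_norm C; rewrite /K; lra.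
  split; last by rewrite /u ltrBlDr ltrDl pmulr_lgt0 ?invr_gt0 ?mulr_gt0// subr_gt0.
  have e : `|(f j z - x) / (2 * K)| <= 1 / 2.
    rewrite normf_div [`|2 * K|]gtr0_norm ?mulr_gt0// ler_pdivrMr ?mulr_gt0//; lra.
  by move: e; rewrite ler_norml /u => /andP[]; lra.
have cu : clf u.
  apply: (cl_ext (cl_sub (cst (1 / 2)) (cl_scale (2 * K)^-1 (cl_sub cf (cst x))))) => j z.
  by rewrite /u [_^-1 * _]mulrC.
apply: (@lim (fun n j z => stepp n (u j z)) _ 1).
- by move=> n; apply: cl_exp; apply: cl_sub => //; exact: cl_exp.
- by move=> n j z; have /andP[h1 h2] := stepp_itv n (uE j z).1; rewrite ger0_norm.
move=> j z; have := stepp_cvg (uE j z).1; rewrite (uE j z).2 indicE.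
have -> // : (z \in [set z | x < f j z]) = (x < f j z).
by apply/idP/idP => [/set_mem//|h]; exact/mem_set.
Qed.

(** The limit exceeds [x] if and only if, for some [k], all terms from some rank on exceed
    [x + 1 / (k + 1)]. This reaches unbounded limits, which lie outside the closure although their
    level sets have indicators in it. *)
Lemma clset_gt_lim (f_ : nat -> J -> R * T -> R) f :
  (forall n x, clset (fun j => [set z | x < f_ n j z])) -> (forall j z, (fun n => f_ n j z) @ \oo --> f j z) ->
  forall x, clset (fun j => [set z | x < f j z]).
Proof.
move=> hf ff x.
apply: (clset_ext (clset_bigcup (fun k => clset_bigcup (fun N => clset_bigcap (fun n => hf (N + n)%N (x + k.+1%:R^-1)))))) => j.
apply/seteqP; split => z /=.
  move=> [k _ [N _ h]]; apply: (@lt_le_trans _ _ (x + k.+1%:R^-1)); first by rewrite ltrDl invr_gt0.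
  apply: (cvgr_to_ge (ff j z)); exists N => // n /= Nn.
  by have := h (n - N)%N I; rewrite /= subnKC// => /ltW.
move=> xf; have fx : 0 < (f j z - x) / 2 by rewrite divr_gt0// subr_gt0.
have [k _ hk] := near_invS_le fx; have {}hk := hk k (leqnn k).
have /cvgrPdist_lt /(_ _ fx)[N _ hN] := ff j z.
exists k => //; exists N => // n _ /=.
have := hN (N + n)%N (leq_addr _ _); rewrite ltr_norml /= => /andP[_]; exact: lt_of_half.
Qed.

(** Stability under complements and countable unions reduces Borel sets to half-lines. The factor
    [a] stands for the integral of [g], by which averaging multiplies the jump sizes. *)
Lemma clset_borel (a : R) (f : J -> R * T -> R) : a != 0 ->
  (forall x, clset (fun j => [set z | x < a * f j z])) ->
  forall B : set R, measurable B -> clset (fun j => f j @^-1` B).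
Proof.
move=> a0 hf.
have H : <<s @RGenOInfty.G R >> `<=` [set B | clset (fun j => (fun z => a * f j z) @^-1` B)].
  apply: smallest_sub.
    split => /=.
    - by apply: (cl_ext (cst 0)) => j z; rewrite preimage_set0 indic0.
    - by move=> B SB; rewrite setTD; apply: (clset_ext (clsetC SB)) => j; rewrite preimage_setC.
    - by move=> F SF; apply: (clset_ext (clset_bigcup SF)) => j; rewrite preimage_bigcup.
  move=> _ [x ->] /=; apply: (clset_ext (hf x)) => j.
  by apply/seteqP; split => z /=; rewrite in_itv /= andbT.
move=> B mB; have mB' : measurable ((fun y : R => a^-1 * y) @^-1` B).
  by rewrite -[X in measurable X]setTI; apply: (@mulrl_measurable R setT a^-1).
have {}mB' : <<s @RGenOInfty.G R >> ((fun y : R => a^-1 * y) @^-1` B).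
  exact: (eq_ind _ (fun S : set (set R) => S ((fun y : R => a^-1 * y) @^-1` B)) mB' _ (@RGenOInfty.measurableE R)).
apply: (clset_ext (H _ mB')) => j; apply/seteqP; split => z /=; by rewrite mulKf.
Qed.

Lemma cl_borel_fun (f : J -> R * T -> R) (beta : R -> R) C :
  (forall B : set R, measurable B -> clset (fun j => f j @^-1` B)) ->
  measurable_fun setT beta -> (forall y, `|beta y| <= C) -> clf (fun j z => beta (f j z)).
Proof.
move=> hf mb bC.
have approx n : exists h : J -> R * T -> R, clf h /\ forall j z, `|beta (f j z) - h j z| <= n.+1%:R^-1.
  have e0 : 0 < n.+1%:R^-1 :> R by rewrite invr_gt0.
  have [N [idx [x [midx hx]]]] := finidx_approx mb bC e0.
  exists (fun j z => x (idx (f j z))); split => [|j z]; last exact: hx.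
  apply: (@cl_ext _ _ _ _ _ _ _ _ _ (fun j z => \sum_i x i * \1_(f j @^-1` (idx @^-1` [set i])) z)) => [|j z].
    by apply: cl_sum => i; apply: cl_scale; exact: hf.
  rewrite (bigD1 (idx (f j z)))//= indicE mem_set// mulr1 big1 ?addr0// => i ne.
  by rewrite indicE memNset ?mulr0//= => e; rewrite e eqxx in ne.
have [h hh] := choice approx.
apply: (@lim h _ (C + 1)).
- by move=> n; exact: (hh n).1.
- move=> n j z; have -> : h n j z = beta (f j z) - (beta (f j z) - h n j z) by ring.
  apply: le_trans (ler_normB _ _) _; apply: lerD => //; apply: le_trans ((hh n).2 j z) _.
  by rewrite invf_le1// ler1n.
move=> j z; apply/cvgrPdist_le => e e0; near=> n.
by apply: le_trans ((hh n).2 j z) _; near: n; exact: near_invS_le.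
Unshelve. all: by end_near. Qed.

End Sets.

(** * Fubini's theorem over a set of finite measure *)

Section ProductIntegrable.
Context d1 d2 (S : measurableType d1) (T : measurableType d2) (R : realType).
Context (m : {sigma_finite_measure set S -> \bar R}) (lam : {sigma_finite_measure set T -> \bar R}).

Lemma integrable_prod_bounded (F : S -> R) (k : S * T -> R) (C : set T) :
  m.-integrable setT (EFin \o F) -> measurable_fun setT k -> (forall q, `|k q| <= 1) ->
  measurable C -> (lam C < +oo)%E ->
  (m \x lam)%E.-integrable setT (EFin \o (fun q => F q.1 * k q * \1_C q.2)).
Proof.
move=> iF mk k1 mC lC; have mF := measurable_integrable iF.
have mf : measurable_fun setT (fun q : S * T => F q.1 * k q * \1_C q.2).
  apply: measurable_funM; first by apply: measurable_funM => //; exact: (measurableT_comp mF measurable_fst).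
  exact: (measurableT_comp (measurable_indic mC) measurable_snd).
apply/integrable12ltyP; first exact/measurable_EFinP.
have iV : m.-integrable setT (EFin \o (fun z => `|F z| * fine (lam C))).
  have := integrableZr measurableT (fine (lam C)) (integrable_abse iF).
  by apply: eq_integrable => // z _; rewrite /= EFinM.
have fC : lam C \is a fin_num by rewrite ge0_fin_numE.
case/integrableP: iV => mV; apply: le_lt_trans; apply: ge0_le_integral => //.
- by move=> z _; apply: integral_ge0.
- have mf' : measurable_fun setT (fun q : S * T => `|(F q.1 * k q * \1_C q.2)%:E|%E).
    by apply: measurableT_comp => //; exact/measurable_EFinP.
  exact: (@measurable_fun_fubini_tonelli_F _ _ _ _ _ lam _ mf' (fun q => abse_ge0 _)).
- exact: measurableT_comp.
move=> z _; rewrite /= normrM normr_id (ger0_norm (fine_ge0 _))// EFinM fineK//.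
have mCE : measurable_fun setT (fun y => (\1_C y)%:E : \bar R) by apply/measurable_EFinP; exact: measurable_indic.
have -> : lam C = (\int[lam]_y (\1_C y)%:E)%E by rewrite integral_indic// setIT.
rewrite -ge0_integralZl_EFin//.
apply: ge0_le_integral => //.
- apply/measurable_EFinP; apply: measurableT_comp => //; apply: measurable_funM; last exact: measurable_indic.
  apply: measurable_funM; first exact: measurable_cst.
  exact: (measurableT_comp mk (measurable_pair1 z)).
- exact: emeasurable_funM.
- move=> y _; rewrite -EFinM lee_fin !normrM indicE (ger0_norm (ler0n R _)).
  by rewrite ler_wpM2r// ler_piMr.
Qed.

Lemma sigma_finite_prod : sigma_finite setT (m \x lam)%E.
Proof.
have /sigma_finiteP[F [UF ndF Foo]] := sigma_finiteT m.
have /sigma_finiteP[G [UG ndG Goo]] := sigma_finiteT lam.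
exists (fun n => F n `*` G n).
  apply/seteqP; split => // -[x y] _.
  have [i _ Fx] : (\bigcup_n F n) x by rewrite -UF.
  have [j _ Gy] : (\bigcup_n G n) y by rewrite -UG.
  exists (maxn i j) => //; split => /=.
    by apply: (subsetPset _ _ (ndF i (maxn i j) _)) => //; exact: leq_maxl.
  by apply: (subsetPset _ _ (ndG j (maxn i j) _)) => //; exact: leq_maxr.
move=> n; have [mF lF] := Foo n; have [mG lG] := Goo n.
split; first exact: measurableX.
by rewrite product_measure1E// lte_mul_pinfty// ge0_fin_numE.
Qed.

Lemma fubini_bounded (F : S -> R) (k : S * T -> R) (C : set T) :
  m.-integrable setT (EFin \o F) -> measurable_fun setT k -> (forall q, `|k q| <= 1) ->
  measurable C -> (lam C < +oo)%E ->
  lam.-integrable setT (EFin \o (fun u => Rintegral m setT (fun z => F z * k (z, u) * \1_C u))) /\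
  Rintegral lam setT (fun u => Rintegral m setT (fun z => F z * k (z, u) * \1_C u)) =
  Rintegral m setT (fun z => Rintegral lam setT (fun u => F z * k (z, u) * \1_C u)).
Proof.
move=> iF mk k1 mC lC; have ip := integrable_prod_bounded iF mk k1 mC lC.
by have [i1 r1] := Rintegral12 ip; have [i2 r2] := Rintegral21 ip; split; [exact: i2|rewrite r2 -r1].
Qed.

End ProductIntegrable.

(** The first measure is a plain one with sigma-finiteness as a hypothesis, so that the product of
    [rho] and [lam] can be taken for it. *)
Lemma sigma_finite_fubini_bounded d1 d2 (S : measurableType d1) (T : measurableType d2) (R : realType)
    (m : {measure set S -> \bar R}) (lam : {sigma_finite_measure set T -> \bar R})
    (F : S -> R) (k : S * T -> R) (C : set T) : sigma_finite setT m ->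
  m.-integrable setT (EFin \o F) -> measurable_fun setT k -> (forall q, `|k q| <= 1) ->
  measurable C -> (lam C < +oo)%E ->
  lam.-integrable setT (EFin \o (fun u => Rintegral m setT (fun z => F z * k (z, u) * \1_C u))) /\
  Rintegral lam setT (fun u => Rintegral m setT (fun z => F z * k (z, u) * \1_C u)) =
  Rintegral m setT (fun z => Rintegral lam setT (fun u => F z * k (z, u) * \1_C u)).
Proof. by move=> /pack_sigma_finite[m' ->]; exact: fubini_bounded. Qed.

Lemma greedy_step (R : realType) (x y i k : R) : x <= k * (2 + 4 * i) -> y <= 1 ->
  x + 2 * y + 4 * i <= (k + 1) * (2 + 4 * i).
Proof. by move=> h1 h2; lra. Qed.

(** * Averages over translations *)

Section Average.
Context (R : realType) (d : nat) (lam : {sigma_finite_measure set (d.-tuple R) -> \bar R}).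
Context (rho : {sigma_finite_measure set R -> \bar R}).
Context (g : d.-tuple R -> R).
Hypothesis mg : measurable_fun setT g.
Context (J : finType) (c : J -> R).
Let T : measurableType _ := (d.-tuple R : Type).
Let m := (rho \x lam)%E.
Hypothesis int_cos : forall (r : R) (u : d.-tuple R), m.-integrable setT (EFin \o (fun z => 1 - cos (r * z.1 * g (tsub u z.2)))).
Context (r : R) (u0 : d.-tuple R).
Local Notation clf := (cl lam rho g c r u0).
Local Notation W := (weight g c r u0).
Context (C : set (d.-tuple R)) (t : R).
Hypothesis mC : measurable C.
Hypothesis lC : (lam C < +oo)%E.
Let V := fine (lam C).
Hypothesis V0 : 0 < V.

Let h (u : d.-tuple R) j z : R := sin (t * ev g c j z u).
(** For fixed [u] the sine is a trigonometric polynomial, but its average over [C] is not. As [g] is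
    only measurable, Riemann sums may fail to converge to the average; the points [u] are chosen by
    an energy argument instead. *)
Definition average j z : R := V^-1 * Rintegral lam setT (fun u => h u j z * \1_C u).

Let h1 u j z : `|h u j z| <= 1. Proof. exact: sin_max. Qed.

Let mjoint j : measurable_fun setT (fun q : (R * d.-tuple R) * d.-tuple R => h q.2 j q.1).
Proof.
apply: measurable_sin_comp; apply: measurable_funM; first exact: measurable_cst.
apply: measurable_funM.
  apply: measurable_funM; first exact: measurable_cst.
  exact: (measurableT_comp measurable_fst measurable_fst).
apply: (measurableT_comp mg); apply/measurable_fun_tnthP => i.
apply: (@eq_measurable_fun _ _ _ _ _ (fun q : (R * d.-tuple R) * d.-tuple R => tnth q.2 i - tnth q.1.2 i)).
  by move=> z _ /=; rewrite tnth_mktuple.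
apply: measurable_funB.
  exact: (measurableT_comp (measurable_tnth i) measurable_snd).
exact: (measurableT_comp (measurable_tnth i) (measurableT_comp measurable_snd measurable_fst)).
Qed.

Let mh u j : measurable_fun setT (h u j).
Proof.
apply: measurable_sin_comp; apply: measurable_funM; first exact: measurable_cst.
exact: measurable_ev.
Qed.

Let mhu j z : measurable_fun setT (fun u => h u j z).
Proof. exact: (measurableT_comp (mjoint j) (measurable_pair1 z)). Qed.

Let iC : lam.-integrable setT (EFin \o (\1_C : d.-tuple R -> R)).
Proof.
apply/integrableP; split; first by apply/measurable_EFinP; exact: measurable_indic.
rewrite (eq_integral (fun u => (\1_C u)%:E)) => [|u _]; first by rewrite integral_indic// setIT.
by rewrite /= ger0_norm.
Qed.

Let ihC j z : lam.-integrable setT (EFin \o (fun u => h u j z * \1_C u)).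
Proof.
apply: (integrable_le measurableT _ iC) => [|u _].
  by apply: measurable_funM => //; exact: measurable_indic.
by rewrite normrM indicE (ger0_norm (ler0n R _)) ler_piMl.
Qed.

Let iC1 : Rintegral lam setT (\1_C : d.-tuple R -> R) = V.
Proof. by rewrite /Rintegral integral_indic// setIT. Qed.

Lemma average_le1 j z : `|average j z| <= 1.
Proof.
rewrite /average normrM gtr0_norm ?invr_gt0// ler_pdivrMl// mulr1.
apply: le_trans (le_normr_Rintegral measurableT (ihC j z)) _; rewrite -[leRHS]iC1.
apply: (@le_Rintegral _ _ _ lam setT (fun u => `|h u j z * \1_C u|) \1_C measurableT (integrable_abse (ihC j z)) iC).
by move=> u _; rewrite normrM indicE (ger0_norm (ler0n R _)) ler_piMl.
Qed.

Lemma measurable_average j : measurable_fun setT (average j).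
Proof.
pose k q : R := (1 + h q.2 j q.1) * \1_C q.2.
have mk : measurable_fun setT (fun q : (R * d.-tuple R) * d.-tuple R => (k q)%:E).
  apply/measurable_EFinP; apply: measurable_funM; first by apply: measurable_funD => //; exact: measurable_cst.
  exact: (measurableT_comp (measurable_indic mC) measurable_snd).
have k0 q : (0 <= (k q)%:E)%E.
  by rewrite lee_fin mulr_ge0//; have := h1 q.2 j q.1; rewrite ler_norml; lra.
have mF := @measurable_fun_fubini_tonelli_F _ _ _ _ _ lam _ mk k0.
have e z : average j z = V^-1 * (fine (fubini_F lam (fun q => (k q)%:E) z) - V).
  rewrite /average; congr (_ * _); rewrite /fubini_F /k /=.
  rewrite -[fine _]/(Rintegral lam setT (fun u => (1 + h u j z) * \1_C u)).
  have -> : Rintegral lam setT (fun u => (1 + h u j z) * \1_C u) = Rintegral lam setT (fun u => \1_C u + h u j z * \1_C u).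
    by apply: eq_Rintegral => u _; ring.
  by rewrite (RintegralD measurableT iC (ihC j z)) iC1 addrAC subrr add0r.
rewrite (_ : average j = fun z => V^-1 * (fine (fubini_F lam (fun q => (k q)%:E) z) - V)); last exact/funext.
apply: measurable_funM; first exact: measurable_cst.
apply: measurable_funB; last exact: measurable_cst.
exact: (measurableT_comp (fine_measurable measurableT) mF).
Qed.

Let Wint j := @integrable_weight R d lam rho g mg J c int_cos r u0 j.
Let mulW j (f : R * d.-tuple R -> R) (K : R) (mf : measurable_fun setT f) (fK : forall z, `|f z| <= K) :=
  @integrable_mul_weight R d lam rho g mg J c int_cos r u0 j f K mf fK.

Lemma average_fubini j (D : R * d.-tuple R -> R) K : measurable_fun setT D -> (forall z, `|D z| <= K) ->
  lam.-integrable setT (EFin \o (fun u => Rintegral m setT (fun z => D z * h u j z * W j z) * \1_C u)) /\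
  Rintegral lam setT (fun u => Rintegral m setT (fun z => D z * h u j z * W j z) * \1_C u) =
  V * Rintegral m setT (fun z => D z * average j z * W j z).
Proof.
move=> mD DK.
have iDW := mulW j mD DK.
have msf : sigma_finite setT m by exact: sigma_finite_prod.
have [i2 r2] : lam.-integrable setT (EFin \o (fun u => Rintegral m setT (fun z => D z * W j z * h u j z * \1_C u))) /\
    Rintegral lam setT (fun u => Rintegral m setT (fun z => D z * W j z * h u j z * \1_C u)) =
    Rintegral m setT (fun z => Rintegral lam setT (fun u => D z * W j z * h u j z * \1_C u)).
  exact: (@sigma_finite_fubini_bounded _ _ _ _ R m lam (fun z => D z * W j z) (fun q => h q.2 j q.1) C
    msf iDW (mjoint j) (fun q => h1 q.2 j q.1) mC lC).
have e2 u : Rintegral m setT (fun z => D z * h u j z * W j z) * \1_C u =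
    Rintegral m setT (fun z => D z * W j z * h u j z * \1_C u).
  have iDh : m.-integrable setT (EFin \o (fun z => D z * h u j z * W j z)).
    apply: (@mulW j (fun z => D z * h u j z) K) => [|z]; first exact: measurable_funM.
    by rewrite normrM; apply: le_trans (DK z); rewrite ler_piMr.
  rewrite -(RintegralZr (\1_C u) measurableT iDh); apply: eq_Rintegral => z _; ring.
have e1 z : Rintegral lam setT (fun u => D z * W j z * h u j z * \1_C u) = V * (D z * average j z * W j z).
  have -> : V * (D z * average j z * W j z) = D z * W j z * Rintegral lam setT (fun u => h u j z * \1_C u).
    rewrite /average; field; exact: lt0r_neq0.
  by rewrite -(RintegralZl (D z * W j z) measurableT (ihC j z)); apply: eq_Rintegral => u _; ring.
split.
  by apply: eq_integrable i2 => // u _; rewrite /= e2.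
have iDa : m.-integrable setT (EFin \o (fun z => D z * average j z * W j z)).
  apply: (@mulW j (fun z => D z * average j z) K) => [|z].
    by apply: measurable_funM => //; exact: measurable_average.
  by rewrite normrM; apply: le_trans (DK z); rewrite ler_piMr// average_le1.
rewrite -(RintegralZl V measurableT iDa).
transitivity (Rintegral lam setT (fun u => Rintegral m setT (fun z => D z * W j z * h u j z * \1_C u))).
  by apply: eq_Rintegral => u _; exact: e2.
rewrite r2; apply: eq_Rintegral => z _; exact: e1.
Qed.

(** By Fubini the sum, averaged over [u] in [C], is 0, so it cannot exceed [e] for every [u]. *)
Lemma average_choice (D : J -> R * d.-tuple R -> R) K e : (forall j, measurable_fun setT (D j)) ->
  (forall j z, `|D j z| <= K) -> 0 < e ->
  exists u, \sum_j Rintegral m setT (fun z => D j z * (h u j z - average j z) * W j z) <= e.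
Proof.
move=> mD DK e0; apply: contrapT => /forallNP hu.
pose phi u := \sum_j Rintegral m setT (fun z => D j z * h u j z * W j z).
pose kap := \sum_j Rintegral m setT (fun z => D j z * average j z * W j z).
have lb u : kap + e <= phi u.
  have /negP := hu u; rewrite -ltNge => /ltW hh; rewrite -lerBrDl; apply: (le_trans hh).
  rewrite le_eqVlt; apply/orP; left; apply/eqP.
  rewrite /phi /kap -sumrB; apply: eq_bigr => j _; rewrite -RintegralB//.
  - by apply: eq_Rintegral => z _; ring.
  - apply: (@mulW j (fun z => D j z * h u j z) K) => [|z]; first exact: measurable_funM.
    by rewrite normrM; apply: le_trans (DK j z); rewrite ler_piMr.
  - apply: (@mulW j (fun z => D j z * average j z) K) => [|z].
      by apply: measurable_funM => //; exact: measurable_average.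
    by rewrite normrM; apply: le_trans (DK j z); rewrite ler_piMr// average_le1.
have F j := average_fubini j (mD j) (DK j).
have [e3 i3] := Rintegral_sum (index_enum J) measurableT (fun j => (F j).1).
have : Rintegral lam setT (fun u => (kap + e) * \1_C u) <= Rintegral lam setT (fun u => \sum_j
    Rintegral m setT (fun z => D j z * h u j z * W j z) * \1_C u).
  apply: le_Rintegral => //.
    by have := integrableZl measurableT (kap + e) iC; apply: eq_integrable => // u _; rewrite /= EFinM.
  by move=> u _; rewrite -mulr_suml ler_wpM2r//; exact: lb.
rewrite e3 (eq_bigr _ (fun j _ => (F j).2)) -mulr_sumr (RintegralZl (kap + e) measurableT iC) iC1 mulrC.
by rewrite ler_pM2l// gerDl leNgt e0.
Qed.

Let I1 := \sum_j Rintegral m setT (W j).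

Let h_cl u : clf (h u).
Proof.
have tr := istrig_term 0 1 [:: (t, u)].
by apply: (cl_ext (cl_istrig lam rho g c r u0 tr)) => j z; rewrite lin1 mul0r add0r mul1r.
Qed.

(* Some point [u] of the cube makes the cross term at most its average, which is 0; so a sum
   of [K] well-chosen sines has squared distance only [O(K)] to [K] times their average. *)
Lemma average_greedy K : exists D : J -> R * d.-tuple R -> R, [/\ clf D, forall j z, `|D j z| <= K%:R &
  \sum_j Rintegral m setT (fun z => (D j z - K%:R * average j z) ^+ 2 * W j z) <= K%:R * (2 + 4 * I1)].
Proof.
elim: K => [|K [D [cD DK hD]]].
  exists (fun _ _ => 0); split=> [|j z|]; first exact: cl_cst.
    by rewrite normr0.
  rewrite mul0r big1// => j _; rewrite (_ : (fun z => _) = fun=> 0) ?Rintegral_cst ?mul0r//.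
  by apply/funext => z; rewrite mul0r subrr expr0n mul0r.
have mD := cl_measurable mg cD.
pose E j z := D j z - K%:R * average j z.
have mE j : measurable_fun setT (E j).
  by apply: measurable_funB => //; apply: measurable_funM; [exact: measurable_cst|exact: measurable_average].
have EK j z : `|E j z| <= K%:R + K%:R.
  apply: le_trans (ler_normB _ _) _; apply: lerD => //.
  by rewrite normrM ger0_norm// ler_piMr// average_le1.
have [u hu] := average_choice mE EK (@ltr01 R).
exists (fun j z => D j z + h u j z); split.
- exact: (cl_add mg int_cos cD (h_cl u)).
- by move=> j z; rewrite -natr1; apply: le_trans (ler_normD _ _) _; exact: lerD.
pose G j z := h u j z - average j z.
have mG j : measurable_fun setT (G j) by apply: measurable_funB => //; exact: measurable_average.
have G2 j z : `|G j z| <= 2 by apply: le_trans (ler_normB _ _) _; have := h1 u j z; have := average_le1 j z; lra.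
have iE j : m.-integrable setT (EFin \o (fun z => E j z ^+ 2 * W j z)).
  apply: (@mulW j (fun z => E j z ^+ 2) ((K%:R + K%:R) ^+ 2)) => [|z]; first exact: measurable_funX.
  by rewrite normrX lerXn2r ?nnegrE// addr_ge0.
have iEG j : m.-integrable setT (EFin \o (fun z => E j z * G j z * W j z)).
  apply: (@mulW j (fun z => E j z * G j z) ((K%:R + K%:R) * 2)) => [|z]; first exact: measurable_funM.
  by rewrite normrM; apply: ler_pM.
have iW2 j : m.-integrable setT (EFin \o (fun z => 4 * W j z)).
  by have := integrableZl measurableT 4 (Wint j); apply: eq_integrable => // z _; rewrite /= EFinM.
have iEG2 j : m.-integrable setT (EFin \o (fun z => 2 * (E j z * G j z * W j z))).
  by have := integrableZl measurableT 2 (iEG j); apply: eq_integrable => // z _; rewrite /= EFinM.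
have iS j : m.-integrable setT (EFin \o (fun z => E j z ^+ 2 * W j z + 2 * (E j z * G j z * W j z))).
  by have := integrableD measurableT (iE j) (iEG2 j); apply: eq_integrable => // z _; rewrite /= EFinD.
have iB j : m.-integrable setT (EFin \o (fun z => E j z ^+ 2 * W j z + 2 * (E j z * G j z * W j z) + 4 * W j z)).
  by have := integrableD measurableT (iS j) (iW2 j); apply: eq_integrable => // z _; rewrite /= !EFinD.
(* The square of [E + G] is expanded with [G ^+ 2 <= 4]. After summation over [j] the cross terms
   are at most 1 by the choice of [u], whence the increment [2 + 4 * I1]. *)
have step j : Rintegral m setT (fun z => (D j z + h u j z - K.+1%:R * average j z) ^+ 2 * W j z) <=
    Rintegral m setT (fun z => E j z ^+ 2 * W j z) + 2 * Rintegral m setT (fun z => E j z * G j z * W j z) +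
    4 * Rintegral m setT (W j).
  rewrite -(RintegralZl 2 measurableT (iEG j)) -(RintegralZl 4 measurableT (Wint j)).
  rewrite -(RintegralD measurableT (iE j) (iEG2 j)) -(RintegralD measurableT (iS j) (iW2 j)).
  have eq z : D j z + h u j z - K.+1%:R * average j z = E j z + G j z by rewrite /E /G -natr1; ring.
  apply: le_Rintegral => //.
    apply: (@mulW j _ ((K%:R + K%:R + 2) ^+ 2)) => [|z].
      apply: measurable_funX; apply: (@eq_measurable_fun _ _ _ _ _ (fun z => E j z + G j z)) => [z _|]; first by rewrite eq.
      exact: measurable_funD.
    rewrite normrX lerXn2r ?nnegrE// ?addr_ge0// eq; apply: le_trans (ler_normD _ _) _; exact: lerD.
  move=> z _; rewrite eq.
  have -> : E j z ^+ 2 * W j z + 2 * (E j z * G j z * W j z) + 4 * W j z = (E j z ^+ 2 + 2 * (E j z * G j z) + 4) * W j z by ring.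
  rewrite ler_wpM2r ?weight_ge0// sqrrD -[_ *+ 2]mulr_natl lerD2l -(real_normK (num_real (G j z))).
  have -> : 4 = 2 ^+ 2 :> R by rewrite expr2; ring.
  by rewrite lerXn2r ?nnegrE.
apply: le_trans (ler_sum _ (fun j _ => step j)) _.
rewrite !big_split -!mulr_sumr -/I1 -natr1 mulrDl mul1r.
have hu' : \sum_j Rintegral m setT (fun z => E j z * G j z * W j z) <= 1 by [].
have hD' : \sum_j Rintegral m setT (fun z => E j z ^+ 2 * W j z) <= K%:R * (2 + 4 * I1) := hD.
move: hD' hu'; rewrite /=; set X := \sum_j _; set Y := \sum_j _ => hD' hu'.
have hh := greedy_step hD' hu'; rewrite -natr1.
apply: (@le_trans _ _ (X + 2 * Y + 4 * I1)); first by rewrite le_eqVlt; apply/orP; left; apply/eqP; ring.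
by apply: (le_trans hh); rewrite le_eqVlt; apply/orP; left; apply/eqP; ring.
Qed.

(** After [(n + 1) ^ 2] greedy steps the normalised sum is at squared distance of order
    [1 / (n + 1) ^ 2] from the average. The inequality [|E| <= v + E ^+ 2 / v] with
    [v = 1 / (n + 1)] turns this into a distance of order [1 / (n + 1)] in weighted L1. *)
Lemma cl_average : clf average.
Proof.
have /choice[D hD] n : exists D : J -> R * d.-tuple R -> R, [/\ clf D, forall j z, `|D j z| <= (n.+1 ^ 2)%:R &
  \sum_j Rintegral m setT (fun z => (D j z - (n.+1 ^ 2)%:R * average j z) ^+ 2 * W j z) <= (n.+1 ^ 2)%:R * (2 + 4 * I1)].
  exact: average_greedy.
pose f_ n j z := n.+1%:R^-2 * D n j z.
have n2 n : (n.+1 ^ 2)%:R = n.+1%:R ^+ 2 :> R by rewrite natrX.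
have n0 n : 0 < n.+1%:R ^+ 2 :> R by rewrite exprn_gt0.
have clf_ n : clf (f_ n) by have [cD _ _] := hD n; exact: cl_scale.
have f1 n j z : `|f_ n j z| <= 1.
  have [_ hDn _] := hD n; rewrite /f_ normrM gtr0_norm ?invr_gt0// ler_pdivrMl// mulr1 -n2; exact: hDn.
apply: (@cl_lim _ _ _ _ _ _ _ _ _ f_ average 1) => //.
- exact: average_le1.
- exact: measurable_average.
move=> j.
have I0 i : 0 <= Rintegral m setT (W i) by apply: Rintegral_ge0 => z _; exact: weight_ge0.
have I1j : Rintegral m setT (W j) <= I1 by rewrite /I1 (bigD1 j)//= lerDl sumr_ge0.
have up : (fun n : nat => (I1 + (2 + 4 * I1)) * n.+1%:R^-1) @ \oo --> (0 : R).
  by rewrite -(mulr0 (I1 + (2 + 4 * I1))); apply: cvgM; [exact: cvg_cst|exact: cvg_harmonic].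
have lo : (fun n : nat => 0 : R) @ \oo --> (0 : R) by exact: cvg_cst.
apply: (squeeze_cvgr _ lo up); apply: nearW => n; apply/andP; split.
  by apply: Rintegral_ge0 => z _; rewrite mulr_ge0// weight_ge0.
have [cD DK hn] := hD n.
have mf i := cl_measurable mg (clf_ n) i.
pose E i z := f_ n i z - average i z.
have mE i : measurable_fun setT (E i) by apply: measurable_funB => //; exact: measurable_average.
have E2 i z : `|E i z| <= 2 by apply: le_trans (ler_normB _ _) _; have := f1 n i z; have := average_le1 i z; lra.
have iE2 i : m.-integrable setT (EFin \o (fun z => E i z ^+ 2 * W i z)).
  apply: (@mulW i _ (2 ^+ 2)) => [|z]; first exact: measurable_funX.
  by rewrite normrX lerXn2r ?nnegrE.
have hE : Rintegral m setT (fun z => E j z ^+ 2 * W j z) <= (2 + 4 * I1) * n.+1%:R^-1 ^+ 2.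
  apply: (@le_trans _ _ (\sum_i Rintegral m setT (fun z => E i z ^+ 2 * W i z))).
    rewrite [leRHS](bigD1 j)//= lerDl sumr_ge0// => i _; apply: Rintegral_ge0 => z _.
    by rewrite mulr_ge0 ?sqr_ge0 ?weight_ge0.
  have eqE i z : (D n i z - (n.+1 ^ 2)%:R * average i z) ^+ 2 * W i z = (n.+1%:R ^+ 2) ^+ 2 * (E i z ^+ 2 * W i z).
    by rewrite /E /f_ n2; field; rewrite addrC natr1.
  have := hn; under eq_bigr => i _ do under eq_Rintegral => z _ do rewrite eqE.
  under eq_bigr => i _ do rewrite (RintegralZl _ measurableT (iE2 i)).
  rewrite -mulr_sumr n2 [(_ ^+ 2) ^+ 2]expr2 -mulrA ler_pM2l// => hh.
  by rewrite exprVn -(ler_pM2l (n0 n)) mulrCA mulfV ?mulr1// gt_eqF.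
set v : R := n.+1%:R^-1 in hE *.
have v0 : 0 < v by rewrite invr_gt0.
pose B z := v * W j z + v^-1 * (E j z ^+ 2 * W j z).
have i1 : m.-integrable setT (EFin \o (fun z => v * W j z)).
  by have := integrableZl measurableT v (Wint j); apply: eq_integrable => // z _; rewrite /= EFinM.
have i2 : m.-integrable setT (EFin \o (fun z => v^-1 * (E j z ^+ 2 * W j z))).
  by have := integrableZl measurableT v^-1 (iE2 j); apply: eq_integrable => // z _; rewrite /= EFinM.
have iB : m.-integrable setT (EFin \o B).
  by have := integrableD measurableT i1 i2; apply: eq_integrable => // z _; rewrite /= EFinD.
apply: (@le_trans _ _ (Rintegral m setT B)).
  apply: le_Rintegral => //.
    apply: (@mulW j _ 2) => [|z]; first by apply: measurableT_comp => //; exact: mE.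
    by rewrite normr_id; exact: E2.
  move=> z _; rewrite /B mulrA -mulrDl ler_wpM2r ?weight_ge0// -/(E j z).
  rewrite -(real_normK (num_real (E j z))); set x := `|_|.
  have q : 0 <= (x - v) ^+ 2 by exact: sqr_ge0.
  have x0 : 0 <= x by exact: normr_ge0.
  rewrite -(ler_pM2l v0) mulrDr mulrA [v * v^-1]mulfV ?gt_eqF// mul1r.
  nra.
rewrite /B (RintegralD measurableT i1 i2) (RintegralZl v measurableT (Wint j)) (RintegralZl v^-1 measurableT (iE2 j)).
rewrite mulrDl; apply: lerD; first by rewrite mulrC ler_wpM2r// ltW.
have -> : (2 + 4 * I1) * v = v^-1 * ((2 + 4 * I1) * v ^+ 2) by field; rewrite gt_eqF.
by rewrite ler_wpM2l// invr_ge0 ltW.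
Qed.

End Average.

(** Infinite [y] are included, [fine] being 0 there, so that a constant can leave an integral that
    may diverge. *)
Lemma fine_mulEFin (R : realType) (a : R) (y : \bar R) : fine (a%:E * y) = a * fine y.
Proof.
case: y => [y||]; rewrite ?mulr0//.
  have [a0|a0|->] := ltrgt0P a; last by rewrite mul0e.
    by rewrite gt0_muley ?lte_fin.
  by rewrite lt0_muley ?lte_fin.
have [a0|a0|->] := ltrgt0P a; last by rewrite mul0e.
  by rewrite gt0_muleNy ?lte_fin.
by rewrite lt0_muleNy ?lte_fin.
Qed.

(** The indicator at [a * x] is at most 1 and at most [a ^+ 2 * x ^+ 2 / e ^+ 2], hence at most
    [1 + a ^+ 2 / e ^+ 2] times [m1 x]. *)
Lemma integrable_annulus (R : realType) (rho : {measure set R -> \bar R}) (B : set R) (e a : R) :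
  levy_measure rho -> measurable B -> 0 < e -> (forall y, B y -> e <= `|y|) ->
  rho.-integrable setT (EFin \o (fun x => \1_B (a * x) : R)).
Proof.
move=> hrho mB e0 Be; apply: (m1_dominated hrho (C := 1 + a ^+ 2 / e ^+ 2)) => [|x].
  apply: (measurableT_comp (measurable_indic mB)); apply: measurable_funM; first exact: measurable_cst.
  exact: measurable_id.
have e2 : 0 < e ^+ 2 by rewrite exprn_gt0.
rewrite indicE ger0_norm//; case: (boolP (_ \in _)) => [/set_mem/Be h|_]; last first.
  by rewrite mulr_ge0 ?m1_ge0// addr_ge0// divr_ge0// ?sqr_ge0// ltW.
have h2 : e ^+ 2 <= a ^+ 2 * x ^+ 2.
  by rewrite -exprMn -(real_normK (num_real (a * x))) lerXn2r ?nnegrE// ltW.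
have q0 : 0 <= a ^+ 2 / e ^+ 2 by rewrite divr_ge0 ?sqr_ge0 ?ltW.
rewrite /m1 /Num.min; case: ifP => _; first by rewrite mulr1 lerDl.
rewrite mulrDl mul1r; apply: (@le_trans _ _ (a ^+ 2 / e ^+ 2 * x ^+ 2)); last by rewrite lerDr sqr_ge0.
by rewrite mulrAC ler_pdivlMr// mul1r.
Qed.

(** * Recovering the jump sizes *)

Section JumpSets.
Context (R : realType) (d : nat) (lam : {sigma_finite_measure set (d.-tuple R) -> \bar R}).
Hypothesis hlam : is_lebesgue_measure lam.
Context (rho : {sigma_finite_measure set R -> \bar R}).
Context (g : d.-tuple R -> R).
Hypothesis ig : lam.-integrable setT (EFin \o g).
Hypothesis g0 : Rintegral lam setT g != 0.
Context (J : finType) (c : J -> R).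
Let T := d.-tuple R.
Let m := (rho \x lam)%E.
Hypothesis int_cos : forall (r : R) (u : T), m.-integrable setT (EFin \o (fun z => 1 - cos (r * z.1 * g (tsub u z.2)))).
Let mg : measurable_fun setT g. Proof. exact: measurable_integrable ig. Qed.
Let I0 := Rintegral lam setT g.

Lemma lam_cube_gt0 N : 0 < fine (lam (@cube R d N.+1)).
Proof.
rewrite hlam => [|i]; last by rewrite !tnth_mktuple (le_trans (_ : _ <= 0)) ?oppr_le0.
rewrite /= prodr_gt0// => i _; rewrite !tnth_mktuple opprK addr_gt0//.
Qed.

Lemma cvg_mul_sin (x : R) : (fun n : nat => n.+1%:R * sin (n.+1%:R^-1 * x)) @ \oo --> x.
Proof.
have h : (fun n : nat => n.+1%:R * sin (n.+1%:R^-1 * x)) @ \oo --> x * 1.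
  apply: (@cvg_scaled_quotient R (fun t => sin (t * x)) x 1 (fun n => n.+1%:R) (fun n => n.+1%:R^-1)) => //.
  - by rewrite mul0r sin0.
  - by apply: is_derive_eq; rewrite /= mul0r cos0 ?scaler0 ?scaler1 /GRing.scale /=; ring.
  - exact: cvg_harmonic.
  - by apply: cvg_near_cst; apply: nearW => n; rewrite divff.
by rewrite mulr1 in h.
Qed.

Section Fixed.
Context (r : R) (u0 : T).

Let ig_tr (s : T) : lam.-integrable setT (EFin \o (fun u => g (tsub u s))) /\
  Rintegral lam setT (fun u => g (tsub u s)) = I0.
Proof. exact: (integral_translation hlam s ig). Qed.

Let G N j (z : R * T) : R := Rintegral lam setT (fun u => ev g c j z u * \1_(@cube R d N.+1) u).

Let iev j z : lam.-integrable setT (EFin \o ev g c j z).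
Proof.
have := integrableZl measurableT (c j * z.1) (ig_tr z.2).1.
by apply: eq_integrable => // u _; rewrite /= /ev EFinM.
Qed.

Let mcube N : measurable (@cube R d N). Proof. exact: measurable_box. Qed.

Let G_gt N x : clset lam rho g c r u0 (fun j => [set z | x < G N j z]).
Proof.
pose C := @cube R d N.+1; pose V := fine (lam C).
have V0 : 0 < V by exact: lam_cube_gt0.
have lC : (lam C < +oo)%E by exact: (lam_cube_lty hlam).
pose F n j z := n.+1%:R * V * average lam g c C n.+1%:R^-1 j z.
apply: (clset_gt_lim mg int_cos (f_ := F)) => [n {}x|j z].
  apply: (clset_gt mg int_cos); apply: (cl_scale mg int_cos).
  exact: (@cl_average R d lam rho g mg J c int_cos r u0 C n.+1%:R^-1 (mcube N.+1) lC V0).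
have ms n : measurable_fun setT (fun u => sin (n.+1%:R^-1 * ev g c j z u)).
  apply: measurable_sin_comp; apply: measurable_funM; first exact: measurable_cst.
  exact: measurable_integrable (iev j z).
have FE n : F n j z = Rintegral lam setT (fun u => n.+1%:R * sin (n.+1%:R^-1 * ev g c j z u) * \1_C u).
  have ih : lam.-integrable setT (EFin \o (fun u => sin (n.+1%:R^-1 * ev g c j z u) * \1_C u)).
    apply: (integrable_le measurableT _ (g := fun u => n.+1%:R^-1 * `|ev g c j z u|)).
    - exact: (measurable_funM (ms n) (measurable_indic (mcube N.+1))).
    - have := integrableZl measurableT n.+1%:R^-1 (integrable_abse (iev j z)).
      by apply: eq_integrable => // u _; rewrite /= EFinM.
    - move=> u _; rewrite normrM indicE (ger0_norm (ler0n R _)).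
      apply: le_trans (_ : `|sin (n.+1%:R^-1 * ev g c j z u)| <= _); first by case: (u \in C); rewrite ?mulr1// mulr0.
      by apply: le_trans (sin_norm_le _) _; rewrite normrM gtr0_norm// invr_gt0.
  rewrite /F /average -/V mulrA mulfK ?gt_eqF// -(RintegralZl n.+1%:R measurableT ih).
  by apply: eq_Rintegral => u _; rewrite mulrA.
rewrite (_ : (fun n => F n j z) = (fun n => Rintegral lam setT (fun u => n.+1%:R * sin (n.+1%:R^-1 * ev g c j z u) * \1_C u))); last exact/funext.
apply: (Rintegral_dct measurableT _ _ _ (integrable_abse (iev j z)) _).2.
- move=> n; exact: (measurable_funM (measurable_funM (measurable_cst _) (ms n)) (measurable_indic (mcube N.+1))).
- exact: (measurable_funM (measurable_integrable (iev j z)) (measurable_indic (mcube N.+1))).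
- by apply: aeW => u _; apply: cvgM; [exact: cvg_mul_sin|exact: cvg_cst].
- move=> n u _; rewrite normrM indicE (ger0_norm (ler0n R _)).
  apply: le_trans (_ : `|n.+1%:R * sin (n.+1%:R^-1 * ev g c j z u)| <= _); first by case: (u \in _); rewrite ?mulr1// mulr0.
  rewrite normrM; apply: le_trans (ler_wpM2l (normr_ge0 _) (sin_norm_le _)) _.
  by rewrite normrM mulrA -normrM divff// normr1 mul1r.
Qed.

(* Since [n sin (y / n)] tends to [y], averages over growing cubes recover the integral of
   [u |-> c_j x g(u - s)], which is [c_j x] times the nonzero integral of [g]. *)
Lemma clset_jump (B : set R) : measurable B -> clset lam rho g c r u0 (fun j => [set z : R * T | B (c j * z.1)]).
Proof.
move=> mB; apply: (clset_borel mg int_cos g0 (f := fun j z => c j * z.1)) mB => x.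
apply: (clset_gt_lim mg int_cos (f_ := G)) => [n y|j z]; first exact: G_gt.
have e : I0 * (c j * z.1) = Rintegral lam setT (ev g c j z).
  by rewrite /ev (RintegralZl (c j * z.1) measurableT (ig_tr z.2).1) (ig_tr z.2).2 mulrC.
rewrite /= -/I0 e.
apply: (Rintegral_dct measurableT _ _ _ (integrable_abse (iev j z)) _).2.
- move=> n; exact: (measurable_funM (measurable_integrable (iev j z)) (measurable_indic (mcube n.+1))).
- exact: measurable_integrable (iev j z).
- apply: aeW => u _; apply: cvg_near_cst.
  have [N _ hN] := cube_near u; exists N => // n /= Nn.
  by rewrite indicE mem_set ?mulr1//; apply: hN => /=; exact: leqW.
- move=> n u _; rewrite normrM indicE (ger0_norm (ler0n R _)).
  by case: (u \in _); rewrite ?mulr1// mulr0.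
Qed.

Let w (y : R) (s : T) : R := (1 - cos (r * (y * g (tsub u0 s)))) ^+ 2.
(** Integrated over locations, the weight depends on the dilated size [c j * x] alone, so one
    function of that size can compensate it for all [j] at once. *)
Definition jump_weight (y : R) : R := Rintegral lam setT (w y).

Let mw : measurable_fun setT (fun z : R * T => w z.1 z.2).
Proof.
apply: measurable_funX; apply: measurable_funB; first exact: measurable_cst.
apply: measurable_cos_comp; apply: measurable_funM; first exact: measurable_cst.
apply: measurable_funM; first exact: measurable_fst.
apply: (measurableT_comp mg); apply/measurable_fun_tnthP => i.
apply: (@eq_measurable_fun _ _ _ _ _ (fun z : R * T => tnth u0 i - tnth z.2 i)).
  by move=> z _ /=; rewrite tnth_mktuple.
apply: measurable_funB; first exact: measurable_cst.
exact: (measurableT_comp (measurable_tnth i) measurable_snd).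
Qed.

Lemma measurable_jump_weight : measurable_fun setT jump_weight.
Proof.
have mw' : measurable_fun setT (fun z : R * T => (w z.1 z.2)%:E) by exact/measurable_EFinP.
have w0 (z : R * T) : (0 <= (w z.1 z.2)%:E)%E by rewrite lee_fin sqr_ge0.
exact: (measurableT_comp (fine_measurable measurableT) (@measurable_fun_fubini_tonelli_F _ _ _ _ _ lam _ mw' w0)).
Qed.

Lemma jump_weight_ge0 y : 0 <= jump_weight y.
Proof. by apply: Rintegral_ge0 => s _; exact: sqr_ge0. Qed.

Lemma integrable_jump_weight j : {ae rho, forall x, lam.-integrable setT (EFin \o w (c j * x))}.
Proof.
have := ae_integrable1 (@integrable_weight R d lam rho g mg J c int_cos r u0 j).
by apply: filterS => x; apply: eq_integrable.
Qed.

(** A vanishing integral forces [cos (r * y * g)] to be 1 almost everywhere. Where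
    [|r * y * g| <= 1] this means that the argument is 0, which is impossible on the non-null set
    where [g] is nonzero and bounded by [n + 1]. *)
Lemma jump_weight_gt0 (K : R) n y : ~ {ae lam, forall s, ~ (0 < `|g (tsub u0 s)| <= n.+1%:R)} ->
  0 < r -> r * K * n.+1%:R <= 1 -> 0 < `|y| <= K ->
  lam.-integrable setT (EFin \o w y) -> 0 < jump_weight y.
Proof.
move=> nae r0 rK /andP[y0 yK] iw; rewrite lt_neqAle jump_weight_ge0 andbT eq_sym; apply/eqP => h0.
apply: nae.
have mwy : measurable_fun setT (EFin \o w y) by exact: measurable_int iw.
have e0 : (\int[lam]_(s in setT) `|(w y s)%:E| = 0)%E.
  have e1 : (jump_weight y)%:E = (\int[lam]_(s in setT) `|(w y s)%:E|)%E.
    rewrite /jump_weight -EFin_Rintegral//; apply: eq_integral => s _.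
    by rewrite abse_EFin ger0_norm ?sqr_ge0.
  by rewrite -e1 h0.
have /(ae_eq_integral_abs lam measurableT mwy) := e0.
apply: filterS => s /(_ I) [] /eqP; rewrite sqrf_eq0 subr_eq0 => /eqP h1 /andP[gp gn].
have t0 : `|r * (y * g (tsub u0 s))| <= 1.
  rewrite !normrM gtr0_norm// mulrA; apply: (le_trans _ rK); apply: ler_pM => //.
    by rewrite mulr_ge0// ltW.
  by rewrite ler_pM2l.
have t1 : 0 < `|r * (y * g (tsub u0 s))| by rewrite !normrM gtr0_norm// !mulr_gt0.
move: t0 t1 h1; set t := r * _ => t0 t1 h1.
have s0 : sin t = 0.
  by apply/eqP; rewrite -sqrf_eq0 sin2cos2 -h1 expr1n subrr.
have sp : sin `|t| = 0 by case: (ger0P t) => _; rewrite ?sinN s0 ?oppr0.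
by have := @sin2_gt0 R `|t|; rewrite sp ltxx t1 (le_lt_trans t0) ?ltr1n// => /(_ isT).
Qed.
Lemma Rintegral_weight j (beta : R -> R) C : measurable_fun setT beta -> (forall y, `|beta y| <= C) ->
  Rintegral m setT (fun z => beta (c j * z.1) ^+ 2 * weight g c r u0 j z) =
  Rintegral rho setT (fun x => beta (c j * x) ^+ 2 * jump_weight (c j * x)).
Proof.
move=> mb bC.
have mbc : measurable_fun setT (fun z : R * T => beta (c j * z.1)).
  apply: (measurableT_comp mb); apply: measurable_funM; first exact: measurable_cst.
  exact: measurable_fst.
have ii : m.-integrable setT (EFin \o (fun z => beta (c j * z.1) ^+ 2 * weight g c r u0 j z)).
  apply: (@integrable_mul_weight R d lam rho g mg J c int_cos r u0 j _ (C ^+ 2)) => [|z].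
    exact: measurable_funX.
  by rewrite normrX lerXn2r ?nnegrE// (le_trans (normr_ge0 _) (bC 0)).
rewrite -(Rintegral12 ii).2; apply: eq_Rintegral => x _ /=.
have mwc : measurable_fun setT (w (c j * x)) by exact: (measurableT_comp mw (measurable_pair1 _)).
rewrite /jump_weight /Rintegral -fine_mulEFin; congr fine.
have mw2 : measurable_fun setT (fun s => (w (c j * x) s)%:E) by exact/measurable_EFinP.
have w0 s : setT s -> (0 <= (w (c j * x) s)%:E)%E by rewrite lee_fin sqr_ge0.
have := @ge0_integralZl _ _ _ lam setT measurableT (fun s => (w (c j * x) s)%:E) mw2 (beta (c j * x) ^+ 2)%:E w0.
by rewrite lee_fin sqr_ge0 => <-.
Qed.

End Fixed.

(** The indicator of [g (tsub u s) != 0] is integrated in both orders. Over [s] it measures a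
    reflection of the set where [g] does not vanish, over [u] a translate of it, to which
    translation invariance applies. If all reflections were null, [g] would vanish almost
    everywhere. *)
Lemma nonzero_reflection : exists u0 : T, ~ {ae lam, forall s, g (tsub u0 s) = 0}.
Proof.
apply: contrapT => hn; have {}hn u : {ae lam, forall s, g (tsub u s) = 0}.
  by apply: contrapT => h; apply: hn; exists u.
pose N := [set y | g y != 0].
have mN : measurable N.
  rewrite (_ : N = setT `&` g @^-1` (~` [set 0])).
    by apply: mg => //; exact: measurableC.
  by apply/seteqP; split => y /=; [move=> /eqP h; split|move=> [_ /eqP]].
pose F (z : T * T) : \bar R := (\1_N (tsub z.1 z.2))%:E.
have mts : measurable_fun setT (fun z : T * T => tsub z.1 z.2).
  apply/measurable_fun_tnthP => i.
  apply: (@eq_measurable_fun _ _ _ _ _ (fun z : T * T => tnth z.1 i - tnth z.2 i)).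
    by move=> z _ /=; rewrite tnth_mktuple.
  apply: measurable_funB.
    exact: (measurableT_comp (measurable_tnth i) measurable_fst).
  exact: (measurableT_comp (measurable_tnth i) measurable_snd).
have mF : measurable_fun setT F.
  by apply/measurable_EFinP; exact: (measurableT_comp (measurable_indic mN) mts).
have F0 z : (0 <= F z)%E by rewrite lee_fin.
have := @fubini_tonelli _ _ _ _ _ lam lam F mF F0.
rewrite integral0_eq; last first.
  move=> u _; rewrite -[RHS](integral0 lam setT); apply: ae_eq_integral => //.
    exact: (measurableT_comp mF (measurable_pair1 u)).
  apply: filterS (hn u) => s gs _ /=; rewrite /F indicE memNset//= /N /=.
  by rewrite gs eqxx.
under eq_integral => s _.
  rewrite (_ : (fun u => F (u, s)) = EFin \o (\1_(ttrans s @^-1` N) : T -> R)); last first.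
    by apply/funext => u; rewrite /F /= !indicE.
  rewrite integral_indic ?setIT//; last by rewrite -[X in measurable X]setTI; exact: measurable_ttrans.
  rewrite (lam_translation hlam)//.
  over.
rewrite integral_cst//= => /esym h.
have lT : lam setT != 0%E.
  apply/eqP => lT; have := lam_cube_gt0 0; rewrite (_ : lam (cube 1) = 0%E) ?ltxx//.
  apply/eqP; rewrite eq_le measure_ge0 andbT -lT; apply: le_measure; rewrite ?inE//.
  exact: measurable_box.
have {h} /eqP lN : lam N == 0%E.
  by have /eqP := h; rewrite mule_eq0 (negbTE lT) orbF.
have ae0 : {ae lam, forall x, g x = cst 0 x}.
  by exists N; split => // x /= /eqP.
move/eqP: g0; apply.
by rewrite (ae_eq_Rintegral mg (measurable_cst (0 : R)) ae0) /Rintegral integral0.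
Qed.

Section Positive.
Context (gam b : R) (sig : J -> R).
Hypothesis hrho : levy_measure rho.
Let Yg (s : T) : T -> R := fun u => g (tsub u s).
Hypothesis int_re : forall phi : seq (R * T), lam.-integrable setT (EFin \o (fun s => lk_re b rho (lin phi (Yg s)))).
Hypothesis int_im : forall phi : seq (R * T), lam.-integrable setT (EFin \o (fun s => lk_im gam rho (lin phi (Yg s)))).
Hypothesis pos : forall p : seq (R * R * seq (R * T)), (forall y, 0 <= trig p y) -> trig p (fun=> 0) = 0 ->
  0 <= \sum_(t <- p) (t.1.1 * (\sum_j sig j * Rintegral lam setT (fun s => lk_re b rho (c j * lin t.2 (Yg s)))) +
     t.1.2 * (\sum_j sig j * Rintegral lam setT (fun s => lk_im gam rho (c j * lin t.2 (Yg s))))).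

(** The test function is the indicator of [B] divided by the square root of [jump_weight], so that
    its square times the weight is [\1_B] in the limit. *)
Lemma jump_positive (B : set R) (e K : R) : measurable B -> 0 < e -> (forall y, B y -> e <= `|y| <= K) ->
  0 <= \sum_j sig j * Rintegral rho setT (fun x => \1_B (c j * x)).
Proof.
move=> mB e0 Be.
have [u0 hu0] := nonzero_reflection.
have [n hn] : exists n : nat, ~ {ae lam, forall s, ~ (0 < `|g (tsub u0 s)| <= n.+1%:R)}.
  apply: contrapT => h; apply: hu0.
  have : {ae lam, forall s n, ~ (0 < `|g (tsub u0 s)| <= n.+1%:R)}.
    by apply: ae_foralln => n; apply: contrapT => h'; apply: h; exists n.
  apply: filterS => s hs; apply/eqP; apply: contrapT => /negP g1.
  apply: (hs (Num.truncn `|g (tsub u0 s)|)); rewrite normr_gt0 g1/= ltW//.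
  exact: truncnS_gt.
(* For [|y| <= K1] and [|g| <= n + 1] the scale [r] below gives [|r * y * g| <= 1], the range in
   which [jump_weight_gt0] works. *)
pose K1 := `|K| + 1; have K1p : 0 < K1 by rewrite ltr_wpDl.
have n0 : 0 < n.+1%:R :> R by rewrite ltr0n.
pose r := (K1 * n.+1%:R)^-1.
have r0 : 0 < r by rewrite invr_gt0 mulr_gt0.
have rK : r * K1 * n.+1%:R <= 1 by rewrite /r -mulrA mulVf// gt_eqF// mulr_gt0.
pose h := jump_weight r u0.
have mh : measurable_fun setT h by exact: measurable_jump_weight.
have h0 y : 0 <= h y by exact: jump_weight_ge0.
(* The floor keeps [beta] bounded, as membership in the closure demands. It disappears in the limit
   because the weight is positive at almost every jump that [c j] sends into [B]. *)
pose mx N y := Num.max (h y) N.+1%:R^-1.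
have mx0 N y : 0 < mx N y by rewrite lt_max invr_gt0 ltr0n orbT.
have mmx N : measurable_fun setT (mx N) by exact: (measurable_maxr mh (measurable_cst _)).
pose beta N y := \1_B y * (Num.sqrt (mx N y))^-1.
have mbeta N : measurable_fun setT (beta N).
  rewrite (_ : beta N = fun y => \1_B y * (mx N y `^ (- 2^-1))).
    apply: (measurable_funM (measurable_indic mB)); exact: (measurableT_comp (measurable_powR _) (mmx N)).
  by apply/funext => y; rewrite /beta powRN powR12_sqrt// ltW.
have bbeta N y : `|beta N y| <= (Num.sqrt N.+1%:R^-1)^-1.
  rewrite normrM indicE (ger0_norm (ler0n R _)) ger0_norm ?invr_ge0 ?sqrtr_ge0//.
  apply: (@le_trans _ _ (Num.sqrt (mx N y))^-1).
    by case: (_ \in _); rewrite ?mul1r// mul0r invr_ge0 sqrtr_ge0.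
  rewrite lef_pV2 ?posrE ?sqrtr_gt0 ?invr_gt0 ?ltr0n//.
  by rewrite ler_wsqrtr// le_max lexx orbT.
have phiE N y : beta N y ^+ 2 * h y = \1_B y * (h y / mx N y).
  rewrite exprMn exprVn sqr_sqrtr ?ltW// -mulrA [_^-1 * _]mulrC; congr (_ * _).
  by rewrite indicE; case: (_ \in _); rewrite ?expr1n// expr0n.
have posN N : 0 <= \sum_j sig j * Rintegral rho setT (fun x => \1_B (c j * x) * (h (c j * x) / mx N (c j * x))).
  have cb := cl_borel_fun mg int_cos (clset_jump r u0) (mbeta N) (bbeta N).
  have := cl_positive hrho mg int_re int_im pos int_cos cb.
  congr (_ <= _); apply: eq_bigr => j _; congr (_ * _).
  rewrite (Rintegral_weight r u0 j (mbeta N) (bbeta N)).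
  by apply: eq_Rintegral => x _; exact: phiE.
have lim : (fun N => \sum_j sig j * Rintegral rho setT (fun x => \1_B (c j * x) * (h (c j * x) / mx N (c j * x)))) @ \oo -->
    \sum_j sig j * Rintegral rho setT (fun x => \1_B (c j * x)).
  apply: cvg_bigsum => j; apply: cvgM; first exact: cvg_cst.
  have mc : measurable_fun setT (fun x : R => c j * x).
    by apply: measurable_funM; [exact: measurable_cst|exact: measurable_id].
  have iB : rho.-integrable setT (EFin \o (fun x => \1_B (c j * x) : R)).
    by apply: (integrable_annulus _ hrho mB e0) => y /Be /andP[].
  apply: (Rintegral_dct measurableT _ _ _ iB _).2.
  - move=> N; apply: measurable_funM; first exact: (measurableT_comp (measurable_indic mB) mc).
    have mx1 : measurable_fun setT (fun y => h y / mx N y).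
      rewrite (_ : (fun y => _) = fun y => h y * (mx N y `^ (- 1))).
        exact: (measurable_funM mh (measurableT_comp (measurable_powR _) (mmx N))).
      by apply/funext => y; rewrite powR_inv1// ltW.
    exact: (measurableT_comp mx1 mc).
  - exact: (measurableT_comp (measurable_indic mB) mc).
  - have := integrable_jump_weight r u0 j; apply: filterS => x iw _; rewrite indicE.
    case: (boolP (_ \in _)) => [/set_mem/Be/andP[ey yK]|_]; last first.
      by apply: cvg_near_cst; apply: nearW => N; rewrite mul0r.
    have hp : 0 < h (c j * x).
      apply: (jump_weight_gt0 hn r0 rK _ iw); rewrite (lt_le_trans e0 ey)/=.
      by apply: (le_trans yK); apply: (le_trans (ler_norm _)); rewrite lerDl.
    have hv : (fun N : nat => N.+1%:R^-1) @ \oo --> (0 : R) by exact: cvg_harmonic.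
    have hl : \forall N \near \oo, (N.+1%:R^-1 : R) < h (c j * x) by exact: (cvgr_lt 0 hv _ hp).
    apply: cvg_near_cst; apply: filterS hl => N hN.
    by rewrite /mx max_l ?ltW// divff ?mulr1// gt_eqF.
  - move=> N x _; rewrite normrM indicE (ger0_norm (ler0n R _)) ler_piMr//.
    rewrite ger0_norm ?divr_ge0// ?(ltW (mx0 _ _))// ler_pdivrMr// mul1r.
    by rewrite le_max lexx.
rewrite -(cvg_lim (@Rhausdorff R) lim).
by apply: limr_ge; [apply/cvg_ex; eexists; exact: lim|apply: nearW].
Qed.

End Positive.
End JumpSets.

(** * Signed combinations of dilated exponents *)

(** A limit of Poisson exponents: jumps [1 / (n + 1)] and [- 1 / (n + 1)], each at rate
    [(n + 1) ^ 2 / 2], have cancelling imaginary parts and total variance 1. *)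
Lemma levy_exp_gauss (R : realType) :
  levy_exp (fun th : 1.-tuple R => - (thead th ^+ 2) / 2) (fun=> 0).
Proof.
have th0 (t : R) (th : 1.-tuple R) : thead (tscale t th) = t * thead th.
  by rewrite /thead tnth_mktuple.
have cosE (x : R) : cos x - 1 = - 2 * sin (2^-1 * x) ^+ 2.
  have e2 : x = 2^-1 * x + 2^-1 * x by field.
  by rewrite {1}e2 cosD -!expr2 cos2sin2; ring.
pose A n (th : 1.-tuple R) := n.+1%:R ^+ 2 * (cos (thead th * n.+1%:R^-1) - 1).
apply: (@levy_exp_lim _ _ A (fun _ _ => 0)).
- move=> n; pose c := n.+1%:R ^+ 2 / 2 : R.
  have c0 : 0 <= c by rewrite divr_ge0// sqr_ge0.
  apply: (levy_exp_ext (levy_exp_scale c0 (levy_exp_add (levy_exp_poisson n.+1%:R^-1) (levy_exp_poisson (- n.+1%:R^-1))))) => th.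
    by rewrite mulrN cosN /A /c; field.
  by rewrite mulrN sinN subrr mulr0.
- move=> th.
  have h := @cvg_mul_sin R (2^-1 * thead th).
  have h2 : (fun n : nat => - 2 * (n.+1%:R * sin (n.+1%:R^-1 * (2^-1 * thead th))) ^+ 2) @ \oo --> - 2 * (2^-1 * thead th) ^+ 2.
    by apply: cvgM; [exact: cvg_cst|apply: cvgM].
  rewrite (_ : - (thead th ^+ 2) / 2 = - 2 * (2^-1 * thead th) ^+ 2); last by field.
  rewrite (_ : (fun n => A n th) = (fun n : nat => - 2 * (n.+1%:R * sin (n.+1%:R^-1 * (2^-1 * thead th))) ^+ 2)) //.
  apply/funext => n; rewrite /A cosE exprMn [_ * (2^-1 * _)]mulrCA [n.+1%:R^-1 * _]mulrC; ring.
- by move=> th; exact: cvg_cst.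
- move=> th; apply: cvg_seq_nbhs => u u0.
  under eq_fun do rewrite th0.
  have h : (fun n => - ((u n * thead th) ^+ 2) / 2) @ \oo --> - ((0 * thead th) ^+ 2) / 2.
    apply: cvgM; last exact: cvg_cst.
    by apply: cvgN; apply: cvgM; (apply: cvgM; [exact: u0|exact: cvg_cst]).
  by rewrite mul0r expr0n/= oppr0 mul0r in h.
- by move=> th; exact: cvg_cst.
Qed.

Section SignedSums.
Context (R : realType) (gam b : R) (rho : {measure set R -> \bar R}).
Hypothesis hrho : levy_measure rho.
Context (J : finType) (c sig : J -> R).
Hypothesis v0 : 0 <= \sum_j sig j * c j ^+ 2.
Hypothesis jump_pos : forall (B : set R) (e K : R), measurable B -> 0 < e ->
  (forall y, B y -> e <= `|y| <= K) -> 0 <= \sum_j sig j * Rintegral rho setT (fun x => \1_B (c j * x)).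

Let mc j : measurable_fun setT (fun x : R => c j * x).
Proof. by apply: measurable_funM; [exact: measurable_cst|exact: measurable_id]. Qed.

Section Annulus.
Context (A : set R) (e K : R).
Hypothesis mA : measurable A.
Hypothesis e0 : 0 < e.
Hypothesis hA : forall y, A y -> e <= `|y| <= K.
Let K0 : 0 <= `|K|. Proof. exact: normr_ge0. Qed.

(** The integral of [F] over [A] against the signed sum of the dilated images of [rho]. The sum is
    not formed as a measure; [jump_pos] gives its nonnegativity set by set. *)
Let S (F : R -> R) := \sum_j sig j * Rintegral rho setT (fun x => \1_A (c j * x) * F (c j * x)).

Let i1A j : rho.-integrable setT (EFin \o (fun x => \1_A (c j * x) : R)).
Proof. by apply: (integrable_annulus _ hrho mA e0) => y /hA/andP[]. Qed.

Lemma integrable_annulus_mul j (F : R -> R) (C : R) : measurable_fun setT F -> (forall y, `|F y| <= C) ->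
  rho.-integrable setT (EFin \o (fun x => \1_A (c j * x) * F (c j * x))).
Proof.
move=> mF FC; apply: (integrable_le measurableT _ (g := fun x => C * \1_A (c j * x))).
- exact: (measurable_funM (measurableT_comp (measurable_indic mA) (mc j)) (measurableT_comp mF (mc j))).
- by have := integrableZl measurableT C (i1A j); apply: eq_integrable => // x _; rewrite /= EFinM.
- move=> x _; rewrite normrM indicE ger0_norm// mulrC ler_wpM2r//.
Qed.

Let finite_values (n : nat) : exists N (idx : R -> 'I_N.+1) (x : 'I_N.+1 -> R),
  (forall i, measurable (idx @^-1` [set i])) /\
  forall y, A y -> `|x (idx y) - y| <= n.+1%:R^-1.
Proof.
have n0 : 0 < n.+1%:R^-1 :> R by rewrite invr_gt0.
pose cl (x : R) : R := Num.max (- `|K|) (Num.min `|K| x).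
have mcl : measurable_fun setT cl.
  apply: measurable_maxr; first exact: measurable_cst.
  by apply: measurable_minr; [exact: measurable_cst|exact: measurable_id].
have clK x : `|cl x| <= `|K|.
  rewrite ler_norml /cl le_max lexx /= ge_max ge_min lexx /= andbT.
  by apply: (le_trans _ K0); rewrite oppr_le0.
have [N [idx [x [midx hx]]]] := finidx_approx mcl clK n0.
exists N, idx, x; split => // y /hA/andP[_ yK].
have ycl : cl y = y.
  have : `|y| <= `|K| by apply: (le_trans yK); exact: ler_norm.
  by rewrite ler_norml => /andP[h1 h2]; rewrite /cl min_r ?max_r.
by have := hx y; rewrite ycl distrC.
Qed.

Let S_finite N (idx : R -> 'I_N.+1) (h : 'I_N.+1 -> R) : (forall i, measurable (idx @^-1` [set i])) ->
  S (h \o idx) = \sum_i (\sum_j sig j * Rintegral rho setT (fun x => \1_(A `&` idx @^-1` [set i]) (c j * x))) * h i.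
Proof.
move=> midx.
have i2 j i : rho.-integrable setT (EFin \o (fun x => h i * \1_(A `&` idx @^-1` [set i]) (c j * x))).
  have ii : rho.-integrable setT (EFin \o (fun x => \1_(A `&` idx @^-1` [set i]) (c j * x) : R)).
    by apply: (integrable_annulus _ hrho _ e0) => [|y [/hA/andP[]]//]; exact: measurableI.
  by have := integrableZl measurableT (h i) ii; apply: eq_integrable => // x _; rewrite /= EFinM.
under [RHS]eq_bigr => i _ do rewrite mulr_suml.
rewrite exchange_big/=; apply: eq_bigr => j _.
under [RHS]eq_bigr => i _ do rewrite -mulrA.
rewrite -mulr_sumr; congr (_ * _).
rewrite (_ : (fun x => \1_A (c j * x) * (h \o idx) (c j * x)) =
    (fun x => \sum_i h i * \1_(A `&` idx @^-1` [set i]) (c j * x))).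
  rewrite (Rintegral_sum (index_enum _) measurableT (i2 j)).1; apply: eq_bigr => i _.
  have ii : rho.-integrable setT (EFin \o (fun x => \1_(A `&` idx @^-1` [set i]) (c j * x) : R)).
    by apply: (integrable_annulus _ hrho _ e0) => [|y [/hA/andP[]]//]; exact: measurableI.
  by rewrite (RintegralZl (h i) measurableT ii) mulrC.
apply/funext => x; rewrite (bigD1 (idx (c j * x)))//= big1 ?addr0 => [|i ni].
  rewrite mulrC !indicE in_setI; congr (_ * _).
  by rewrite [X in _ && X]mem_set// andbT.
rewrite indicE memNset ?mulr0// => -[_ /= h']; by rewrite h' eqxx in ni.
Qed.

Let S_lim (F : R -> R) (q : nat -> R -> R) (C : R) : continuous F -> (forall y, `|F y| <= C) ->
  (forall n, measurable_fun setT (F \o q n)) ->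
  (forall n y, A y -> `|q n y - y| <= n.+1%:R^-1) -> (fun n => S (F \o q n)) @ \oo --> S F.
Proof.
move=> cF FC mFq hq; apply: cvg_bigsum => j; apply: cvgM; first exact: cvg_cst.
have iC : rho.-integrable setT (EFin \o (fun x => C * \1_A (c j * x))).
  by have := integrableZl measurableT C (i1A j); apply: eq_integrable => // x _; rewrite /= EFinM.
apply: (Rintegral_dct measurableT _ _ _ iC _).2.
- move=> n; exact: (measurable_funM (measurableT_comp (measurable_indic mA) (mc j)) (measurableT_comp (mFq n) (mc j))).
- exact: (measurable_funM (measurableT_comp (measurable_indic mA) (mc j)) (measurableT_comp (continuous_measurable_fun cF) (mc j))).
- apply: aeW => x _; rewrite indicE; case: (boolP (_ \in _)) => [/set_mem Ax|_]; last first.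
    by apply: cvg_near_cst; apply: nearW => n; rewrite !mul0r.
  apply: cvgM; first exact: cvg_cst.
  have hc : (fun n => q n (c j * x)) @ \oo --> c j * x.
    apply/cvgrPdist_le => d d0; near=> n; rewrite distrC; apply: le_trans (hq _ _ Ax) _.
    by near: n; exact: near_invS_le.
  exact: (cvg_comp _ _ hc (cF _)).
- move=> n x _; rewrite normrM indicE ger0_norm// mulrC ler_wpM2r//; exact: FC.
Unshelve. all: by end_near. Qed.

Let S_ray (F : R -> R) (C : R) (t0 : R) : continuous F -> (forall y, `|F y| <= C) -> F 0 = 0 ->
  S (fun y => F (t * t0 * y)) @[t --> (0 : R)] --> (0 : R).
Proof.
move=> cF FC F0; apply: cvg_seq_nbhs => u u0.
have z : 0 = \sum_j sig j * Rintegral rho setT (fun x => \1_A (c j * x) * (0 : R)).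
  rewrite big1// => j _; under eq_Rintegral do rewrite mulr0.
  by rewrite /Rintegral integral0 mulr0.
rewrite [X in _ --> X]z; apply: cvg_bigsum => j; apply: cvgM; first exact: cvg_cst.
have iC : rho.-integrable setT (EFin \o (fun x => C * \1_A (c j * x))).
  by have := integrableZl measurableT C (i1A j); apply: eq_integrable => // x _; rewrite /= EFinM.
have mF n : measurable_fun setT (fun x => F (u n * t0 * (c j * x))).
  apply: (measurableT_comp (continuous_measurable_fun cF)).
  by apply: measurable_funM; [exact: measurable_cst|exact: mc].
apply: (Rintegral_dct measurableT _ _ _ iC _).2.
- by move=> n; exact: (measurable_funM (measurableT_comp (measurable_indic mA) (mc j)) (mF n)).
- by exact: (measurable_funM (measurableT_comp (measurable_indic mA) (mc j)) (measurable_cst _)).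
- apply: aeW => x _; apply: cvgM; first exact: cvg_cst.
  have hc : (fun n => u n * t0 * (c j * x)) @ \oo --> 0 * t0 * (c j * x).
    by apply: cvgM; [apply: cvgM; [exact: u0|exact: cvg_cst]|exact: cvg_cst].
  rewrite !mul0r in hc; rewrite -F0; exact: (cvg_comp _ _ hc (cF _)).
- move=> n x _; rewrite normrM indicE ger0_norm// mulrC ler_wpM2r//.
Qed.

(** For a finite-valued approximation of the identity on [A] the sums are combinations of Poisson
    exponents with weights [p i], nonnegative by [jump_pos]. Staying away from 0 keeps all masses
    finite. *)
Lemma levy_exp_jumps : levy_exp
  (fun th : 1.-tuple R => \sum_j sig j * Rintegral rho setT (fun x => \1_A (c j * x) * (cos (thead th * (c j * x)) - 1)))
  (fun th : 1.-tuple R => \sum_j sig j * Rintegral rho setT (fun x => \1_A (c j * x) * sin (thead th * (c j * x)))).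
Proof.
have th0 (t : R) (th : 1.-tuple R) : thead (tscale t th) = t * thead th.
  by rewrite /thead tnth_mktuple.
pose N n := sval (cid (finite_values n)).
pose idx n : R -> 'I_(N n).+1 := sval (cid (svalP (cid (finite_values n)))).
pose x n : 'I_(N n).+1 -> R := sval (cid (svalP (cid (svalP (cid (finite_values n)))))).
have hx n : (forall i, measurable (idx n @^-1` [set i])) /\ forall y, A y -> `|x n (idx n y) - y| <= n.+1%:R^-1.
  exact: svalP (cid (svalP (cid (svalP (cid (finite_values n)))))).
pose q n := x n \o idx n.
have cc : continuous (fun y : R => cos y - 1).
  by move=> y; apply: cvgB; [exact: continuous_cos|exact: cvg_cst].
have cs : continuous (@sin R) by exact: continuous_sin.
have cl (F : R -> R) (t : R) : continuous F -> continuous (fun y : R => F (t * y)).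
  by move=> cF y; apply: continuous_comp; [exact: (cvgM (cvg_cst _) cvg_id)|exact: cF].
have c2 (y : R) : `|cos y - 1| <= 2 by apply: le_trans (ler_normB _ _) _; rewrite normr1; have := cos_max y; lra.
have s2 (y : R) : `|sin y| <= 1 by exact: sin_max.
have mq (F : R -> R) n : measurable_fun setT (F \o q n).
  exact: (measurable_finidx (F \o x n) (hx n).1).
apply: (@levy_exp_lim _ _
  (fun n th => S ((fun y => cos (thead th * y) - 1) \o q n))
  (fun n th => S ((fun y => sin (thead th * y)) \o q n))).
- move=> n.
  pose p i := \sum_j sig j * Rintegral rho setT (fun z => \1_(A `&` idx n @^-1` [set i]) (c j * z)).
  have p0 i : 0 <= p i.
    by apply: (jump_pos (K := K) _ e0) => [|y [/hA//]]; apply: measurableI => //; exact: (hx n).1.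
  apply: (levy_exp_ext (levy_exp_sum (index_enum _) p0 (fun i => levy_exp_poisson (x n i)))) => th.
    by have := S_finite (fun i => cos (thead th * x n i) - 1) (hx n).1.
  by have := S_finite (fun i => sin (thead th * x n i)) (hx n).1.
- move=> th; apply: (@S_lim (fun y => cos (thead th * y) - 1) q 2 (cl _ _ cc)) => // n y Ay.
  exact: (hx n).2.
- move=> th; apply: (@S_lim (fun y => sin (thead th * y)) q 1 (cl _ _ cs)) => // n y Ay.
  exact: (hx n).2.
- move=> th; under eq_fun do rewrite th0.
  by apply: (S_ray (F := fun y => cos y - 1) (C := 2)) => //; rewrite cos0 subrr.
- move=> th; under eq_fun do rewrite th0.
  by apply: (S_ray (F := @sin R) (C := 1)) => //; rewrite sin0.
Qed.

End Annulus.

(** The cut-off is put on the dilated jump [c j * x], where positivity is known, rather than on [x].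
    The compensators over the cut-off region are absorbed in the drift [D n], which may have any
    sign and need not converge by itself. *)
Theorem levy_exp_signed : levy_exp
  (fun th : 1.-tuple R => \sum_j sig j * lk_re b rho (c j * thead th))
  (fun th : 1.-tuple R => \sum_j sig j * lk_im gam rho (c j * thead th)).
Proof.
have th0 (t : R) (th : 1.-tuple R) : thead (tscale t th) = t * thead th.
  by rewrite /thead tnth_mktuple.
pose A n := [set y : R | n.+1%:R^-1 <= `|y| <= n.+1%:R].
have mA n : measurable (A n).
  have mn : measurable_fun setT (fun y : R => `|y|) by exact: measurableT_comp.
  rewrite (_ : A n = setT `&` (fun y : R => `|y|) @^-1` `[n.+1%:R^-1, n.+1%:R]%classic).
    by apply: mn => //; exact: measurable_itv.
  by apply/seteqP; split => y /=; rewrite in_itv/=; [|case].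
have n0 n : 0 < n.+1%:R^-1 :> R by rewrite invr_gt0.
have hA n y : A n y -> n.+1%:R^-1 <= `|y| <= n.+1%:R by [].
pose D n := \sum_j sig j * (gam * c j - c j * Rintegral rho setT (fun x => \1_(A n) (c j * x) * tau1 x)).
pose v := b ^+ 2 * (\sum_j sig j * c j ^+ 2).
have v1 : 0 <= v by rewrite mulr_ge0// sqr_ge0.
have m1A n j : measurable_fun setT (fun x => \1_(A n) (c j * x) : R).
  exact: (measurableT_comp (measurable_indic (mA n)) (mc j)).
have itr (F : R -> R) (C : R) n j : measurable_fun setT F -> (forall x, `|F x| <= C * m1 x) ->
    rho.-integrable setT (EFin \o (fun x => \1_(A n) (c j * x) * F x)).
  move=> mF FC; apply: (m1_dominated hrho (C := C)) => [|x].
    exact: measurable_funM.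
  rewrite normrM indicE ger0_norm//; apply: le_trans (FC x).
  by case: (_ \in _); rewrite ?mul1r// mul0r.
(* If [c j = 0], the dilated jump never enters [A n] and the integrals on the left are 0, hence the
   condition that [F] vanish in this case. *)
have lim (F : R -> R) (C : R) j : measurable_fun setT F -> (forall x, `|F x| <= C * m1 x) ->
    (c j = 0 -> forall x, F x = 0) -> F 0 = 0 ->
    (fun n => Rintegral rho setT (fun x => \1_(A n) (c j * x) * F x)) @ \oo --> Rintegral rho setT F.
  move=> mF FC Fc F0.
  have iC : rho.-integrable setT (EFin \o (fun x => C * m1 x)).
    have := integrableZl measurableT C (integrable_m1 hrho).
    by apply: eq_integrable => // x _; rewrite /= EFinM.
  apply: (Rintegral_dct measurableT _ mF _ iC _).2.
  - by move=> n; exact: measurable_funM.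
  - apply: aeW => x _; have [cx|cx] := eqVneq (c j * x) 0.
      have -> : F x = 0.
        by move/eqP: cx; rewrite mulf_eq0 => /orP[/eqP/Fc//|/eqP ->].
      by apply: cvg_near_cst; apply: nearW => n; rewrite mulr0.
    have cx0 : 0 < `|c j * x| by rewrite normr_gt0.
    apply: cvg_near_cst; near=> n; rewrite indicE mem_set ?mul1r// /A /=; apply/andP; split.
      by near: n; exact: near_invS_le.
    apply: (@le_trans _ _ n%:R); last by rewrite ler_nat.
    by near: n; exact: nbhs_infty_ger.
  - move=> n x _; rewrite normrM indicE ger0_norm//; apply: le_trans (FC x).
    by case: (_ \in _); rewrite ?mul1r// mul0r.
have kimE n (th : R) j : Rintegral rho setT (fun x => \1_(A n) (c j * x) * kim (c j * th) x) =
    Rintegral rho setT (fun x => \1_(A n) (c j * x) * sin (th * (c j * x))) -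
    th * (c j * Rintegral rho setT (fun x => \1_(A n) (c j * x) * tau1 x)).
  have ms : measurable_fun setT (fun y : R => sin (th * y)).
    by apply: measurable_sin_comp; apply: measurable_funM; [exact: measurable_cst|exact: measurable_id].
  have isn : rho.-integrable setT (EFin \o (fun x => \1_(A n) (c j * x) * sin (th * (c j * x)))).
    by apply: (integrable_annulus_mul (mA n) (n0 n) (@hA n) j (F := fun y => sin (th * y)) (C := 1)) => // y; exact: sin_max.
  have it : rho.-integrable setT (EFin \o (fun x => \1_(A n) (c j * x) * tau1 x)).
    apply: (integrable_le measurableT _ (g := fun x => \1_(A n) (c j * x))).
    - exact: (measurable_funM (m1A n j) (@measurable_tau1 R)).
    - by apply: (integrable_annulus _ hrho (mA n) (n0 n)) => y /hA/andP[].
    - move=> x _; rewrite normrM indicE ger0_norm// ler_piMr// /tau1 normrM normfV.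
      have mx0 : 0 < Num.max 1 `|x| by rewrite lt_max ltr01.
      by rewrite (gtr0_norm mx0) ler_pdivrMr// mul1r le_max lexx orbT.
  have it2 : rho.-integrable setT (EFin \o (fun x => th * c j * (\1_(A n) (c j * x) * tau1 x))).
    by have := integrableZl measurableT (th * c j) it; apply: eq_integrable => // x _; rewrite /= EFinM.
  rewrite mulrA -(RintegralZl (th * c j) measurableT it) -(RintegralB measurableT isn it2).
  by apply: eq_Rintegral => x _; rewrite /kim (_ : th * (c j * x) = c j * th * x); ring.
have ray (F : R -> R) (th : 1.-tuple R) : continuous F -> F 0 = 0 ->
    \sum_j sig j * F (c j * thead (tscale t th)) @[t --> (0 : R)] --> (0 : R).
  move=> cF F0; apply: cvg_seq_nbhs => u u0.
  have z : 0 = \sum_j sig j * F (c j * (0 * thead th)).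
    by rewrite big1// => j _; rewrite mul0r mulr0 F0 mulr0.
  rewrite [X in _ --> X]z; apply: cvg_bigsum => j; apply: cvgM; first exact: cvg_cst.
  under eq_fun do rewrite th0.
  have hc : (fun n => c j * (u n * thead th)) @ \oo --> c j * (0 * thead th).
    by apply: cvgM; [exact: cvg_cst|apply: cvgM; [exact: u0|exact: cvg_cst]].
  exact: (cvg_comp _ _ hc (cF _)).
apply: (@levy_exp_lim _ _
  (fun n th => (\sum_j sig j * Rintegral rho setT (fun x => \1_(A n) (c j * x) * (cos (thead th * (c j * x)) - 1))) +
     (v * (- (thead th ^+ 2) / 2) + 0))
  (fun n th => (\sum_j sig j * Rintegral rho setT (fun x => \1_(A n) (c j * x) * sin (thead th * (c j * x)))) +
     (v * 0 + thead th * D n))).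
- move=> n; apply: levy_exp_add; first exact: (levy_exp_jumps (mA n) (n0 n) (@hA n)).
  apply: levy_exp_add; first exact: (levy_exp_scale v1 (@levy_exp_gauss R)).
  apply: (levy_exp_ext (levy_exp_drift [tuple D n])) => // th.
  by rewrite /dotp big_ord_recl big_ord0 addr0.
- move=> th; set t := thead th.
  rewrite (_ : \sum_j _ = \sum_j sig j * Rintegral rho setT (kre (c j * t)) + (v * (- (t ^+ 2) / 2) + 0)); last first.
    rewrite addr0 /v mulrAC mulr_sumr -big_split/=; apply: eq_bigr => j _.
    by rewrite /lk_re /Kre; ring.
  apply: cvgD; last exact: cvg_cst.
  apply: cvg_bigsum => j; apply: cvgM; first exact: cvg_cst.
  rewrite (_ : (fun n => _) = (fun n => Rintegral rho setT (fun x => \1_(A n) (c j * x) * kre (c j * t) x))); last first.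
    apply/funext => n; apply: eq_Rintegral => x _; rewrite /kre.
    by rewrite (_ : t * (c j * x) = c j * t * x)//; ring.
  apply: (lim _ _ j (measurable_kre _) (kre_le _)) => [-> x|].
    by rewrite mul0r kre0.
  by rewrite /kre mulr0 cos0 subrr.
- move=> th; set t := thead th.
  rewrite (_ : \sum_j _ = \sum_j (sig j * Rintegral rho setT (kim (c j * t)) + sig j * (gam * (c j * t)))); last first.
    by apply: eq_bigr => j _; rewrite /lk_im /Kim; ring.
  rewrite (_ : (fun n => _) = (fun n => \sum_j (sig j * Rintegral rho setT (fun x => \1_(A n) (c j * x) * kim (c j * t) x) + sig j * (gam * (c j * t))))); last first.
    apply/funext => n; rewrite mulr0 add0r /D mulr_sumr -big_split/=; apply: eq_bigr => j _.
    by rewrite kimE; ring.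
  apply: cvg_bigsum => j; apply: cvgD; last exact: cvg_cst.
  apply: cvgM; first exact: cvg_cst.
  apply: (lim _ _ j (measurable_kim _) (kim_le _)) => [-> x|].
    by rewrite mul0r kim0.
  by rewrite /kim mulr0 sin0 /tau1 mul0r mulr0 subrr.
- by move=> th; apply: (ray _ th (@continuous_lk_re R b rho hrho) (lk_re0 b rho)).
- by move=> th; apply: (ray _ th (@continuous_lk_im R gam rho hrho) (lk_im0 gam rho)).
Unshelve. all: by end_near. Qed.

End SignedSums.

(** * Fields of stochastic integrals *)

Definition field_fun (R : realType) d k (f : 'I_k -> d.-tuple R -> R) (s : d.-tuple R) : k.-tuple R :=
  [tuple f i s | i < k].

Definition field_exponent (R : realType) d (lam : {measure set (d.-tuple R) -> \bar R}) k
    (f : 'I_k -> d.-tuple R -> R) (a : R -> R) (th : k.-tuple R) : R :=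
  Rintegral lam setT (fun s => a (dotp th (field_fun f s))).

Definition dilation_diff (R : realType) (q : R) (a : R -> R) (t : R) : R := a t - a (q^-1 * t).

Section FieldTransfer.
Context (R : realType) (d : nat) (lam : {measure set (d.-tuple R) -> \bar R}).
Hypothesis hlam : is_lebesgue_measure lam.
Context (k : nat) (f : 'I_k -> d.-tuple R -> R).
Hypothesis mf : forall i, measurable_fun setT (f i).

(** What [levy_exp_field] asks of each part of the exponent, gathered in a form that passes to
    dilation differences, so that the induction on [m] can run. *)
Let field_ok (a : R -> R) := [/\ continuous a, a 0 = 0,
  forall th, lam.-integrable setT (EFin \o (fun s => a (dotp th (field_fun f s)))) &
  forall th, field_exponent lam f a (tscale t th) @[t --> (0 : R)] --> (0 : R)].

Lemma field_exponent_qdiff q a : (forall th, lam.-integrable setT (EFin \o (fun s => a (dotp th (field_fun f s))))) ->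
  qdiff q (field_exponent lam f a) = field_exponent lam f (dilation_diff q a).
Proof.
move=> ia; apply/funext => th; rewrite /qdiff /field_exponent -(RintegralB measurableT (ia th) (ia (tscale q^-1 th))).
by apply: eq_Rintegral => s _; rewrite /dilation_diff dotp_scalel.
Qed.

Let field_ok_diff q a : field_ok a -> field_ok (dilation_diff q a).
Proof.
move=> [ca a0 ia ra]; split.
- move=> t; apply: cvgB; first exact: ca.
  by apply: continuous_comp; [exact: (cvgM (cvg_cst _) cvg_id)|exact: ca].
- by rewrite /dilation_diff mulr0 subrr.
- move=> th; have := integrableB measurableT (ia th) (ia (tscale q^-1 th)).
  by apply: eq_integrable => // s _; rewrite /dilation_diff /= EFinB dotp_scalel.
- move=> th; rewrite -(field_exponent_qdiff q ia) /qdiff.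
  have h : field_exponent lam f a (tscale t th) - field_exponent lam f a (tscale t (tscale q^-1 th)) @[t --> (0 : R)] --> 0 - (0 : R).
    by apply: cvgB; exact: ra.
  rewrite subrr in h; apply: cvg_trans h; apply: near_eq_cvg; apply: nearW => t.
  by rewrite !tscaleA mulrC.
Qed.

Lemma qdiff_thead q (a : R -> R) :
  qdiff q (fun th : 1.-tuple R => a (thead th)) = (fun th => dilation_diff q a (thead th)).
Proof. by apply/funext => th; rewrite /qdiff /dilation_diff /thead tnth_mktuple. Qed.

Lemma levy_exp_field_exponent a b : field_ok a -> field_ok b ->
  levy_exp (fun th : 1.-tuple R => a (thead th)) (fun th => b (thead th)) ->
  levy_exp (field_exponent lam f a) (field_exponent lam f b).
Proof.
move=> [ca a0 ia ra] [cb b0 ib rb] hab.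
have mff i : measurable_fun setT (fun s => tnth (field_fun f s) i).
  by apply: (eq_measurable_fun (f i)) => // s _; rewrite tnth_mktuple.
exact: (@levy_exp_field _ _ R lam k (field_fun f) mff a b ca cb a0 b0 hab (@cube R d) (fun n => measurable_box _ _)
  (lam_cube_lty hlam) (@cube_near R d) ia ib ra rb).
Qed.

Lemma urbanik_exp_field m a b : field_ok a -> field_ok b ->
  urbanik_exp m (fun th : 1.-tuple R => a (thead th)) (fun th => b (thead th)) ->
  urbanik_exp m (field_exponent lam f a) (field_exponent lam f b).
Proof.
elim: m a b => [|m IH] a b oa ob h q q1; have [h1 h2] := h q q1;
  have [_ _ ia _] := oa; have [_ _ ib _] := ob;
  rewrite !field_exponent_qdiff//; rewrite !qdiff_thead in h1 h2.
- by split => //; apply: levy_exp_field_exponent => //; exact: field_ok_diff.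
- split; first by apply: levy_exp_field_exponent => //; exact: field_ok_diff.
  by apply: IH => //; exact: field_ok_diff.
Qed.

End FieldTransfer.

Section StochField.
Context (R : realType) (d : nat) (lam : {measure set (d.-tuple R) -> \bar R}).
Hypothesis hlam : is_lebesgue_measure lam.
Context {dO : measure_display} {Om : measurableType dO} (P : probability Om R).
Context (L : set (d.-tuple R) -> Om -> R) (gam b : R) (rho : {measure set R -> \bar R}).
Hypothesis hL : homogeneous_levy_basis P lam L gam b rho.
Let hrho : levy_measure rho := levy_basis_measure hL.

(** Makes the values of the basis stochastic integrals, so that one description of
    finite-dimensional laws covers both fields. *)
Lemma stoch_integral_indic A : bounded_borel A -> is_stoch_integral P lam L (\1_A) (L A).
Proof.
move=> bA; pose s0 := @SimpleRep R d 1 (fun=> 1) (fun=> A).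
have sE (B : set (d.-tuple R)) : sr_int L s0 B = L (B `&` A).
  by apply/funext => w; rewrite /sr_int big_ord1 mul1r.
have cst (Z : Om -> R) : cvg_in_prob P (fun=> Z) Z.
  move=> e e0; rewrite (_ : [set w | _] = set0) ?measure0; first exact: cvg_cst.
  by apply/seteqP; split => w //=; rewrite subrr normr0 leNgt e0.
have [_ mL _ _ _] := hL.
exists (fun=> s0); split => [//||B mB|].
- by apply: aeW => x; rewrite /sr_fun big_ord1 mul1r; exact: cvg_cst.
- exists (L (B `&` A)); split; last by rewrite sE; exact: cst.
  apply: mL; apply: (bounded_borel_sub bA); last by move=> x [].
  by apply: measurableI => //; exact: bA.1.
- by rewrite sE setTI; exact: cst.
Qed.

Section Field.
Context (k : nat) (f : 'I_k -> d.-tuple R -> R) (Y : 'I_k -> Om -> R).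
Hypothesis mf : forall i, measurable_fun setT (f i).
Hypothesis mY : forall i, measurable_fun setT (Y i).
Hypothesis hY : forall i, is_stoch_integral P lam L (f i) (Y i).

Let mcomb (th : k.-tuple R) : measurable_fun setT (fun s => dotp th (field_fun f s)).
Proof.
by apply: measurable_dotp_comp => i; apply: (eq_measurable_fun (f i)) => // s _; rewrite tnth_mktuple.
Qed.

Let fieldE (a : R -> R) (t : R) th :
  Rintegral lam setT (fun s => a (t * dotp th (field_fun f s))) = field_exponent lam f a (tscale t th).
Proof. by apply: eq_Rintegral => s _; rewrite dotp_scalel. Qed.

Let comb (th : k.-tuple R) :
  [/\ forall t, lam.-integrable setT (EFin \o (fun s => lk_re b rho (t * dotp th (field_fun f s)))) /\
        lam.-integrable setT (EFin \o (fun s => lk_im gam rho (t * dotp th (field_fun f s)))),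
      continuous (fun t : R => field_exponent lam f (lk_re b rho) (tscale t th)),
      continuous (fun t : R => field_exponent lam f (lk_im gam rho) (tscale t th)) &
      forall t, charfun P (fun w => \sum_i tnth th i * Y i w) t =
        cexp (Complex (field_exponent lam f (lk_re b rho) (tscale t th))
                      (field_exponent lam f (lk_im gam rho) (tscale t th)))].
Proof.
have mS : measurable_fun setT (fun w => \sum_i tnth th i * Y i w).
  by apply: measurable_sum => i; apply: measurable_funM => //; exact: measurable_cst.
have hS : is_stoch_integral P lam L (fun s => dotp th (field_fun f s)) (fun w => \sum_i tnth th i * Y i w).
  have := stoch_integral_sum hL (index_enum 'I_k) (fun i => tnth th i) mY hY.
  congr (is_stoch_integral _ _ _ _ _); apply/funext => s; rewrite /dotp.
  by apply: eq_bigr => i _; rewrite tnth_mktuple.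
have eE (a : R -> R) : (fun t : R => field_exponent lam f a (tscale t th)) =
    (fun t : R => Rintegral lam setT (fun s => a (t * dotp th (field_fun f s)))).
  by apply/funext => t; rewrite fieldE.
have [h1 h2 h3 h4] := stoch_integral_exponent hlam hL (mcomb th) mS hS.
by split; [exact: h1|rewrite eE; exact: h2|rewrite eE; exact: h3|move=> t; rewrite h4 !fieldE].
Qed.

Lemma integrable_field_re th : lam.-integrable setT (EFin \o (fun s => lk_re b rho (dotp th (field_fun f s)))).
Proof.
have [h _ _ _] := comb th; have := (h 1).1.
by apply: eq_integrable => // s _; rewrite /= mul1r.
Qed.

Lemma integrable_field_im th : lam.-integrable setT (EFin \o (fun s => lk_im gam rho (dotp th (field_fun f s)))).
Proof.
have [h _ _ _] := comb th; have := (h 1).2.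
by apply: eq_integrable => // s _; rewrite /= mul1r.
Qed.

Let field_exponent0 a th : a 0 = 0 -> field_exponent lam f a (tscale 0 th) = 0.
Proof.
move=> a0; rewrite -fieldE; under eq_Rintegral do rewrite mul0r a0.
by rewrite /Rintegral integral0.
Qed.

Lemma ray_field_re : ray_continuous (field_exponent lam f (lk_re b rho)).
Proof.
split=> th; first by have [_ c _ _] := comb th.
by rewrite field_exponent0// lk_re0.
Qed.

Lemma ray_field_im : ray_continuous (field_exponent lam f (lk_im gam rho)).
Proof.
split=> th; first by have [_ _ c _] := comb th.
by rewrite field_exponent0// lk_im0.
Qed.

Lemma urbanik_field m : urbanik_cf m (charfun_vec P (fun w => [tuple Y i w | i < k])) <->
  urbanik_exp m (field_exponent lam f (lk_re b rho)) (field_exponent lam f (lk_im gam rho)).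
Proof.
apply: (urbanik_cfP m ray_field_re ray_field_im) => th.
have [_ _ _ h] := comb th; have := h 1; rewrite !tscale1 => <-.
have e w : dotp th [tuple Y i w | i < k] = 1 * \sum_i tnth th i * Y i w.
  by rewrite mul1r /dotp; apply: eq_bigr => i _; rewrite tnth_mktuple.
rewrite /charfun_vec /charfun.
by congr Complex; apply: eq_Rintegral => w _; rewrite e.
Qed.

Lemma urbanik_field_of_base m :
  urbanik_exp m (fun th : 1.-tuple R => lk_re b rho (thead th)) (fun th => lk_im gam rho (thead th)) ->
  urbanik_cf m (charfun_vec P (fun w => [tuple Y i w | i < k])).
Proof.
move=> h; apply/urbanik_field.
have ray0 F (th : k.-tuple R) : ray_continuous F -> F (tscale t th) @[t --> (0 : R)] --> (0 : R).
  by move=> [cF F0]; have c := cF th 0; rewrite /continuous_at F0 in c.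
apply: (urbanik_exp_field hlam mf) => //; split.
- exact: (@continuous_lk_re R b rho hrho).
- exact: lk_re0.
- exact: integrable_field_re.
- by move=> th; exact: (ray0 _ th ray_field_re).
- exact: (@continuous_lk_im R gam rho hrho).
- exact: lk_im0.
- exact: integrable_field_im.
- by move=> th; exact: (ray0 _ th ray_field_im).
Qed.

End Field.

Lemma base_of_basis m : basis_in_urbanik P L m ->
  urbanik_exp m (fun th : 1.-tuple R => lk_re b rho (thead th)) (fun th => lk_im gam rho (thead th)).
Proof.
move=> h; pose A := box [tuple (0 : R) | i < d] [tuple (1 : R) | i < d].
have bA : bounded_borel A.
  split; first exact: measurable_box.
  exists 1 => x Ax i; have := Ax i; rewrite !tnth_mktuple => /andP[x0 x1].
  by rewrite ger0_norm// ltW.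
have lA : lam A = 1%E.
  rewrite /A hlam => [|i]; last by rewrite !tnth_mktuple.
  by rewrite big1// => i _; rewrite !tnth_mktuple subr0.
have := h 1%N (fun=> A) (fun=> bA).
have th0 (t : R) (th : 1.-tuple R) : thead (tscale t th) = t * thead th.
  by rewrite /thead tnth_mktuple.
have ray F : continuous F -> F 0 = 0 -> ray_continuous (fun th : 1.-tuple R => F (thead th)).
  move=> cF F0; split => th; last by rewrite th0 mul0r.
  rewrite (_ : (fun t => _) = F \o (fun t : R => t * thead th)); last first.
    by apply/funext => t; rewrite th0.
  move=> t; apply: continuous_comp; last exact: cF.
  exact: (cvgM cvg_id (cvg_cst _)).
move/(urbanik_cfP m (ray _ (@continuous_lk_re R b rho hrho) (lk_re0 b rho))
  (ray _ (@continuous_lk_im R gam rho hrho) (lk_im0 gam rho))); apply => th.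
have [_ _ _ _ cf] := hL; have := cf A bA (thead th).
rewrite lA /= lk_exponentE => e.
transitivity (charfun P (L A) (thead th)).
  by rewrite /charfun_vec /charfun; congr Complex; apply: eq_Rintegral => w _;
    rewrite /dotp big_ord1 tnth_mktuple.
by rewrite e; congr cexp; apply/eqP; rewrite eq_complex /= !mul0r !mul1r subr0 addr0 !eqxx.
Qed.

End StochField.

(** * Moving averages *)

Section MovingAverage.
Context (R : realType) (d : nat) (lam : {sigma_finite_measure set (d.-tuple R) -> \bar R}).
Hypothesis hlam : is_lebesgue_measure lam.
Context {dO : measure_display} {Om : measurableType dO} (P : probability Om R).
Context (L : set (d.-tuple R) -> Om -> R) (gam b : R) (rho : {sigma_finite_measure set R -> \bar R}).
Hypothesis hL : homogeneous_levy_basis P lam L gam b rho.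
Context (g : d.-tuple R -> R) (X : d.-tuple R -> Om -> R).
Hypothesis ig : lam.-integrable setT (EFin \o g).
Hypothesis g0 : Rintegral lam setT g != 0.
Hypothesis mX : forall u, measurable_fun setT (X u).
Hypothesis hX : forall u, is_stoch_integral P lam L (fun s => g (tsub u s)) (X u).
Let hrho : levy_measure rho := levy_basis_measure hL.

Let shifts k (u : 'I_k -> d.-tuple R) (i : 'I_k) (s : d.-tuple R) : R := g (tsub (u i) s).

Definition dilation_sum (J : finType) (c sig : J -> R) (a : R -> R) (t : R) : R :=
  \sum_j sig j * a (c j * t).

(** A difference doubles the index set: the second copy is dilated by [q^-1] and enters with the
    opposite sign. Iterated differences thus keep the form [dilation_sum]. *)
Definition double_scale (J : Type) (c : J -> R) (q : R) (j : J + J) : R :=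
  match j with inl i => c i | inr i => c i * q^-1 end.

Definition double_sign (J : Type) (sig : J -> R) (j : J + J) : R :=
  match j with inl i => sig i | inr i => - sig i end.

Let mg : measurable_fun setT g. Proof. exact: measurable_integrable ig. Qed.

Let mts (u : d.-tuple R) : measurable_fun setT (tsub u).
Proof.
apply/measurable_fun_tnthP => i.
apply: (@eq_measurable_fun _ _ _ _ _ (fun s : d.-tuple R => tnth u i - tnth s i)).
  by move=> s _ /=; rewrite tnth_mktuple.
by apply: measurable_funB; [exact: measurable_cst|exact: measurable_tnth].
Qed.

Let mshifts k (u : 'I_k -> d.-tuple R) i : measurable_fun setT (shifts u i).
Proof. exact: (measurableT_comp mg (mts (u i))). Qed.

Let ire k (u : 'I_k -> d.-tuple R) (th : k.-tuple R) :
  lam.-integrable setT (EFin \o (fun s => lk_re b rho (dotp th (field_fun (shifts u) s)))).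
Proof.
exact: (integrable_field_re hlam hL (mshifts u) (fun i => mX (u i)) (fun i => hX (u i)) th).
Qed.

Let iim k (u : 'I_k -> d.-tuple R) (th : k.-tuple R) :
  lam.-integrable setT (EFin \o (fun s => lk_im gam rho (dotp th (field_fun (shifts u) s)))).
Proof.
exact: (integrable_field_im hlam hL (mshifts u) (fun i => mX (u i)) (fun i => hX (u i)) th).
Qed.

Section LinearForms.
Let Yg (s : d.-tuple R) : d.-tuple R -> R := fun u => g (tsub u s).

Let lin_dotp (phi : seq (R * d.-tuple R)) s :
  lin phi (Yg s) = dotp [tuple (tnth (in_tuple phi) i).1 | i < size phi]
    (field_fun (shifts (fun i : 'I_(size phi) => (tnth (in_tuple phi) i).2)) s).
Proof.
rewrite /lin big_tnth /dotp; apply: eq_bigr => i _; by rewrite !tnth_mktuple.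
Qed.

Lemma integrable_lin_re phi : lam.-integrable setT (EFin \o (fun s => lk_re b rho (lin phi (Yg s)))).
Proof.
have := ire (fun i : 'I_(size phi) => (tnth (in_tuple phi) i).2) [tuple (tnth (in_tuple phi) i).1 | i < size phi].
by apply: eq_integrable => // s _; rewrite /= lin_dotp.
Qed.

Lemma integrable_lin_im phi : lam.-integrable setT (EFin \o (fun s => lk_im gam rho (lin phi (Yg s)))).
Proof.
have := iim (fun i : 'I_(size phi) => (tnth (in_tuple phi) i).2) [tuple (tnth (in_tuple phi) i).1 | i < size phi].
by apply: eq_integrable => // s _; rewrite /= lin_dotp.
Qed.

(** The inner integral over [rho] is [- Kre] at [r * g (tsub u s)], at most [- lk_re] there, and the
    latter is integrable in [s] because [X u] is a stochastic integral. *)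
Lemma integrable_one_minus_cos (r : R) (u : d.-tuple R) :
  (rho \x lam)%E.-integrable setT (EFin \o (fun z => 1 - cos (r * z.1 * g (tsub u z.2)))).
Proof.
have mF : measurable_fun setT (EFin \o (fun z : R * d.-tuple R => 1 - cos (r * z.1 * g (tsub u z.2)))).
  apply/measurable_EFinP; apply: measurable_funB; first exact: measurable_cst.
  apply: measurable_cos_comp; apply: measurable_funM.
    by apply: measurable_funM; [exact: measurable_cst|exact: measurable_fst].
  exact: (measurableT_comp (measurableT_comp mg (mts u)) measurable_snd).
apply/(@integrable21ltyP _ _ _ _ R rho lam _ mF).
have inner s : (\int[rho]_x `|(EFin \o (fun z : R * d.-tuple R => (1 - cos (r * z.1 * g (tsub u z.2)))%R)) (x, s)| =
    (- Kre rho (r * g (tsub u s)))%:E)%E.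
  have ik := integrable_kre hrho (r * g (tsub u s)).
  have -> : - Kre rho (r * g (tsub u s)) = Rintegral rho setT (fun x => -1 * kre (r * g (tsub u s)) x).
    by rewrite (RintegralZl (-1) measurableT ik) mulN1r.
  rewrite -EFin_Rintegral//; last first.
    by have := integrableZl measurableT (-1) ik; apply: eq_integrable => // x _; rewrite /= EFinM.
  apply: eq_integral => x _ /=; rewrite ger0_norm ?subr_ge0 ?cos_le1// /kre mulN1r opprB.
  by rewrite [r * x * _]mulrAC.
under eq_integral => s _ do rewrite inner.
have := integrable_lin_re [:: (r, u)].
have linE s : lin [:: (r, u)] (Yg s) = r * g (tsub u s) by rewrite /lin big_seq1.
move=> /integrableP[_]; apply: le_lt_trans.
apply: ge0_le_integral => //.
- by move=> s _; rewrite lee_fin oppr_ge0 Kre_le0.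
- apply/measurable_EFinP; apply: measurableT_comp => //.
  apply: (measurableT_comp (continuous_measurable_fun (@continuous_Kre R rho hrho))).
  by apply: measurable_funM; [exact: measurable_cst|exact: (measurableT_comp mg (mts u))].
- apply: measurableT_comp => //; apply: measurable_int (integrable_lin_re [:: (r, u)]).
- move=> s _; rewrite /= lee_fin linE ler0_norm ?lk_re_le0//.
  by rewrite lerN2 lk_re_le_Kre.
Qed.

Section Sum.
Context (J : finType) (c sig : J -> R).

Let integrable_dilation (k : nat) (u : 'I_k -> d.-tuple R) (a : R -> R) :
  (forall th : k.-tuple R, lam.-integrable setT (EFin \o (fun s => a (dotp th (field_fun (shifts u) s))))) ->
  forall (th : k.-tuple R) (r : R), lam.-integrable setT (EFin \o (fun s => a (r * dotp th (field_fun (shifts u) s)))).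
Proof.
move=> ia th r; have := ia (tscale r th).
by apply: eq_integrable => // s _; rewrite /= dotp_scalel.
Qed.

Lemma integrable_dilation_sum (k : nat) (u : 'I_k -> d.-tuple R) (a : R -> R) :
  (forall th : k.-tuple R, lam.-integrable setT (EFin \o (fun s => a (dotp th (field_fun (shifts u) s))))) ->
  forall th, lam.-integrable setT (EFin \o (fun s => dilation_sum c sig a (dotp th (field_fun (shifts u) s)))) /\
    field_exponent lam (shifts u) (dilation_sum c sig a) th =
    \sum_j sig j * Rintegral lam setT (fun s => a (c j * dotp th (field_fun (shifts u) s))).
Proof.
move=> ia th; have ij j := integrable_dilation ia th (c j).
have isj j : lam.-integrable setT (EFin \o (fun s => sig j * a (c j * dotp th (field_fun (shifts u) s)))).
  by have := integrableZl measurableT (sig j) (ij j); apply: eq_integrable => // s _; rewrite /= EFinM.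
have [e i] := Rintegral_sum (index_enum J) measurableT isj.
split; first exact: i.
rewrite /field_exponent /dilation_sum e; apply: eq_bigr => j _.
by rewrite (RintegralZl (sig j) measurableT (ij j)).
Qed.

Lemma levy_exp_dilation_sum : 0 <= \sum_j sig j * c j ^+ 2 ->
  (forall k (u : 'I_k -> d.-tuple R), levy_exp (field_exponent lam (shifts u) (dilation_sum c sig (lk_re b rho)))
     (field_exponent lam (shifts u) (dilation_sum c sig (lk_im gam rho)))) ->
  levy_exp (fun th : 1.-tuple R => dilation_sum c sig (lk_re b rho) (thead th))
           (fun th => dilation_sum c sig (lk_im gam rho) (thead th)).
Proof.
move=> v0 h; apply: (@levy_exp_signed R gam b rho hrho J c sig v0) => B e K mB e0 Be.
apply: (jump_positive hlam ig g0 integrable_one_minus_cos hrho integrable_lin_re integrable_lin_im _ mB e0 Be).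
move=> p p0 pz.
pose A phi := \sum_j sig j * Rintegral lam setT (fun s => lk_re b rho (c j * lin phi (Yg s))).
pose A' phi := \sum_j sig j * Rintegral lam setT (fun s => lk_im gam rho (c j * lin phi (Yg s))).
apply: (@levy_exp_trig_positive R _ A A' p _ p0 pz) => U.
pose u (i : 'I_(size U)) := tnth (in_tuple U) i.
exists (field_exponent lam (shifts u) (dilation_sum c sig (lk_re b rho))),
  (field_exponent lam (shifts u) (dilation_sum c sig (lk_im gam rho))); split => [|phi sub uU]; first exact: h.
rewrite (integrable_dilation_sum (ire u) _).2 (integrable_dilation_sum (iim u) _).2.
have dE s := dotp_coef (Yg s) uU sub.
by split; apply: eq_bigr => j _; apply: (f_equal (fun y => sig j * y)); apply: eq_Rintegral => s _;
  rewrite -dE.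
Qed.

End Sum.

Lemma dilation_diff_sum (J : finType) (c sig : J -> R) q (a : R -> R) :
  dilation_diff q (dilation_sum c sig a) =
  dilation_sum (double_scale c q) (double_sign sig) a.
Proof.
apply/funext => t; rewrite /dilation_diff /dilation_sum big_sumType /= -sumrN.
by congr (_ + _); apply: eq_bigr => j _; rewrite mulNr mulrA.
Qed.

Let qre k (u : 'I_k -> d.-tuple R) (J : finType) (c sig : J -> R) q :
  qdiff q (field_exponent lam (shifts u) (dilation_sum c sig (lk_re b rho))) =
  field_exponent lam (shifts u) (dilation_sum (double_scale c q) (double_sign sig) (lk_re b rho)).
Proof.
by rewrite (field_exponent_qdiff q (fun th => (integrable_dilation_sum c sig (ire u) th).1)) dilation_diff_sum.
Qed.

Let qim k (u : 'I_k -> d.-tuple R) (J : finType) (c sig : J -> R) q :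
  qdiff q (field_exponent lam (shifts u) (dilation_sum c sig (lk_im gam rho))) =
  field_exponent lam (shifts u) (dilation_sum (double_scale c q) (double_sign sig) (lk_im gam rho)).
Proof.
by rewrite (field_exponent_qdiff q (fun th => (integrable_dilation_sum c sig (iim u) th).1)) dilation_diff_sum.
Qed.

Lemma urbanik_exp_dilation_sum m (J : finType) (c sig : J -> R) : 0 <= \sum_j sig j * c j ^+ 2 ->
  (forall k (u : 'I_k -> d.-tuple R), urbanik_exp m (field_exponent lam (shifts u) (dilation_sum c sig (lk_re b rho)))
     (field_exponent lam (shifts u) (dilation_sum c sig (lk_im gam rho)))) ->
  urbanik_exp m (fun th : 1.-tuple R => dilation_sum c sig (lk_re b rho) (thead th))
           (fun th => dilation_sum c sig (lk_im gam rho) (thead th)).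
Proof.
(* The doubled coefficient is the old one times [1 - q ^- 2]; the induction therefore ranges over
   all index sets, scales and signs with a nonnegative coefficient. *)
have v' (I : finType) (e s : I -> R) q : 1 < q -> 0 <= \sum_j s j * e j ^+ 2 ->
    0 <= \sum_j double_sign s j * double_scale e q j ^+ 2.
  move=> q1 v0; rewrite big_sumType /=.
  have -> : \sum_i - s i * (e i * q^-1) ^+ 2 = - (q^-1 ^+ 2 * \sum_i s i * e i ^+ 2).
    by rewrite mulr_sumr -sumrN; apply: eq_bigr => i _; rewrite exprMn; ring.
  rewrite subr_ge0 ler_piMl// exprn_ile1// ?invr_ge0 ?invf_le1 ?ltW// (lt_trans ltr01 q1)//.
elim: m J c sig => [|m IH] J c sig v0 h q q1; rewrite !qdiff_thead !dilation_diff_sum.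
- split => //; apply: levy_exp_dilation_sum => [|k u]; first exact: v'.
  by rewrite -qre -qim; have [] := h k u q q1.
- split; first apply: levy_exp_dilation_sum => [|k u]; last apply: IH => [|k u]; try exact: v'.
    by rewrite -qre -qim; have [] := h k u q q1.
  by rewrite -qre -qim; have [] := h k u q q1.
Qed.

End LinearForms.

Theorem moving_average_urbanik m : field_in_urbanik P X m <-> basis_in_urbanik P L m.
Proof.
split=> h k u.
- move=> bA; have [_ mL _ _ _] := hL.
  apply: (urbanik_field_of_base hlam hL (f := fun i => \1_(u i))) => [i|i|i|].
  + exact: (measurable_indic (bA i).1).
  + exact: mL.
  + exact: (stoch_integral_indic hL (bA i)).
  (* The exponent itself is the sum with one index, scale 1 and sign 1, of Gaussian coefficient
     1. *)
  have sumE (a : R -> R) : dilation_sum (fun _ : 'I_1 => 1) (fun=> 1) a = a.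
    by apply/funext => t; rewrite /dilation_sum big_ord1 !mul1r.
  have := @urbanik_exp_dilation_sum m 'I_1 (fun=> 1) (fun=> 1).
  rewrite !sumE big_ord1 mul1r expr1n; apply => // n v.
  by have /(urbanik_field hlam hL (mshifts v) (fun i => mX (v i)) (fun i => hX (v i))) := h n v.
- apply: (urbanik_field_of_base hlam hL (f := shifts u)) => // [i|].
    exact: hX.
  exact: (base_of_basis hlam hL h).
Qed.

End MovingAverage.

Theorem theorem4p12 (R : realType) (d : nat)
    (dO : measure_display) (Om : measurableType dO) (P : probability Om R)
    (lam : {measure set (d.-tuple R) -> \bar R})
    (L : set (d.-tuple R) -> Om -> R) (gam b : R) (rho : {measure set R -> \bar R})
    (g : d.-tuple R -> R) (X : d.-tuple R -> Om -> R) :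
  is_lebesgue_measure lam ->
  homogeneous_levy_basis P lam L gam b rho ->
  lam.-integrable setT (EFin \o g) ->
  in_L_Phi0 lam gam b rho g ->
  (forall xi : d.-tuple R, fourier lam g xi != 0) ->
  (forall u : d.-tuple R, measurable_fun setT (X u) /\
     is_stoch_integral P lam L (fun s => g (tsub u s)) (X u)) ->
  forall m : nat, field_in_urbanik P X m <-> basis_in_urbanik P L m.
Proof.
move=> hlam hL ig _ hg hX m.
have g0 : Rintegral lam setT g != 0.
  apply: contraNneq (hg [tuple 0 | i < d]) => e.
  have d0 s : dotp [tuple 0 | i < d] s = 0 :> R by rewrite dotp0.
  rewrite /fourier; under eq_Rintegral do rewrite d0 cos0 mulr1.
  under [X in Complex _ X]eq_Rintegral do rewrite d0 sin0 mulr0.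
  by rewrite e [X in Complex _ X]/Rintegral integral0.
(* Fubini's theorem is used for bundled sigma-finite measures, so both measures are replaced by
   their bundled copies. *)
have [lam' elam] := pack_sigma_finite (lam_sigma_finite hlam).
have [rho' erho] := pack_sigma_finite (levy_sigma_finite (levy_basis_measure hL)).
subst lam rho.
by apply: (moving_average_urbanik hlam hL ig g0) => u; have [] := hX u.
Qed.
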